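(* Let $\Lambda=\{1,\ldots,n\}$ or $\Lambda=\mathbb N$, and fix $I,J\in\mathbb S$ with $J\perp I$. Let $f_j\in H^\infty(\mathbb B)$, $j\in\Lambda$, satisfy $$\sum_{j\in\Lambda}|f_j(q)|^2\le1,\qquad q\in\mathbb B,$$ and let $\mathcal M_{\mathbf f}:H^2(\mathbb B;\ell^2(\Lambda))\to H^2(\mathbb B)$ be the associated row multiplier, $\mathcal M_{\mathbf f}(h_j)_{j\in\Lambda}=\sum_{j\in\Lambda}f_j\star h_j$. Let $h\in H^\infty(\mathbb B)$ and $\gamma>0$. Then the following statements are equivalent. (i) The inequality $$M_hM_h^*\le\gamma^2\mathcal M_{\mathbf f}\mathcal M_{\mathbf f}^*$$ holds on $H^2(\mathbb B)$. (ii) There exist $g_j\in H^\infty(\mathbb B)$, $j\in\Lambda$, such that $$h=\sum_{j\in\Lambda}f_j\star g_j,$$ and the analytic block function $$\Psi_{\mathbf g}(z):=\begin{pmatrix}\mathscr R_I(g_1)(z)\\ \mathscr R_I(g_2)(z)\\ \vdots\end{pmatrix}:\mathbb C_I^2\to E_\Lambda$$ belongs to $H^\infty(\mathbb D_I,\mathcal B(\mathbb C_I^2,E_\Lambda))$ and satisfies $\|\Psi_{\mathbf g}\|_\infty\le\gamma$. If $\Lambda=\mathbb N$, the series $\sum_{j\in\Lambda}f_j\star g_j$ in (ii) converges absolutely and uniformly on compact subsets of $\mathbb B$. In particular, when $\Lambda$ is finite, the inequality in (i) gives a Toeplitz-operator characterization, with quantitative control, of membership of $h$ in the right ideal generated by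 $f_1,\ldots,f_n$.
   Context: $\mathbb H$ denotes the quaternions with the usual conjugation and modulus $|\cdot|$; $\mathbb B=\{q\in\mathbb H:|q|<1\}$; $\mathbb S=\{I\in\mathbb H:I^2=-1\}$. For $I\in\mathbb S$, $\mathbb C_I=\mathbb R+\mathbb R I$ (a copy of the complex plane) and $\mathbb D_I=\mathbb B\cap\mathbb C_I$; $J\perp I$ means $IJ=-JI$. A real-differentiable function $f:\mathbb B\to\mathbb H$ is (left) slice regular if for every $I\in\mathbb S$ one has $\frac12\bigl(\frac{\partial}{\partial x}+I\frac{\partial}{\partial y}\bigr)f(x+Iy)=0$ on $\mathbb D_I$; equivalently $f(q)=\sum_{m\ge0}q^m a_m$ with $a_m\in\mathbb H$, converging uniformly on compact subsets of $\mathbb B$. For $f(q)=\sum_m q^m a_m$ and $g(q)=\sum_m q^m b_m$, the slice regular product is $(f\star g)(q)=\sum_m q^m\bigl(\sum_{k=0}^m a_k b_{m-k}\bigr)$. $H^\infty(\mathbb B)$ is the space of bounded slice regular functions on $\mathbb B$ with the sup norm; it is a ring under $\star$, and the right ideal generated by $f_1,\dots,f_n$ is $\{\sum_{j=1}^n f_j\star g_j: g_j\in H^\infty(\mathbb B)\}$. Every slice regular $f$ has a unique splitting $f|_{\mathbb D_I}=F+GJ$ with $F,G:\mathbb D_I\to\mathbb C_I$ holomorphic. For a $\mathbb C_I$-valued holomorphic $U$ put $U^\#(z)=\overline{U(\overline z)}$, and define the fixed-slice matrix realization $$\mathscr R_I(f)(z)=\begin{pmatrix}F(z)&G(z)\\-G^\#(z)&F^\#(z)\end{pmatrix}.$$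 $H^2(\mathbb B)$ is the right quaternionic Hilbert space of slice regular $h(q)=\sum_m q^m a_m$ with $\|h\|^2=\sum_m|a_m|^2<\infty$ and inner product $\langle h,u\rangle=\sum_m\overline{a_m}b_m$ for $u(q)=\sum_m q^m b_m$. $H^2(\mathbb B;\ell^2(\Lambda))$ is the right quaternionic Hilbert space of families $(h_j)_{j\in\Lambda}$ in $H^2(\mathbb B)$ with $\|(h_j)\|^2=\sum_j\|h_j\|^2<\infty$. For $f\in H^\infty(\mathbb B)$, $M_f:H^2(\mathbb B)\to H^2(\mathbb B)$ is the left multiplier $M_fu=f\star u$. Under the hypothesis $\sum_j|f_j|^2\le1$ on $\mathbb B$, the row multiplier $\mathcal M_{\mathbf f}$ is a well-defined bounded operator (for $\Lambda=\mathbb N$ the series converges in $H^2$-norm). Adjoints are taken with respect to these inner products, and operator inequalities are in the sense of quadratic forms. $E_\Lambda=\ell^2(\Lambda;\mathbb C_I^2)$ (so $E_\Lambda=\mathbb C_I^{2n}$ if $\Lambda=\{1,\dots,n\}$). For complex Hilbert spaces $E,E_*$, $H^\infty(\mathbb D_I,\mathcal B(E,E_* ))$ is the space of bounded holomorphic functions on $\mathbb D_I$ with values in the bounded operators $E\to E_*$, with norm $\|A\|_\infty=\sup_{z\in\mathbb D_I}\|A(z)\|_{\mathrm{op}}$. *)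

(* Defs.v *)
From HB Require Import structures.
From mathcomp Require Import all_boot all_order all_algebra.
From mathcomp Require Import ring.
From mathcomp Require Import all_classical all_reals all_analysis.

Set Implicit Arguments.
Unset Strict Implicit.
Unset Printing Implicit Defensive.

Import Order.TTheory GRing.Theory Num.Theory.
Import numFieldNormedType.Exports.

Local Open Scope classical_set_scope.
Local Open Scope ring_scope.

(* [Quat a b c d] is a + b i + c j + d k. *)
Record quat (R : Type) := Quat { qre : R; qi : R; qj : R; qk : R }.

Section QuatChoice.
Context {R : choiceType}.
Definition quat_to (q : quat R) := (qre q, qi q, qj q, qk q).
Definition quat_of (t : R * R * R * R) :=
  let: (a, b, c, d) := t in Quat a b c d.
Lemma quat_toK : cancel quat_to quat_of. Proof. by case. Qed.
HB.instance Definition _ := Choice.copy (quat R) (can_type quat_toK).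
End QuatChoice.

Section QuatAlgebra.
Context {R : realType}.
Local Notation H := (quat R).

Lemma quatP (p q : H) : qre p = qre q -> qi p = qi q -> qj p = qj q ->
  qk p = qk q -> p = q.
Proof. by case: p q => a b c d [a' b' c' d'] /= -> -> -> ->. Qed.

Definition qadd (p q : H) : H :=
  Quat (qre p + qre q) (qi p + qi q) (qj p + qj q) (qk p + qk q).
Definition qopp (p : H) : H := Quat (- qre p) (- qi p) (- qj p) (- qk p).
Definition qzero : H := Quat 0 0 0 0.

Lemma qaddA : associative qadd.
Proof. by move=> p q r; apply: quatP => /=; ring. Qed.
Lemma qaddC : commutative qadd.
Proof. by move=> p q; apply: quatP => /=; ring. Qed.
Lemma qadd0 : left_id qzero qadd.
Proof. by move=> p; apply: quatP => /=; ring. Qed.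
Lemma qaddN : left_inverse qzero qopp qadd.
Proof. by move=> p; apply: quatP => /=; ring. Qed.

HB.instance Definition _ :=
  GRing.isZmodule.Build H qaddA qaddC qadd0 qaddN.

Definition qone : H := Quat 1 0 0 0.
Definition qmul (p q : H) : H :=
  let: Quat a b c d := p in let: Quat a' b' c' d' := q in
  Quat (a * a' - b * b' - c * c' - d * d')
       (a * b' + b * a' + c * d' - d * c')
       (a * c' - b * d' + c * a' + d * b')
       (a * d' + b * c' - c * b' + d * a').

Lemma qmulA : associative qmul.
Proof. by move=> [? ? ? ?] [? ? ? ?] [? ? ? ?]; apply: quatP => /=; ring. Qed.
Lemma qmul1l : left_id qone qmul.
Proof. by move=> [? ? ? ?]; apply: quatP => /=; ring. Qed.
Lemma qmul1r : right_id qone qmul.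
Proof. by move=> [? ? ? ?]; apply: quatP => /=; ring. Qed.
Lemma qmulDl : left_distributive qmul +%R.
Proof. by move=> [? ? ? ?] [? ? ? ?] [? ? ? ?]; apply: quatP => /=; ring. Qed.
Lemma qmulDr : right_distributive qmul +%R.
Proof. by move=> [? ? ? ?] [? ? ? ?] [? ? ? ?]; apply: quatP => /=; ring. Qed.
Lemma qone_neq0 : qone != 0.
Proof. by apply/eqP => /(congr1 (@qre R))/eqP; rewrite oner_eq0. Qed.

HB.instance Definition _ := GRing.Zmodule_isNzRing.Build H
  qmulA qmul1l qmul1r qmulDl qmulDr qone_neq0.

Definition qscale (x : R) (q : H) : H :=
  Quat (x * qre q) (x * qi q) (x * qj q) (x * qk q).

Lemma qscaleA x y q : qscale x (qscale y q) = qscale (x * y) q.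
Proof. by apply: quatP => /=; ring. Qed.
Lemma qscale1 : left_id 1 qscale.
Proof. by move=> q; apply: quatP => /=; ring. Qed.
Lemma qscaleDr : right_distributive qscale +%R.
Proof. by move=> x p q; apply: quatP => /=; ring. Qed.
Lemma qscaleDl q : {morph qscale^~ q : x y / x + y}.
Proof. by move=> x y; apply: quatP => /=; ring. Qed.

HB.instance Definition _ := GRing.Zmodule_isLmodule.Build R H
  qscaleA qscale1 qscaleDr qscaleDl.

Lemma qscaleAl (x : R) (p q : H) : x *: (p * q) = (x *: p) * q.
Proof. by case: p q => ? ? ? ? [? ? ? ?]; apply: quatP => /=; ring. Qed.
HB.instance Definition _ := GRing.Lmodule_isLalgebra.Build R H qscaleAl.

Lemma qscaleAr (x : R) (p q : H) : x *: (p * q) = p * (x *: q).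
Proof. by case: p q => ? ? ? ? [? ? ? ?]; apply: quatP => /=; ring. Qed.
HB.instance Definition _ := GRing.Lalgebra_isAlgebra.Build R H qscaleAr.

Definition qconj (q : H) : H := Quat (qre q) (- qi q) (- qj q) (- qk q).

Definition qsqn (q : H) : R := qre q ^+ 2 + qi q ^+ 2 + qj q ^+ 2 + qk q ^+ 2.
Definition qmod (q : H) : R := Num.sqrt (qsqn q).

Lemma qsqn_ge0 q : 0 <= qsqn q.
Proof. by rewrite /qsqn !addr_ge0 // sqr_ge0. Qed.

Lemma qmodD (p q : H) : qmod (p + q) <= qmod p + qmod q.
Proof.
have P : 0 <= qmod p by rewrite sqrtr_ge0.
have Q : 0 <= qmod q by rewrite sqrtr_ge0.
rewrite -(@ler_pXn2r _ 2) ?nnegrE ?addr_ge0 ?sqrtr_ge0 //.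
rewrite sqrrD !sqr_sqrtr ?qsqn_ge0 //.
set d := qre p * qre q + qi p * qi q + qj p * qj q + qk p * qk q.
have -> : qsqn (p + q) = qsqn p + d *+ 2 + qsqn q.
  by rewrite /qsqn /d /=; ring.
rewrite lerD2r lerD2l lerMn2r /=.
apply: le_trans (ler_norm _) _.
rewrite -(@ler_pXn2r _ 2) ?nnegrE ?mulr_ge0 //.
rewrite real_normK ?num_real // exprMn !sqr_sqrtr ?qsqn_ge0 // -subr_ge0.
rewrite [leRHS](_ : _ =
   (qre p * qi q - qi p * qre q) ^+ 2 + (qre p * qj q - qj p * qre q) ^+ 2 +
   (qre p * qk q - qk p * qre q) ^+ 2 + (qi p * qj q - qj p * qi q) ^+ 2 +
   (qi p * qk q - qk p * qi q) ^+ 2 + (qj p * qk q - qk p * qj q) ^+ 2).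
  by rewrite !addr_ge0 // sqr_ge0.
by rewrite /qsqn /d; ring.
Qed.

Lemma qmodZ (x : R) (q : H) : qmod (x *: q) = `|x| * qmod q.
Proof.
rewrite /qmod -sqrtr_sqr -sqrtrM ?sqr_ge0 //; congr Num.sqrt.
by rewrite /qsqn /=; ring.
Qed.

Lemma qmod_eq0 (q : H) : qmod q = 0 -> q = 0.
Proof.
move/eqP; rewrite sqrtr_eq0 => q0.
have {q0} : qsqn q == 0 by rewrite eq_le q0 qsqn_ge0.
rewrite /qsqn !paddr_eq0 ?addr_ge0 ?sqr_ge0 // !sqrf_eq0.
by move=> /andP[/andP[/andP[/eqP a /eqP b] /eqP c] /eqP d]; apply: quatP.
Qed.

(* After this, [`|q|] is the modulus and the topology is the Euclidean one. *)
HB.instance Definition _ :=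
  Lmodule_isNormed.Build R H qmodD qmodZ qmod_eq0.

End QuatAlgebra.

Section Defs.
Context {R : realType}.
Local Notation H := (quat R).

(* Functions on the unit ball are total functions [H -> H] of which only the
   values on [qball] matter. *)

Definition qball : set H := [set q | `|q| < 1].
Definition imag_unit : set H := [set I | I * I = - 1].
Definition slice (I : H) : set H := [set q | exists x y : R, q = x%:A + y *: I].
Definition disc (I : H) : set H := qball `&` slice I.

Definition slice_regular (f : H -> H) : Prop :=
  (forall q, qball q -> differentiable f q) /\
  forall I, imag_unit I -> forall x y : R, qball (x%:A + y *: I) ->
    2^-1 *: (derive1 (fun s : R => f (s%:A + y *: I)) x
             + I * derive1 (fun t : R => f (x%:A + t *: I)) y) = 0.

Definition qpseries (a : nat -> H) (q : H) : nat -> H :=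
  series (fun m => q ^+ m * a m).

(* The coefficients a_m of f(q) = sum_m q^m a_m on the ball. *)
Definition coefs (f : H -> H) : nat -> H :=
  xget (fun=> 0) [set a | forall q, qball q -> qpseries a q @ \oo --> f q].

Definition star (f g : H -> H) (q : H) : H :=
  limn (qpseries (fun m => \sum_(k < m.+1) coefs f k * coefs g (m - k)%N) q).

Definition Hinf (f : H -> H) : Prop :=
  slice_regular f /\ exists M : R, forall q, qball q -> `|f q| <= M.

(* Partial sums of sum_(j in L) u_j, L a set of indices; eventually constant
   when L is finite. *)
Definition psum (V : nmodType) (L : set nat) (u : nat -> V) (n : nat) : V :=
  \sum_(0 <= j < n | j \in L) u j.

Definition right_ideal (n : nat) (f : nat -> H -> H) : set (H -> H) :=
  [set h | exists g : nat -> H -> H, (forall j, (j < n)%N -> Hinf (g j)) /\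
     forall q, qball q -> h q = \sum_(0 <= j < n) star (f j) (g j) q].

Definition H2normsq (h : H -> H) : \bar R :=
  (\sum_(0 <= m <oo) (`|coefs h m| ^+ 2)%:E)%E.

Definition H2 : set (H -> H) :=
  [set h | slice_regular h /\ (H2normsq h < +oo)%E].

Definition H2dot (h u : H -> H) : H :=
  limn (series (fun m => qconj (coefs h m) * coefs u m)).

Definition H2l2 (L : set nat) : set (nat -> H -> H) :=
  [set h | (forall j, L j -> H2 (h j)) /\
           (\esum_(j in L) H2normsq (h j) < +oo)%E].

Definition H2l2dot (L : set nat) (h u : nat -> H -> H) : H :=
  limn (psum L (fun j => H2dot (h j) (u j))).

(* The sum of the f_j * h_j in the sense of convergence in the norm of H2. *)
Definition row_mult (L : set nat) (f h : nat -> H -> H) : H -> H :=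
  xget (fun=> 0) [set u | H2 u /\
    H2normsq (fun q => psum L (fun j => star (f j) (h j) q) n - u q)
      @[n --> \oo] --> 0%E].

(* S is an adjoint of T : (D, dotD) -> (E, dotE). *)
Definition is_adjoint (X Y : Type) (D : set X) (dotD : X -> X -> H)
    (E : set Y) (dotE : Y -> Y -> H) (T : X -> Y) (S : Y -> X) : Prop :=
  forall y, E y -> D (S y) /\ forall x, D x -> dotE (T x) y = dotD x (S y).

Definition mult_adj (h : H -> H) : (H -> H) -> (H -> H) :=
  xget (fun _ _ => 0) [set S | is_adjoint H2 H2dot H2 H2dot (star h) S].

Definition row_mult_adj (L : set nat) (f : nat -> H -> H) :
    (H -> H) -> (nat -> H -> H) :=
  xget (fun _ _ _ => 0)
    [set S | is_adjoint (H2l2 L) (H2l2dot L) H2 H2dot (row_mult L f) S].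

(* For u in H2 and A = T T^*, <A u, u> is a real quaternion. *)
Definition op_le (A B : (H -> H) -> (H -> H)) : Prop :=
  forall u, H2 u -> qre (H2dot (A u) u) <= qre (H2dot (B u) u).

(* The unique (p1, p2) in C_I x C_I with q = p1 + p2 J; applied to the values
   of f it yields the splitting f = F + G J on the disc. *)
Definition slice_split (I J q : H) : H * H :=
  xget (0, 0) [set p | [/\ slice I p.1, slice I p.2 & q = p.1 + p.2 * J]].

Definition sharp (U : H -> H) (z : H) : H := qconj (U (qconj z)).

Definition realiz (I J : H) (f : H -> H) (z : H) : 'M[H]_2 :=
  let F w := (slice_split I J (f w)).1 in
  let G w := (slice_split I J (f w)).2 in
  \matrix_(r < 2, c < 2)
    if r == 0 then (if c == 0 then F z else G z)
    else (if c == 0 then - sharp G z else sharp F z).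

Definition C2 (I : H) : set 'cV[H]_2 := [set v | forall i, slice I (v i 0)].

Definition C2normsq (v : 'cV[H]_2) : R := \sum_i `|v i 0| ^+ 2.

Definition ell2normsq (L : set nat) (w : nat -> 'cV[H]_2) : \bar R :=
  (\esum_(j in L) (C2normsq (w j))%:E)%E.

Definition ell2C2 (I : H) (L : set nat) : set (nat -> 'cV[H]_2) :=
  [set w | (forall j, L j -> C2 I (w j)) /\ (ell2normsq L w < +oo)%E].

(* A map C_I^2 -> E_L, of which only the values on [C2 I], at the indices in L,
   matter. *)
Definition colop := 'cV[H]_2 -> nat -> 'cV[H]_2.

Definition opnorm (I : H) (L : set nat) (T : colop) : \bar R :=
  ereal_sup [set (ell2normsq L (T v) `^ 2^-1)%E
            | v in [set v | C2 I v /\ C2normsq v <= 1]].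

(* C_I is commutative, so scaling a vector on the left is its usual structure
   of C_I-vector space. *)
Definition bounded_op (I : H) (L : set nat) (T : colop) : Prop :=
  [/\ forall v, C2 I v -> ell2C2 I L (T v),
      forall c v w, slice I c -> C2 I v -> C2 I w ->
        forall j, L j -> T (c *: v + w) j = c *: T v j + T w j
    & (opnorm I L T < +oo)%E].

Definition holomorphic_op (I : H) (L : set nat) (A : H -> colop) : Prop :=
  forall z, disc I z -> exists2 D : colop, bounded_op I L D &
    forall e : R, 0 < e -> \forall w \near z, disc I w ->
      (opnorm I L (fun v j => A w v j - A z v j - (w - z) *: D v j)%R
        <= (e * `|w - z|)%:E)%E.

Definition Hinf_op_norm (I : H) (L : set nat) (A : H -> colop) : \bar R :=
  ereal_sup [set opnorm I L (A z) | z in disc I].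

Definition Hinf_op (I : H) (L : set nat) (A : H -> colop) : Prop :=
  [/\ forall z, disc I z -> bounded_op I L (A z),
      holomorphic_op I L A
    & (Hinf_op_norm I L A < +oo)%E].

Definition Psi (I J : H) (g : nat -> H -> H) (z : H) : colop :=
  fun v j => realiz I J (g j) z *m v.

(* [{family compactly_in A, F --> s}] is uniform convergence on the compact
   subsets of A. *)
Definition abs_unif_cvg_on_compacts (u : nat -> H -> H) : Prop :=
  (exists s : H -> R,
    {family compactly_in qball,
       (fun n q => \sum_(0 <= j < n) `|u j q|) @ \oo --> s}) /\
  (exists s : H -> H,
    {family compactly_in qball,
       (fun n q => \sum_(0 <= j < n) u j q) @ \oo --> s}).

End Defs.

(* Main.v *)
(* Everything is read on coefficients: [star] is convolution. The column operator
   of (g_j) and the function Psi_g are two faces of one operator, because the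
   realization at z turns the vector of a quaternion u into the vector of
   sum_m b_m u z^m, so that Psi_g is bounded by gamma on the disc iff
   u |-> (g_j * u)_j is bounded by gamma on H^2. One direction integrates over
   circles of the disc (Parseval); the other one tests the operator on geometric
   sequences. With this, (ii) => (i) is duality: M_h^* = sum_j M_(g_j)^* M_(f_j)^*.

   For (i) => (ii), a Leech factorization, truncate to polynomials of degree less
   than N and to finitely many f_j, perturbed so that the gap
   Q = gamma^2 sum_j T_j T_j^* - T_h T_h^* of the Toeplitz matrices is positive
   definite. Since T T^* - Z^* T T^* Z has rank one, Q is the storage function of
   a state space system whose impulse response is an exact contractive solution.
   An ultrafilter limit removes the truncation.

   A slice regular function is a power series by the Cauchy-Goursat theorem in the
   logarithmic variable, which makes its Fourier coefficients on circles
   proportional to r^m. *)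

Require Import Defs.
From HB Require Import structures.
From mathcomp Require Import all_boot all_order all_algebra.
From mathcomp Require Import ring lra.
From mathcomp Require Import all_classical all_reals all_analysis.

Set Implicit Arguments.
Unset Strict Implicit.
Unset Printing Implicit Defensive.

Import Order.TTheory GRing.Theory Num.Theory.
Import numFieldNormedType.Exports.

Local Open Scope classical_set_scope.
Local Open Scope ring_scope.

(** * Quaternions *)

Section QuatBasics.
Context {R : realType}.
Local Notation H := (quat R).
Implicit Types p q r : H.

(** The star product is not pointwise, so the bound on sum_j |f_j|^2 does not directly control the
    row multiplier. On a slice a value f(z) splits into a part commuting with I and a part
    anticommuting with I; powers of z moved across them evaluate the other factor at z and at its
    conjugate. This gives boundedness with a factor 2, enough for the row multiplier and its adjoint
    to exist. The sharp constant gamma comes from another evaluation: with the powers of z written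
    to the right of the coefficients, convolution becomes composition, sum_m (b * u)_m z^m = sum_m
    b_m U z^m with U = sum_l u_l z^l, and nothing is lost. Infinite families, norms and adjoints are
    handled as bounds valid for all finite sections. Such bounds survive coordinatewise limits, so
    weak compactness amounts to choosing limits of coefficients; the equation h = sum_j f_j * g_j
    survives because the tails of the coefficients of the f_j are small uniformly in the
    approximation. The perturbation that makes the gap definite is one additional constant column,
    which adds a multiple of the identity. *)

Lemma qmulE p q : p * q =
  Quat (qre p * qre q - qi p * qi q - qj p * qj q - qk p * qk q)
       (qre p * qi q + qi p * qre q + qj p * qk q - qk p * qj q)
       (qre p * qj q - qi p * qk q + qj p * qre q + qk p * qi q)
       (qre p * qk q + qi p * qj q - qj p * qi q + qk p * qre q).
Proof. by case: p q => ? ? ? ? [? ? ? ?]. Qed.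

Lemma qaddE p q : p + q =
  Quat (qre p + qre q) (qi p + qi q) (qj p + qj q) (qk p + qk q).
Proof. by []. Qed.
Lemma qoppE p : - p = Quat (- qre p) (- qi p) (- qj p) (- qk p).
Proof. by []. Qed.
Lemma qscaleE (x : R) p : x *: p = Quat (x * qre p) (x * qi p) (x * qj p) (x * qk p).
Proof. by []. Qed.
Lemma qzeroE : (0 : H) = Quat 0 0 0 0. Proof. by []. Qed.
Lemma qoneE : (1 : H) = Quat 1 0 0 0. Proof. by []. Qed.
Definition quatE := (qmulE, qaddE, qoppE, qscaleE, qoneE, qzeroE).

Lemma qconjK : involutive (@qconj R).
Proof. by case=> a b c d; rewrite /qconj /= !opprK. Qed.
Lemma qconjD p q : qconj (p + q) = qconj p + qconj q.
Proof. by apply: quatP => /=; ring. Qed.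
Lemma qconjN p : qconj (- p) = - qconj p.
Proof. by apply: quatP. Qed.
Lemma qconjB p q : qconj (p - q) = qconj p - qconj q.
Proof. by rewrite qconjD qconjN. Qed.
Lemma qconj0 : qconj (0 : H) = 0.
Proof. by apply: quatP => //=; rewrite oppr0. Qed.
Lemma qconj1 : qconj (1 : H) = 1.
Proof. by apply: quatP => //=; rewrite oppr0. Qed.
Lemma qconjZ (x : R) p : qconj (x *: p) = x *: qconj p.
Proof. by apply: quatP => /=; ring. Qed.
Lemma qconjM p q : qconj (p * q) = qconj q * qconj p.
Proof. by rewrite !qmulE; apply: quatP => /=; ring. Qed.
Lemma qconjX q n : qconj (q ^+ n) = qconj q ^+ n.
Proof.
elim: n => [|n IH]; first by rewrite !expr0 qconj1.
by rewrite exprS qconjM IH -exprSr.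
Qed.
Lemma qconj_sum (I : Type) (s : seq I) (P : pred I) (F : I -> H) :
  qconj (\sum_(i <- s | P i) F i) = \sum_(i <- s | P i) qconj (F i).
Proof. exact: (big_morph _ qconjD qconj0). Qed.
Lemma qre_sum (I : Type) (s : seq I) (P : pred I) (F : I -> H) :
  qre (\sum_(i <- s | P i) F i) = \sum_(i <- s | P i) qre (F i).
Proof. by elim/big_rec2: _ => //= i x y _ <-. Qed.
Lemma qreD p q : qre (p + q) = qre p + qre q. Proof. by []. Qed.
Lemma qreZ (x : R) p : qre (x *: p) = x * qre p. Proof. by []. Qed.
Lemma qmul_conj q : q * qconj q = (qsqn q)%:A.
Proof. by rewrite /qsqn !quatE; apply: quatP => /=; ring. Qed.
Lemma qconj_mul q : qconj q * q = (qsqn q)%:A.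
Proof. by rewrite /qsqn !quatE; apply: quatP => /=; ring. Qed.

Lemma qsqnM p q : qsqn (p * q) = qsqn p * qsqn q.
Proof. by rewrite qmulE /qsqn /=; ring. Qed.
Lemma qsqn_conj q : qsqn (qconj q) = qsqn q.
Proof. by rewrite /qsqn /=; ring. Qed.
Lemma qsqnZ (x : R) q : qsqn (x *: q) = x ^+ 2 * qsqn q.
Proof. by rewrite /qsqn /=; ring. Qed.
Lemma qsqn0 : qsqn (0 : H) = 0.
Proof. by rewrite /qsqn /=; ring. Qed.
Lemma qsqn1 : qsqn (1 : H) = 1.
Proof. by rewrite /qsqn /=; ring. Qed.
Lemma qsqnN p : qsqn (- p) = qsqn p.
Proof. by rewrite /qsqn /=; ring. Qed.
Lemma qsqn_eq0 p : (qsqn p == 0) = (p == 0).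
Proof.
apply/eqP/eqP => [|->]; last exact: qsqn0.
by move=> p0; apply: qmod_eq0; rewrite /qmod p0 sqrtr0.
Qed.

Lemma normqE q : `|q| = Num.sqrt (qsqn q). Proof. by []. Qed.
Lemma normq2 q : `|q| ^+ 2 = qsqn q.
Proof. by rewrite normqE sqr_sqrtr ?qsqn_ge0. Qed.
Lemma normqM p q : `|p * q| = `|p| * `|q|.
Proof. by rewrite !normqE qsqnM sqrtrM ?qsqn_ge0. Qed.
Lemma normq_conj q : `|qconj q| = `|q|.
Proof. by rewrite !normqE qsqn_conj. Qed.
Lemma normq1 : `|1 : H| = 1.
Proof. by rewrite normqE qsqn1 sqrtr1. Qed.
Lemma normqX q n : `|q ^+ n| = `|q| ^+ n.
Proof. by elim: n => [|n IH]; rewrite ?expr0 ?normq1 // !exprS normqM IH. Qed.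
Lemma normqA (x : R) : `|x%:A : H| = `|x|.
Proof. by rewrite normrZ normq1 mulr1. Qed.

Lemma qreA (x : R) : qre (x%:A : H) = x.
Proof. by rewrite quatE /= mulr1. Qed.

Definition qinv q : H := (qsqn q)^-1 *: qconj q.
Lemma qmulV q : q != 0 -> q * qinv q = 1.
Proof.
move=> q0; rewrite /qinv -scalerAr qmul_conj scalerA mulVf ?scale1r //.
by rewrite qsqn_eq0.
Qed.
Lemma qmulVl q : q != 0 -> qinv q * q = 1.
Proof.
move=> q0; rewrite /qinv -scalerAl qconj_mul scalerA mulVf ?scale1r //.
by rewrite qsqn_eq0.
Qed.

Lemma qmul_eq0 p q : p * q = 0 -> p = 0 \/ q = 0.
Proof.
move=> /(congr1 (@qsqn R)); rewrite qsqnM qsqn0 => /eqP.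
by rewrite mulf_eq0 !qsqn_eq0 => /orP[] /eqP; [left|right].
Qed.

Definition qdot p q : R := qre (qconj p * q).

Lemma qdotE p q :
  qdot p q = qre p * qre q + qi p * qi q + qj p * qj q + qk p * qk q.
Proof. by rewrite /qdot qmulE /=; ring. Qed.
Lemma qdotC p q : qdot p q = qdot q p.
Proof. by rewrite !qdotE; ring. Qed.
Lemma qdotDl p q r : qdot (p + q) r = qdot p r + qdot q r.
Proof. by rewrite !qdotE /=; ring. Qed.
Lemma qdotDr p q r : qdot r (p + q) = qdot r p + qdot r q.
Proof. by rewrite !qdotE /=; ring. Qed.
Lemma qdotNr p q : qdot p (- q) = - qdot p q.
Proof. by rewrite !qdotE /=; ring. Qed.
Lemma qdotZl (x : R) p q : qdot (x *: p) q = x * qdot p q.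
Proof. by rewrite !qdotE /=; ring. Qed.
Lemma qdot0l q : qdot 0 q = 0.
Proof. by rewrite !qdotE /=; ring. Qed.
Lemma qdot0r q : qdot q 0 = 0.
Proof. by rewrite !qdotE /=; ring. Qed.
Lemma qdotMl p q r : qdot (p * q) r = qdot q (qconj p * r).
Proof. by rewrite /qdot qconjM mulrA. Qed.
Lemma qdot_suml (I : Type) (s : seq I) (P : pred I) (F : I -> H) q :
  qdot (\sum_(i <- s | P i) F i) q = \sum_(i <- s | P i) qdot (F i) q.
Proof. exact: (big_morph (qdot^~ q) (fun a b => qdotDl a b q) (qdot0l q)). Qed.
Lemma qdot_sumr (I : Type) (s : seq I) (P : pred I) (F : I -> H) q :
  qdot q (\sum_(i <- s | P i) F i) = \sum_(i <- s | P i) qdot q (F i).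
Proof. exact: (big_morph (qdot q) (fun a b => qdotDr a b q) (qdot0r q)). Qed.
Lemma qdotqq q : qdot q q = qsqn q.
Proof. by rewrite qdotE /qsqn; ring. Qed.

Lemma qsqnD p q : qsqn (p + q) = qsqn p + 2 * qdot p q + qsqn q.
Proof. by rewrite -!qdotqq !qdotDl !qdotDr (qdotC q p); ring. Qed.
Lemma qsqnB p q : qsqn (p - q) = qsqn p - 2 * qdot p q + qsqn q.
Proof. by rewrite qsqnD qdotNr qsqnN mulrN. Qed.

Lemma qsqnD_le p q : qsqn (p + q) <= 2 * (qsqn p + qsqn q).
Proof.
rewrite -subr_ge0; have -> : 2 * (qsqn p + qsqn q) - qsqn (p + q) = qsqn (p - q).
  by rewrite qsqnD qsqnB; ring.
exact: qsqn_ge0.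
Qed.

(** Positivity of |t p - q|^2, divided by t. With the weight free, the duality arguments close
    without square roots. *)
Lemma qdot_le p q (t : R) : 0 < t -> 2 * qdot p q <= t * qsqn p + t^-1 * qsqn q.
Proof.
move=> t0; have t1 : t != 0 by rewrite gt_eqF.
have := qsqn_ge0 (t *: p - q); rewrite qsqnB qsqnZ qdotZl => h.
have : 0 <= t^-1 * (t ^+ 2 * qsqn p - 2 * (t * qdot p q) + qsqn q).
  by rewrite mulr_ge0 // invr_ge0 ltW.
have -> : t^-1 * (t ^+ 2 * qsqn p - 2 * (t * qdot p q) + qsqn q) =
  t * qsqn p + t^-1 * qsqn q - 2 * qdot p q by field.
by rewrite subr_ge0.
Qed.

Lemma qre_le q : `|qre q| <= `|q|.
Proof.
rewrite -(@ler_pXn2r _ 2) ?nnegrE // normq2 real_normK ?num_real // /qsqn.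
by rewrite -!addrA lerDl !addr_ge0 ?sqr_ge0.
Qed.
Lemma qi_le q : `|qi q| <= `|q|.
Proof.
rewrite -(@ler_pXn2r _ 2) ?nnegrE // normq2 real_normK ?num_real // /qsqn.
by rewrite (addrC (_ ^+ 2) (qi q ^+ 2)) -!addrA lerDl !addr_ge0 ?sqr_ge0.
Qed.
Lemma qj_le q : `|qj q| <= `|q|.
Proof.
rewrite -(@ler_pXn2r _ 2) ?nnegrE // normq2 real_normK ?num_real // /qsqn.
by rewrite -addrA addrCA lerDl !addr_ge0 ?sqr_ge0.
Qed.
Lemma qk_le q : `|qk q| <= `|q|.
Proof.
rewrite -(@ler_pXn2r _ 2) ?nnegrE // normq2 real_normK ?num_real // /qsqn.
by rewrite lerDr !addr_ge0 ?sqr_ge0.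
Qed.
Lemma qdot_norm p q : `|qdot p q| <= `|p| * `|q|.
Proof. by apply: le_trans (qre_le _) _; rewrite normqM normq_conj. Qed.

(** The 2 is the square root of the number of components. *)
Lemma normq_le q (e : R) : `|qre q| <= e -> `|qi q| <= e -> `|qj q| <= e ->
  `|qk q| <= e -> `|q| <= 2 * e.
Proof.
move=> h1 h2 h3 h4; have e0 : 0 <= e := le_trans (normr_ge0 _) h1.
rewrite -(@ler_pXn2r _ 2) ?nnegrE ?mulr_ge0 // normq2 /qsqn.
have k (x : R) : `|x| <= e -> x ^+ 2 <= e ^+ 2.
  by move=> h; rewrite -(real_normK (num_real x)) ler_pXn2r ?nnegrE.
by have := k _ h1; have := k _ h2; have := k _ h3; have := k _ h4; lra.
Qed.

Lemma qcvgP {T : Type} {F : set_system T} {FF : ProperFilter F} (u : T -> H) (l : H) :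
  u @ F --> l <-> [/\ (fun x => qre (u x)) @ F --> qre l, (fun x => qi (u x)) @ F --> qi l,
                      (fun x => qj (u x)) @ F --> qj l & (fun x => qk (u x)) @ F --> qk l].
Proof.
split=> [ul|[h1 h2 h3 h4]].
  have k (c : H -> R) : (forall q, `|c q| <= `|q|) ->
      (forall p q, c (p - q) = c p - c q) -> (fun x => c (u x)) @ F --> c l.
    move=> cle cB; apply/cvgrPdist_le => e e0.
    move/cvgrPdist_le : ul => /(_ _ e0); apply: filterS => x /=.
    by rewrite -cB; apply: le_trans.
  by split; apply: k => //; [exact: qre_le|exact: qi_le|exact: qj_le|exact: qk_le].
apply/cvgrPdist_le => e e0; have e2 : 0 < e / 2 by rewrite divr_gt0.
move/cvgrPdist_le : h1 => /(_ _ e2) h1; move/cvgrPdist_le : h2 => /(_ _ e2) h2.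
move/cvgrPdist_le : h3 => /(_ _ e2) h3; move/cvgrPdist_le : h4 => /(_ _ e2) h4.
near=> x; have -> : e = 2 * (e / 2) by field.
by apply: normq_le => /=; near: x.
Unshelve. all: by end_near. Qed.

Lemma qcvgM {T : Type} {F : set_system T} {FF : ProperFilter F} (u v : T -> H) (a b : H) :
  u @ F --> a -> v @ F --> b -> (fun x => u x * v x) @ F --> a * b.
Proof.
move=> /qcvgP[u1 u2 u3 u4] /qcvgP[v1 v2 v3 v4]; apply/qcvgP; rewrite qmulE /=.
split; under eq_fun do rewrite qmulE /=.
- exact: cvgB (cvgB (cvgB (cvgM u1 v1) (cvgM u2 v2)) (cvgM u3 v3)) (cvgM u4 v4).
- exact: cvgB (cvgD (cvgD (cvgM u1 v2) (cvgM u2 v1)) (cvgM u3 v4)) (cvgM u4 v3).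
- exact: cvgD (cvgD (cvgB (cvgM u1 v3) (cvgM u2 v4)) (cvgM u3 v1)) (cvgM u4 v2).
- exact: cvgD (cvgB (cvgD (cvgM u1 v4) (cvgM u2 v3)) (cvgM u3 v2)) (cvgM u4 v1).
Qed.
Lemma qcvgMl {T : Type} {F : set_system T} {FF : ProperFilter F} (v : T -> H) (a b : H) :
  v @ F --> b -> (fun x => a * v x) @ F --> a * b.
Proof. by move=> vb; apply: qcvgM => //; exact: cvg_cst. Qed.
Lemma qcvgMr {T : Type} {F : set_system T} {FF : ProperFilter F} (u : T -> H) (a b : H) :
  u @ F --> a -> (fun x => u x * b) @ F --> a * b.
Proof. by move=> vb; apply: qcvgM => //; exact: cvg_cst. Qed.
Lemma qcvg_conj {T : Type} {F : set_system T} {FF : ProperFilter F} (u : T -> H) (a : H) :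
  u @ F --> a -> (fun x => qconj (u x)) @ F --> qconj a.
Proof.
move=> /qcvgP[u1 u2 u3 u4]; apply/qcvgP => /=; split=> //; exact: cvgN.
Qed.

Lemma qcvg_qsqn {T : Type} {F : set_system T} {FF : ProperFilter F} (u : T -> H) (a : H) :
  u @ F --> a -> (fun x => qsqn (u x)) @ F --> qsqn a.
Proof.
move=> ua; have /qcvgP[h _ _ _] : (fun x => qconj (u x) * u x) @ F --> qconj a * a.
  exact: qcvgM (qcvg_conj ua) ua.
have -> : (fun x => qsqn (u x)) = (fun x => qre (qconj (u x) * u x)).
  by apply/funext => x; rewrite -qdotqq.
by rewrite -qdotqq.
Qed.

(** Each component is additive and 1-Lipschitz, so it maps a Cauchy filter to a Cauchy filter of
    reals. Completeness is what gives absolutely convergent series a sum. *)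
Lemma quat_complete (F : set_system H) : ProperFilter F -> cauchy F -> cvg F.
Proof.
move=> FF /cauchy_ballP Fc.
have k (c : H -> R) : (forall q, `|c q| <= `|q|) ->
    (forall p q, c (p - q) = c p - c q) -> cvg (c @ F).
  move=> cle cB; apply: R_complete; apply/cauchy_ballP => e e0.
  have := Fc e e0; rewrite /nbhs /= => -[[A B]] /= [FA FB] AB.
  exists (c @` A, c @` B); first by split; [move: FA|move: FB]; apply: filterS => x Ax; exists x.
  case=> x y /= [[x' Ax' <-] [y' By' <-]].
  have := AB (x', y') (conj Ax' By'); rewrite -!ball_normE /= -cB.
  by apply: le_lt_trans.
have [/cvg_ex[a ha] /cvg_ex[b hb]] := (k _ qre_le (fun _ _ => erefl), k _ qi_le (fun _ _ => erefl)).
have [/cvg_ex[c hc] /cvg_ex[d hd]] := (k _ qj_le (fun _ _ => erefl), k _ qk_le (fun _ _ => erefl)).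
apply/cvg_ex; exists (Quat a b c d).
by have := (@qcvgP _ F FF id (Quat a b c d)).2; rewrite /= ; apply.
Qed.

End QuatBasics.

HB.instance Definition _ (R : realType) :=
  Uniform_isComplete.Build (quat R) (@quat_complete R).

(** * Power series *)

Section PowerSeries.
Context {R : realType}.
Local Notation H := (quat R).
Implicit Types (a b : nat -> H) (q e : H).

Lemma slice_derive (f : H -> H) (I : H) (x y : R) :
  differentiable f (x%:A + y *: I) ->
  derive1 (fun s : R => f (s%:A + y *: I)) x = 'd f (x%:A + y *: I) 1 /\
  derive1 (fun t : R => f (x%:A + t *: I)) y = 'd f (x%:A + y *: I) I.
Proof.
move=> df; split; rewrite -deriveE // /derive1 /derive;
  set d := (fun _ : R => _); set d' := (fun _ : R => _);
  suff -> : d = d' by []; rewrite funeqE => s; rewrite /d /d' /=.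
  by rewrite scalerDl addrA.
by rewrite scalerDl addrCA.
Qed.

Lemma differentiableE (f : H -> H) q (ep : R) : differentiable f q -> 0 < ep ->
  exists2 d : R, 0 < d & forall e, `|e| < d ->
    `|f (q + e) - f q - 'd f q e| <= ep * `|e|.
Proof.
move=> /diff_locally/eqadd_some_oP /= h ep0; have {h} := h _ ep0.
move=> /nbhs_norm0P[d /= d0 hd].
exists d => // e ed; have := hd e ed; rewrite /= !fctE /=.
by rewrite opprD addrA (addrC e).
Qed.

Lemma differentiable_intro (f D : H -> H) q (C K d : R) :
  (forall (t : R) e1 e2, D (t *: e1 + e2) = t *: D e1 + D e2) ->
  (forall e, `|D e| <= C * `|e|) -> 0 < d -> 0 <= K ->
  (forall e, `|e| < d -> `|f (q + e) - f q - D e| <= K * `|e| ^+ 2) ->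
  differentiable f q /\ forall e, 'd f q e = D e.
Proof.
move=> Dlin DC d0 K0 hK.
pose DL : {linear H -> H} := HB.pack D (GRing.isLinear.Build _ _ _ _ _ Dlin).
have Dc : continuous DL.
  apply/linear_bounded_continuous; apply/linear_boundedP; near=> r => x.
  apply: le_trans (DC x) _; rewrite ler_wpM2r //.
have fo : f \o shift q = cst (f q) + DL +o_ 0 id.
  apply/eqaddoP => ep ep0; apply/nbhs_norm0P.
  (* The second bound makes K |e|^2 <= ep |e|; the [+ 1] allows K = 0. *)
  exists (Num.min d (ep / (K + 1))).
    by rewrite /= lt_min d0 divr_gt0 // ltr_wpDl.
  move=> e /=; rewrite lt_min => /andP[ed eK]; rewrite !fctE /= opprD addrA (addrC e).
  apply: le_trans (hK _ ed) _; rewrite expr2 mulrA ler_wpM2r //.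
  move: eK; rewrite ltr_pdivlMr ?ltr_wpDl // => /ltW; apply: le_trans.
  by rewrite mulrC ler_wpM2l // lerDl.
have dE := diff_unique Dc fo.
split; last by move=> e; rewrite dE.
by apply/diff_locallyP; rewrite dE.
Unshelve. all: by end_near. Qed.

(** Summing the recursion gives S_(n+1) <= rho * S_n + Y, whose fixed point is Y / (1 - rho). This
    bounds the series of derivatives and remainders without expanding (q + e)^m, which has no
    binomial formula when q and e do not commute. *)
Lemma geo_rec_sum (rho Y : R) (x y : nat -> R) : 0 <= rho < 1 -> x 0%N <= 0 ->
  (forall m, x m.+1 <= rho * x m + y m) ->
  (forall n, \sum_(0 <= m < n) y m <= Y) ->
  forall n, \sum_(0 <= m < n) x m <= Y / (1 - rho).
Proof.
move=> /andP[r0 r1] x0 xr yY.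
have Y0 : 0 <= Y by have := yY 0%N; rewrite big_nil.
have r1' : 0 < 1 - rho by rewrite subr_gt0.
elim=> [|n IH]; first by rewrite big_nil divr_ge0 // ltW.
rewrite big_nat_recl //; apply: le_trans (_ : rho * (Y / (1 - rho)) + Y <= _).
  apply: le_trans (_ : 0 + \sum_(0 <= i < n) (rho * x i + y i) <= _).
    by apply: lerD => //; apply: ler_sum.
  rewrite add0r big_split /= -mulr_sumr; apply: lerD => //.
  by rewrite ler_wpM2l.
rewrite le_eqVlt; apply/orP; left; apply/eqP; field.
by rewrite gt_eqF.
Qed.

Lemma geo_sum (rho : R) n : 0 <= rho < 1 -> \sum_(0 <= m < n) rho ^+ m <= (1 - rho)^-1.
Proof.
move=> /andP[r0 r1]; have r1' : 0 < 1 - rho by rewrite subr_gt0.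
have h : (1 - rho) * (\sum_(0 <= m < n) rho ^+ m) = 1 - rho ^+ n.
  by have := subrX1 rho n; rewrite big_mkord; lra.
rewrite -[leRHS]mulr1 ler_pdivlMl // h lerBlDr lerDl exprn_ge0 //.
Qed.

Lemma series_abs_cvg (u : nat -> H) (B : R) :
  (forall n, \sum_(0 <= m < n) `|u m| <= B) ->
  cvgn (series u) /\ `|limn (series u)| <= B.
Proof.
move=> uB.
have cn : cvgn [normed series u].
  apply: nondecreasing_is_cvgn; first by apply: nondecreasing_series => n _ _; exact: normr_ge0.
  by exists B => _ [n _ <-]; exact: uB.
split; first exact: normed_cvg.
apply: le_trans (lim_series_norm cn) _; apply: limr_le => //.
by near=> n; exact: uB.
Unshelve. all: by end_near. Qed.

(* [powD], [powL], [powR] are (q+e)^m - q^m, its linear part in e, and the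
   remainder; the recursions make them summable by [geo_rec_sum]. *)
Fixpoint powL q e m : H := if m is m'.+1 then q * powL q e m' + e * q ^+ m' else 0.
Definition powD q e m : H := (q + e) ^+ m - q ^+ m.
Definition powR q e m : H := powD q e m - powL q e m.

Lemma powD_rec q e m : powD q e m.+1 = (q + e) * powD q e m + e * q ^+ m.
Proof. by rewrite /powD !exprS mulrBr (mulrDl q e (q ^+ m)) opprD addrA subrK. Qed.

Lemma powR_rec q e m : powR q e m.+1 = q * powR q e m + e * powD q e m.
Proof.
rewrite /powR powD_rec /= mulrDl opprD addrA addrAC addrK addrAC.
by rewrite -mulrBr.
Qed.

Section PowEst.
Variables (q e : H) (rho : R).
Hypotheses (r01 : 0 <= rho < 1) (qr : `|q| <= rho) (qer : `|q + e| <= rho).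

Lemma powL_sum n : \sum_(0 <= m < n) `|powL q e m| <= `|e| / (1 - rho) ^+ 2.
Proof.
have [r0 r1] := andP r01.
rewrite expr2 invfM mulrA.
apply: (geo_rec_sum (y := fun m => `|e| * rho ^+ m)) => //= [|m|k].
- by rewrite normr0.
- apply: le_trans (ler_normD _ _) _; rewrite !normqM normqX.
  by apply: lerD; rewrite ?ler_wpM2r ?ler_wpM2l // lerXn2r // nnegrE.
- by rewrite -mulr_sumr ler_wpM2l // geo_sum.
Qed.

Lemma powD_sum n : \sum_(0 <= m < n) `|powD q e m| <= `|e| / (1 - rho) ^+ 2.
Proof.
have [r0 r1] := andP r01.
rewrite expr2 invfM mulrA.
apply: (geo_rec_sum (y := fun m => `|e| * rho ^+ m)) => //= [|m|k].
- by rewrite /powD !expr0 subrr normr0.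
- rewrite powD_rec; apply: le_trans (ler_normD _ _) _; rewrite !normqM normqX.
  by apply: lerD; rewrite ?ler_wpM2r ?ler_wpM2l // lerXn2r // nnegrE.
- by rewrite -mulr_sumr ler_wpM2l // geo_sum.
Qed.

(** The recursion for the remainder is driven by [powD], itself driven by the geometric series; each
    of the three levels costs one factor 1 / (1 - rho), and the last two one factor |e| each. *)
Lemma powR_sum n : \sum_(0 <= m < n) `|powR q e m| <= `|e| ^+ 2 / (1 - rho) ^+ 3.
Proof.
have [r0 r1] := andP r01.
rewrite (exprSr (1 - rho)) invfM mulrA.
apply: (geo_rec_sum (y := fun m => `|e| * `|powD q e m|)) => //= [|m|k].
- by rewrite /powR /powD /= !expr0 !subrr normr0.
- rewrite powR_rec; apply: le_trans (ler_normD _ _) _; rewrite !normqM.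
  by apply: lerD; rewrite ?ler_wpM2r.
- by rewrite -mulr_sumr expr2 -mulrA ler_wpM2l // powD_sum.
Qed.
End PowEst.

Lemma powL_lin (t : R) q e1 e2 m :
  powL q (t *: e1 + e2) m = t *: powL q e1 m + powL q e2 m.
Proof.
elim: m => [|m /= ->]; first by rewrite /= scaler0 addr0.
by rewrite mulrDl mulrDr scalerDr -scalerAr -scalerAl !addrA; congr (_ + _); rewrite addrAC.
Qed.

(** For c = I and q in the slice of I this is the Cauchy-Riemann equation of the monomials, from
    which power series inherit regularity. *)
Lemma powL_comm q e c m : c * q = q * c -> powL q (c * e) m = c * powL q e m.
Proof.
move=> cq; elim: m => [|m /= ->]; first by rewrite /= mulr0.
by rewrite mulrDr !mulrA cq.
Qed.

Definition bseq a := exists C : R, forall m, `|a m| <= C.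

Definition psum_fun a q := limn (qpseries a q).

Lemma bseq_ge0 a (C : R) : (forall m, `|a m| <= C) -> 0 <= C.
Proof. by move=> /(_ 0%N); apply: le_trans. Qed.

Lemma weighted_cvg a (c : nat -> H) (C B : R) : (forall m, `|a m| <= C) ->
  (forall n, \sum_(0 <= m < n) `|c m| <= B) ->
  cvgn (series (fun m => c m * a m)) /\ `|limn (series (fun m => c m * a m))| <= B * C.
Proof.
move=> aC cB; apply: series_abs_cvg => n.
apply: le_trans (_ : (\sum_(0 <= m < n) `|c m|) * C <= _).
  by rewrite mulr_suml; apply: ler_sum => m _; rewrite normqM ler_wpM2l.
by rewrite ler_wpM2r // (bseq_ge0 aC).
Qed.

Lemma normX_sum q n : qball q -> \sum_(0 <= m < n) `|q ^+ m| <= (1 - `|q|)^-1.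
Proof.
rewrite /qball /= => q1; under eq_bigr do rewrite normqX.
by apply: geo_sum; rewrite normr_ge0.
Qed.

Lemma qpseries_cvg a q : bseq a -> qball q -> qpseries a q @ \oo --> psum_fun a q.
Proof.
move=> [C aC] qb.
by have [] := weighted_cvg aC (fun n => normX_sum n qb).
Qed.

Lemma psum_fun_diff a q : bseq a -> qball q ->
  differentiable (psum_fun a) q /\
  forall e, 'd (psum_fun a) q e = limn (series (fun m => powL q e m * a m)).
Proof.
move=> [C aC] qb; have C0 := bseq_ge0 aC.
have ba : bseq a by exists C.
have q1 : `|q| < 1 by [].
(* Midpoint between |q| and 1: a common radius for [q] and [q + e] as soon as |e| < (1 - |q|) /
   2. *)
pose rho := (1 + `|q|) / 2.
have r01 : 0 <= rho < 1.
  by rewrite divr_ge0 ?addr_ge0 //= ltr_pdivrMr // mul1r; lra.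
have qr : `|q| <= rho by rewrite /rho ler_pdivlMr //; lra.
have Lc e := weighted_cvg aC (@powL_sum q e rho r01 qr).
set D := fun e => limn (series (fun m => powL q e m * a m)).
apply: (@differentiable_intro _ _ _ (C / (1 - rho) ^+ 2) (C / (1 - rho) ^+ 3) ((1 - `|q|) / 2)).
- move=> t e1 e2; apply: cvg_lim => //.
  rewrite (_ : series _ = fun n => t *: series (fun m => powL q e1 m * a m) n + series (fun m => powL q e2 m * a m) n).
    apply: cvgD; last exact: (Lc _).1.
    by apply: cvgZl_tmp; exact: (Lc _).1.
  apply/funext => n; rewrite /series /= scaler_sumr -big_split /=.
  by apply: eq_bigr => m _; rewrite powL_lin mulrDl scalerAl.
- by move=> e; rewrite mulrAC (mulrC C) mulrAC; exact: (Lc e).2.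
- by rewrite divr_gt0 // subr_gt0.
- by rewrite divr_ge0 // exprn_ge0 // subr_ge0 ltW //; case/andP: r01.
- move=> e ed.
  have qer : `|q + e| <= rho.
    apply: le_trans (ler_normD _ _) _; move: ed; rewrite /rho ltr_pdivlMr // ler_pdivlMr //; lra.
  have qeb : qball (q + e) by apply: le_lt_trans qer _; case/andP: r01.
  have [_] := weighted_cvg aC (@powR_sum q e rho r01 qr qer).
  rewrite [leRHS](_ : _ = C / (1 - rho) ^+ 3 * `|e| ^+ 2); last by ring.
  congr (`|_| <= _); apply: cvg_lim => //.
  rewrite (_ : series _ = qpseries a (q + e) - qpseries a q - series (fun m => powL q e m * a m)).
    by apply: cvgB; [apply: cvgB; exact: qpseries_cvg|exact: (Lc e).1].
  apply/funext => n; rewrite !fctE /qpseries /series /= -!sumrB.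
  by apply: eq_bigr => m _; rewrite /powR /powD !mulrBl.
Qed.

Lemma psum_fun_regular a : bseq a -> slice_regular (psum_fun a).
Proof.
move=> ba; split=> [q qb|I hI x y qb]; first exact: (psum_fun_diff ba qb).1.
have [df dE] := psum_fun_diff ba qb.
have [-> ->] := slice_derive df; rewrite !dE.
have [C aC] := ba.
set q := _ + _ in qb *.
have q1 : `|q| < 1 by [].
have r01 : 0 <= `|q| < 1 by rewrite normr_ge0.
have Iq : I * q = q * I.
  by rewrite mulrDr mulrDl -!scalerAr -!scalerAl mulr1 mul1r.
have Lc e := weighted_cvg aC (fun n => powL_sum e r01 (lexx _) n).
have -> : I * limn (series (fun m => powL q I m * a m)) = - limn (series (fun m => powL q 1 m * a m)).
  have E : (fun n => I * series (fun m => powL q I m * a m) n) =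
      - series (fun m => powL q 1 m * a m).
    apply/funext => n; rewrite /series /= !fctE /= mulr_sumr -sumrN.
    apply: eq_bigr => m _; rewrite mulrA -powL_comm // hI -mulNr; congr (_ * _).
    by rewrite -[-1 in LHS]mulr1 powL_comm ?mulN1r // mulrN mulr1.
  rewrite -limN; last exact: (Lc 1).1.
  by rewrite -E; apply/esym/cvg_lim => //; exact: (qcvgMl (a := I) (Lc I).1).
by rewrite subrr scaler0.
Qed.

Lemma psum_fun_le a q (C : R) : (forall m, `|a m| <= C) -> qball q ->
  `|psum_fun a q| <= C / (1 - `|q|).
Proof.
move=> aC qb; rewrite mulrC.
exact: (weighted_cvg aC (fun n => normX_sum n qb)).2.
Qed.

Lemma psum_fun_shift a q : bseq a -> qball q ->
  psum_fun a q = a 0%N + q * psum_fun (fun m => a m.+1) q.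
Proof.
move=> [C aC] qb; apply/cvg_lim => //.
rewrite -(cvg_shiftS (qpseries a q)) /=.
have -> : (fun n => qpseries a q n.+1) =
    fun n => a 0%N + q * qpseries (fun m => a m.+1) q n.
  apply/funext => n; rewrite /qpseries /series /= big_nat_recl // expr0 mul1r.
  by rewrite mulr_sumr; congr (_ + _); apply: eq_bigr => m _; rewrite exprS mulrA.
apply: cvgD; first exact: cvg_cst.
by apply: qcvgMl; apply: qpseries_cvg => //; exists C.
Qed.

Lemma bseq_zero0 d : bseq d ->
  (forall x : R, 0 < x < 1 -> psum_fun d x%:A = 0) -> d 0%N = 0.
Proof.
move=> [C dC] hd.
have C0 := bseq_ge0 dC; have bd : bseq d by exists C.
apply/eqP; rewrite -normr_eq0 eq_le normr_ge0 andbT leNgt; apply/negP => d0.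
set t := `|d 0%N| in d0.
(* The rest of the series at x is at most x * C / (1 - x) <= 2 C x, since x <= 1/4, and 2 C x <= t /
   2 is too small to cancel the constant term, of modulus t. The [t] in the denominator covers C =
   0. *)
pose x := t / (4 * (C + t)).
have x0 : 0 < x by rewrite divr_gt0 // mulr_gt0 // ltr_wpDl.
have x4 : x <= 1 / 4.
  by rewrite ler_pdivrMr ?mulr_gt0 ?ltr_wpDl // mulrA; lra.
have x1 : 0 < x < 1 by rewrite x0 /=; lra.
have nx : `|x%:A : H| = x by rewrite normqA gtr0_norm.
have xb : qball (x%:A : H) by rewrite /qball /= nx; lra.
have := psum_fun_shift bd xb; rewrite (hd _ x1) => /esym/eqP; rewrite addr_eq0 => /eqP h.
have : t <= x * (C / (1 - x)).
  rewrite /t h normrN normqM nx ler_wpM2l ?(ltW x0) //.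
  have := @psum_fun_le (fun m => d m.+1) _ C (fun m => dC m.+1) xb.
  by rewrite nx.
have e1 : C / (1 - x) <= C * 2.
  rewrite ler_wpM2l // -[2]invrK lef_pV2 ?posrE ?invr_gt0 //; lra.
move=> h1; have {h1} h2 : t <= x * (C * 2).
  by apply: le_trans h1 _; rewrite ler_wpM2l // ltW.
have : x * (4 * (C + t)) = t by rewrite divfK // gt_eqF // mulr_gt0 // ltr_wpDl.
by nra.
Qed.

Lemma bseq_zero d : bseq d ->
  (forall x : R, 0 < x < 1 -> psum_fun d x%:A = 0) -> forall n, d n = 0.
Proof.
move=> bd hd n; elim: n d bd hd => [|n IH] d bd hd; first exact: bseq_zero0.
apply: (IH (fun m => d m.+1)) => [|x x1]; first by have [C dC] := bd; exists C.
have [x0 x1'] := andP x1.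
have xb : qball (x%:A : H) by rewrite /qball /= normqA gtr0_norm.
have := psum_fun_shift bd xb.
rewrite hd // (bseq_zero0 bd hd) add0r => /esym/qmul_eq0[/(congr1 (@qre R))|//].
by rewrite qreA => x00; move: x0; rewrite x00 ltxx.
Qed.

Definition has_ps (F : H -> H) a := forall q, qball q -> qpseries a q @ \oo --> F q.

Lemma qcvg_unique (u : nat -> H) (l l' : H) : u @ \oo --> l -> u @ \oo --> l' -> l = l'.
Proof. by move=> h h'; rewrite -(cvg_lim _ h) // -(cvg_lim _ h'). Qed.

Lemma cvg_seq_bound (u : nat -> H) (l : H) : u @ \oo --> l ->
  exists C : R, forall n, `|u n| <= C.
Proof.
move=> ul; have /cvg_seq_bounded [M [Mr hM]] : cvgn u by apply/cvg_ex; exists l.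
exists (M + 1) => n; apply: hM => //; by rewrite ltrDl.
Qed.

(** Only real points are tested because they lie on every slice: coefficients computed on different
    slices can thus be compared. *)
Lemma ps_unique_real (F : H -> H) a b :
  (forall x : R, 0 < x < 1 -> qpseries a (x%:A : H) @ \oo --> F (x%:A : H)) ->
  (forall x : R, 0 < x < 1 -> qpseries b (x%:A : H) @ \oo --> F (x%:A : H)) -> a = b.
Proof.
move=> ha hb; apply/funext => n; apply/eqP; rewrite -subr_eq0.
(* Coefficients of a series converging in the ball may be unbounded, while [bseq_zero] asks for a
   bounded sequence. The rescaled differences are bounded because both series converge at 1/2. *)
pose d m := (2^-1) ^+ m *: (a m - b m).
have half : 0 < (2^-1 : R) by rewrite invr_gt0.
have XA (x : R) m : (x%:A : H) ^+ m = (x ^+ m)%:A.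
  elim: m => [|m IH]; first by rewrite !expr0 scale1r.
  by rewrite !exprS IH -scalerAl mul1r scalerA.
have sB (x : R) : (fun m => x%:A ^+ m * d m) =
   (fun m => (x / 2)%:A ^+ m * a m - (x / 2)%:A ^+ m * b m).
  apply/funext => m; rewrite -mulrBr !XA -!scalerAl !mul1r /d scalerA.
  by rewrite exprMn exprVn.
have xcv (x : R) : 0 < x <= 1 -> series (fun m => x%:A ^+ m * d m) @ \oo --> (0 : H).
  move=> /andP[x0 x1]; rewrite sB -(subrr (F ((x / 2)%:A))).
  have x2 : 0 < x / 2 < 1 by rewrite divr_gt0 //= ltr_pdivrMr //; lra.
  rewrite (_ : series _ = fun k => qpseries a (x / 2)%:A k - qpseries b (x / 2)%:A k).
    by apply: cvgB; [exact: ha|exact: hb].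
  by apply/funext => k; rewrite /series /qpseries /series /= sumrB.
have bd : bseq d.
  have [C hC] := cvg_seq_bound (xcv 1 ltac:(by rewrite ltr01 lexx)).
  exists (C + C) => m; have := hC m.+1; have := hC m.
  rewrite /series /= big_nat_recr //= scale1r expr1n mul1r.
  set S := \sum_(0 <= i < m) _ => h1 h2.
  have -> : d m = (S + d m) - S by rewrite addrAC subrr add0r.
  by apply: le_trans (ler_normB _ _) _; rewrite lerD.
have := @bseq_zero d bd _ n; rewrite /d => h.
have /h {h} : forall x : R, 0 < x < 1 -> psum_fun d x%:A = 0.
  by move=> x /andP[x0 x1]; apply/cvg_lim => //; apply: xcv; rewrite x0 ltW.
move=> /eqP; rewrite scaler_eq0 expf_eq0 (gt_eqF half) andbF /=; by [].
Qed.

Lemma has_ps_unique F a b : has_ps F a -> has_ps F b -> a = b.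
Proof.
move=> ha hb; apply: (@ps_unique_real F) => x /andP[x0 x1]; [apply: ha|apply: hb];
  by rewrite /qball /= normqA gtr0_norm.
Qed.

Lemma coefsE F a : has_ps F a -> coefs F = a.
Proof.
move=> h; apply: has_ps_unique (h); rewrite /coefs; case: xgetP => [c -> //|].
by move=> /(_ a) [].
Qed.

Lemma has_psum a : bseq a -> has_ps (psum_fun a) a.
Proof. by move=> ba q qb; apply: qpseries_cvg. Qed.

Lemma coefs_psum a : bseq a -> coefs (psum_fun a) = a.
Proof. by move=> /has_psum/coefsE. Qed.

Lemma has_psD F G a b : has_ps F a -> has_ps G b ->
  has_ps (fun q => F q + G q) (fun m => a m + b m).
Proof.
move=> ha hb q qb; rewrite (_ : qpseries _ q = fun k => qpseries a q k + qpseries b q k).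
  by apply: cvgD; [exact: ha|exact: hb].
by apply/funext => k; rewrite /qpseries /series /= -big_split /=; apply: eq_bigr => i _; rewrite mulrDr.
Qed.

Lemma has_psN F a : has_ps F a -> has_ps (fun q => - F q) (fun m => - a m).
Proof.
move=> ha q qb; rewrite (_ : qpseries _ q = fun k => - qpseries a q k).
  by apply: cvgN; exact: ha.
by apply/funext => k; rewrite /qpseries /series /= -sumrN; apply: eq_bigr => i _; rewrite mulrN.
Qed.

Lemma has_psZ (t : R) F a : has_ps F a -> has_ps (fun q => t *: F q) (fun m => t *: a m).
Proof.
move=> ha q qb; rewrite (_ : qpseries _ q = fun k => t *: qpseries a q k).
  by apply: cvgZl_tmp; exact: ha.
by apply/funext => k; rewrite /qpseries /series /= scaler_sumr; apply: eq_bigr => i _; rewrite scalerAr.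
Qed.

Lemma has_ps0 : has_ps (fun=> 0) (fun=> 0).
Proof.
move=> q qb; rewrite (_ : qpseries _ q = fun=> 0); first exact: cvg_cst.
by apply/funext => k; rewrite /qpseries /series /= big1 // => i _; rewrite mulr0.
Qed.

Lemma psum0 (V : nmodType) (L : set nat) (u : nat -> V) : psum L u 0 = 0.
Proof. by rewrite /psum big_nil. Qed.

Lemma psumS (V : nmodType) (L : set nat) (u : nat -> V) n :
  psum L u n.+1 = psum L u n + (if n \in L then u n else 0).
Proof. by rewrite /psum big_mkcond /= big_nat_recr //= -big_mkcond. Qed.

Lemma has_ps_psum (L : set nat) (F : nat -> H -> H) (a : nat -> nat -> H) n :
  (forall j, L j -> has_ps (F j) (a j)) ->
  has_ps (fun q => psum L (fun j => F j q) n) (fun m => psum L (fun j => a j m) n).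
Proof.
move=> h; elim: n => [|n IH] q qb.
  rewrite psum0 (_ : (fun m => _) = fun=> 0); first exact: has_ps0.
  by apply/funext => m; rewrite psum0.
rewrite psumS.
have -> : (fun m => psum L (fun j => a j m) n.+1) =
  (fun m => psum L (fun j => a j m) n + (if n \in L then a n m else 0)).
  by apply/funext => m; rewrite psumS.
apply: (@has_psD (fun q => psum L (fun j => F j q) n) (fun q => if n \in L then F n q else 0)) => //.
by case: (boolP (n \in L)) => [/set_mem /h //|_]; exact: has_ps0.
Qed.

End PowerSeries.

(** * Cauchy-Goursat on a slice *)

Section Integrals.
Context {R : realType}.
Local Notation H := (quat R).
Implicit Types (a b c : R) (f g : R -> R) (u v : R -> H).

(** Two-sided continuity, also at the endpoints: it composes pointwise, without subspace
    topologies. *)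
Definition cont_on {V : topologicalType} a b (f : R -> V) :=
  forall x, a <= x <= b -> {for x, continuous f}.

Definition rint a b f : R := \int[lebesgue_measure]_(x in `[a, b]) f x.

Lemma cont_on_integrable a b f : cont_on a b f ->
  (@lebesgue_measure R).-integrable `[a, b] (EFin \o f).
Proof.
move=> cf; apply: continuous_compact_integrable; first exact: segment_compact.
apply: continuous_in_subspaceT => x; rewrite inE /= in_itv /=; exact: cf.
Qed.
Local Hint Extern 0 (measurable _) => exact: measurable_itv : core.

Lemma rint_eq a b f g : (forall x, a <= x <= b -> f x = g x) -> rint a b f = rint a b g.
Proof.
by move=> fg; apply: eq_Rintegral => x; rewrite inE /= in_itv /=; exact: fg.
Qed.

Lemma rintD a b f g : cont_on a b f -> cont_on a b g ->
  rint a b (fun x => f x + g x) = rint a b f + rint a b g.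
Proof. by move=> cf cg; rewrite /rint RintegralD //; exact: cont_on_integrable. Qed.

Lemma rintZ a b (k : R) f : cont_on a b f ->
  rint a b (fun x => k * f x) = k * rint a b f.
Proof. by move=> cf; rewrite /rint RintegralZl //; exact: cont_on_integrable. Qed.

Lemma rintN a b f : cont_on a b f -> rint a b (fun x => - f x) = - rint a b f.
Proof.
move=> cf; rewrite -[RHS]mulN1r -rintZ //; apply: rint_eq => x _; by rewrite mulN1r.
Qed.

Lemma rint_cst a b (k : R) : a <= b -> rint a b (fun=> k) = k * (b - a).
Proof.
move=> ab; rewrite /rint Rintegral_cst //= lebesgue_measure_itv /= lte_fin.
by move: ab; rewrite le_eqVlt => /predU1P[->|ab]; rewrite ?ab ?ltxx ?subrr.
Qed.

Lemma rint_le a b f g : cont_on a b f -> cont_on a b g ->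
  (forall x, a <= x <= b -> f x <= g x) -> rint a b f <= rint a b g.
Proof.
move=> cf cg fg; apply: le_Rintegral => //; exact: cont_on_integrable.
Qed.

Lemma cont_on_cst a b (V : topologicalType) (k : V) : cont_on a b (fun=> k).
Proof. by move=> x _; exact: cvg_cst. Qed.

Lemma rint_norm a b f (M : R) : a <= b -> cont_on a b f ->
  (forall x, a <= x <= b -> `|f x| <= M) -> `|rint a b f| <= M * (b - a).
Proof.
move=> ab cf fM; rewrite ler_norml -mulNr -!rint_cst //; apply/andP; split;
  apply: rint_le => // [|x /fM]; try exact: cont_on_cst;
  by rewrite ler_norml => /andP[].
Qed.

Lemma rint_chasles a c b f : a <= c <= b -> cont_on a b f ->
  rint a b f = rint a c f + rint c b f.
Proof.
move=> /andP[ac cb] cf; have i := cont_on_integrable cf.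
have := @Rintegral_itvB R f (BLeft a) (BRight b) c i; rewrite !bnd_simp => /(_ ac cb).
rewrite /rint => h; rewrite -[LHS](subrK (\int[lebesgue_measure]_(t in `[a, c]) f t)) h addrC.
rewrite Rintegral_itv_obnd_cbnd //; apply: integrableS i => //.
by apply: subset_itvr; rewrite bnd_simp.
Qed.

Lemma rint_FTC a b f (F : R -> R) : a < b -> cont_on a b f ->
  (forall x, is_derive x (1 : R) F (f x)) -> rint a b f = F b - F a.
Proof.
move=> ab cf dF; rewrite /rint /Rintegral (@continuous_FTC2 _ f F) //.
- by apply: continuous_in_subspaceT => x; rewrite inE /= in_itv /=; exact: cf.
- have cF x : {for x, continuous F}.
    by apply: differentiable_continuous; apply/derivable1_diffP; have [] := dF x.
  split=> [x _||]; first by have [] := dF x.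
    by apply: cvg_at_right_filter; exact: cF.
  by apply: cvg_at_left_filter; exact: cF.
- by move=> x _; rewrite derive1E; have [] := dF x.
Qed.

Definition qint a b u : H :=
  Quat (rint a b (fun x => qre (u x))) (rint a b (fun x => qi (u x)))
       (rint a b (fun x => qj (u x))) (rint a b (fun x => qk (u x))).

Lemma cont_on_comps a b u : cont_on a b u ->
  [/\ cont_on a b (fun x => qre (u x)), cont_on a b (fun x => qi (u x)),
      cont_on a b (fun x => qj (u x)) & cont_on a b (fun x => qk (u x))].
Proof. by move=> cu; split=> x /cu /qcvgP[]. Qed.

Lemma qint_eq a b u v : (forall x, a <= x <= b -> u x = v x) -> qint a b u = qint a b v.
Proof. by move=> uv; apply: quatP => /=; apply: rint_eq => x /uv ->. Qed.

Lemma qintD a b u v : cont_on a b u -> cont_on a b v ->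
  qint a b (fun x => u x + v x) = qint a b u + qint a b v.
Proof.
move=> /cont_on_comps[? ? ? ?] /cont_on_comps[? ? ? ?].
by apply: quatP => /=; apply: rintD.
Qed.

Lemma cont_onD {V : normedModType R} a b (f g : R -> V) :
  cont_on a b f -> cont_on a b g -> cont_on a b (fun x => f x + g x).
Proof. by move=> cf cg x xab; have h1 := cf x xab; have h2 := cg x xab; exact: (continuousD h1 h2). Qed.
Lemma cont_onN {V : normedModType R} a b (f : R -> V) :
  cont_on a b f -> cont_on a b (fun x => - f x).
Proof. by move=> cf x xab; exact: continuousN (cf x xab). Qed.
Lemma cont_onRM a b f g :
  cont_on a b f -> cont_on a b g -> cont_on a b (fun x => f x * g x).
Proof. by move=> cf cg x xab; exact: continuousM (cf x xab) (cg x xab). Qed.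
Lemma cont_onM a b u v :
  cont_on a b u -> cont_on a b v -> cont_on a b (fun x => u x * v x).
Proof. by move=> cf cg x xab; exact: qcvgM (cf x xab) (cg x xab). Qed.
Lemma cont_onC a b u : cont_on a b u -> cont_on a b (fun x => qconj (u x)).
Proof. by move=> cf x xab; exact: qcvg_conj (cf x xab). Qed.

(** Every component of [p * u x] is such a combination of the components of [u x], so one linearity
    statement serves all four. *)
Lemma rint_lin4 a b (k1 k2 k3 k4 : R) f1 f2 f3 f4 :
  cont_on a b f1 -> cont_on a b f2 -> cont_on a b f3 -> cont_on a b f4 ->
  rint a b (fun x => k1 * f1 x + k2 * f2 x + k3 * f3 x + k4 * f4 x) =
  k1 * rint a b f1 + k2 * rint a b f2 + k3 * rint a b f3 + k4 * rint a b f4.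
Proof.
move=> h1 h2 h3 h4.
have Z (k : R) f : cont_on a b f -> cont_on a b (fun x => k * f x).
  by move=> cf; apply: cont_onRM => //; exact: cont_on_cst.
have c12 := cont_onD (Z k1 _ h1) (Z k2 _ h2).
have c123 := cont_onD c12 (Z k3 _ h3).
rewrite (rintD c123 (Z k4 _ h4)) (rintD c12 (Z k3 _ h3)) (rintD (Z k1 _ h1) (Z k2 _ h2)).
by rewrite (rintZ _ h1) (rintZ _ h2) (rintZ _ h3) (rintZ _ h4).
Qed.

Lemma qintMl a b (p : H) u : cont_on a b u ->
  qint a b (fun x => p * u x) = p * qint a b u.
Proof.
move=> /cont_on_comps[h1 h2 h3 h4].
have L k1 k2 k3 k4 := @rint_lin4 a b k1 k2 k3 k4 _ _ _ _ h1 h2 h3 h4.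
rewrite qmulE; apply: quatP => /=.
- transitivity (qre p * rint a b (fun x => qre (u x)) + - qi p * rint a b (fun x => qi (u x))
    + - qj p * rint a b (fun x => qj (u x)) + - qk p * rint a b (fun x => qk (u x))); last by ring.
  rewrite -L; apply: rint_eq => x _; rewrite qmulE /=; ring.
- transitivity (qi p * rint a b (fun x => qre (u x)) + qre p * rint a b (fun x => qi (u x))
    + - qk p * rint a b (fun x => qj (u x)) + qj p * rint a b (fun x => qk (u x))); last by ring.
  rewrite -L; apply: rint_eq => x _; rewrite qmulE /=; ring.
- transitivity (qj p * rint a b (fun x => qre (u x)) + qk p * rint a b (fun x => qi (u x))
    + qre p * rint a b (fun x => qj (u x)) + - qi p * rint a b (fun x => qk (u x))); last by ring.
  rewrite -L; apply: rint_eq => x _; rewrite qmulE /=; ring.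
- transitivity (qk p * rint a b (fun x => qre (u x)) + - qj p * rint a b (fun x => qi (u x))
    + qi p * rint a b (fun x => qj (u x)) + qre p * rint a b (fun x => qk (u x))); last by ring.
  rewrite -L; apply: rint_eq => x _; rewrite qmulE /=; ring.
Qed.

Lemma qint_conj a b u : cont_on a b u -> qint a b (fun x => qconj (u x)) = qconj (qint a b u).
Proof. by move=> /cont_on_comps[h1 h2 h3 h4]; apply: quatP; rewrite //= rintN. Qed.

Lemma qintMr a b (p : H) u : cont_on a b u ->
  qint a b (fun x => u x * p) = qint a b u * p.
Proof.
move=> cu; rewrite -[RHS]qconjK qconjM -qint_conj // -qintMl; last exact: cont_onC.
rewrite -qint_conj; last by apply: cont_onM; [exact: cont_on_cst|exact: cont_onC].
by apply: qint_eq => x _; rewrite qconjM !qconjK.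
Qed.

Lemma qintN a b u : cont_on a b u -> qint a b (fun x => - u x) = - qint a b u.
Proof.
move=> cu; rewrite -[RHS]mulN1r -qintMl //.
by apply: qint_eq => x _; rewrite mulN1r.
Qed.

(** The components are bounded separately, whence the 2. The estimates built on it only have to tend
    to zero. *)
Lemma qint_norm a b u (M : R) : a <= b -> cont_on a b u ->
  (forall x, a <= x <= b -> `|u x| <= M) -> `|qint a b u| <= 2 * (M * (b - a)).
Proof.
move=> ab /cont_on_comps[h1 h2 h3 h4] uM; apply: normq_le;
  apply: rint_norm => // x xab; (apply: le_trans (uM _ xab));
  [exact: qre_le|exact: qi_le|exact: qj_le|exact: qk_le].
Qed.

Lemma qint_chasles a c b u : a <= c <= b -> cont_on a b u ->
  qint a b u = qint a c u + qint c b u.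
Proof.
move=> acb /cont_on_comps[h1 h2 h3 h4]; apply: quatP => /=; exact: rint_chasles.
Qed.

Lemma qint_cst a b (k : H) : a <= b -> qint a b (fun=> k) = (b - a) *: k.
Proof. by move=> ab; apply: quatP => /=; rewrite rint_cst // mulrC. Qed.

Lemma rint_sum a b (n : nat) (F : nat -> R -> R) : (forall i, cont_on a b (F i)) ->
  rint a b (fun x => \sum_(0 <= i < n) F i x) = \sum_(0 <= i < n) rint a b (F i) /\
  cont_on a b (fun x => \sum_(0 <= i < n) F i x).
Proof.
move=> cF; elim: n => [|n [IH cIH]].
  have -> : (fun x => \sum_(0 <= i < 0) F i x) = fun=> 0 by apply/funext => x; rewrite big_nil.
  split; last exact: cont_on_cst.
  by rewrite big_nil -[RHS](mul0r (rint a b (fun=> 0))) -rintZ ?mul0r //; exact: cont_on_cst.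
have E : (fun x => \sum_(0 <= i < n.+1) F i x) = (fun x => \sum_(0 <= i < n) F i x + F n x).
  by apply/funext => x; rewrite big_nat_recr.
by rewrite E rintD // IH big_nat_recr //=; split=> //; exact: cont_onD.
Qed.

End Integrals.

(** * The complex plane of an imaginary unit *)

Section Slice.
Context {R : realType}.
Local Notation H := (quat R).
Variable I : H.
Hypothesis hI : imag_unit I.
Implicit Types (w z e p : H) (s t x y : R).

(** A nonzero real part a would annihilate the imaginary components through 2 a v = 0, leaving a^2 =
    -1. *)
Lemma imag_unitE : qre I = 0 /\ qi I ^+ 2 + qj I ^+ 2 + qk I ^+ 2 = 1.
Proof.
move: hI; rewrite /imag_unit /= qmulE => h.
have h1 := congr1 (@qre R) h; have h2 := congr1 (@qi R) h.
have h3 := congr1 (@qj R) h; have h4 := congr1 (@qk R) h.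
move: h1 h2 h3 h4; rewrite /= oppr0.
set a := qre I; set b := qi I; set c := qj I; set d := qk I => h1 h2 h3 h4.
have a0 : a = 0.
  apply/eqP/negPn/negP => a0.
  have k (v : R) : a * v + v * a = 0 -> v = 0.
    move=> kv; have : a * v = 0 by lra.
    by move/eqP; rewrite mulf_eq0 (negbTE a0) /= => /eqP.
  have b0 : b = 0 by apply: k; lra.
  have c0 : c = 0 by apply: k; lra.
  have d0 : d = 0 by apply: k; lra.
  by move: h1; rewrite b0 c0 d0; nra.
by split=> //; move: h1; rewrite a0; lra.
Qed.

Lemma qsqnI : qsqn I = 1.
Proof. by have [a b] := imag_unitE; rewrite /qsqn a; lra. Qed.
Lemma normI : `|I| = 1.
Proof. by rewrite normqE qsqnI sqrtr1. Qed.
Lemma conjI : qconj I = - I.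
Proof. by have [a b] := imag_unitE; apply: quatP => //=; rewrite a oppr0. Qed.

(** Membership in C_I, encoded as commutation with I: closure under the ring operations is plain
    rewriting, and [ciE] recovers the coordinates. *)
Definition cI w := I * w = w * I.
Lemma cI_A x : cI x%:A.
Proof. by rewrite /cI -scalerAl -scalerAr mul1r mulr1. Qed.
Lemma cI_D w z : cI w -> cI z -> cI (w + z).
Proof. by rewrite /cI mulrDl mulrDr => -> ->. Qed.
Lemma cI_N w : cI w -> cI (- w).
Proof. by rewrite /cI mulrN mulNr => ->. Qed.
Lemma cI_Z x w : cI w -> cI (x *: w).
Proof. by rewrite /cI -scalerAl -scalerAr => ->. Qed.
Lemma cI_M w z : cI w -> cI z -> cI (w * z).
Proof. by rewrite /cI => hw hz; rewrite mulrA hw -!mulrA hz. Qed.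
Lemma cI_1 : cI 1. Proof. by rewrite /cI mulr1 mul1r. Qed.
Lemma cI_0 : cI 0. Proof. by rewrite /cI mulr0 mul0r. Qed.
Lemma cI_X w n : cI w -> cI (w ^+ n).
Proof. by move=> hw; elim: n => [|n IH]; rewrite ?expr0 ?exprS; [exact: cI_1|exact: cI_M]. Qed.
Lemma cI_conj w : cI w -> cI (qconj w).
Proof.
rewrite /cI => /(congr1 qconj); rewrite !qconjM conjI mulrN mulNr => /oppr_inj.
by move=> ->.
Qed.

Definition slice_point x y : H := x%:A + y *: I.
Lemma cI_ci x y : cI (slice_point x y).
Proof. by apply: cI_D; [exact: cI_A|apply: cI_Z]. Qed.
Definition yI w := qdot I w.

Lemma ciE w : cI w -> w = slice_point (qre w) (yI w).
Proof.
have [a b] := imag_unitE.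
rewrite /cI !qmulE /slice_point /yI qdotE !quatE a /= => h.
have h2 := congr1 (@qi R) h; have h3 := congr1 (@qj R) h; have h4 := congr1 (@qk R) h.
move: h2 h3 h4 => /=.
case: w {h} => w0 w1 w2 w3 /=; case: I a b => i0 i1 i2 i3 /= a b h2 h3 h4.
(* Commuting quaternions have imaginary parts with zero cross product, so the imaginary part of [w]
   is parallel to [I]. *)
have e1 : i2 * w3 = i3 * w2 by lra.
have e2 : i1 * w3 = i3 * w1 by lra.
have e3 : i1 * w2 = i2 * w1 by lra.
apply: quatP => /=; try lra.
- transitivity (w1 * (i1 ^+ 2 + i2 ^+ 2 + i3 ^+ 2)); first by rewrite b mulr1.
  transitivity (w1 * i1 ^+ 2 + i2 * (i2 * w1) + i3 * (i3 * w1)); first by ring.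
  by rewrite -e3 -e2; ring.
- transitivity (w2 * (i1 ^+ 2 + i2 ^+ 2 + i3 ^+ 2)); first by rewrite b mulr1.
  transitivity (i1 * (i1 * w2) + w2 * i2 ^+ 2 + i3 * (i3 * w2)); first by ring.
  by rewrite e3 -e1; ring.
- transitivity (w3 * (i1 ^+ 2 + i2 ^+ 2 + i3 ^+ 2)); first by rewrite b mulr1.
  transitivity (i1 * (i1 * w3) + i2 * (i2 * w3) + w3 * i3 ^+ 2); first by ring.
  by rewrite e1 e2; ring.
Qed.

Lemma qre_ci x y : qre (slice_point x y) = x.
Proof. by have [a b] := imag_unitE; rewrite /slice_point !quatE /= a; ring. Qed.
Lemma yI_ci x y : yI (slice_point x y) = y.
Proof.
have [a b] := imag_unitE; rewrite /yI qdotE /slice_point !quatE /= a.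
by transitivity (y * (qi I ^+ 2 + qj I ^+ 2 + qk I ^+ 2)); [ring|rewrite b mulr1].
Qed.
Lemma qsqn_ci x y : qsqn (slice_point x y) = x ^+ 2 + y ^+ 2.
Proof.
have [a b] := imag_unitE; rewrite /qsqn /slice_point !quatE /= a.
by transitivity (x ^+ 2 + y ^+ 2 * (qi I ^+ 2 + qj I ^+ 2 + qk I ^+ 2)); [ring|rewrite b mulr1].
Qed.
Lemma yI_le w : `|yI w| <= `|w|.
Proof. by apply: le_trans (qdot_norm _ _) _; rewrite normI mul1r. Qed.
Lemma cI_comm w z : cI w -> cI z -> w * z = z * w.
Proof.
move=> /ciE -> /ciE ->; set a := qre w; set b := yI w; set c := qre z; set d := yI z.
rewrite /slice_point !mulrDl !mulrDr -!scalerAl -!scalerAr !mul1r !mulr1 !scalerA.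
rewrite (mulrC c a) (mulrC d a) (mulrC c b) (mulrC d b).
by rewrite !addrA; congr (_ + _); rewrite addrAC.
Qed.
Lemma ci_mul x y x' y' : slice_point x y * slice_point x' y' = slice_point (x * x' - y * y') (x * y' + y * x').
Proof.
have [a b] := imag_unitE.
apply: quatP; rewrite /slice_point !quatE /= a; try ring.
transitivity (x * x' - y * y' * (qi I ^+ 2 + qj I ^+ 2 + qk I ^+ 2)); first by ring.
by rewrite b; ring.
Qed.
Lemma ci_conj x y : qconj (slice_point x y) = slice_point x (- y).
Proof. by rewrite /slice_point qconjD !qconjZ qconj1 conjI scalerN scaleNr. Qed.

Definition slice_cis t := slice_point (cos t) (sin t).
Lemma cI_cis t : cI (slice_cis t). Proof. exact: cI_ci. Qed.
Lemma cisD s t : slice_cis (s + t) = slice_cis s * slice_cis t.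
Proof. by rewrite /slice_cis ci_mul cosD sinD (addrC (sin s * cos t)) (mulrC (sin s)). Qed.
Lemma cis0 : slice_cis 0 = 1.
Proof. by rewrite /slice_cis cos0 sin0 /slice_point scale0r addr0 scale1r. Qed.
Lemma qsqn_cis t : qsqn (slice_cis t) = 1.
Proof. by rewrite /slice_cis qsqn_ci cos2Dsin2. Qed.
Lemma norm_cis t : `|slice_cis t| = 1.
Proof. by rewrite normqE qsqn_cis sqrtr1. Qed.
Lemma cisN t : slice_cis (- t) = qconj (slice_cis t).
Proof. by rewrite /slice_cis cosN sinN ci_conj. Qed.
Lemma cis_nat t n : slice_cis (n%:R * t) = slice_cis t ^+ n.
Proof.
elim: n => [|n IH]; first by rewrite mul0r cis0.
by rewrite -addn1 natrD mulrDl mul1r cisD IH addn1 exprSr.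
Qed.
Lemma cis_2pi : slice_cis (2 * pi) = 1.
Proof. by rewrite /slice_cis mulr_natl cos2pi sin2pi /slice_point scale0r addr0 scale1r. Qed.

Definition slice_exp w := expR (qre w) *: slice_cis (yI w).
Lemma cexpD w z : slice_exp (w + z) = slice_exp w * slice_exp z.
Proof.
rewrite /slice_exp qreD expRD /yI qdotDr cisD -scalerAl -scalerAr scalerA.
by [].
Qed.
Lemma cI_cexp w : cI (slice_exp w). Proof. exact/cI_Z/cI_cis. Qed.
Lemma cexp_ci s t : slice_exp (slice_point s t) = expR s *: slice_cis t.
Proof. by rewrite /slice_exp qre_ci yI_ci. Qed.
Lemma cis_cont t : {for t, continuous slice_cis}.
Proof.
apply: cvgD; apply: cvgZr_tmp; [exact: continuous_cos|exact: continuous_sin].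
Qed.

End Slice.

(** * Complex derivatives along a slice *)

Section Hol.
Context {R : realType}.
Local Notation H := (quat R).
Variable I : H.
Hypothesis hI : imag_unit I.
Implicit Types (w z e p : H) (s t x y : R).
Local Notation cI := (cI I).
Local Notation ci := (slice_point I).
Local Notation cis := (slice_cis I).
Local Notation cexp := (slice_exp I).

(* [F] has complex derivative [p] at [w] along the slice of [I]; [F] need not
   take its values in that slice. *)
Definition hol (F : H -> H) w p := forall ep : R, 0 < ep -> exists2 d : R, 0 < d &
  forall e, cI e -> `|e| < d -> `|F (w + e) - F w - e * p| <= ep * `|e|.

Lemma derive_small (f : R -> R) (l : R) : is_derive (0 : R) (1 : R) f l ->
  forall ep : R, 0 < ep -> exists2 d : R, 0 < d &
    forall h : R, `|h| < d -> `|f h - f 0 - h * l| <= ep * `|h|.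
Proof.
move=> df ep ep0; have [df1 dfl] := df.
have /cvgrPdist_le /(_ _ ep0) : h^-1 *: ((f \o shift 0) (h *: 1) - f 0) @[h --> 0^'] --> l.
  by rewrite -dfl; exact: df1.
move=> /nbhs_ballP[d /= d0 hd]; exists d => // h hdl.
have [->|h0] := eqVneq h 0; first by rewrite mul0r subr0 subrr normr0 mulr0.
have := hd h; rewrite /ball /= sub0r normrN => /(_ hdl h0).
rewrite /= addr0 [h%:A]mulr1 => k.
have -> : f h - f 0 - h * l = - (h * (l - h^-1 *: (f h - f 0))).
  by rewrite mulrBr /GRing.scale /= mulrA mulfV // mul1r opprB.
by rewrite normrN normrM mulrC ler_wpM2r.
Qed.

Lemma cexp0 : cexp 0 = 1.
Proof. by rewrite /slice_exp /yI qdot0r expR0 scale1r cis0. Qed.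

(** The derivative at the origin comes from the real derivatives of exp, cos and sin; the addition
    formula carries it to every other point. *)
Lemma hol_cexp0 : hol cexp 0 1.
Proof.
(* The two coordinates of the error are at most 4 eta |e| and 5 eta |e|, so 16 leaves room. *)
move=> ep ep0; pose eta := Num.min 1 (ep / 16).
have eta0 : 0 < eta by rewrite lt_min ltr01 divr_gt0.
have eta1 : eta <= 1 by rewrite ge_min lexx.
have eta8 : eta <= ep / 16 by rewrite ge_min lexx orbT.
have [d1 d10 h1] := derive_small (is_derive_expR 0) eta0.
have [d2 d20 h2] := derive_small (is_derive_cos 0) eta0.
have [d3 d30 h3] := derive_small (is_derive_sin 0) eta0.
exists (Num.min (Num.min d1 (eta / 2)) (Num.min d2 d3)); first by rewrite !lt_min d10 d20 d30 divr_gt0.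
move=> e ce; rewrite !lt_min => /andP[/andP[e1 e2] /andP[e3 e4]].
set s := qre e; set t := yI I e.
have sle : `|s| <= `|e| := qre_le _.
have tle : `|t| <= `|e| := yI_le hI _.
rewrite add0r mulr1 (ciE hI ce) -/s -/t cexp_ci //.
rewrite cexp0.
have {h1} := h1 s (le_lt_trans sle e1).
have {h2} := h2 t (le_lt_trans tle e3).
have {h3} := h3 t (le_lt_trans tle e4).
rewrite expR0 sin0 cos0 oppr0 mulr0 !subr0 addr0 !mulr1 => h3 h2 h1.
have s1 : `|s| <= eta / 2 by apply: le_trans sle (ltW e2).
have -> : expR s *: cis t - 1 - ci s t =
   ci (expR s * cos t - 1 - s) (expR s * sin t - t).
  by rewrite /slice_cis /slice_point scalerDr !scalerA; apply: quatP; rewrite !quatE /=; ring.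
have -> : ci s t = e by rewrite /s /t -ciE.
apply: le_trans (ler_normD _ _) _; rewrite !normrZ normq1 mulr1 (normI hI) mulr1.
set N := `|e| in sle tle *.
have e2' : expR s <= 3.
  have : expR s - 1 - s <= eta * `|s| by apply: le_trans (ler_norm _) h1.
  have : eta * `|s| <= 1 * 1 by apply: ler_pM => //; lra.
  have : s <= `|s| := ler_norm _.
  by lra.
have e3' : `|expR s - 1| <= 2 * eta.
  have -> : expR s - 1 = (expR s - 1 - s) + s by ring.
  apply: le_trans (ler_normD _ _) _.
  have : eta * `|s| <= eta * 1 by apply: ler_wpM2l; lra.
  by lra.
have ex0 := expR_gt0 s.
have N0 : 0 <= N by apply: normr_ge0.
have b1 : `|expR s * cos t - 1 - s| <= 4 * eta * N.
  have -> : expR s * cos t - 1 - s = (expR s - 1 - s) + expR s * (cos t - 1) by ring.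
  apply: le_trans (ler_normD _ _) _; rewrite normrM (gtr0_norm ex0).
  have : eta * `|s| <= eta * N by rewrite ler_wpM2l // ltW.
  have : expR s * `|cos t - 1| <= 3 * (eta * `|t|) by apply: ler_pM => //; exact: ltW.
  have : eta * `|t| <= eta * N by rewrite ler_wpM2l // ltW.
  by lra.
have b2 : `|expR s * sin t - t| <= 4 * eta * N + eta * N.
  have -> : expR s * sin t - t = (expR s - 1) * t + expR s * (sin t - t) by ring.
  apply: le_trans (ler_normD _ _) _; rewrite !normrM (gtr0_norm ex0).
  have : `|expR s - 1| * `|t| <= (2 * eta) * N by apply: ler_pM.
  have : expR s * `|sin t - t| <= 3 * (eta * `|t|) by apply: ler_pM => //; exact: ltW.
  have : eta * `|t| <= eta * N by rewrite ler_wpM2l // ltW.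
  by lra.
have : eta * N <= ep / 16 * N by rewrite ler_wpM2r.
have := mulr_ge0 (ltW ep0) N0; by lra.
Qed.

Lemma hol_cexp (k : R) w : hol (fun w => cexp (k *: w)) w (k *: cexp (k *: w)).
Proof.
move=> ep ep0; pose M := (`|k| + 1) * (`|cexp (k *: w)| + 1).
have M0 : 0 < M by rewrite mulr_gt0 // ltr_wpDl.
have [d d0 hd] := hol_cexp0 (divr_gt0 ep0 M0).
exists (d / (`|k| + 1)); first by rewrite divr_gt0 // ltr_wpDl.
move=> e ce; rewrite ltr_pdivlMr ?ltr_wpDl // => ed.
have ke : `|k *: e| < d.
  by rewrite normrZ; apply: le_lt_trans ed; rewrite mulrC ler_wpM2l // lerDl.
have := hd _ (cI_Z k ce) ke; rewrite add0r mulr1 => h.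
rewrite scalerDr cexpD //.
have -> : cexp (k *: w) * cexp (k *: e) - cexp (k *: w) - e * (k *: cexp (k *: w)) =
   cexp (k *: w) * (cexp (k *: e) - cexp 0 - k *: e).
  rewrite !mulrBr cexp0 mulr1.
  by rewrite -[e * _]scalerAr -[_ * (k *: e)]scalerAr (cI_comm hI ce (cI_Z _ (cI_cis _ _))).
rewrite normqM; apply: le_trans (ler_wpM2l (normr_ge0 _) h) _.
rewrite (normrZ k e).
have -> : `|cexp (k *: w)| * (ep / M * (`|k| * `|e|)) =
    (`|cexp (k *: w)| * `|k| / M) * (ep * `|e|) by ring.
have E0 : 0 <= ep * `|e| by rewrite mulr_ge0 // ltW.
rewrite -[leRHS]mul1r ler_wpM2r //.
rewrite ler_pdivrMr // mul1r /M mulrC; apply: ler_pM => //; by rewrite lerDl.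
Qed.

Lemma hol_bound F w p : hol F w p -> exists2 d : R, 0 < d &
  forall e, cI e -> `|e| < d -> `|F (w + e) - F w| <= (`|p| + 1) * `|e|.
Proof.
move=> /(_ 1 ltr01)[d d0 hd]; exists d => // e ce ed; have := hd e ce ed.
rewrite mul1r => h.
have -> : F (w + e) - F w = (F (w + e) - F w - e * p) + e * p by rewrite subrK.
apply: le_trans (ler_normD _ _) _; rewrite normqM mulrDl mul1r addrC (mulrC `|e|).
by rewrite lerD2l.
Qed.

Lemma hol_comp F (A : H -> H) w a p : (forall w, cI (A w)) -> cI a ->
  hol A w a -> hol F (A w) p -> hol (fun w => F (A w)) w (a * p).
Proof.
move=> cA ca hA hF ep ep0.
pose M := `|a| + 1 + `|p| + 1.
have a1 : 0 < `|a| + 1 by rewrite ltr_wpDl.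
have p1 : 0 < `|p| + 1 by rewrite ltr_wpDl.
have [d1 d10 h1] := hA _ (divr_gt0 ep0 (mulr_gt0 (ltr0n _ 2) p1)).
have [d2 d20 h2] := hol_bound hA.
have [d3 d30 h3] := hF _ (divr_gt0 ep0 (mulr_gt0 (ltr0n _ 2) a1)).
exists (Num.min (Num.min d1 d2) (d3 / (`|a| + 1))); first by rewrite !lt_min d10 d20 divr_gt0.
move=> e ce; rewrite !lt_min ltr_pdivlMr // => /andP[/andP[e1 e2] e3].
have {h1} h1 := h1 e ce e1; have {h2} h2 := h2 e ce e2.
set g := A (w + e) - A w in h2.
have cg : cI g by apply: cI_D => //; exact: cI_N.
have gd : `|g| < d3 by apply: le_lt_trans h2 _; rewrite mulrC.
have {h3} := h3 g cg gd; rewrite [A w + g]addrC subrK => h3.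
have -> : F (A (w + e)) - F (A w) - e * (a * p) =
    (F (A (w + e)) - F (A w) - g * p) + (g - e * a) * p.
  by rewrite [(g - _) * p]mulrBl mulrA addrA subrK.
apply: le_trans (ler_normD _ _) _; rewrite normqM.
have b1 : `|F (A (w + e)) - F (A w) - g * p| <= ep / 2 * `|e|.
  apply: le_trans h3 _; apply: le_trans (ler_wpM2l _ h2) _.
    by rewrite divr_ge0 ?mulr_ge0 // ltW.
  by rewrite le_eqVlt; apply/orP; left; apply/eqP; field; rewrite gt_eqF.
have b2 : `|g - e * a| * `|p| <= ep / 2 * `|e|.
  apply: le_trans (ler_wpM2r (normr_ge0 _) h1) _.
  have -> : ep / (2 * (`|p| + 1)) * `|e| * `|p| = (ep / 2 * `|e|) * (`|p| / (`|p| + 1)).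
    by field; rewrite gt_eqF.
  rewrite -[leRHS]mulr1 ler_wpM2l ?mulr_ge0 ?divr_ge0 ?(ltW ep0) //.
  by rewrite ler_pdivrMr // mul1r lerDl.
by lra.
Qed.

(** The slice-valued factor stands on the left: in the Leibniz rule the increment [e] has to pass
    [A w] to reach [p], and it passes only what commutes with it. *)
Lemma hol_mul (A F : H -> H) w a p : (forall w, cI (A w)) ->
  hol A w a -> hol F w p -> hol (fun w => A w * F w) w (a * F w + A w * p).
Proof.
move=> cA hA hF ep ep0.
pose M := `|F w| + `|p| + 1 + `|a| + `|A w| + 1.
have nF0 := normr_ge0 (F w); have np0 := normr_ge0 p.
have na0 := normr_ge0 a; have nA0 := normr_ge0 (A w).
have M1 : 1 <= M by rewrite /M; lra.
have M0 : 0 < M by lra.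
have eM : 0 < ep / (4 * M) by rewrite divr_gt0 // mulr_gt0.
have [d1 d10 h1] := hA _ eM; have [d3 d30 h3] := hF _ eM.
have [d2 d20 h2] := hol_bound hF.
pose d4 := ep / (4 * M * M).
have d40 : 0 < d4 by rewrite divr_gt0 // !mulr_gt0.
exists (Num.min (Num.min d1 d2) (Num.min d3 (Num.min 1 d4))).
  by rewrite !lt_min d10 d20 d30 ltr01.
move=> e ce; rewrite !lt_min => /andP[/andP[e1 e2] /andP[e3 /andP[e5 e4]]].
have {h1} h1 := h1 e ce e1; have {h2} h2 := h2 e ce e2; have {h3} h3 := h3 e ce e3.
have -> : A (w + e) * F (w + e) - A w * F w - e * (a * F w + A w * p) =
   (A (w + e) - A w - e * a) * F (w + e) + (e * a) * (F (w + e) - F w)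
   + A w * (F (w + e) - F w - e * p).
  rewrite mulrDr !mulrBl !mulrBr !mulrA (cI_comm hI ce (cA w)).
  rewrite -!mulrA; set u1 := A (w + e) * _; set u2 := A w * F (w + e).
  set u3 := e * (a * F (w + e)); set u4 := e * (a * F w); set u5 := A w * F w.
  set u6 := A w * (e * p).
  by move: u1 u2 u3 u4 u5 u6 => u1 u2 u3 u4 u5 u6; apply: quatP => /=; ring.
have nF : `|F (w + e)| <= M.
  have -> : F (w + e) = (F (w + e) - F w) + F w by rewrite subrK.
  apply: le_trans (ler_normD _ _) _.
  have : (`|p| + 1) * `|e| <= (`|p| + 1) * 1 by rewrite ler_wpM2l ?addr_ge0 // ltW.
  by rewrite /M; lra.
set N := `|e| in h1 h2 h3 e1 e2 e3 e4 e5 *; have N0 : 0 <= N by apply: normr_ge0.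
have b1 : `|(A (w + e) - A w - e * a) * F (w + e)| <= ep / 4 * N.
  rewrite normqM; apply: le_trans (_ : (ep / (4 * M) * N) * M <= _); first exact: ler_pM.
  by rewrite le_eqVlt; apply/orP; left; apply/eqP; field; rewrite gt_eqF.
have b3 : `|A w * (F (w + e) - F w - e * p)| <= ep / 4 * N.
  rewrite normqM; apply: le_trans (_ : M * (ep / (4 * M) * N) <= _).
    by apply: ler_pM => //; rewrite /M; lra.
  by rewrite le_eqVlt; apply/orP; left; apply/eqP; field; rewrite gt_eqF.
have b2 : `|e * a * (F (w + e) - F w)| <= ep / 4 * N.
  rewrite !normqM; apply: le_trans (_ : (N * M) * (M * N) <= _).
    apply: ler_pM => //; rewrite ?mulr_ge0 // -/N.
      by rewrite ler_wpM2l //; rewrite /M; lra.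
    apply: le_trans h2 _; rewrite ler_wpM2r //.
    by rewrite /M; lra.
  have : N * (M * M) <= ep / 4.
    move: (ltW e4); rewrite /d4 ler_pdivlMr ?mulr_gt0 // => k.
    by rewrite ler_pdivlMr // (le_trans _ k) // le_eqVlt; apply/orP; left; apply/eqP; ring.
  move=> k; have := ler_wpM2r N0 k; apply: le_trans.
  by rewrite le_eqVlt; apply/orP; left; apply/eqP; ring.
apply: le_trans (ler_normD _ _) _; apply: le_trans (lerD (ler_normD _ _) (lexx _)) _.
by have := mulr_ge0 (ltW ep0) N0; lra.
Qed.

(** The regularity equation says that the differential maps I to I times its value at 1; by real
    linearity it is then e |-> e * 'd f w 1 for every e in the slice. *)
Lemma hol_regular (f : H -> H) w : slice_regular f -> qball w -> cI w ->
  hol f w ('d f w 1).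
Proof.
move=> [df hf] wb cw; have dw := df _ wb.
have wE := ciE hI cw; rewrite /slice_point in wE.
have CR : 'd f w I = I * 'd f w 1.
  have wb' := wb; rewrite wE in wb'.
  have := hf I hI _ _ wb'; have dw' := dw; rewrite wE in dw'.
  have [-> ->] := slice_derive dw'; rewrite -wE.
  move=> /eqP; rewrite scaler_eq0 invr_eq0 pnatr_eq0 /= => /eqP h.
  have : I * ('d f w 1 + I * 'd f w I) = 0 by rewrite h mulr0.
  by rewrite mulrDr mulrA hI mulN1r => /eqP; rewrite subr_eq0 => /eqP.
move=> ep ep0; have [d d0 hd] := differentiableE dw ep0; exists d => // e ce ed.
have <- : 'd f w e = e * 'd f w 1; last exact: hd.
rewrite (ciE hI ce) /slice_point linearD !linearZ /= mulrDl -!scalerAl mul1r.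
by congr (_ + _ *: _).
Qed.

End Hol.

(** * Goursat's theorem on rectangles *)

Section Goursat.
Context {R : realType}.
Local Notation H := (quat R).
Variable I : H.
Hypothesis hI : imag_unit I.
Implicit Types (w z e p : H) (a b c d s t x y : R).
Local Notation cI := (cI I).
Local Notation ci := (slice_point I).
Local Notation hol := (hol I).

Lemma ci_sub s t x y : ci s t - ci x y = ci (s - x) (t - y).
Proof. by rewrite /slice_point !scalerBl; apply: quatP => /=; ring. Qed.
Lemma ci_add s t x y : ci s t + ci x y = ci (s + x) (t + y).
Proof. by rewrite /slice_point !scalerDl; apply: quatP => /=; ring. Qed.
Lemma norm_ci_le s t : `|ci s t| <= `|s| + `|t|.
Proof. by apply: le_trans (ler_normD _ _) _; rewrite !normrZ normq1 normI // !mulr1. Qed.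

Lemma hol_cont u w p (g : R -> H) x : hol u w p -> g x = w -> (forall y, cI (g y)) ->
  {for x, continuous g} -> {for x, continuous (fun y => u (g y))}.
Proof.
move=> /hol_bound[d d0 hd] gx cg gc; apply/cvgrPdist_le => ep ep0.
pose K := `|p| + 1; have K0 : 0 < K by rewrite ltr_wpDl.
have m0 : 0 < Num.min (d / 2) (ep / K) by rewrite lt_min !divr_gt0.
move/cvgrPdist_le : gc => /(_ _ m0); apply: filterS => y; rewrite distrC gx le_min => /andP[h1 h2].
rewrite distrC.
have := hd (g y - w) (cI_D (cg _) (cI_N _)); rewrite [w + _]addrC subrK.
rewrite -gx => /(_ (cg _)) h; apply: le_trans (h _) _.
  by rewrite gx; apply: le_lt_trans h1 _; rewrite ltr_pdivrMr // ltr_pMr // ltr1n.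
by rewrite gx mulrC -ler_pdivlMr.
Qed.

Lemma cont_ci_l t x : {for x, continuous (fun s => ci s t)}.
Proof. by apply: cvgD; [apply: cvgZr_tmp; exact: cvg_id|exact: cvg_cst]. Qed.
Lemma cont_ci_r t x : {for x, continuous (fun s => ci t s)}.
Proof. by apply: cvgD; [exact: cvg_cst|apply: cvgZr_tmp; exact: cvg_id]. Qed.

(** The integral of dw u(w) counterclockwise around the rectangle, with w = s + t I. The [I] of the
    vertical sides stands on the left because [u] need not commute with it. *)
Definition bdry (u : H -> H) a b c d : H :=
  qint a b (fun s => u (ci s c)) + I * qint c d (fun t => u (ci b t))
  - qint a b (fun s => u (ci s d)) - I * qint c d (fun t => u (ci a t)).

Lemma rint_id a b : a <= b -> rint a b id = (b ^+ 2 - a ^+ 2) / 2.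
Proof.
rewrite le_eqVlt => /predU1P[->|ab].
  by rewrite subrr mul0r /rint set_itv1 Rintegral_set1.
have dF x : is_derive x (1 : R) (fun x => x ^+ 2 / 2) x.
  have -> : (fun x => x ^+ 2 / 2) = (2^-1 *: (fun x : R => x ^+ 2)).
    by apply/funext => y; rewrite mulrC.
  by apply: is_derive_eq; rewrite /GRing.scale /=; lra.
by rewrite (rint_FTC ab _ dF); [field|move=> x _; exact: cvg_id].
Qed.

Lemma qint_scale a b (f : R -> R) p : cont_on a b f ->
  qint a b (fun s => f s *: p) = rint a b f *: p.
Proof.
move=> cf; apply: quatP => /=; rewrite mulrC -rintZ //;
  by apply: rint_eq => x _; rewrite mulrC.
Qed.

Definition affine (K p : H) (w : H) : H := K + w * p.

Lemma affine_cont a b K p (g : R -> H) : cont_on a b g -> cont_on a b (fun s => affine K p (g s)).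
Proof.
move=> cg; apply: cont_onD; first exact: cont_on_cst.
by apply: cont_onM => //; exact: cont_on_cst.
Qed.

Lemma qint_ci_l a b c : a <= b -> qint a b (fun s => ci s c) = ci ((b ^+ 2 - a ^+ 2) / 2) ((b - a) * c).
Proof.
move=> ab; rewrite /slice_point qintD; last 2 first.
- by move=> x _; apply: cvgZr_tmp; exact: cvg_id.
- exact: cont_on_cst.
rewrite qint_cst // scalerA; congr (_ + _).
by rewrite (@qint_scale a b id) ?rint_id // => x _; exact: cvg_id.
Qed.

Lemma qint_ci_r a c d : c <= d -> qint c d (fun t => ci a t) = ci ((d - c) * a) ((d ^+ 2 - c ^+ 2) / 2).
Proof.
move=> cd; rewrite /slice_point qintD; last 2 first.
- exact: cont_on_cst.
- by move=> x _; apply: cvgZr_tmp; exact: cvg_id.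
rewrite qint_cst // scalerA; congr (_ + _).
by rewrite (@qint_scale c d id) ?rint_id // => x _; exact: cvg_id.
Qed.

Lemma bdry_affine K p a b c d : a <= b -> c <= d -> bdry (affine K p) a b c d = 0.
Proof.
move=> ab cd; rewrite /bdry /affine.
have cl t x y : cont_on x y (fun s => ci s t) by move=> z _; exact: cont_ci_l.
have cr t x y : cont_on x y (fun s => ci t s) by move=> z _; exact: cont_ci_r.
rewrite !qintD; try exact: cont_on_cst; try by apply: cont_onM => //; exact: cont_on_cst.
rewrite !qintMr // !qint_cst // !qint_ci_l // !qint_ci_r //.
rewrite [I * (_ + ci ((d - c) * b) _ * p)]mulrDr [I * (_ + ci ((d - c) * a) _ * p)]mulrDr !mulrA.
have Ici x y : I * ci x y = ci (- y) x.
  rewrite /slice_point mulrDr -!scalerAr mulr1 hI scalerN scaleNr; exact: addrC.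
rewrite !Ici.
set k1 := (b - a) *: K; set k2 := I * _.
transitivity ((ci ((b ^+ 2 - a ^+ 2) / 2) ((b - a) * c) + ci (- ((d ^+ 2 - c ^+ 2) / 2)) ((d - c) * b)
   - ci ((b ^+ 2 - a ^+ 2) / 2) ((b - a) * d) - ci (- ((d ^+ 2 - c ^+ 2) / 2)) ((d - c) * a)) * p).
  move: k1 k2 (ci _ ((b - a) * c)) (ci _ ((d - c) * b)) (ci _ ((b - a) * d)) (ci _ ((d - c) * a)).
  move=> k1 k2 c1 c2 c3 c4; rewrite !mulrBl mulrDl.
  by move: (c1 * p) (c2 * p) (c3 * p) (c4 * p) => u1 u2 u3 u4; apply: quatP => /=; ring.
rewrite ci_add !ci_sub.
set x := _ - _ : R; set y := _ - _ : R.
have -> : x = 0 by rewrite /x; ring.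
have -> : y = 0 by rewrite /y; ring.
by rewrite /slice_point !scale0r addr0 mul0r.
Qed.

Lemma bdryD (u v : H -> H) a b c d :
  (forall t, cont_on a b (fun s => u (ci s t))) -> (forall s, a <= s <= b -> cont_on c d (fun t => u (ci s t))) ->
  (forall t, cont_on a b (fun s => v (ci s t))) -> (forall s, a <= s <= b -> cont_on c d (fun t => v (ci s t))) ->
  a <= b -> bdry (fun w => u w + v w) a b c d = bdry u a b c d + bdry v a b c d.
Proof.
move=> u1 u2 v1 v2 ab; rewrite /bdry !qintD //; try by [apply: u2; rewrite ?lexx ?ab|apply: v2; rewrite ?lexx ?ab].
rewrite !mulrDr; move: (I * _) (I * _) (I * _) (I * _) => x1 x2 x3 x4.
by move: (qint _ _ _) (qint _ _ _) (qint _ _ _) (qint _ _ _) => y1 y2 y3 y4; apply: quatP => /=; ring.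
Qed.

Lemma bdry_norm (u : H -> H) a b c d M : a <= b -> c <= d ->
  (forall t, c <= t <= d -> cont_on a b (fun s => u (ci s t))) -> (forall s, a <= s <= b -> cont_on c d (fun t => u (ci s t))) ->
  (forall s t, a <= s <= b -> c <= t <= d -> `|u (ci s t)| <= M) ->
  `|bdry u a b c d| <= 4 * M * ((b - a) + (d - c)).
Proof.
move=> ab cd u1 u2 uM; rewrite /bdry.
have i1 t : c <= t <= d -> `|qint a b (fun s => u (ci s t))| <= 2 * (M * (b - a)).
  by move=> h; apply: qint_norm => //; [exact: u1|move=> x hx; exact: uM].
have i2 s : a <= s <= b -> `|I * qint c d (fun t => u (ci s t))| <= 2 * (M * (d - c)).
  by move=> h; rewrite normqM normI // mul1r; apply: qint_norm => //; [exact: u2|move=> x hx; exact: uM].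
have := i1 c ltac:(by rewrite lexx); have := i1 d ltac:(by rewrite lexx cd).
have := i2 a ltac:(by rewrite lexx); have := i2 b ltac:(by rewrite lexx ab).
move: (qint a b _) (qint a b _) (I * _) (I * _) => x1 x2 x3 x4 h1 h2 h3 h4.
apply: le_trans (ler_normB _ _) _; apply: le_trans (lerD (ler_normB _ _) (lexx _)) _.
apply: le_trans (lerD (lerD (ler_normD _ _) (lexx _)) (lexx _)) _; lra.
Qed.

Lemma bdry_split_l (u : H -> H) a m b c d : a <= m <= b ->
  (forall t, cont_on a b (fun s => u (ci s t))) ->
  bdry u a b c d = bdry u a m c d + bdry u m b c d.
Proof.
move=> amb u1; rewrite /bdry !(qint_chasles amb) //.
move: (qint a m _) (qint a m _) (qint m b _) (qint m b _) (I * _) (I * _) (I * _) => x1 x2 x3 x4 x5 x6 x7.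
by apply: quatP => /=; ring.
Qed.

Lemma bdry_split_r (u : H -> H) a b c m d : c <= m <= d -> a <= b ->
  (forall s, a <= s <= b -> cont_on c d (fun t => u (ci s t))) ->
  bdry u a b c d = bdry u a b c m + bdry u a b m d.
Proof.
move=> cmd ab u1; rewrite /bdry.
rewrite (qint_chasles cmd (u1 b _)) ?lexx ?ab // (qint_chasles cmd (u1 a _)) ?lexx ?ab // !mulrDr.
move: (qint a b _) (qint a b _) (qint a b _) (I * _) (I * _) (I * _) (I * _) => x1 x2 x3 x4 x5 x6 x7.
by apply: quatP => /=; ring.
Qed.

(** Subtracting the first order Taylor polynomial does not change the boundary integral, by
    [bdry_affine]. What remains is at most ep / 4 times the half perimeter, and [bdry_norm]
    contributes 4 times the half perimeter. *)
Lemma bdry_local (u : H -> H) s0 t0 p ep :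
  hol u (ci s0 t0) p -> 0 < ep -> exists2 dl, 0 < dl & forall a b c d,
   a <= s0 <= b -> c <= t0 <= d -> b - a < dl -> d - c < dl ->
  (forall t, cont_on a b (fun s => u (ci s t))) -> (forall s, a <= s <= b -> cont_on c d (fun t => u (ci s t))) ->
  `|bdry u a b c d| <= ep * ((b - a) + (d - c)) ^+ 2.
Proof.
move=> hu ep0; have ep4 : 0 < ep / 4 by rewrite divr_gt0.
have [dl dl0 hd] := hu _ ep4; exists (dl / 2); first by rewrite divr_gt0.
move=> a b c d /andP[as0 sb] /andP[ct0 td] ba dc u1 u2.
have ab : a <= b := le_trans as0 sb; have cd : c <= d := le_trans ct0 td.
pose K := u (ci s0 t0) - ci s0 t0 * p.
pose v w := u w - affine K p w.
have cl t x y : cont_on x y (fun s => ci s t) by move=> z _; exact: cont_ci_l.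
have cr t x y : cont_on x y (fun s => ci t s) by move=> z _; exact: cont_ci_r.
have v1 t : cont_on a b (fun s => v (ci s t)).
  by apply: cont_onD; [exact: u1|apply: cont_onN; exact: affine_cont].
have v2 s : a <= s <= b -> cont_on c d (fun t => v (ci s t)).
  by move=> hs; apply: cont_onD; [exact: u2|apply: cont_onN; exact: affine_cont].
have -> : bdry u a b c d = bdry v a b c d.
  rewrite -[RHS](addr0) -(bdry_affine K p ab cd) -bdryD //; last 2 first.
  - by move=> t; exact: affine_cont.
  - by move=> s _; exact: affine_cont.
  by congr (bdry _ a b c d); apply/funext => w; rewrite /v subrK.
set S := (b - a) + (d - c).
have vM s t : a <= s <= b -> c <= t <= d -> `|v (ci s t)| <= ep / 4 * S.
  move=> /andP[h1 h2] /andP[h3 h4].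
  have k1 : `|s - s0| <= b - a by rewrite ler_norml; lra.
  have k2 : `|t - t0| <= d - c by rewrite ler_norml; lra.
  have k3 := norm_ci_le (s - s0) (t - t0).
  have := hd (ci (s - s0) (t - t0)) (cI_ci _ _ _).
  rewrite -ci_sub [ci s0 t0 + _]addrC subrK => h.
  have {h} h : `|u (ci s t) - u (ci s0 t0) - (ci s t - ci s0 t0) * p| <= ep / 4 * `|ci s t - ci s0 t0|.
    by apply: h; rewrite ci_sub; apply: le_lt_trans k3 _; lra.
  rewrite /v /affine /K.
  have -> : u (ci s t) - (u (ci s0 t0) - ci s0 t0 * p + ci s t * p) =
     u (ci s t) - u (ci s0 t0) - (ci s t - ci s0 t0) * p.
    by rewrite mulrBl; move: (u _) (u _) (_ * p) (_ * p) => y1 y2 y3 y4; apply: quatP => /=; ring.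
  apply: le_trans h _; rewrite ler_wpM2l ?(ltW ep4) // ci_sub; apply: le_trans k3 _; rewrite /S; lra.
apply: le_trans (bdry_norm ab cd (fun t _ => v1 t) v2 vM) _.
by rewrite -/S le_eqVlt; apply/orP; left; apply/eqP; field.
Qed.

Lemma nested_point (a v : nat -> R) : (forall n, a n <= a n.+1) ->
  (forall n, a n.+1 + v n.+1 <= a n + v n) -> (forall n, 0 <= v n) ->
  exists x, forall n, a n <= x <= a n + v n.
Proof.
move=> ai vi v0.
have am m n : (m <= n)%N -> a m <= a n.
  by move=> /subnK <-; elim: (n - m)%N => // k; move=> /le_trans; apply; rewrite addSn.
have vm m n : (m <= n)%N -> a n + v n <= a m + v m.
  by move=> /subnK <-; elim: (n - m)%N => // k; apply: le_trans; rewrite addSn.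
have ub n m : a n <= a m + v m.
  case: (leqP n m) => [nm|/ltnW mn].
    by apply: le_trans (am _ _ nm) _; rewrite lerDl.
  by apply: le_trans (vm _ _ mn); rewrite lerDl.
have hs : has_sup (range a).
  by split; [exists (a 0%N); exists 0%N|exists (a 0%N + v 0%N) => _ [n _ <-]].
exists (sup (range a)) => n; apply/andP; split.
  by apply: sup_upper_bound => //; exists n.
by apply: ge_sup; [exists (a 0%N); exists 0%N|move=> _ [m _ <-]].
Qed.

Lemma half_small x d : 0 < d -> 0 <= x -> exists n, forall k, (n <= k)%N -> x / 2 ^+ k < d.
Proof.
move=> e0 x0; pose n := Num.bound (x / d); exists n => k nk.
have : x / d < 2 ^+ k.
  apply: lt_le_trans (archi_boundP _) _; first by rewrite divr_ge0 // ltW.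
  rewrite -natrX ler_nat; apply: leq_trans (ltnW (ltn_expl k (ltnSn 1))).
  exact: nk.
rewrite ltr_pdivrMr // => k1; rewrite ltr_pdivrMr ?exprn_gt0 //.
by rewrite mulrC.
Qed.

Lemma half_norm (x y z : H) : x = y + z -> `|y| < `|x| / 2 -> `|x| / 2 <= `|z|.
Proof. by move=> -> h; have := ler_normD y z; lra. Qed.

Section Bisect.
Variables (u : H -> H) (A B C D : R).
Hypotheses (AB : A <= B) (CD : C <= D).
Hypothesis hu : forall s t, A <= s <= B -> exists p, hol u (ci s t) p.

Lemma u_cont_l a b t : A <= a -> b <= B -> cont_on a b (fun s => u (ci s t)).
Proof.
move=> Aa bB x /andP[ax xb].
have xAB : A <= x <= B by rewrite (le_trans Aa ax) (le_trans xb bB).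
have [p hp] := hu t xAB.
by apply: (hol_cont hp) => //; [move=> y; exact: cI_ci|exact: cont_ci_l].
Qed.
Lemma u_cont_r c d s : A <= s <= B -> cont_on c d (fun t => u (ci s t)).
Proof.
move=> sAB x _; have [p hp] := hu x sAB.
by apply: (hol_cont hp) => //; [move=> y; exact: cI_ci|exact: cont_ci_r].
Qed.

Let w n := (B - A) / 2 ^+ n.
Let h n := (D - C) / 2 ^+ n.
Let bd n m (P : R * R) := bdry u P.1 (P.1 + w n) P.2 (P.2 + h m).

(** Two successive halvings, of the width and then of the height, replace the choice among four
    quarters. Each one only compares the first half with the whole, and together they keep at least
    a quarter of the boundary integral. *)
Fixpoint corner n : R * R := if n is n'.+1 then
  let P := corner n' in
  let P' := if `|bd n' n' P| / 2 <= `|bd n'.+1 n' P| then P else (P.1 + w n'.+1, P.2) in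
  if `|bd n'.+1 n' P'| / 2 <= `|bd n'.+1 n'.+1 P'| then P' else (P'.1, P'.2 + h n'.+1)
  else (A, C).

Let w0 n : 0 <= w n. Proof. by rewrite divr_ge0 ?subr_ge0 // exprn_ge0. Qed.
Let h0 n : 0 <= h n. Proof. by rewrite divr_ge0 ?subr_ge0 // exprn_ge0. Qed.
Let wS n : w n = w n.+1 + w n.+1.
Proof. by rewrite /w exprS; field; rewrite expf_neq0 // pnatr_eq0. Qed.
Let hS n : h n = h n.+1 + h n.+1.
Proof. by rewrite /h exprS; field; rewrite expf_neq0 // pnatr_eq0. Qed.

Lemma corner_inv n : [/\ A <= (corner n).1, (corner n).1 + w n <= B &
  `|bdry u A B C D| / 4 ^+ n <= `|bd n n (corner n)|].
Proof.
elim: n => [|n [IH1 IH2 IH3]].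
  by rewrite /bd /w /h /= expr0 !divr1 !subrKC !lexx.
rewrite [corner n.+1]/=; set P := corner n in IH1 IH2 IH3 *.
set P' := if _ then P else _.
have [a1 a2 a3] : [/\ A <= P'.1, P'.1 + w n.+1 <= B & `|bd n n P| / 2 <= `|bd n.+1 n P'|].
  have wB : P.1 + w n.+1 <= B by apply: le_trans IH2; rewrite lerD2l (wS n) lerDl.
  rewrite /P'; case: ifPn => [k|]; first by split; [exact: IH1|exact: wB|exact: k].
  rewrite -ltNge => k; split=> /=.
  - by apply: le_trans IH1 _; rewrite lerDl.
  - by rewrite -addrA -(wS n).
  apply: (half_norm _ k); rewrite /bd /= (bdry_split_l (m := P.1 + w n.+1)).
  - by rewrite -[P.1 + w n.+1 + w n.+1]addrA -(wS n).
  - by rewrite lerDl w0 lerD2l (wS n) lerDl w0.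
  - by move=> t; apply: u_cont_l.
have b3 : `|bdry u A B C D| / 4 ^+ n.+1 <= `|bd n.+1 n P'| / 2.
  have -> : `|bdry u A B C D| / 4 ^+ n.+1 = `|bdry u A B C D| / 4 ^+ n / 2 / 2.
    have e4 : (4 : R)^-1 = 2^-1 * 2^-1 by rewrite -invfM -natrM.
    by rewrite exprSr invfM e4 !mulrA.
  have half : 0 < (2 : R)^-1 by rewrite invr_gt0.
  rewrite (ler_pM2r half); apply: le_trans a3; rewrite (ler_pM2r half); exact: IH3.
case: ifPn => [k|].
  by split; [exact: a1|exact: a2|exact: le_trans b3 k].
rewrite -ltNge => k; split; [exact: a1|exact: a2|apply: le_trans b3 _].
apply: (half_norm _ k); rewrite /bd /= (bdry_split_r (m := P'.2 + h n.+1)).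
- by rewrite -[P'.2 + h n.+1 + h n.+1]addrA -(hS n).
- by rewrite lerDl h0 lerD2l (hS n) lerDl h0.
- by rewrite lerDl.
- by move=> s /andP[s1 s2]; apply: u_cont_r; rewrite (le_trans a1 s1) (le_trans s2 a2).
Qed.

Lemma corner_step n : [/\ (corner n).1 <= (corner n.+1).1, (corner n.+1).1 + w n.+1 <= (corner n).1 + w n,
   (corner n).2 <= (corner n.+1).2 & (corner n.+1).2 + h n.+1 <= (corner n).2 + h n].
Proof.
rewrite [corner n.+1]/=; set P := corner n.
have k1 : P.1 + w n.+1 <= P.1 + w n by rewrite lerD2l (wS n) lerDl.
have k2 : P.2 + h n.+1 <= P.2 + h n by rewrite lerD2l (hS n) lerDl.
have k3 : P.1 + w n.+1 + w n.+1 <= P.1 + w n by rewrite -addrA -(wS n).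
have k4 : P.2 + h n.+1 + h n.+1 <= P.2 + h n by rewrite -addrA -(hS n).
by do 2 case: ifPn => _ /=; split; rewrite ?lerDl.
Qed.

(** The n-th rectangle carries at least 4^-n of the integral, and near the limit point at most ep (S
    / 2^n)^2, up to a constant, by [bdry_local]. The powers cancel and ep is arbitrary. *)
Lemma goursat : bdry u A B C D = 0.
Proof.
have [s0 hs0] : exists x, forall n, (corner n).1 <= x <= (corner n).1 + w n.
  by apply: nested_point => // n; have [] := corner_step n.
have [t0 ht0] : exists x, forall n, (corner n).2 <= x <= (corner n).2 + h n.
  by apply: nested_point => // n; have [] := corner_step n.
have s0AB : A <= s0 <= B.
  by have := hs0 0%N; rewrite /w /= expr0 divr1 subrKC.
have [p hp] := hu t0 s0AB.
apply/eqP; rewrite -normr_eq0 eq_le normr_ge0 andbT; apply/ler_addgt0Pl => ep ep0; rewrite addr0.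
pose S := (B - A) + (D - C).
have S0 : 0 <= S by rewrite addr_ge0 // subr_ge0.
have S1 : 0 < S ^+ 2 + 1 by rewrite ltr_wpDl // sqr_ge0.
(* Dividing by S^2 + 1 rather than S^2 keeps degenerate rectangles in the argument. *)
have [dl dl0 hd] := bdry_local hp (divr_gt0 ep0 S1).
have BA0 : 0 <= B - A by rewrite subr_ge0.
have DC0 : 0 <= D - C by rewrite subr_ge0.
have [n1 hn1] := half_small dl0 BA0.
have [n2 hn2] := half_small dl0 DC0.
pose n := maxn n1 n2; have [c1 c2 c3] := corner_inv n.
have wd : w n < dl by apply: hn1; rewrite leq_maxl.
have hdl : h n < dl by apply: hn2; rewrite leq_maxr.
have := hd (corner n).1 ((corner n).1 + w n) (corner n).2 ((corner n).2 + h n) (hs0 n) (ht0 n).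
rewrite !(addrAC _ _ (- (corner n).1)) !(addrAC _ _ (- (corner n).2)) !subrr !add0r => /(_ wd hdl).
have k1 t : cont_on (corner n).1 ((corner n).1 + w n) (fun s => u (ci s t)) by exact: u_cont_l.
have k2 s : (corner n).1 <= s <= (corner n).1 + w n ->
   cont_on (corner n).2 ((corner n).2 + h n) (fun t => u (ci s t)).
  by move=> /andP[e1 e2]; apply: u_cont_r; rewrite (le_trans c1 e1) (le_trans e2 c2).
move=> /(_ k1 k2) /(le_trans c3).
have -> : w n + h n = S / 2 ^+ n by rewrite /w /h /S -mulrDl.
rewrite ler_pdivrMr ?exprn_gt0 // => k; apply: le_trans k _.
have -> : ep / (S ^+ 2 + 1) * (S / 2 ^+ n) ^+ 2 * 4 ^+ n = ep * (S ^+ 2 / (S ^+ 2 + 1)).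
  have -> : (4 : R) ^+ n = (2 ^+ n) ^+ 2 by rewrite exprAC; congr (_ ^+ _); rewrite -natrX.
  by field; rewrite expf_neq0 ?pnatr_eq0 // gt_eqF.
by rewrite -[leRHS]mulr1 ler_wpM2l ?(ltW ep0) // ler_pdivrMr // mul1r lerDl.
Qed.

End Bisect.
End Goursat.

(** * Fourier coefficients and power series expansion *)

Section Fourier.
Context {R : realType}.
Local Notation H := (quat R).
Variable I : H.
Hypothesis hI : imag_unit I.
Implicit Types (w z e p : H) (a b s t x y : R) (u v : R -> H) (c : nat -> H).
Local Notation cI := (cI I).
Local Notation ci := (slice_point I).
Local Notation cis := (slice_cis I).
Local Notation hol := (hol I).
Local Notation cexp := (slice_exp I).
Local Notation ctp := (cont_on (- pi) pi).

Let pi0 : 0 < pi :> R := pi_gt0 R.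
Let pipi : - pi <= pi :> R. Proof. by have := pi0; lra. Qed.
Let pipi' : - pi < pi :> R. Proof. by have := pi0; lra. Qed.

Let p20 : (2 * pi : R) != 0.
Proof. by rewrite mulf_neq0 ?gt_eqF. Qed.

Lemma I_neq0 : I != 0.
Proof.
apply/eqP => I0; have := qsqnI hI; rewrite I0 qsqn0 => /esym/eqP.
by rewrite oner_eq0.
Qed.

Lemma cis_cont_lin x t : {for t, continuous (fun s => cis (x * s))}.
Proof.
apply: (@continuous_comp _ _ _ (fun s => x * s) cis); last exact: cis_cont.
by apply: cvgM; [exact: cvg_cst|exact: cvg_id].
Qed.
Lemma cis_ct x a b : cont_on a b (fun s => cis (x * s)).
Proof. by move=> t _; exact: cis_cont_lin. Qed.

Lemma cis_pm n : cis (n%:R * pi) = cis (n%:R * - pi).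
Proof.
have -> : n%:R * pi = n%:R * (2 * pi) + n%:R * - pi :> R by ring.
by rewrite cisD // cis_nat // cis_2pi expr1n mul1r.
Qed.

Lemma qint_cis n : (0 < n)%N -> qint (- pi) pi (fun t => cis (n%:R * t)) = 0.
Proof.
move=> n0; have nR : (n%:R : R) != 0 by rewrite pnatr_eq0 -lt0n.
have dl t : is_derive t (1 : R) (fun t => n%:R * t) n%:R.
  have -> : (fun t : R => n%:R * t) = n%:R *: (@idfun R) by [].
  by apply: is_derive_eq; rewrite /GRing.scale /= mulr1.
have ds t : is_derive t (1 : R) (fun t => sin (n%:R * t) / n%:R) (cos (n%:R * t)).
  have -> : (fun t : R => sin (n%:R * t) / n%:R) = n%:R^-1 *: (sin \o (fun t => n%:R * t)).
    by apply/funext => y /=; rewrite mulrC.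
  apply: is_derive_eq; rewrite /GRing.scale /=; field; exact: nR.
have dc t : is_derive t (1 : R) (fun t => - cos (n%:R * t) / n%:R) (sin (n%:R * t)).
  have -> : (fun t : R => - cos (n%:R * t) / n%:R) = (- n%:R^-1) *: (cos \o (fun t => n%:R * t)).
    by apply/funext => y /=; rewrite mulNr -mulrN mulrC.
  apply: is_derive_eq; rewrite /GRing.scale /=; field; exact: nR.
have cn s : {for s, continuous (fun t : R => n%:R * t)}.
  by apply: cvgM; [exact: cvg_cst|exact: cvg_id].
have cc : ctp (fun t => cos (n%:R * t)).
  by move=> s _; apply: (@continuous_comp _ _ _ (fun t => n%:R * t) cos); [exact: cn|exact: continuous_cos].
have cs : ctp (fun t => sin (n%:R * t)).
  by move=> s _; apply: (@continuous_comp _ _ _ (fun t => n%:R * t) sin); [exact: cn|exact: continuous_sin].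
rewrite /slice_cis /slice_point qintD; last 2 first.
- by move=> t /cc h; apply: cvgZr_tmp.
- by move=> t /cs h; apply: cvgZr_tmp.
rewrite !qint_scale // (rint_FTC pipi' cc ds) (rint_FTC pipi' cs dc).
have := cis_pm n; rewrite /slice_cis => e.
have := congr1 (@qre R) e; rewrite !qre_ci // => ->.
have := congr1 (yI I) e; rewrite !yI_ci // => ->.
by rewrite !subrr !scale0r addr0.
Qed.

Lemma qint_cisN n : (0 < n)%N -> qint (- pi) pi (fun t => cis (- n%:R * t)) = 0.
Proof.
move=> n0; rewrite -[RHS]qconj0 -(qint_cis n0) -qint_conj; last exact: cis_ct.
by apply: qint_eq => t _; rewrite -cisN // mulNr.
Qed.

Lemma qint_cis_sub (m n : nat) : m != n ->
  qint (- pi) pi (fun t => cis ((m%:R - n%:R) * t)) = 0.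
Proof.
case: (ltngtP m n) => // mn _.
  have -> : m%:R - n%:R = - (n - m)%:R :> R by rewrite natrB ?opprB // ltnW.
  by rewrite qint_cisN // subn_gt0.
have -> : m%:R - n%:R = (m - n)%:R :> R by rewrite natrB // ltnW.
by rewrite qint_cis // subn_gt0.
Qed.

(** The frequency is a real number, so that negative and shifted indices need no separate treatment.
    The character stands on the left, as the powers of q do in a regular series. *)
Definition fourier u x : H := (2 * pi)^-1 *: qint (- pi) pi (fun t => cis (- x * t) * u t).

Definition tp (c : nat -> H) M t : H := \sum_(0 <= m < M) cis (m%:R * t) * c m.

Lemma tp_ct c M a b : cont_on a b (tp c M).
Proof.
elim: M => [|M IH].
  have -> : tp c 0 = fun=> 0 by apply/funext => t; rewrite /tp big_nil.
  exact: cont_on_cst.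
have -> : tp c M.+1 = fun t => tp c M t + cis (M%:R * t) * c M.
  by apply/funext => t; rewrite /tp big_nat_recr.
by apply: cont_onD => //; apply: cont_onM; [exact: cis_ct|exact: cont_on_cst].
Qed.

Lemma qdot_ct a b u v : cont_on a b u -> cont_on a b v ->
  cont_on a b (fun t => qdot (u t) (v t)).
Proof.
move=> cu cv; have := cont_onM (cont_onC cu) cv; by case/cont_on_comps.
Qed.

Lemma rint_qdot a b u p : cont_on a b u ->
  rint a b (fun t => qdot (u t) p) = qdot (qint a b u) p.
Proof.
move=> cu; rewrite /qdot -qint_conj // -qintMr //; exact: cont_onC.
Qed.

Lemma fc_qdot u (m : nat) p : ctp u ->
  rint (- pi) pi (fun t => qdot (u t) (cis (m%:R * t) * p)) = 2 * pi * qdot (fourier u m%:R) p.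
Proof.
move=> cu; rewrite /fourier qdotZl mulrA mulfV ?mul1r ?mulf_neq0 ?gt_eqF //.
rewrite -rint_qdot; last by apply: cont_onM => //; exact: cis_ct.
by apply: rint_eq => t _; rewrite qdotMl -cisN // mulNr opprK.
Qed.

Lemma rint_tp u c M : ctp u ->
  rint (- pi) pi (fun t => qdot (u t) (tp c M t)) =
  2 * pi * \sum_(0 <= m < M) qdot (fourier u m%:R) (c m).
Proof.
move=> cu; rewrite /tp mulr_sumr.
have [] := @rint_sum R (- pi) pi M (fun m t => qdot (u t) (cis (m%:R * t) * c m)).
  by move=> m; apply: qdot_ct => //; apply: cont_onM; [exact: cis_ct|exact: cont_on_cst].
move=> h _; transitivity (rint (- pi) pi (fun t => \sum_(0 <= i < M) qdot (u t) (cis (i%:R * t) * c i))).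
  by apply: rint_eq => t _; rewrite qdot_sumr.
by rewrite h; apply: eq_bigr => m _; rewrite fc_qdot.
Qed.

Lemma fcD u v x : ctp u -> ctp v -> fourier (fun t => u t + v t) x = fourier u x + fourier v x.
Proof.
move=> cu cv; rewrite /fourier -scalerDr -qintD; try by apply: cont_onM => //; exact: cis_ct.
by congr (_ *: _); apply: qint_eq => t _; rewrite mulrDr.
Qed.

Lemma fc_mono (m n : nat) p : fourier (fun t => cis (m%:R * t) * p) n%:R = if m == n then p else 0.
Proof.
rewrite /fourier; have -> : qint (- pi) pi (fun t => cis (- n%:R * t) * (cis (m%:R * t) * p)) =
  qint (- pi) pi (fun t => cis ((m%:R - n%:R) * t)) * p.
  rewrite -qintMr; last exact: cis_ct.
  by apply: qint_eq => t _; rewrite mulrA -cisD // -mulrDl addrC.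
case: eqVneq => [->|mn]; last by rewrite qint_cis_sub // mul0r scaler0.
rewrite subrr (@qint_eq _ _ _ _ (fun=> 1)) ?qint_cst //; last by move=> t _; rewrite mul0r cis0.
rewrite -scalerAl mul1r scalerA opprK -mulr2n mulr_natl mulVf ?scale1r //.
by rewrite mulrn_eq0 /= gt_eqF.
Qed.

Lemma fc_tp c M (n : nat) : fourier (tp c M) n%:R = if (n < M)%N then c n else 0.
Proof.
elim: M => [|M IH].
  have -> : tp c 0 = fun=> 0 by apply/funext => t; rewrite /tp big_nil.
  rewrite /fourier (@qint_eq _ _ _ _ (fun=> 0)) ?qint_cst ?scaler0 // => t _; exact: mulr0.
have -> : tp c M.+1 = fun t => tp c M t + cis (M%:R * t) * c M.
  by apply/funext => t; rewrite /tp big_nat_recr.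
rewrite fcD; [|exact: tp_ct|by apply: cont_onM; [exact: cis_ct|exact: cont_on_cst]].
rewrite IH fc_mono ltnS (leq_eqVlt n M) (eq_sym M).
by case: eqVneq => [->|_] /=; rewrite ?ltnn ?add0r ?addr0.
Qed.

Lemma parseval c M :
  rint (- pi) pi (fun t => qsqn (tp c M t)) = 2 * pi * \sum_(0 <= m < M) qsqn (c m).
Proof.
transitivity (rint (- pi) pi (fun t => qdot (tp c M t) (tp c M t))).
  by apply: rint_eq => t _; rewrite qdotqq.
rewrite rint_tp; last exact: tp_ct.
congr (_ * _); rewrite [LHS]big_nat [RHS]big_nat; apply: eq_bigr => m /andP[_ mM].
by rewrite fc_tp mM qdotqq.
Qed.

Lemma qsqn_ct a b u : cont_on a b u -> cont_on a b (fun t => qsqn (u t)).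
Proof.
move=> cu; have -> : (fun t => qsqn (u t)) = (fun t => qdot (u t) (u t)).
  by apply/funext => t; rewrite qdotqq.
exact: qdot_ct.
Qed.

Lemma bessel u M : ctp u ->
  2 * pi * \sum_(0 <= m < M) qsqn (fourier u m%:R) <= rint (- pi) pi (fun t => qsqn (u t)).
Proof.
move=> cu; pose g := tp (fun m => fourier u m%:R) M.
have cg : ctp g by exact: tp_ct.
have : 0 <= rint (- pi) pi (fun t => qsqn (u t - g t)).
  rewrite -[0](mul0r (pi - - pi)) -rint_cst //; apply: rint_le.
  - exact: cont_on_cst.
  - by apply: qsqn_ct; apply: cont_onD => //; exact: cont_onN.
  - by move=> t _; exact: qsqn_ge0.
have -> : rint (- pi) pi (fun t => qsqn (u t - g t)) =
    rint (- pi) pi (fun t => qsqn (u t) + (-2 * qdot (u t) (g t) + qsqn (g t))).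
  by apply: rint_eq => t _; rewrite qsqnB; ring.
have c1 := qdot_ct cu cg; have c2 := qsqn_ct cg; have c3 := qsqn_ct cu.
have c4 : ctp (fun t => -2 * qdot (u t) (g t)) by apply: cont_onRM => //; exact: cont_on_cst.
rewrite (rintD c3 (cont_onD c4 c2)) (rintD c4 c2) (rintZ _ c1) rint_tp //.
have := parseval (fun m => fourier u m%:R) M; rewrite -/g => ->.
under eq_bigr do rewrite qdotqq.
by lra.
Qed.

Section Taylor.
Variable f : H -> H.
Hypothesis hf : slice_regular f.

Lemma cis_ball r t : 0 <= r < 1 -> qball (r *: cis t).
Proof. by move=> /andP[r0 r1]; rewrite /qball /= normrZ norm_cis // mulr1 ger0_norm. Qed.

Lemma regular_cont q : qball q -> {for q, continuous f}.
Proof. by move=> qb; apply: differentiable_continuous; apply: hf.1. Qed.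

Lemma circle_cont r t : 0 <= r < 1 -> {for t, continuous (fun t => f (r *: cis t))}.
Proof.
move=> r01; apply: (@continuous_comp _ _ _ (fun t => r *: cis t) f).
  by apply: cvgZl_tmp; exact: cis_cont.
by apply: regular_cont; exact: cis_ball.
Qed.
Lemma circle_ct r a b : 0 <= r < 1 -> cont_on a b (fun t => f (r *: cis t)).
Proof. by move=> r01 t _; exact: circle_cont. Qed.

Lemma norm_fc_le u x K : ctp u -> (forall t, - pi <= t <= pi -> `|u t| <= K) -> `|fourier u x| <= 2 * K.
Proof.
move=> cu uK; have p2 : 0 < 2 * pi :> R by rewrite mulr_gt0.
rewrite /fourier normrZ ger0_norm ?invr_ge0 ?(ltW p2) // mulrC ler_pdivrMr //.
have -> : 2 * K * (2 * pi) = 2 * (K * (pi - - pi)) by ring.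
apply: qint_norm => //; first by apply: cont_onM => //; exact: cis_ct.
by move=> t ht; rewrite normqM norm_cis // mul1r; exact: uK.
Qed.

(* the change of variables w = log z turns z^(-x) f(z) into a function
   holomorphic on a half-plane, to which Goursat applies on a rectangle *)
Lemma fc_const_log (x : R) a b : cis (x * pi) = cis (x * - pi) -> a <= b -> b < 0 ->
  expR (- x * a) *: fourier (fun t => f (expR a *: cis t)) x =
  expR (- x * b) *: fourier (fun t => f (expR b *: cis t)) x.
Proof.
move=> hx ab b0.
pose U w := cexp (- x *: w) * f (cexp w).
have UE s t : U (ci s t) = expR (- x * s) *: (cis (- x * t) * f (expR s *: cis t)).
  rewrite /U cexp_ci // (_ : - x *: ci s t = ci (- x * s) (- x * t)); last first.
    by rewrite /slice_point scalerDr !scalerA.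
  by rewrite cexp_ci // scalerAl.
have hU s t : a <= s <= b -> exists p, hol U (ci s t) p.
  move=> /andP[_ sb].
  have zb : qball (cexp (ci s t)).
    by rewrite cexp_ci //; apply: cis_ball; rewrite ltW ?expR_gt0 //= expR_lt1; exact: le_lt_trans b0.
  eexists; apply: hol_mul => //; last 2 first.
  - exact: (hol_cexp hI (- x) (ci s t)).
  - apply: hol_comp; last exact: (hol_regular hI hf zb (cI_cexp _ _)).
    + by move=> w; exact: cI_cexp.
    + exact: (cI_cexp I (ci s t)).
    + have := hol_cexp hI 1 (ci s t); rewrite !scale1r.
      by under eq_fun do rewrite scale1r.
  by move=> w; exact: cI_cexp.
have G := goursat hI ab pipi hU.
move: G; rewrite /bdry.
(* The two horizontal sides cancel: the point of the circle and, by [hx], the character take the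
   same value at the angles pi and - pi. *)
have -> : qint a b (fun s => U (ci s pi)) = qint a b (fun s => U (ci s (- pi))).
  have hx' : cis (- x * pi) = cis (- x * - pi) by rewrite mulNr -mulrN -hx mulrN mulNr opprK.
  have cpi : cis pi = cis (- pi) by have := cis_pm 1; rewrite !mul1r.
  by apply: qint_eq => s _; rewrite !UE hx' cpi.
rewrite [X in X - _ = _]addrAC subrr add0r -mulrBr => /qmul_eq0[I0|/eqP].
  exact: (False_ind _ (negP I_neq0 (introT eqP I0))).
have e1 s : a <= s <= b -> qint (- pi) pi (fun t => U (ci s t)) = (2 * pi) *: (expR (- x * s) *: fourier (fun t => f (expR s *: cis t)) x).
  move=> /andP[_ sb]; rewrite /fourier !scalerA mulrAC mulfV ?mul1r ?mulf_neq0 ?gt_eqF //.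
  under eq_fun do rewrite UE.
  have cc : ctp (fun t => cis (- x * t) * f (expR s *: cis t)).
    apply: cont_onM; first exact: cis_ct.
    by apply: circle_ct; rewrite ltW ?expR_gt0 //= expR_lt1; exact: le_lt_trans b0.
  have := qintMl (expR (- x * s))%:A cc; rewrite -scalerAl mul1r => <-.
  by apply: qint_eq => t _; rewrite -scalerAl mul1r.
have aab : a <= a <= b by rewrite lexx.
have abb : a <= b <= b by rewrite lexx andbT.
rewrite (e1 _ aab) (e1 _ abb) -scalerBr scaler_eq0 => /orP[h|].
  exact: (False_ind _ (negP p20 h)).
rewrite subr_eq0 => /eqP h; exact: esym h.
Qed.

End Taylor.
End Fourier.

(** * Taylor coefficients and convergence on circles *)

Section Taylor2.
Context {R : realType}.
Local Notation H := (quat R).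
Variable I : H.
Hypothesis hI : imag_unit I.
Implicit Types (w z e p : H) (a b s t x y : R) (u v : R -> H) (c : nat -> H).
Local Notation cI := (cI I).
Local Notation cis := (slice_cis I).
Local Notation hol := (hol I).
Local Notation fc := (fourier I).
Local Notation ctp := (cont_on (- pi) pi).
Variable f : H -> H.
Hypothesis hf : slice_regular f.
Let fr r t := f (r *: cis t).

Let pi0 : 0 < pi :> R := pi_gt0 R.

Lemma fr_ct r : 0 < r < 1 -> ctp (fr r).
Proof. by move=> /andP[r0 r1]; apply: circle_ct => //; rewrite (ltW r0). Qed.

Lemma fc_const (x r r' : R) : cis (x * pi) = cis (x * - pi) -> 0 < r < 1 -> 0 < r' < 1 ->
  expR (- x * ln r) *: fc (fr r) x = expR (- x * ln r') *: fc (fr r') x.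
Proof.
move=> hx; wlog rr' : r r' / r <= r' => [W r1 r2|].
  by case: (leP r r') => [h|/ltW h]; [exact: W|apply/esym; exact: W].
move=> /andP[r0 r1] /andP[r0' r1'].
have := @fc_const_log _ I hI f hf x (ln r) (ln r') hx.
rewrite !lnK ?posrE //; apply; first by rewrite ler_ln.
by apply: ln_lt0; rewrite r0'.
Qed.

(** The radius 1/2 is arbitrary: by [fc_const] every radius in (0, 1) gives the same value after
    division by its n-th power. *)
Definition taylor_coef (n : nat) : H := 2 ^+ n *: fc (fr 2^-1) n%:R.

Lemma fc_taylor n r : 0 < r < 1 -> fc (fr r) n%:R = r ^+ n *: taylor_coef n.
Proof.
move=> r01; have [r0 r1] := andP r01.
have h01 : 0 < (2^-1 : R) < 1 by rewrite invr_gt0 ltr0n invf_lt1 ?ltr1n.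
have := fc_const (cis_pm hI n) r01 h01.
rewrite !mulNr !expRN !expRM_natl !lnK ?posrE ?invr_gt0 //.
rewrite exprVn invrK -/(taylor_coef n) => <-.
by rewrite scalerA mulfV ?scale1r // expf_neq0 // gt_eqF.
Qed.

Lemma fr_bounded : exists K, exists2 d : R, 0 < d & forall r t, 0 < r < d -> `|fr r t| <= K.
Proof.
have q0 : qball (0 : H) by rewrite /qball /= normr0.
have /cvgrPdist_lt /(_ 1 ltr01) /nbhs_norm0P[d /= d0 hd] := regular_cont hf q0.
exists (`|f 0| + 1), d => // r t /andP[r0 rd].
have := hd (r *: cis t); rewrite /= normrZ norm_cis // mulr1 gtr0_norm // => /(_ rd) h.
have -> : fr r t = f 0 - (f 0 - fr r t) by rewrite subKr.
by apply: le_trans (ler_normB _ _) _; rewrite lerD2l ltW.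
Qed.

(** The product of this coefficient with r^(n+1) does not depend on r, and it tends to zero with r
    because f is bounded near the origin. *)
Lemma fc_neg n r : 0 < r < 1 -> fc (fr r) (- n.+1%:R) = 0.
Proof.
move=> r01; have [r0 r1] := andP r01.
have [K [d d0 hK]] := fr_bounded.
have hx : cis (- n.+1%:R * pi) = cis (- n.+1%:R * - pi).
  by rewrite mulrNN mulNr -mulrN cis_pm.
pose C := r ^+ n.+1 *: fc (fr r) (- n.+1%:R).
have CE r' : 0 < r' < 1 -> C = r' ^+ n.+1 *: fc (fr r') (- n.+1%:R).
  move=> r01'; have [r0' r1'] := andP r01'.
  have := fc_const hx r01 r01'; rewrite !opprK !expRM_natl !lnK ?posrE //.
have K0 : 0 <= K.
  by apply: le_trans (hK (d / 2) 0 _) => //; rewrite divr_gt0 //= ltr_pdivrMr //; lra.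
have Cs r' : 0 < r' < 1 -> r' < d -> `|C| <= r' * (2 * K).
  move=> r01' rd; have [r0' r1'] := andP r01'; rewrite (CE _ r01') normrZ.
  apply: ler_pM => //.
    rewrite ger0_norm ?exprn_ge0 ?(ltW r0') // exprS ler_piMr ?(ltW r0') //.
    by rewrite exprn_ile1 ?(ltW r0') // ltW.
  by apply: norm_fc_le => //; [exact: fr_ct|move=> t _; apply: hK; rewrite r0'].
have C0 : C = 0.
  apply/eqP; rewrite -normr_eq0 eq_le normr_ge0 andbT leNgt; apply/negP => cp.
  (* Small enough for r' * 2 K <= |C| / 2, which contradicts the bound on |C|. *)
  pose r' := Num.min (Num.min (1 / 2) (d / 2)) (`|C| / (4 * (K + 1))).
  have K1 : 0 < 4 * (K + 1) by rewrite mulr_gt0 // ltr_wpDl.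
  have r'0 : 0 < r' by rewrite !lt_min !divr_gt0.
  have r'1 : r' <= 1 / 2 by rewrite !ge_min lexx.
  have r'2 : r' <= d / 2 by rewrite !ge_min lexx orbT.
  have r'3 : r' <= `|C| / (4 * (K + 1)) by rewrite ge_min lexx orbT.
  have := Cs r' _ _; rewrite r'0 /= => /(_ _ _)/le_gtF.
  have e1 : r' < 1 by lra.
  have e2 : r' < d by lra.
  move=> /(_ e1 e2); rewrite ler_pdivlMr // in r'3.
  by move/negbT; rewrite -leNgt; nra.
move: C0; rewrite /C => /eqP; rewrite scaler_eq0 expf_eq0 (gt_eqF r0) andbF /=.
by move/eqP.
Qed.

Section Kappa.
Variables (r t0 : R).
Hypothesis r01 : 0 < r < 1.
Let z0 := r *: cis t0.
Let p := 'd f z0 1.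

Let z0b : qball z0. Proof. by apply: cis_ball => //; case/andP: r01 => /ltW -> ->. Qed.

(** Difference quotient at the point z0 of the circle, with division on the left, where increments
    of the slice act. It is continuous on the circle, so Bessel's inequality makes its Fourier
    coefficients small. Since the error of the n-th Taylor sum at z0 is a single coefficient of it,
    the Taylor series converges at z0 itself. *)
Definition kappa w := if w == z0 then p else qinv (w - z0) * (f w - f z0).
Let k t := kappa (r *: cis t).

Lemma kappa_rel w : (w - z0) * kappa w = f w - f z0.
Proof.
rewrite /kappa; case: eqVneq => [->|wz]; first by rewrite !subrr mul0r.
by rewrite mulrA qmulV ?mul1r // subr_eq0.
Qed.

Lemma circle_map_cont t : {for t, continuous (fun t => r *: cis t)}.
Proof. by apply: cvgZl_tmp; exact: cis_cont. Qed.

Lemma kappa_cont t1 : {for t1, continuous k}.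
Proof.
have hz : hol f z0 p by apply: hol_regular => //; exact/cI_Z/cI_cis.
have gc := @circle_map_cont t1.
have [e|ne] := eqVneq (r *: cis t1) z0.
  apply/cvgrPdist_le => ep ep0; have [d d0 hd] := hz _ ep0.
  move/cvgrPdist_lt : gc => /(_ _ d0); apply: filterS => t; rewrite e distrC => h.
  rewrite /k {1}/kappa e eqxx /kappa; case: eqVneq => [_|ne]; first by rewrite subrr normr0 ltW.
  set g := r *: cis t in h ne *; have cg : cI (g - z0).
    by apply: cI_D; [exact/cI_Z/cI_cis|apply: cI_N; exact/cI_Z/cI_cis].
  have := hd _ cg h; rewrite [z0 + _]addrC subrK => k1.
  have gz : g - z0 != 0 by rewrite subr_eq0.
  have -> : p - qinv (g - z0) * (f g - f z0) = - (qinv (g - z0) * (f g - f z0 - (g - z0) * p)).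
    by rewrite [in RHS]mulrBr [_ * (_ * p)]mulrA qmulVl // mul1r opprB.
  rewrite normrN normqM; have n0 : 0 < `|g - z0| by rewrite normr_gt0.
  have -> : `|qinv (g - z0)| = `|g - z0|^-1.
    have := congr1 Num.norm (qmulV gz); rewrite normqM normq1 => hq.
    by apply: (mulfI (lt0r_neq0 n0)); rewrite hq mulfV // gt_eqF.
  by rewrite mulrC ler_pdivrMr.
have g0 : r *: cis t1 - z0 != 0 by rewrite subr_eq0.
have kc : (fun t => (qsqn (r *: cis t - z0))^-1 *: (qconj (r *: cis t - z0) * (f (r *: cis t) - f z0))) t @[t --> t1]
    --> k t1.
  have -> : k t1 = (qsqn (r *: cis t1 - z0))^-1 *: (qconj (r *: cis t1 - z0) * (f (r *: cis t1) - f z0)).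
    by rewrite /k /kappa (negbTE ne) /qinv -scalerAl.
  have dc : {for t1, continuous (fun t => r *: cis t - z0)}.
    by apply: cvgB => //; exact: cvg_cst.
  have d1 : {for t1, continuous (fun t => qconj (r *: cis t - z0))} by exact: qcvg_conj dc.
  have d2 : {for t1, continuous (fun t => qsqn (r *: cis t - z0))} by exact: qcvg_qsqn dc.
  have d3 : {for t1, continuous (fun t => f (r *: cis t) - f z0)}.
    by apply: cvgB; [apply: circle_cont => //; case/andP: r01 => /ltW -> ->|exact: cvg_cst].
  have d4 : {for t1, continuous (fun t => qconj (r *: cis t - z0) * (f (r *: cis t) - f z0))}.
    exact: qcvgM d1 d3.
  by apply: cvgZ => //; apply: cvgV => //; rewrite qsqn_eq0.
apply: cvg_trans kc; apply: near_eq_cvg.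
have n0 : 0 < `|r *: cis t1 - z0| by rewrite normr_gt0.
move/cvgrPdist_lt : gc => /(_ _ n0); apply: filterS => t h.
rewrite /k /kappa; case: eqVneq => [e|_]; last by rewrite /qinv -scalerAl.
by move: h; rewrite e ltxx.
Qed.

Let kct a b : cont_on a b k. Proof. by move=> t _; exact: kappa_cont. Qed.

Lemma fc_shift u (x y : R) : fc (fun t => cis (y * t) * u t) x = fc u (x - y).
Proof.
rewrite /fourier; congr (_ *: _); apply: qint_eq => t _.
by rewrite mulrA -cisD // -mulrDl opprB addrC.
Qed.

(** Fourier coefficients of [kappa_rel]: the factor r cis t shifts the frequency by one. Frequencies
    are written n - m so that the identity also covers the negative ones. *)
Lemma fc_kappa (n m : nat) :
  fc (fr r) (n%:R - m%:R) - (if m == n then f z0 else 0) =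
  r *: fc k (n%:R - m%:R - 1) - z0 * fc k (n%:R - m%:R).
Proof.
rewrite -(fc_mono hI m n (f z0)) -!(fc_shift _ n%:R m%:R).
have cu : ctp (fun t => cis (m%:R * t) * fr r t).
  by apply: cont_onM; [exact: cis_ct|exact: fr_ct].
have cv : ctp (fun t => cis (m%:R * t) * f z0).
  by apply: cont_onM; [exact: cis_ct|exact: cont_on_cst].
have p2 : (2 * pi : R) != 0 by rewrite mulf_neq0 ?gt_eqF.
have c1 x : ctp (fun t => cis (x * t) * k t) by apply: cont_onM; [exact: cis_ct|exact: kct].
have c2 x : ctp (fun t => cis (- x * t) * (cis (m%:R * t) * k t)) by apply: cont_onM; [exact: cis_ct|exact: c1].
have c3 x : ctp (fun t => cis (- x * t) * (cis (m%:R * t) * fr r t)) by apply: cont_onM; [exact: cis_ct|].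
have c4 x : ctp (fun t => cis (- x * t) * (cis (m%:R * t) * f z0)) by apply: cont_onM; [exact: cis_ct|].
rewrite -addrA (addrC (- m%:R)) addrA -fc_shift /fourier -scalerBr.
rewrite (scalerA r) (mulrC r) -scalerA -scalerAr -scalerBr; congr (_ *: _).
rewrite -(qintN (c4 _)) -(qintD (c3 _) (cont_onN (c4 _))).
have -> : r *: qint (- pi) pi (fun t => cis (- (n%:R - 1) * t) * (cis (m%:R * t) * k t)) =
   qint (- pi) pi (fun t => r%:A * (cis (- (n%:R - 1) * t) * (cis (m%:R * t) * k t))).
  by rewrite (qintMl r%:A (c2 _)) -scalerAl mul1r.
rewrite -(qintMl z0 (c2 _)) -(qintN (cont_onM (@cont_on_cst _ _ _ _ z0) (c2 _))).
rewrite -qintD; last 2 first.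
- exact: (cont_onM (@cont_on_cst _ _ _ _ (r%:A : H)) (c2 _)).
- exact: (cont_onN (cont_onM (@cont_on_cst _ _ _ _ z0) (c2 _))).
apply: qint_eq => t _; rewrite -!mulrBr -(kappa_rel (r *: cis t)) -/(k t).
rewrite !mulrA -!mulrBl; congr (_ * _); rewrite mulrBr mulrBl; congr (_ - _).
- rewrite -!scalerAl mul1r -scalerAr -!cisD //; congr (_ *: slice_cis _ _); ring.
- rewrite -[RHS]mulrA; apply: (cI_comm hI); last exact: (cI_Z r (cI_cis I t0)).
  by apply: cI_M; exact: cI_cis.
Qed.

(** Multiplication by a character shifts the frequencies by m and leaves the modulus unchanged. The
    bound is therefore uniform in m, and with m = M it reaches the negative frequencies. *)
Lemma bessel_kappa : exists B : R, forall m M, \sum_(0 <= i < M) qsqn (fc k (i%:R - m%:R)) <= B.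
Proof.
exists ((2 * pi)^-1 * rint (- pi) pi (fun t => qsqn (k t))) => m M.
rewrite ler_pdivlMl ?mulr_gt0 //.
have cu : ctp (fun t => cis (m%:R * t) * k t) by apply: cont_onM; [exact: cis_ct|exact: kct].
have := bessel hI M cu.
under eq_bigr do rewrite fc_shift.
move=> /le_trans; apply; rewrite le_eqVlt; apply/orP; left; apply/eqP.
by apply: rint_eq => t _; rewrite qsqnM qsqn_cis // mul1r.
Qed.

(** As f has no negative frequencies, [fc_kappa] becomes r fc(-j-2) = z0 fc(-j-1) with |z0| = r. All
    negative coefficients then have the same modulus, which square summability forces to be zero. *)
Lemma fc_kappa_neg1 : fc k (-1) = 0.
Proof.
have [r0 r1] := andP r01.
have st j : `|fc k (- j.+2%:R)| = `|fc k (- j.+1%:R)|.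
  have := fc_kappa 0 j.+1; rewrite !sub0r fc_neg // subr0 => /esym/eqP.
  rewrite subr_eq0 -opprD natr1 => /eqP/(congr1 Num.norm).
  have nz : `|z0| = r by rewrite /z0 normrZ norm_cis // mulr1 gtr0_norm.
  rewrite normrZ normqM nz gtr0_norm // => /mulfI; apply.
  by rewrite gt_eqF.
have al j : qsqn (fc k (- j.+1%:R)) = qsqn (fc k (-1)).
  by elim: j => // j IH; rewrite -normq2 st normq2.
have [B hB] := bessel_kappa.
apply/eqP; rewrite -qsqn_eq0 eq_le qsqn_ge0 andbT leNgt; apply/negP => q0.
have B0 : 0 <= B by have := hB 0%N 0%N; rewrite big_nil.
pose M := Num.bound (B / qsqn (fc k (-1))).
have := hB M M; have -> : \sum_(0 <= i < M) qsqn (fc k (i%:R - M%:R)) = \sum_(0 <= i < M) qsqn (fc k (-1)).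
  rewrite [LHS]big_nat [RHS]big_nat; apply: eq_bigr => i /andP[_ iM].
  rewrite -opprB -natrB 1?ltnW //; have : (0 < M - i)%N by rewrite subn_gt0.
  by case: (M - i)%N => // j _; exact: al.
rewrite sumr_const_nat subn0 -mulr_natl; apply/negP; rewrite -ltNge.
by rewrite -ltr_pdivrMr //; apply: archi_boundP; rewrite divr_ge0 // ltW.
Qed.

Let T n := cis (n%:R * t0) * fc k (n%:R - 1).

(** By [fc_kappa] each Taylor term is the difference r T_m - r T_(m+1), up to the value f z0
    subtracted in the term m = 0. The sum telescopes, and T_0 vanishes by [fc_kappa_neg1]. *)
Lemma taylor_partial n : \sum_(0 <= m < n.+1) z0 ^+ m * taylor_coef m - f z0 = - (r *: T n.+1).
Proof.
have zX m : z0 ^+ m = r ^+ m *: cis (m%:R * t0) by rewrite /z0 exprZn cis_nat.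
have st m : z0 ^+ m * taylor_coef m - (if (0 == m)%N then f z0 else 0) = r *: T m - r *: T m.+1.
  have := fc_kappa m 0; rewrite !subr0 fc_taylor // => h.
  have e0 : (if (0 == m)%N then f z0 else 0) = cis (m%:R * t0) * (if (0 == m)%N then f z0 else 0).
    by case: eqP => [<-|_]; rewrite ?mul0r ?cis0 ?mul1r ?mulr0.
  rewrite e0 zX -scalerAl scalerAr -mulrBr h mulrBr -scalerAr; congr (_ - _).
  have zK (w1 w2 : H) : w1 * (z0 * w2) = r *: (w1 * cis t0 * w2).
    by rewrite /z0 -scalerAl -scalerAr mulrA.
  rewrite zK -cisD // /T.
  have -> : m%:R * t0 + t0 = m.+1%:R * t0 by rewrite -natr1 mulrDl mul1r.
  by rewrite -natr1 addrK.
elim: n => [|n IH].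
  rewrite big_nat1 (st 0%N) /T mul0r cis0 // sub0r fc_kappa_neg1 mulr0 scaler0 sub0r //.
rewrite big_nat_recr //= addrAC IH; have := st n.+1; rewrite subr0 => ->.
by rewrite addrA addNr add0r.
Qed.

Lemma taylor_circle : qpseries taylor_coef z0 @ \oo --> f z0.
Proof.
have [B hB] := bessel_kappa; have [r0 r1] := andP r01.
have c0 : (fun i : nat => qsqn (fc k i%:R)) @ \oo --> (0 : R).
  apply: cvg_series_cvg_0; apply: nondecreasing_is_cvgn.
    by apply: nondecreasing_series => n _ _; exact: qsqn_ge0.
  exists B => _ [n _ <-]; have := hB 0%N n.
  by under eq_bigr do rewrite subr0.
have cT : (fun n : nat => r *: T n.+1) @ \oo --> (0 : H).
  apply/cvgrPdist_lt => ep ep0.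
  have ep2 : 0 < ep ^+ 2 by rewrite exprn_gt0.
  move/cvgrPdist_lt : c0 => /(_ _ ep2); apply: filterS => n.
  rewrite !sub0r !normrN ger0_norm ?qsqn_ge0 // => h.
  rewrite normrZ gtr0_norm // /T normqM norm_cis // mul1r -natr1 addrK.
  apply: le_lt_trans (_ : `|fc k n%:R| < ep).
    by rewrite ler_piMl // ltW.
  by rewrite -(@ltr_pXn2r _ 2) ?nnegrE ?(ltW ep0) // normq2.
rewrite -(cvg_shiftS (qpseries taylor_coef z0)) /=.
have -> : (fun n => qpseries taylor_coef z0 n.+1) = fun n => f z0 - r *: T n.+1.
  apply/funext => n; have := taylor_partial n.
  by rewrite /qpseries /series /= => /eqP; rewrite subr_eq addrC => /eqP ->.
have h : (fun n : nat => f z0 - r *: T n.+1) @ \oo --> f z0 - 0.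
  by apply: cvgB cT; exact: cvg_cst.
by rewrite subr0 in h.
Qed.

End Kappa.
End Taylor2.

(** * Power series of slice regular functions and comparison of coefficients *)

Section Regular.
Context {R : realType}.
Local Notation H := (quat R).
Implicit Types (f : H -> H) (q : H).

Definition iq : H := Quat 0 1 0 0.
Lemma iq_unit : imag_unit iq.
Proof. by rewrite /imag_unit /iq /= qmulE /=; apply: quatP => /=; ring. Qed.

Lemma imag_unitN (I : H) : imag_unit I -> imag_unit (- I).
Proof. by rewrite /imag_unit /= mulrNN. Qed.

Lemma imag_unitP (I : H) : qre I = 0 -> qsqn I = 1 -> imag_unit I.
Proof.
move=> a b; rewrite /imag_unit /=; have : qconj I * I = (qsqn I)%:A by exact: qconj_mul.
have -> : qconj I = - I by apply: quatP => //=; rewrite a oppr0.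
by rewrite b scale1r mulNr => /eqP; rewrite eqr_oppLR => /eqP.
Qed.

Lemma polar q : exists2 I : H, imag_unit I & exists t, q = `|q| *: slice_cis I t.
Proof.
have [->|q0] := eqVneq q 0.
  by exists iq; [exact: iq_unit|exists 0; rewrite normr0 scale0r].
have n0 : 0 < `|q| by rewrite normr_gt0.
pose v := q - (qre q)%:A; pose y := `|v|.
have vre : qre v = 0 by rewrite /v !quatE /=; ring.
have sq : qsqn q = qre q ^+ 2 + y ^+ 2.
  by rewrite /y normq2 /qsqn /v !quatE /=; ring.
have [I hI vI] : exists2 I, imag_unit I & v = y *: I.
  have [v0|v0] := eqVneq v 0.
    by exists iq; [exact: iq_unit|rewrite /y v0 normr0 scale0r].
  have y0 : y != 0 by rewrite normr_eq0.
  exists (y^-1 *: v); last by rewrite scalerA mulfV ?scale1r.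
  apply: imag_unitP; first by rewrite qreZ vre mulr0.
  by rewrite qsqnZ -normq2 -/y exprVn mulVf // expf_neq0.
exists I => //; exists (acos (qre q / `|q|)).
have ab : -1 <= qre q / `|q| <= 1.
  by rewrite -ler_norml normrM normfV (ger0_norm (normr_ge0 q)) ler_pdivrMr // mul1r qre_le.
rewrite /slice_cis sin_acos // acosK; last by rewrite in_itv /=.
have -> : Num.sqrt (1 - (qre q / `|q|) ^+ 2) = y / `|q|.
  have -> : 1 - (qre q / `|q|) ^+ 2 = (y / `|q|) ^+ 2.
    rewrite !exprMn exprVn normq2 sq; field.
    by rewrite -sq qsqn_eq0.
  by rewrite sqrtr_sqr ger0_norm //; apply: divr_ge0; exact: normr_ge0.
have -> : slice_point I (qre q / `|q|) (y / `|q|) = `|q|^-1 *: ((qre q)%:A + y *: I).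
  by rewrite /slice_point scalerDr !scalerA !(mulrC (`|q|^-1)).
rewrite scalerA mulfV ?gt_eqF // scale1r -vI /v addrC subrK //.
Qed.

Lemma regular_real f (I : H) : imag_unit I -> slice_regular f ->
  taylor_coef I f = taylor_coef iq f.
Proof.
have key J : imag_unit J -> slice_regular f -> forall x : R, 0 < x < 1 ->
    qpseries (taylor_coef J f) (x%:A : H) @ \oo --> f (x%:A : H).
  by move=> hJ hf x x01; have := @taylor_circle _ J hJ f hf x 0 x01; rewrite cis0.
move=> hI hf; apply: (@ps_unique_real _ f); apply: key => //; exact: iq_unit.
Qed.

(** The origin lies on no circle of positive radius; its value is recovered as the limit of the
    means over small circles. *)
Lemma taylor_coef0 f : slice_regular f -> taylor_coef iq f 0 = f 0.
Proof.
move=> hf; apply/eqP; rewrite -subr_eq0 -normr_eq0 eq_le normr_ge0 andbT.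
apply/ler_addgt0Pl => ep ep0; rewrite addr0.
have q0 : qball (0 : H) by rewrite /qball /= normr0.
have ep2 : 0 < ep / 2 by rewrite divr_gt0.
have /cvgrPdist_lt /(_ _ ep2) /nbhs_norm0P[d /= d0 hd] := regular_cont hf q0.
pose r := Num.min (1 / 2) (d / 2).
have r0 : 0 < r by rewrite lt_min !divr_gt0.
have r1 : r <= 1 / 2 by rewrite ge_min lexx.
have r2 : r <= d / 2 by rewrite ge_min lexx orbT.
have r01 : 0 < r < 1 by rewrite r0 /=; lra.
have r01' : 0 <= r < 1 by rewrite (ltW r0) /=; lra.
have := fc_taylor iq_unit hf 0 r01; rewrite expr0 scale1r => <-.
have hc : cont_on (- pi) pi (fun t => f (r *: slice_cis iq t)) by apply: circle_ct => //; exact: iq_unit.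
have -> : f 0 = fourier iq (fun t => slice_cis iq (0%:R * t) * f 0) 0%:R by rewrite fc_mono //; exact: iq_unit.
have cc : cont_on (- pi) pi (fun t => slice_cis iq (0%:R * t) * f 0).
  by apply: cont_onM; [exact: cis_ct|exact: cont_on_cst].
have fN u x : cont_on (- pi) pi u -> fourier iq (fun t => - u t) x = - fourier iq u x.
  move=> cu; rewrite /fourier -scalerN -qintN; last by apply: cont_onM => //; exact: cis_ct.
  by congr (_ *: _); apply: qint_eq => t _; rewrite mulrN.
rewrite -fN // -fcD //; last exact: cont_onN.
have -> : ep = 2 * (ep / 2) by field.
apply: norm_fc_le; first exact: iq_unit.
  by apply: cont_onD => //; exact: cont_onN.
move=> t _; rewrite mul0r cis0 mul1r distrC ltW //; apply: hd.
by rewrite /= normrZ norm_cis ?mulr1 ?gtr0_norm //; [lra|exact: iq_unit].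
Qed.

Lemma regular_ps f : slice_regular f -> has_ps f (taylor_coef iq f).
Proof.
move=> hf q qb; have [I hI [t qt]] := polar q.
have [q0|q0] := eqVneq q 0.
  rewrite q0 -(taylor_coef0 hf) -(cvg_shiftS (qpseries _ _)) /=.
  rewrite (_ : (fun n => _) = fun=> taylor_coef iq f 0); first exact: cvg_cst.
  apply/funext => n; rewrite /qpseries /series /= big_nat_recl // expr0 mul1r big1 ?addr0 // => i _.
  by rewrite expr0n mul0r.
have r01 : 0 < `|q| < 1 by rewrite normr_gt0 q0.
by have := @taylor_circle _ I hI f hf _ t r01; rewrite -qt (regular_real hI hf).
Qed.

Lemma coefs_taylor f : slice_regular f -> coefs f = taylor_coef iq f.
Proof. by move=> /regular_ps/coefsE. Qed.

Lemma has_ps_coefs f : slice_regular f -> has_ps f (coefs f).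
Proof. by move=> hf; rewrite coefs_taylor //; exact: regular_ps. Qed.

Lemma fc_coefs f (I : H) n r : imag_unit I -> slice_regular f -> 0 < r < 1 ->
  fourier I (fun t => f (r *: slice_cis I t)) n%:R = r ^+ n *: coefs f n.
Proof. by move=> hI hf r01; rewrite fc_taylor // regular_real // coefs_taylor. Qed.

Lemma bernoulli_pow (r : R) k : 0 <= r <= 1 -> 1 - k%:R * (1 - r) <= r ^+ k.
Proof.
move=> /andP[r0 r1]; elim: k => [|k IH]; first by rewrite mul0r subr0 expr0.
rewrite exprS; apply: le_trans (_ : r * (1 - k%:R * (1 - r)) <= _); last by rewrite ler_wpM2l.
rewrite -natr1; have : 0 <= (k%:R : R) * (1 - r) * (1 - r) by rewrite !mulr_ge0 // subr_ge0.
by lra.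
Qed.

(** The limit r -> 1 made explicit: by Bernoulli's inequality r^k loses at most k (1 - r), which
    costs less than ep for 1 - r = d. *)
Lemma limit_pow (S B : R) k : 0 <= S -> (forall r : R, 0 < r < 1 -> r ^+ k * S <= B) -> S <= B.
Proof.
move=> S0 h; apply/ler_addgt0Pl => ep ep0.
pose d := Num.min (1 / 2) (ep / (k%:R * S + 1)).
have kS : 0 <= k%:R * S by rewrite mulr_ge0.
have kS1 : 0 < k%:R * S + 1 by rewrite ltr_wpDl.
have d0 : 0 < d by rewrite lt_min !divr_gt0.
have d1 : d <= 1 / 2 by rewrite ge_min lexx.
have d2 : d <= ep / (k%:R * S + 1) by rewrite ge_min lexx orbT.
have r01 : 0 < 1 - d < 1 by apply/andP; split; lra.
have := h _ r01; have r01' : 0 <= 1 - d <= 1 by apply/andP; split; lra.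
have := bernoulli_pow k r01' => /(ler_wpM2r S0) b1 b2.
have := le_trans b1 b2.
have : d * (k%:R * S + 1) <= ep by rewrite -ler_pdivlMr.
by lra.
Qed.

(** A pointwise inequality is integrated over a circle, with Bessel on the left and Parseval for the
    polynomials on the right; then the radius tends to 1. The polynomials may be evaluated on other
    slices [I' i], since only the angle t is shared; the slice of - I provides conjugate points. *)
Lemma comparison (I : H) (J0 P0 N M : nat) (F : nat -> H -> H) (I' : nat -> H) (u : nat -> nat -> H) :
  imag_unit I -> (forall j, (j < J0)%N -> slice_regular (F j)) -> (forall i, imag_unit (I' i)) ->
  (forall (r t : R), 0 < r < 1 -> \sum_(0 <= j < J0) qsqn (F j (r *: slice_cis I t)) <=
     \sum_(0 <= i < P0) qsqn (\sum_(0 <= l < N) (r *: slice_cis (I' i) t) ^+ l * u i l)) ->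
  \sum_(0 <= j < J0) \sum_(0 <= m < M) qsqn (coefs (F j) m) <=
  \sum_(0 <= i < P0) \sum_(0 <= l < N) qsqn (u i l).
Proof.
move=> hI hF hI' hle.
(* Padding by zero, because [rint_sum] asks for continuity at every index. *)
pose F' j := if (j < J0)%N then F j else fun=> 0.
have hF' j : slice_regular (F' j).
  rewrite /F'; case: ifP => [/hF //|_].
  have <- : psum_fun (fun=> 0 : H) = fun=> 0.
    apply/funext => q; apply/cvg_lim => //.
    rewrite (_ : qpseries _ q = fun=> 0); first exact: cvg_cst.
    by apply/funext => k; rewrite /qpseries /series /= big1 // => i _; rewrite mulr0.
  by apply: psum_fun_regular; exists 0 => m; rewrite normr0.
(* On the circle of radius r the m-th term carries the factor r^(2 m), which is at least r^(2 M) for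
   m < M. *)
apply: (@limit_pow _ _ (2 * M)%N).
  by rewrite sumr_ge0 // => j _; rewrite sumr_ge0 // => m _; exact: qsqn_ge0.
move=> r r01; have [r0 r1] := andP r01.
have pi0 : 0 < 2 * pi :> R by rewrite mulr_gt0 // pi_gt0.
have r01' : 0 <= r < 1 by rewrite (ltW r0).
have cF j : cont_on (- pi) pi (fun t => qsqn (F' j (r *: slice_cis I t))).
  by apply: qsqn_ct; apply: circle_ct.
pose tpi i t := qsqn (tp (I' i) (fun l => r ^+ l *: u i l) N t).
have cT i : cont_on (- pi) pi (tpi i) by apply: qsqn_ct; apply: tp_ct.
have [sF csF] := rint_sum J0 cF; have [sT csT] := rint_sum P0 cT.
have key : rint (- pi) pi (fun t => \sum_(0 <= j < J0) qsqn (F' j (r *: slice_cis I t))) <=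
    rint (- pi) pi (fun t => \sum_(0 <= i < P0) tpi i t).
  apply: rint_le => // t _; have := hle r t r01.
  rewrite (_ : \sum_(0 <= j < J0) qsqn (F j _) = \sum_(0 <= j < J0) qsqn (F' j (r *: slice_cis I t))); last first.
    by rewrite [LHS]big_nat [RHS]big_nat; apply: eq_bigr => j /andP[_ jJ]; rewrite /F' jJ.
  move=> /le_trans; apply; rewrite le_eqVlt; apply/orP; left; apply/eqP.
  apply: eq_bigr => i _; rewrite /tpi /tp; congr qsqn; apply: eq_bigr => l _.
  by rewrite exprZn cis_nat // -scalerAl scalerAr.
rewrite sF sT in key.
have e1 : 2 * pi * (r ^+ (2 * M) * (\sum_(0 <= j < J0) \sum_(0 <= m < M) qsqn (coefs (F j) m))) <=
    \sum_(0 <= i < J0) rint (- pi) pi (fun x => qsqn (F' i (r *: slice_cis I x))).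
  rewrite mulrA mulr_sumr big_nat [leRHS]big_nat; apply: ler_sum => j /andP[_ jJ].
  have cf : cont_on (- pi) pi (fun t => F' j (r *: slice_cis I t)) by apply: circle_ct.
  apply: le_trans (bessel hI M cf); rewrite -mulrA ler_wpM2l ?(ltW pi0) //.
  rewrite mulr_sumr big_nat [leRHS]big_nat; apply: ler_sum => m /andP[_ mM].
  rewrite fc_coefs // qsqnZ /F' jJ ler_wpM2r ?qsqn_ge0 // -exprM.
  by rewrite ler_wiXn2l // ?(ltW r0) ?(ltW r1) // mulnC leq_mul2l ltnW.
have e2 : \sum_(0 <= i < P0) rint (- pi) pi (tpi i) <=
    2 * pi * (\sum_(0 <= i < P0) \sum_(0 <= l < N) qsqn (u i l)).
  rewrite mulr_sumr; apply: ler_sum => i _; rewrite /tpi parseval //.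
  rewrite ler_wpM2l ?(ltW pi0) //; apply: ler_sum => l _; rewrite qsqnZ ler_piMl ?qsqn_ge0 //.
  by rewrite -exprM exprn_ile1 // ?(ltW r0) ?(ltW r1).
by have := le_trans e1 (le_trans key e2); rewrite ler_pM2l.
Qed.

End Regular.

(** * Leech factorization *)

Section Leech.
Context {R : realType}.
Local Notation H := (quat R).

Definition adj m n (A : 'M[H]_(m, n)) : 'M[H]_(n, m) := \matrix_(i, j) qconj (A j i).

Lemma adjK m n (A : 'M[H]_(m, n)) : adj (adj A) = A.
Proof. by apply/matrixP => i j; rewrite !mxE qconjK. Qed.
Lemma adjM m n p (A : 'M[H]_(m, n)) (B : 'M[H]_(n, p)) : adj (A *m B) = adj B *m adj A.
Proof.
apply/matrixP => i j; rewrite !mxE qconj_sum; apply: eq_bigr => k _.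
by rewrite !mxE qconjM.
Qed.
Lemma adjD m n (A B : 'M[H]_(m, n)) : adj (A + B) = adj A + adj B.
Proof. by apply/matrixP => i j; rewrite !mxE qconjD. Qed.
Lemma adjN m n (A : 'M[H]_(m, n)) : adj (- A) = - adj A.
Proof. by apply/matrixP => i j; rewrite !mxE qconjN. Qed.
Lemma adjB m n (A B : 'M[H]_(m, n)) : adj (A - B) = adj A - adj B.
Proof. by rewrite adjD adjN. Qed.
Lemma adj1 n : adj (1%:M : 'M[H]_n) = 1%:M.
Proof. by apply/matrixP => i j; rewrite !mxE eq_sym; case: eqP; rewrite ?qconj1 ?qconj0. Qed.
Lemma adj_sum m n (I : Type) (s : seq I) (F : I -> 'M[H]_(m, n)) :
  adj (\sum_(i <- s) F i) = \sum_(i <- s) adj (F i).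
Proof.
apply: (big_morph (@adj m n) (@adjD m n)).
by apply/matrixP => i j; rewrite !mxE qconj0.
Qed.

Definition qf n (G : 'M[H]_n) (u : 'cV[H]_n) : R := qre ((adj u *m G *m u) 0 0).

(** Determinants do not invert matrices over a noncommutative ring. The inverse is built by block
    elimination: the upper left entry is a positive real, hence central and invertible, and its
    Schur complement is again selfadjoint and positive definite. *)
Lemma posdef_rinv n (G : 'M[H]_n) : adj G = G ->
  (forall u : 'cV_n, u != 0 -> 0 < qf G u) -> exists K, G *m K = 1%:M.
Proof.
elim: n G => [|n IH] G; first by exists 0; rewrite (flatmx0 1%:M) flatmx0.
rewrite -[n.+1]/(1 + n)%N in G * => Ga Gp.
pose a := ulsubmx G; pose b := ursubmx G; pose c := dlsubmx G; pose D := drsubmx G.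
have GE : G = block_mx a b c D by rewrite submxK.
have ca : c = adj b.
  by apply/matrixP => i j; rewrite !mxE -{1}Ga mxE.
have Da : adj D = D by apply/matrixP => i j; rewrite !mxE -{2}Ga mxE.
pose x := G 0 0.
have a00 : a = x%:M.
  apply/matrixP => i j; rewrite !ord1 !mxE eqxx mulr1n; congr (G _ _); exact: val_inj.
have xc : qconj x = x by rewrite /x -{2}Ga mxE.
have xE : x = (qre x)%:A.
  move: xc; case: (x) => x0 x1 x2 x3 [h1 h2 h3].
  by apply: quatP; rewrite !quatE /=; lra.
have x0 : 0 < qre x.
  pose u : 'cV[H]_(1 + n) := col_mx 1%:M 0.
  have u0 : u != 0.
    apply/eqP => /(congr1 (fun M : 'cV_(1 + n) => usubmx M 0 0)).
    rewrite /u col_mxKu !mxE eqxx /=; apply/eqP; exact: oner_neq0.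
  have := Gp _ u0; rewrite /qf; congr (0 < qre _).
  rewrite mxE (bigD1 0) //= big1 ?addr0.
    rewrite mxE (bigD1 0) //= big1 ?addr0.
      rewrite !mxE; case: splitP => // j _; rewrite !ord1 !mxE eqxx /= qconj1 mul1r mulr1.
      by [].
    move=> i; rewrite !mxE; case: splitP => [j|j _ _]; last by rewrite mxE qconj0 mul0r.
    by rewrite ord1 => /= e; rewrite -val_eqE /= e.
  move=> i; rewrite !mxE; case: splitP => [j|j _ _]; last by rewrite mxE mulr0.
  by rewrite ord1 => /= e; rewrite -val_eqE /= e.
pose y : H := (qre x)^-1%:A.
have xy : x * y = 1 by rewrite xE /y -scalerAl mul1r scalerA mulfV ?scale1r // gt_eqF.
have yx : y * x = 1 by rewrite xE /y -scalerAl mul1r scalerA mulVf ?scale1r // gt_eqF.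
have yc : qconj y = y by rewrite /y qconjZ qconj1.
pose ai : 'M[H]_1 := y%:M.
have aai : a *m ai = 1%:M by rewrite a00 /ai -scalar_mxM xy.
have aia : adj ai = ai.
  by apply/matrixP => i j; rewrite !ord1 !mxE eqxx /= !mulr1n yc.
pose S := D - c *m ai *m b.
have Sa : adj S = S by rewrite /S adjB !adjM aia Da ca adjK mulmxA.
have [|L SL] := IH S Sa.
  (* The vector with lower part [u] on which the first row of [G] vanishes; there the form of [G]
     equals the form of the Schur complement. *)
  move=> u u0; pose w : 'cV[H]_(1 + n) := col_mx (- (ai *m b *m u)) u.
  have w0 : w != 0.
    apply: contra_neq u0 => /(congr1 (fun M : 'cV_(1 + n) => dsubmx M)).
    by rewrite /w col_mxKd => ->; apply/matrixP => i j; rewrite !mxE.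
  have := Gp _ w0; rewrite /qf; congr (0 < qre _); congr (fun_of_matrix _ _ _).
  rewrite -!mulmxA {1}GE {2}/w mul_block_col.
  have -> : a *m - (ai *m b *m u) + b *m u = 0.
    by rewrite mulmxN !mulmxA aai mul1mx addNr.
  have -> : c *m - (ai *m b *m u) + D *m u = S *m u.
    by rewrite /S mulmxBl mulmxN !mulmxA addrC.
  have -> : adj w = row_mx (adj (- (ai *m b *m u))) (adj u).
    apply/matrixP => i j; rewrite !mxE; case: splitP => k jk; rewrite ?mxE; by [].
  by rewrite mul_row_col mulmx0 add0r.
exists (block_mx (ai + ai *m b *m L *m c *m ai) (- (ai *m b *m L)) (- (L *m c *m ai)) L).
have -> : (1%:M : 'M[H]_(1 + n)) = block_mx 1%:M 0 0 1%:M by exact: scalar_mx_block.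
have DE : D *m L = 1%:M + c *m ai *m b *m L by rewrite -SL -mulmxDl /S subrK.
rewrite GE mulmx_block; congr block_mx.
- by rewrite mulmxDr mulmxN !mulmxA aai !mul1mx addrK.
- by rewrite mulmxN !mulmxA aai mul1mx addNr.
- by rewrite mulmxDr mulmxN !mulmxA DE !mulmxDl !mul1mx subrr.
- by rewrite mulmxN !mulmxA DE addrC addrK.
Qed.

Lemma posdef_inv n (G : 'M[H]_n) : adj G = G ->
  (forall u : 'cV_n, u != 0 -> 0 < qf G u) ->
  exists K, G *m K = 1%:M /\ K *m G = 1%:M.
Proof.
move=> Ga Gp; have [K GK] := posdef_rinv Ga Gp; exists K; split=> //.
have KG : adj K *m G = 1%:M by rewrite -{1}Ga -adjM GK adj1.
by rewrite -[K]mul1mx -KG -(mulmxA (adj K)) GK mulmx1.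
Qed.

(* Lower triangular Toeplitz matrix of multiplication by [a], and the backward
   shift, on polynomials of degree less than [N]. *)
Definition toep N (a : nat -> H) : 'M[H]_N :=
  \matrix_(l, m) if (m <= l)%N then a (l - m)%N else 0.
Definition bshift N : 'M[H]_N := \matrix_(l, m) (m == l.+1 :> nat)%:R.
Definition cvec N (a : nat -> H) : 'cV[H]_N := \col_l a l.

Lemma qconj_nat (b : bool) : qconj (b%:R : H) = b%:R.
Proof. by case: b; rewrite ?qconj1 ?qconj0. Qed.

Lemma toep_shift N a : toep N a *m adj (bshift N) = adj (bshift N) *m toep N a.
Proof.
apply/matrixP => l m; rewrite !mxE.
have L : \sum_j toep N a l j * adj (bshift N) j m = if (m < l)%N then a (l - m.+1)%N else 0.
  case: (ltnP m.+1 N) => [mN|Nm].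
    rewrite (bigD1 (Ordinal mN)) //= big1 => [|j jm].
      by rewrite !mxE eqxx qconj1 mulr1 addr0.
    by rewrite !mxE qconj_nat (_ : (j == m.+1 :> nat) = false) ?mulr0 //; apply/negbTE; rewrite -val_eqE in jm.
  rewrite big1 => [|j _].
    by rewrite ltnNge -ltnS (leq_trans (ltn_ord l) Nm).
  by rewrite !mxE qconj_nat (_ : (j == m.+1 :> nat) = false) ?mulr0 // ltn_eqF // (leq_trans (ltn_ord j)).
rewrite L; have [l0|l0] := posnP l.
  rewrite l0 ltn0 big1 // => j _.
  by rewrite !mxE qconj_nat l0 mul0r.
have lN : (l.-1 < N)%N by rewrite (leq_ltn_trans (leq_pred _)).
rewrite (bigD1 (Ordinal lN)) //= big1 => [|j jm].
  have e1 : (m <= l.-1)%N = (m < l)%N by rewrite -ltnS prednK.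
  have e2 : (l.-1 - m)%N = (l - m.+1)%N by rewrite -subn1 -subnDA add1n.
  by rewrite !mxE /= prednK // eqxx qconj1 mul1r addr0 e1 e2.
rewrite !mxE qconj_nat (_ : (l == j.+1 :> nat) = false) ?mul0r //; apply/negbTE.
by apply: contra jm => /eqP lj; rewrite -val_eqE /= lj.
Qed.

Lemma bshift_toep N a : bshift N *m adj (toep N a) = adj (toep N a) *m bshift N.
Proof. by have := congr1 (@adj _ _) (toep_shift N a); rewrite !adjM adjK. Qed.

(** 1 - Z^* Z is the projection onto the constants; T commutes with the forward shift Z^* and maps
    the constant 1 to its coefficient vector. *)
Lemma toep_defect N a : toep N a *m adj (toep N a) =
  adj (bshift N) *m (toep N a *m adj (toep N a)) *m bshift N + cvec N a *m adj (cvec N a).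
Proof.
have Z1 : 1%:M = adj (bshift N) *m bshift N + (\matrix_(i, j) ((i == 0%N :> nat) && (j == 0%N :> nat))%:R) :> 'M[H]_N.
  apply/matrixP => i j; rewrite !mxE.
  have [i0|i0] := posnP i.
    rewrite big1 ?add0r ?i0 => [|k _]; last by rewrite !mxE i0 qconj_nat mul0r.
    by rewrite -val_eqE /= i0 eq_sym.
  have iN : (i.-1 < N)%N by rewrite (leq_ltn_trans (leq_pred _)).
  rewrite addr0 (bigD1 (Ordinal iN)) //= big1 ?addr0 => [|k ki].
    by rewrite !mxE prednK // eqxx qconj1 mul1r -val_eqE /= eq_sym.
  rewrite !mxE (_ : (i == k.+1 :> nat) = false) ?qconj0 ?mul0r //; apply/negbTE.
  by apply: contra ki => /eqP lj; rewrite -val_eqE /= lj.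
rewrite -{1}[toep N a]mulmx1 Z1 mulmxDr mulmxDl; congr (_ + _).
  by rewrite !mulmxA toep_shift -!mulmxA bshift_toep.
apply/matrixP => i j; rewrite [RHS]mxE big_ord1 !mxE.
case: N i j {Z1} => [[]|N] // i j.
rewrite (bigD1 ord0) //= big1 ?addr0 => [|k k0].
  rewrite !mxE (bigD1 ord0) //= big1 ?addr0 => [|k k0]; last first.
    by rewrite !mxE (_ : (k == 0%N :> nat) = false) ?mulr0 //; apply: negbTE.
  by rewrite !mxE /= !subn0 mulr1.
rewrite !mxE big1 ?mul0r // => l _; rewrite !mxE.
by rewrite (_ : (k == 0%N :> nat) = false) ?andbF ?mulr0 //; apply: negbTE.
Qed.

Definition re00 (A : 'M[H]_1) : R := qre (A 0 0).
Lemma re00D A B : re00 (A + B) = re00 A + re00 B.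
Proof. by rewrite /re00 mxE. Qed.
Lemma re00N A : re00 (- A) = - re00 A.
Proof. by rewrite /re00 mxE. Qed.
Lemma re00_adj A : re00 (adj A) = re00 A.
Proof. by rewrite /re00 mxE. Qed.
Lemma re00_sum (I : Type) (s : seq I) (F : I -> 'M[H]_1) :
  re00 (\sum_(i <- s) F i) = \sum_(i <- s) re00 (F i).
Proof. by apply: (big_morph re00 re00D); rewrite /re00 mxE. Qed.
Lemma re00_sq (A : 'M[H]_1) : re00 (adj A *m A) = qsqn (A 0 0).
Proof. by rewrite /re00 !mxE big_ord1 !mxE qconj_mul qreA. Qed.
Lemma re00_dot (A B : 'M[H]_1) : re00 (adj A *m B) = qdot (A 0 0) (B 0 0).
Proof. by rewrite /re00 !mxE big_ord1 !mxE. Qed.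

Lemma qf_sub n (Q Z : 'M[H]_n) (s s' : 'cV[H]_n) : adj Q = Q ->
  qf Q (s' - Z *m s) =
  qf Q s' - 2 * re00 (adj s *m (adj Z *m Q *m s')) + qf (adj Z *m Q *m Z) s.
Proof.
move=> Qa; rewrite /qf -![qre _]/(re00 _) adjB adjM !mulmxBl !mulmxBr !re00D !re00N re00D re00N.
have X : re00 (adj s' *m Q *m Z *m s) = re00 (adj s *m adj Z *m Q *m s').
  by rewrite -re00_adj !adjM adjK Qa !mulmxA.
by rewrite !mulmxA X; ring.
Qed.

Lemma mpow_comm n (A : 'M[H]_n) k :
  iter k (mulmx A) 1%:M *m A = A *m iter k (mulmx A) 1%:M.
Proof. by elim: k => [|k IH] /=; [rewrite mul1mx mulmx1|rewrite -mulmxA IH mulmxA]. Qed.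

Section Finite.
Variables (N K : nat) (F : nat -> nat -> H) (h : nat -> H).
Local Notation T a := (toep N a).
Local Notation Z := (bshift N).
Local Notation phi j := (cvec N (F j)).
Local Notation eta := (cvec N h).
(* [gap] is positive definite, and [G = Q + eta eta^* = Z^* Q Z + sum_j phi_j phi_j^*]
   by the rank one defect of Toeplitz matrices. The solution has coefficients
   conj (eta^* (G^-1 Z^* Q)^k G^-1 phi_j), the impulse response of the recursion
   in [energy], for which the quadratic form of [Q] is a storage function. *)
Definition gap : 'M[H]_N := \sum_(0 <= j < K) T (F j) *m adj (T (F j)) - T h *m adj (T h).
Hypothesis gap_pos : forall u : 'cV_N, u != 0 -> 0 < qf gap u.
Local Notation Q := gap.
Let G := Q + eta *m adj eta.

Let Qa : adj Q = Q.
Proof. by rewrite /gap adjB adj_sum adjM adjK; congr (_ - _); apply: eq_bigr => j _; rewrite adjM adjK. Qed.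

Let Qpsd u : 0 <= qf Q u.
Proof.
have [->|u0] := eqVneq u 0; last by rewrite ltW // gap_pos.
by rewrite /qf mulmx0 mxE.
Qed.

Let GE : G = adj Z *m Q *m Z + \sum_(0 <= j < K) phi j *m adj (phi j).
Proof.
rewrite /G /gap mulmxBr mulmxBl mulmx_sumr mulmx_suml.
rewrite {1}(toep_defect N h) opprD addrA subrK.
under eq_bigr do rewrite toep_defect.
by rewrite big_split /= addrAC.
Qed.

Let Ginv : exists Ki, G *m Ki = 1%:M /\ Ki *m G = 1%:M.
Proof.
apply: posdef_inv => [|u u0]; first by rewrite /G adjD Qa adjM adjK.
rewrite /qf /G mulmxDr mulmxDl mxE /= ltr_pwDl ?gap_pos //.
have := re00_sq (adj eta *m u); rewrite adjM adjK !mulmxA /re00 => ->.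
exact: qsqn_ge0.
Qed.

Let Ki := sval (cid Ginv).
Let GK : G *m Ki = 1%:M. Proof. by have [] := svalP (cid Ginv). Qed.
Let KG : Ki *m G = 1%:M. Proof. by have [] := svalP (cid Ginv). Qed.
Let al := Ki *m adj Z *m Q.
Let mpow (A : 'M[H]_N) k := iter k (mulmx A) 1%:M.
Definition sol j k : H := qconj ((adj eta *m mpow al k *m Ki *m phi j) 0 0).

(** The two expressions of [G] both evaluate Re (s^* y), where y = G s. The slack in the inequality
    is the nonnegative sum of qf Q (s' - Z s) and of the |v_j - phi_j^* s|^2. *)
Lemma energy (s s' : 'cV[H]_N) (v : nat -> H) :
  s = Ki *m (adj Z *m Q *m s' + \sum_(0 <= j < K) phi j *m (v j)%:M) ->
  qf Q s + qsqn ((adj eta *m s) 0 0) <= qf Q s' + \sum_(0 <= j < K) qsqn (v j).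
Proof.
set y := _ + _ => sE.
have Gs : G *m s = y by rewrite sE mulmxA GK mul1mx.
have l1 : qf Q s + qsqn ((adj eta *m s) 0 0) = re00 (adj s *m y).
  rewrite -Gs /G mulmxDl mulmxDr re00D -re00_sq adjM adjK !mulmxA; by [].
have l2 : re00 (adj s *m y) = qf (adj Z *m Q *m Z) s + \sum_(0 <= j < K) qsqn ((adj (phi j) *m s) 0 0).
  rewrite -Gs GE mulmxDl mulmxDr re00D; congr (_ + _); first by rewrite /qf /re00 !mulmxA.
  rewrite mulmx_suml mulmx_sumr re00_sum; apply: eq_bigr => j _.
  by rewrite -re00_sq adjM adjK !mulmxA.
have p1 := Qpsd (s' - Z *m s).
have p2 : 0 <= \sum_(0 <= j < K) qsqn (v j - (adj (phi j) *m s) 0 0).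
  by apply: sumr_ge0 => j _; exact: qsqn_ge0.
have e1 : qf Q (s' - Z *m s) = qf Q s' - 2 * re00 (adj s *m (adj Z *m Q *m s')) + qf (adj Z *m Q *m Z) s.
  exact: qf_sub.
have e2 : \sum_(0 <= j < K) qsqn (v j - (adj (phi j) *m s) 0 0) = \sum_(0 <= j < K) qsqn (v j)
   - 2 * re00 (adj s *m \sum_(0 <= j < K) phi j *m (v j)%:M) + \sum_(0 <= j < K) qsqn ((adj (phi j) *m s) 0 0).
  rewrite mulmx_sumr re00_sum mulr_sumr -sumrN -!big_split /=; apply: eq_bigr => j _.
  rewrite qsqnB; congr (_ - 2 * _ + _).
  have := re00_dot (adj (phi j) *m s) (v j)%:M; rewrite adjM adjK -mulmxA => ->.
  by rewrite qdotC !mxE eqxx mulr1n.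
have e3 : re00 (adj s *m y) = re00 (adj s *m (adj Z *m Q *m s')) + re00 (adj s *m \sum_(0 <= j < K) phi j *m (v j)%:M).
  by rewrite /y mulmxDr re00D.
by move: p1 p2; rewrite e1 e2; lra.
Qed.

Lemma mulmx_scalar00 m (A : 'M[H]_(1, m)) (B : 'M[H]_(m, 1)) x : (A *m (B *m x%:M)) 0 0 = (A *m B) 0 0 * x.
Proof. by rewrite mulmxA [LHS]mxE big_ord1; congr (_ * _); rewrite mxE eqxx mulr1n. Qed.

(** The adjoint of the column operator looks forward in m, so the recursion runs backwards from m =
    M, where the state is zero. Summing [energy] along it telescopes, and the storage left at m = 0
    is nonnegative. *)
Lemma sol_contractive M (v : nat -> nat -> H) :
  \sum_(0 <= m < M) qsqn (\sum_(0 <= k < M - m) \sum_(0 <= j < K) qconj (sol j k) * v j (m + k)%N) <=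
  \sum_(0 <= m < M) \sum_(0 <= j < K) qsqn (v j m).
Proof.
pose w m : 'cV[H]_N := \sum_(0 <= j < K) phi j *m (v j m)%:M.
pose s m : 'cV[H]_N := \sum_(0 <= k < M - m) mpow al k *m (Ki *m w (m + k)%N).
have s_rec m : (m < M)%N -> s m = Ki *m (adj Z *m Q *m s m.+1 + w m).
  move=> mM; rewrite /s -(subnSK mM) big_nat_recl // addn0 /= mul1mx mulmxDr addrC; congr (_ + _).
  rewrite !mulmxA -/al mulmx_sumr; apply: eq_bigr => k _.
  by rewrite addnS addSn /= !mulmxA.
have oE m : (adj eta *m s m) 0 0 = \sum_(0 <= k < M - m) \sum_(0 <= j < K) qconj (sol j k) * v j (m + k)%N.
  rewrite /s mulmx_sumr summxE; apply: eq_bigr => k _.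
  rewrite /w !mulmxA mulmx_sumr summxE; apply: eq_bigr => j _.
  by rewrite mulmx_scalar00 /sol qconjK.
have st m : (m < M)%N -> qf Q (s m) + qsqn ((adj eta *m s m) 0 0) <= qf Q (s m.+1) + \sum_(0 <= j < K) qsqn (v j m).
  by move=> mM; apply: energy; exact: s_rec.
have sM : qf Q (s M) = 0.
  by rewrite /s subnn big_nil /qf mulmx0 mxE.
suff ind n : (n <= M)%N -> qf Q (s (M - n)%N) + \sum_(M - n <= m < M) qsqn ((adj eta *m s m) 0 0) <=
    \sum_(M - n <= m < M) \sum_(0 <= j < K) qsqn (v j m).
  have := ind M (leqnn _); rewrite subnn; apply: le_trans.
  rewrite [leLHS](_ : _ = \sum_(0 <= m < M) qsqn ((adj eta *m s m) 0 0)); last by apply: eq_bigr => m _; rewrite oE.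
  by rewrite lerDr.
elim: n => [|n IH] nM; first by rewrite subn0 !big_geq // sM addr0.
have lt : (M - n.+1 < M)%N by rewrite ltn_subrL (leq_trans _ nM).
rewrite !(big_ltn lt) subnSK //.
have a1 := IH (ltnW nM); have a2 := st _ lt; rewrite subnSK // in a2.
rewrite addrA; apply: le_trans (lerD a2 (lexx _)) _.
by rewrite addrAC addrC lerD2l; exact: a1.
Qed.

Lemma bshift_pow k (u : 'cV[H]_N) (i : 'I_N) :
  (iter k (mulmx Z) u) i 0 = if insub (i + k)%N is Some j then u j 0 else 0.
Proof.
elim: k i => [|k IH] i.
  by rewrite /= addn0; case: insubP => [j _ e|]; [congr (u _ 0); exact/val_inj|rewrite ltn_ord].
rewrite iterS mxE; case: (ltnP i.+1 N) => [iN|Ni].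
  rewrite (bigD1 (Ordinal iN)) //= big1 ?addr0 => [|j jm].
    by rewrite mxE eqxx mul1r IH /= addSnnS.
  rewrite mxE (_ : (j == i.+1 :> nat) = false) ?mul0r //; apply/negbTE.
  by rewrite -val_eqE in jm.
rewrite big1 => [|j _].
  by case: insubP => // j + _; rewrite ltnNge (leq_trans Ni) // addnS ltnS leq_addr.
by rewrite mxE (_ : (j == i.+1 :> nat) = false) ?mul0r // ltn_eqF // (leq_trans (ltn_ord j)).
Qed.

(** Multiplying the shift identity for G by its inverse gives sum_j Ki phi_j phi_j^* = 1 - al Z. The
    sum of the al^k (1 - al Z) Z^k telescopes, and its remainder dies on the basis vector e_m
    because Z^(m+1) e_m = 0; the pairing with eta then reads off h m. *)
Lemma sol_eq m : (m < N)%N ->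
  h m = \sum_(0 <= j < K) \sum_(0 <= k < m.+1) F j (m - k)%N * sol j k.
Proof.
move=> mN; pose e : 'cV[H]_N := delta_mx (Ordinal mN) 0.
have PZ : \sum_(0 <= j < K) Ki *m phi j *m adj (phi j) = 1%:M - al *m Z.
  have := congr1 (mulmx Ki) GE; rewrite KG mulmxDr mulmx_sumr !mulmxA -/al => ->.
  by rewrite addrC addKr; apply: eq_bigr => j _; rewrite mulmxA.
have tel n : \sum_(0 <= k < n) mpow al k *m (1%:M - al *m Z) *m iter k (mulmx Z) e = e - mpow al n *m iter n (mulmx Z) e.
  elim: n => [|n IH]; first by rewrite big_nil /= mul1mx subrr.
  rewrite big_nat_recr //= IH mulmxBr mulmx1 mulmxBl addrA subrK; congr (_ - _).
  by rewrite (mulmxA (mpow al n) al Z) (mpow_comm al n) -!mulmxA.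
have ZN : iter m.+1 (mulmx Z) e = 0.
  apply/matrixP => i j; rewrite ord1 bshift_pow mxE; case: insubP => // l _ /= el.
  by rewrite mxE -val_eqE /= el addnS gtn_eqF // ltnS leq_addl.
have := tel m.+1; rewrite ZN mulmx0 subr0 => /(congr1 (fun x => (adj eta *m x) 0 0)).
have he : (adj eta *m e) 0 0 = qconj (h m).
  rewrite mxE (bigD1 (Ordinal mN)) //= big1 ?addr0; last first.
    by move=> i im; rewrite !mxE (negbTE im) mulr0.
  by rewrite !mxE eqxx mulr1.
rewrite he => hm.
rewrite -[h m]qconjK -hm mulmx_sumr summxE qconj_sum exchange_big /=.
apply: eq_big_nat => k /andP[_ km].
rewrite -PZ mulmx_sumr mulmx_suml mulmx_sumr summxE qconj_sum; apply: eq_bigr => j _.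
have -> : adj eta *m (mpow al k *m (Ki *m phi j *m adj (phi j)) *m iter k (mulmx Z) e) =
   (adj eta *m mpow al k *m Ki *m phi j) *m (adj (phi j) *m iter k (mulmx Z) e).
  by rewrite !mulmxA.
rewrite mxE big_ord1 qconjM -/(sol j k); congr (_ * _).
have mk : (m - k < N)%N by rewrite (leq_ltn_trans (leq_subr _ _)).
rewrite mxE (bigD1 (Ordinal mk)) //= big1 => [|i im].
  rewrite bshift_pow /=; case: insubP => [l _ /= el|]; last by rewrite subnK // mN.
  by rewrite addr0 !mxE qconjM qconjK -val_eqE /= el subnK // eqxx qconj1 mul1r.
rewrite bshift_pow; case: insubP => [l _ /= el|_]; last by rewrite mulr0.
rewrite !mxE -val_eqE /= el (_ : (i + k == m)%N = false) ?mulr0 //; apply/negbTE.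
by apply: contra im => /eqP ik; rewrite -val_eqE /= -ik addnK.
Qed.

End Finite.
End Leech.

(** * Convolution and column operators on coefficients *)

Section Conv.
Context {R : realType}.
Local Notation H := (quat R).
Implicit Types (a u v w y : nat -> H) (b : nat -> nat -> H).

Definition conv a u m : H := \sum_(k < m.+1) a k * u (m - k)%N.
(* The adjoint of [conv a] on the first [N] coefficients, see [conv_adj]. *)
Definition bs N a y l : H := \sum_(0 <= k < N - l) qconj (a k) * y (l + k)%N.

Lemma conv_nat a u m : conv a u m = \sum_(0 <= k < m.+1) a k * u (m - k)%N.
Proof. by rewrite big_mkord. Qed.

(** Up to a given degree convolution is the product of polynomials, from which associativity is
    inherited. *)
Lemma conv_poly a u M m : (m < M)%N ->
  conv a u m = ((\poly_(i < M) a i) * (\poly_(i < M) u i))`_m.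
Proof.
move=> mM; rewrite coefM; apply: eq_bigr => k _; rewrite !coef_poly.
have kM : (k < M)%N by apply: leq_ltn_trans mM; rewrite -ltnS ltn_ord.
have mkM : (m - k < M)%N by rewrite (leq_ltn_trans (leq_subr _ _)).
by rewrite kM mkM.
Qed.

Lemma convA a (b : nat -> H) u m : conv (conv a b) u m = conv a (conv b u) m.
Proof.
transitivity (((\poly_(i < m.+1) a i) * (\poly_(i < m.+1) b i) * (\poly_(i < m.+1) u i))`_m).
  rewrite coefM; apply: eq_bigr => k _; rewrite (conv_poly _ _ (ltn_ord k)); congr (_ * _).
  by rewrite coef_poly ltnS leq_subr.
rewrite -mulrA coefM; apply: eq_bigr => k _; rewrite coef_poly ltn_ord; congr (_ * _).
by rewrite (@conv_poly _ _ m.+1) // ltnS leq_subr.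
Qed.

Lemma conv_suml (J : nat) (a : nat -> nat -> H) u m :
  conv (fun k => \sum_(0 <= j < J) a j k) u m = \sum_(0 <= j < J) conv (a j) u m.
Proof.
by rewrite /conv exchange_big /=; apply: eq_bigr => k _; rewrite mulr_suml.
Qed.

Lemma sum_triangle (V : nmodType) (P : nat -> nat -> V) M :
  \sum_(0 <= m < M) \sum_(0 <= k < m.+1) P k (m - k)%N =
  \sum_(0 <= l < M) \sum_(0 <= k < M - l) P k l.
Proof.
elim: M => [|M IH]; first by rewrite !big_nil.
rewrite big_nat_recr //= IH [RHS]big_nat_recr //= subSnn big_nat1.
rewrite (_ : \sum_(0 <= l < M) \sum_(0 <= k < M.+1 - l) P k l =
    \sum_(0 <= l < M) \sum_(0 <= k < M - l) P k l + \sum_(0 <= l < M) P (M - l)%N l); last first.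
  rewrite -big_split /=; apply: eq_big_nat => l /andP[_ lM].
  by rewrite subSn 1?ltnW // big_nat_recr.
rewrite -addrA; congr (_ + _); rewrite big_nat_rev /= big_nat_recr //= ?add0n ?subSS ?subnn.
congr (_ + P _ _); last by rewrite subn0.
by apply: eq_big_nat => k /andP[_ kM]; rewrite ?add0n subSS subKn // ltnW.
Qed.

Lemma conv_adj M a u w :
  \sum_(0 <= m < M) qdot (conv a u m) (w m) = \sum_(0 <= l < M) qdot (u l) (bs M a w l).
Proof.
transitivity (\sum_(0 <= m < M) \sum_(0 <= k < m.+1) qdot (u (m - k)%N) (qconj (a k) * w ((m - k) + k)%N)).
  apply: eq_bigr => m _; rewrite conv_nat qdot_suml; apply: eq_big_nat => k /andP[_ km].
  by rewrite qdotMl subnK // -ltnS.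
rewrite (sum_triangle (fun k l => qdot (u l) (qconj (a k) * w (l + k)%N))).
by apply: eq_bigr => l _; rewrite /bs qdot_sumr.
Qed.

Lemma qsqn_CS (p q : nat -> H) m n :
  qsqn (\sum_(m <= k < n) p k * q k) <= (\sum_(m <= k < n) qsqn (p k)) * (\sum_(m <= k < n) qsqn (q k)).
Proof.
case: (leqP m n) => [/subnKC <-|/ltnW nm]; last by rewrite !big_geq // qsqn0 mul0r.
elim: (n - m)%N => [|d IH]; first by rewrite addn0 !big_geq // qsqn0 mul0r.
rewrite addnS !big_nat_recr ?leq_addr //=.
set S := \sum_(_ <= _ < _) (p _ * q _) in IH *; set A := \sum_(_ <= _ < _) qsqn (p _) in IH *.
set B := \sum_(_ <= _ < _) qsqn (q _) in IH *; set x := p _; set y := q _.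
have A0 : 0 <= A by apply: sumr_ge0 => i _; exact: qsqn_ge0.
have B0 : 0 <= B by apply: sumr_ge0 => i _; exact: qsqn_ge0.
have x0 := qsqn_ge0 x; have y0 := qsqn_ge0 y.
rewrite qsqnD qsqnM.
suff : 2 * qdot S (x * y) <= A * qsqn y + qsqn x * B by lra.
have k0 : 0 <= A * qsqn y + qsqn x * B by rewrite addr_ge0 // mulr_ge0.
apply: le_trans (_ : 2 * (`|S| * `|x * y|) <= _).
  by rewrite ler_wpM2l // (le_trans (ler_norm _) (qdot_norm _ _)).
rewrite -(@ler_pXn2r _ 2) ?nnegrE ?mulr_ge0 // !exprMn !normq2 qsqnM.
have : qsqn S * (qsqn x * qsqn y) <= A * B * (qsqn x * qsqn y) by rewrite ler_wpM2r ?mulr_ge0.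
have := sqr_ge0 (A * qsqn y - qsqn x * B).
by move: (qsqn x) (qsqn y) (qsqn S) => X Y Z; lra.
Qed.

(* the column operator u |-> (b_j * u)_j on l^2 has squared norm at most g2 *)
Definition col_bound (g2 : R) (b : nat -> nat -> H) :=
  forall u Ls J M, (forall l, (Ls <= l)%N -> u l = 0) ->
  \sum_(0 <= j < J) \sum_(0 <= m < M) qsqn (conv (b j) u m) <= g2 * \sum_(0 <= l < Ls) qsqn (u l).

(** The bound for the adjoint operator, on data supported in j < J and m < M: this is the form that
    the state space recursion delivers. *)
Definition col_bound_adj (g2 : R) (b : nat -> nat -> H) := forall M J (v : nat -> nat -> H),
  \sum_(0 <= m < M) qsqn (\sum_(0 <= k < M - m) \sum_(0 <= j < J) qconj (b j k) * v j (m + k)%N) <=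
  g2 * \sum_(0 <= m < M) \sum_(0 <= j < J) qsqn (v j m).

Lemma sum_supp (u : nat -> H) Ls M : (forall l, (Ls <= l)%N -> u l = 0) ->
  \sum_(0 <= l < M) qsqn (u l) <= \sum_(0 <= l < Ls) qsqn (u l).
Proof.
move=> u0; case: (leqP M Ls) => [ML|/ltnW LM].
  rewrite (big_cat_nat (leq0n M) ML) /= lerDl; apply: sumr_ge0 => i _; exact: qsqn_ge0.
rewrite (big_cat_nat (leq0n Ls) LM) /=.
have -> : \sum_(Ls <= l < M) qsqn (u l) = 0; last by rewrite addr0.
by rewrite big_nat big1 // => l /andP[Ll _]; rewrite u0 // qsqn0.
Qed.

Lemma bs_sum J M (b : nat -> nat -> H) (v : nat -> nat -> H) m :
  \sum_(0 <= k < M - m) \sum_(0 <= j < J) qconj (b j k) * v j (m + k)%N = \sum_(0 <= j < J) bs M (b j) (v j) m.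
Proof. by rewrite exchange_big. Qed.

(** With w the column of the b_j * u and S its squared norm, S is the pairing of u with the adjoint
    applied to w. Young's inequality with weight g2 gives 2 S <= g2 |u|^2 + g2^-1 (g2 S), so one S
    is absorbed. *)
Lemma col_bound_dual (g2 : R) b : 0 < g2 -> col_bound_adj g2 b -> col_bound g2 b.
Proof.
move=> g0 hb u Ls J M u0.
pose w j m := conv (b j) u m.
set S := \sum_(0 <= j < J) _.
have SE : S = \sum_(0 <= l < M) qdot (u l) (\sum_(0 <= j < J) bs M (b j) (w j) l).
  rewrite /S; transitivity (\sum_(0 <= j < J) \sum_(0 <= l < M) qdot (u l) (bs M (b j) (w j) l)).
    by apply: eq_bigr => j _; rewrite -conv_adj; apply: eq_bigr => m _; rewrite qdotqq.
  by rewrite exchange_big /=; apply: eq_bigr => l _; rewrite qdot_sumr.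
have h1 : 2 * S <= g2 * \sum_(0 <= l < M) qsqn (u l) +
     g2^-1 * \sum_(0 <= l < M) qsqn (\sum_(0 <= j < J) bs M (b j) (w j) l).
  by rewrite SE !mulr_sumr -big_split /=; apply: ler_sum => l _; exact: qdot_le.
have h2 : \sum_(0 <= l < M) qsqn (\sum_(0 <= j < J) bs M (b j) (w j) l) <= g2 * S.
  have := hb M J w; under eq_bigr do rewrite bs_sum.
  by rewrite exchange_big.
have h3 : g2^-1 * \sum_(0 <= l < M) qsqn (\sum_(0 <= j < J) bs M (b j) (w j) l) <= S.
  by rewrite ler_pdivrMl.
have h4 : g2 * \sum_(0 <= l < M) qsqn (u l) <= g2 * \sum_(0 <= l < Ls) qsqn (u l).
  by rewrite ler_wpM2l ?(ltW g0) //; exact: sum_supp.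
by lra.
Qed.

Definition delta0 : nat -> H := fun m => if m == 0%N then 1 else 0.

Lemma conv_delta0 a m : conv a delta0 m = a m.
Proof.
rewrite /conv big_ord_recr /= subnn /delta0 eqxx mulr1 big1 ?add0r // => k _.
by rewrite subn_eq0 leqNgt ltn_ord mulr0.
Qed.

Lemma col_bound_coefs (g2 : R) b J M : col_bound g2 b ->
  \sum_(0 <= j < J) \sum_(0 <= m < M) qsqn (b j m) <= g2.
Proof.
move=> hb; have := hb delta0 1%N J M; rewrite big_nat1 /delta0 eqxx qsqn1 mulr1.
under eq_bigr do under eq_bigr do rewrite -/delta0 conv_delta0.
by apply => -[|l].
Qed.

(* M_h M_h^* <= g2 M_a M_a^* tested on polynomials; the possibly infinite
   sum on the right is expressed through its upper bounds C. *)
Definition poly_ineq (g2 : R) (a : nat -> nat -> H) (h : nat -> H) := forall N y (C : R),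
  (forall K, \sum_(0 <= j < K) \sum_(0 <= l < N) qsqn (bs N (a j) y l) <= C) ->
  \sum_(0 <= l < N) qsqn (bs N h y l) <= g2 * C.

Definition row_coefs (a : nat -> nat -> H) := forall J M,
  \sum_(0 <= j < J) \sum_(0 <= m < M) qsqn (a j m) <= 1.

Definition series_conv (a b : nat -> nat -> H) (h : nat -> H) := forall m,
  (fun J => \sum_(0 <= j < J) conv (a j) (b j) m) @ \oo --> h m.

Lemma qcvg_sum (T : Type) (F : set_system T) {FF : ProperFilter F} (n : nat) (u : nat -> T -> H) (l : nat -> H) :
  (forall i, u i @ F --> l i) ->
  (fun x => \sum_(0 <= i < n) u i x) @ F --> \sum_(0 <= i < n) l i.
Proof.
move=> h; elim: n => [|n IH].
  rewrite big_nil (_ : (fun x => _) = fun=> 0); first exact: cvg_cst.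
  by apply/funext => x; rewrite big_nil.
rewrite big_nat_recr //= (_ : (fun x => _) = fun x => \sum_(0 <= i < n) u i x + u n x).
  by apply: cvgD.
by apply/funext => x; rewrite big_nat_recr.
Qed.

Lemma rcvg_sum (T : Type) (F : set_system T) {FF : ProperFilter F} (n : nat) (u : nat -> T -> R) (l : nat -> R) :
  (forall i, u i @ F --> l i) ->
  (fun x => \sum_(0 <= i < n) u i x) @ F --> \sum_(0 <= i < n) l i.
Proof.
move=> h; elim: n => [|n IH].
  rewrite big_nil (_ : (fun x => _) = fun=> 0); first exact: cvg_cst.
  by apply/funext => x; rewrite big_nil.
rewrite big_nat_recr //= (_ : (fun x => _) = fun x => \sum_(0 <= i < n) u i x + u n x).
  by apply: cvgD.
by apply/funext => x; rewrite big_nat_recr.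
Qed.

Lemma cvg_le_near (T : Type) (F : set_system T) {FF : ProperFilter F} (u : T -> R) (l C : R) :
  u @ F --> l -> (\forall x \near F, u x <= C) -> l <= C.
Proof.
move=> ul uC; apply/ler_addgt0Pl => e e0.
move/cvgrPdist_le : ul => /(_ _ e0) h.
have [x [h1 h2]] := filter_ex (filterI h uC).
by move: h1; rewrite /= ler_norml => /andP[_]; lra.
Qed.

Lemma qdot_cvg (T : Type) (F : set_system T) {FF : ProperFilter F} (u : T -> H) (l q : H) :
  u @ F --> l -> (fun x => qdot (u x) q) @ F --> qdot l q.
Proof.
move=> ul; have h : (fun x => qconj (u x) * q) @ F --> qconj l * q.
  by apply: qcvgMr; exact: qcvg_conj.
by move: h => /qcvgP[].
Qed.

(** For x = M_h^* y, the number S = |x|^2 equals the pairing of h * x with y, a limit of sums over j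
    of the pairings of b_j * x with M_(a_j)^* y. Young's inequality with weight 1 / g2 bounds twice
    that by S + g2 C. *)
Lemma poly_ineq_of_factorization (g2 : R) (a b : nat -> nat -> H) h : 0 < g2 -> col_bound g2 b -> series_conv a b h ->
  poly_ineq g2 a h.
Proof.
move=> g0 hb hs N y C hC.
pose x l := if (l < N)%N then bs N h y l else 0.
have x0 l : (N <= l)%N -> x l = 0 by rewrite /x ltnNge => ->.
set S := \sum_(0 <= l < N) _.
have Sx : S = \sum_(0 <= l < N) qsqn (x l).
  by apply: eq_big_nat => l /andP[_ lN]; rewrite /x lN.
have SE : S = \sum_(0 <= m < N) qdot (conv h x m) (y m).
  by rewrite conv_adj; apply: eq_big_nat => l /andP[_ lN]; rewrite /x lN qdotqq.
pose s J := \sum_(0 <= m < N) qdot (conv (fun k => \sum_(0 <= j < J) conv (a j) (b j) k) x m) (y m).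
have sS : s @ \oo --> S.
  rewrite SE; apply: rcvg_sum => m; apply: qdot_cvg; rewrite conv_nat.
  under eq_fun do rewrite conv_nat.
  by apply: qcvg_sum => k; apply: qcvgMr; exact: hs.
have sle J : s J <= (S + g2 * C) / 2.
  have -> : s J = \sum_(0 <= j < J) \sum_(0 <= l < N) qdot (conv (b j) x l) (bs N (a j) y l).
    transitivity (\sum_(0 <= m < N) \sum_(0 <= j < J) qdot (conv (a j) (conv (b j) x) m) (y m)).
      apply: eq_bigr => m _; rewrite conv_suml qdot_suml; apply: eq_bigr => j _.
      by rewrite convA.
    by rewrite exchange_big /=; apply: eq_bigr => j _; rewrite conv_adj.
  rewrite ler_pdivlMr // mulrC mulr_sumr.
  have gi : 0 < g2^-1 by rewrite invr_gt0.
  apply: le_trans (_ : g2^-1 * \sum_(0 <= j < J) \sum_(0 <= l < N) qsqn (conv (b j) x l) +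
      g2 * \sum_(0 <= j < J) \sum_(0 <= l < N) qsqn (bs N (a j) y l) <= _).
    rewrite !mulr_sumr -big_split /=; apply: ler_sum => j _.
    rewrite !mulr_sumr -big_split /=; apply: ler_sum => l _.
    by have := qdot_le (conv (b j) x l) (bs N (a j) y l) gi; rewrite invrK.
  apply: lerD; last by rewrite ler_wpM2l ?(ltW g0).
  by rewrite ler_pdivrMl // Sx; exact: hb.
have : S <= (S + g2 * C) / 2 by apply: (cvg_le_near sS); apply: nearW.
by rewrite ler_pdivlMr //; lra.
Qed.

End Conv.

(** * Approximate solutions from perturbed finite sections *)

Section LeechLimit.
Context {R : realType}.
Local Notation H := (quat R).

Definition ext N (u : 'cV[H]_N) (m : nat) : H := if insub m is Some i then u i 0 else 0.

Lemma extE N (u : 'cV[H]_N) (i : 'I_N) : ext u i = u i 0.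
Proof. by rewrite /ext; case: insubP => [j _ e|]; [congr (u _ 0); exact/val_inj|rewrite ltn_ord]. Qed.

Lemma toep_bs N (a : nat -> H) (u : 'cV[H]_N) (l : 'I_N) :
  (adj (toep N a) *m u) l 0 = bs N a (ext u) l.
Proof.
rewrite mxE; transitivity (\sum_(0 <= m < N) if (l <= m)%N then qconj (a (m - l)%N) * ext u m else 0).
  rewrite big_mkord; apply: eq_bigr => m _; rewrite !mxE extE; case: leqP => _ //.
  by rewrite qconj0 mul0r.
rewrite (big_cat_nat (leq0n l) (ltnW (ltn_ord l))) /=.
have -> : \sum_(0 <= m < l) (if (l <= m)%N then qconj (a (m - l)%N) * ext u m else 0) = 0.
  by rewrite big_nat big1 // => m /andP[_ ml]; rewrite leqNgt ml.
rewrite add0r -{1}[l : nat]add0n big_addn /bs; apply: eq_bigr => k _.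
by rewrite leq_addl addnK addnC.
Qed.

Lemma qf_toep N (a : nat -> H) (u : 'cV[H]_N) :
  qf (toep N a *m adj (toep N a)) u = \sum_(0 <= l < N) qsqn (bs N a (ext u) l).
Proof.
rewrite /qf mulmxA -mulmxA mxE qre_sum big_mkord; apply: eq_bigr => l _.
rewrite -toep_bs -qdotqq /qdot; congr (qre (_ * _)).
have := adjM (adj (toep N a)) u; rewrite adjK => <-.
by rewrite mxE.
Qed.

Lemma bs_CS N (a y : nat -> H) l :
  qsqn (bs N a y l) <= (\sum_(0 <= k < N) qsqn (a k)) * (\sum_(0 <= k < N) qsqn (y k)).
Proof.
apply: le_trans (qsqn_CS _ _ _ _) _.
apply: ler_pM; try by apply: sumr_ge0 => i _; exact: qsqn_ge0.
  under eq_bigr do rewrite qsqn_conj.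
  rewrite [leRHS](big_cat_nat (leq0n _) (leq_subr l N)) /= lerDl.
  by apply: sumr_ge0 => i _; exact: qsqn_ge0.
case: (leqP l N) => [lN|Nl]; last first.
  rewrite big_geq; first by apply: sumr_ge0 => i _; exact: qsqn_ge0.
  by rewrite leqn0 subn_eq0 ltnW.
have -> : \sum_(0 <= k < N - l) qsqn (y (l + k)%N) = \sum_(l <= k < N) qsqn (y k).
  by rewrite -{3}[l]add0n big_addn; apply: eq_bigr => k _; rewrite addnC.
rewrite [leRHS](big_cat_nat (leq0n l) lN) /= lerDr.
by apply: sumr_ge0 => i _; exact: qsqn_ge0.
Qed.

Lemma tail_small (s : nat -> R) (B : R) : (forall K, 0 <= s K) ->
  (forall K, \sum_(0 <= j < K) s j <= B) ->
  forall d, 0 < d -> exists K0, forall J K, (K0 <= J)%N -> \sum_(J <= j < K) s j <= d.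
Proof.
move=> s0 sB d d0.
pose A := range (fun K => \sum_(0 <= j < K) s j).
have hs : has_sup A by split; [exists (\sum_(0 <= j < 0) s j); exists 0%N|exists B => _ [K _ <-]].
have [_ [K0 _ <-] hK0] := sup_adherent d0 hs.
exists K0 => J K KJ; case: (leqP J K) => [JK|/ltnW KJ']; last by rewrite big_geq ?ltW.
have : \sum_(0 <= j < K) s j <= sup A by apply: sup_upper_bound => //; exists K.
have k1 : \sum_(0 <= j < K0) s j <= \sum_(0 <= j < J) s j.
  by rewrite [leRHS](big_cat_nat (leq0n _) KJ) /= lerDl; apply: sumr_ge0.
rewrite (big_cat_nat (leq0n _) JK) /=; lra.
Qed.

Lemma conv_rev (a u : nat -> H) m : conv a u m = \sum_(0 <= k < m.+1) a (m - k)%N * u k.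
Proof.
rewrite conv_nat big_nat_rev /=; apply: eq_big_nat => k /andP[_ km].
by rewrite ?add0n subSS subKn.
Qed.

Lemma sum_swap_bound (V : nmodType) (f : nat -> V) J K :
  \sum_(0 <= j < J) (if (j < K)%N then f j else 0) = \sum_(0 <= j < K) (if (j < J)%N then f j else 0).
Proof.
rewrite -!big_mkcond /=.
rewrite (big_nat_widen 0 J (maxn J K)) ?leq_maxl // (big_nat_widen 0 K (maxn J K)) ?leq_maxr //.
by apply: eq_bigl => j; rewrite andbC.
Qed.

(** The additional column sqrt(e) * delta0, at index K, adds e times the identity to the gap. It
    dominates the neglected columns j >= K and makes the gap definite. In the equation it costs one
    term of the form sqrt(e) * [S K m], whose square is at most e because [S] is contractive. *)
Lemma leech_approx (a : nat -> nat -> H) (h : nat -> H) (gamma : R) :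
  0 < gamma -> row_coefs a -> poly_ineq (gamma ^+ 2) a h -> forall N (e : R), 0 < e ->
  exists K (g : nat -> nat -> H), [/\ col_bound (gamma ^+ 2) g, (forall j k, (K <= j)%N -> g j k = 0)
   & forall m, (m < N)%N -> qsqn (h m - \sum_(0 <= j < K) conv (a j) (g j) m) <= e].
Proof.
move=> g0 ra hp N e e0.
have g20 : 0 < gamma ^+ 2 by rewrite exprn_gt0.
(* Chosen so that gamma^2 * N * (e / c) < e: the tail of the a_j, estimated on each of the N
   coefficients, stays below the perturbation. *)
pose c := gamma ^+ 2 * N%:R + 1.
have c0 : 0 < c by rewrite ltr_wpDl // mulr_ge0 // ltW.
pose s j := \sum_(0 <= m < N) qsqn (a j m).
have s0 j : 0 <= s j by apply: sumr_ge0 => m _; exact: qsqn_ge0.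
have [K hK] := tail_small s0 (fun K => ra K N) (divr_gt0 e0 c0).
pose t := Num.sqrt e.
have t2 : t ^+ 2 = e by rewrite sqr_sqrtr // ltW.
pose F j k : H := if (j < K)%N then gamma *: a j k else t *: delta0 k.
have bsZ (x : R) (b y : nat -> H) l : bs N (fun k => x *: b k) y l = x *: bs N b y l.
  rewrite /bs scaler_sumr; apply: eq_bigr => k _; by rewrite qconjZ scalerAl.
have bsd (y : nat -> H) l : (l < N)%N -> bs N delta0 y l = y l.
  move=> lN; rewrite /bs -(subnSK lN) big_nat_recl // /delta0 /= qconj1 mul1r addn0 big1 ?addr0 // => i _.
  by rewrite qconj0 mul0r.
have gp (u : 'cV[H]_N) : u != 0 -> 0 < qf (gap N K.+1 F h) u.
  move=> u0; pose y := ext u; pose U := \sum_(0 <= k < N) qsqn (y k).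
  have U0 : 0 < U.
    rewrite lt0r; apply/andP; split; last by apply: sumr_ge0 => i _; exact: qsqn_ge0.
    apply: contra u0 => /eqP U00; apply/eqP/matrixP => i j; rewrite ord1 mxE.
    apply/eqP; rewrite -qsqn_eq0 -extE; move: U00; rewrite /U big_mkord => /eqP.
    rewrite psumr_eq0 => [/allP/(_ i (mem_index_enum _))/=|k _]; last exact: qsqn_ge0.
    by [].
  have gE : qf (gap N K.+1 F h) u = gamma ^+ 2 * \sum_(0 <= j < K) \sum_(0 <= l < N) qsqn (bs N (a j) y l)
      + e * U - \sum_(0 <= l < N) qsqn (bs N h y l).
    rewrite /gap /qf mulmxBr mulmxBl mulmx_sumr mulmx_suml -[qre _]/(re00 _) re00D re00N re00_sum.
    rewrite -![re00 _]/(qf _ _) qf_toep; congr (_ - _).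
    transitivity (\sum_(0 <= j < K.+1) qf (toep N (F j) *m adj (toep N (F j))) u); first by [].
    rewrite big_nat_recr //=; congr (_ + _).
      rewrite mulr_sumr; apply: eq_big_nat => j /andP[_ jK]; rewrite qf_toep mulr_sumr.
      apply: eq_bigr => l _; rewrite -qsqnZ -bsZ; congr qsqn; apply: eq_bigr => k _.
      by rewrite /F jK.
    rewrite qf_toep mulr_sumr; apply: eq_big_nat => l /andP[_ lN].
    rewrite -t2 -qsqnZ -[y l in RHS](bsd y l lN) -bsZ; congr qsqn; apply: eq_bigr => k _.
    by rewrite /F ltnn.
  rewrite gE; pose C := \sum_(0 <= j < K) \sum_(0 <= l < N) qsqn (bs N (a j) y l) + N%:R * (e / c) * U.
  have hC : \sum_(0 <= l < N) qsqn (bs N h y l) <= gamma ^+ 2 * C.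
    apply: hp => K'.
    have nn j : 0 <= \sum_(0 <= l < N) qsqn (bs N (a j) y l) by apply: sumr_ge0 => l _; exact: qsqn_ge0.
    have tl : \sum_(K <= j < K') \sum_(0 <= l < N) qsqn (bs N (a j) y l) <= N%:R * (e / c) * U.
      apply: le_trans (_ : \sum_(K <= j < K') N%:R * (s j * U) <= _).
        apply: ler_sum => j _; apply: le_trans (_ : \sum_(0 <= l < N) (s j * U) <= _).
          by apply: ler_sum => l _; exact: bs_CS.
        by rewrite sumr_const_nat subn0 mulr_natl.
      rewrite -mulr_sumr -mulr_suml mulrA ler_wpM2r ?(ltW U0) // ler_wpM2l //.
      exact: hK.
    case: (leqP K K') => [KK|/ltnW KK].
      by rewrite (big_cat_nat (leq0n K) KK) /=; apply: lerD.
    rewrite /C (big_cat_nat (leq0n K') KK) /= -addrA lerDl addr_ge0 ?sumr_ge0 //.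
    apply: mulr_ge0; last exact: ltW U0.
    by apply: mulr_ge0 => //; apply: divr_ge0; exact: ltW.
  have : gamma ^+ 2 * (N%:R * (e / c) * U) < e * U.
    rewrite !mulrA ltr_pM2r // (_ : _ * _ * _ * _ = e * (gamma ^+ 2 * N%:R / c)); last by ring.
    by rewrite -[ltRHS]mulr1 ltr_pM2l // ltr_pdivrMr // mul1r /c ltrDl.
  by move: hC; rewrite /C mulrDr; lra.
pose S j k := if (j < K.+1)%N then sol gp j k else 0.
have Scol : col_bound 1 S.
  apply: col_bound_dual => // M J v; rewrite mul1r.
  have := sol_contractive gp M (fun j m => if (j < J)%N then v j m else 0).
  have -> : \sum_(0 <= m < M) qsqn (\sum_(0 <= k < M - m) \sum_(0 <= j < K.+1) qconj (sol gp j k) * (if (j < J)%N then v j (m + k)%N else 0)) =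
    \sum_(0 <= m < M) qsqn (\sum_(0 <= k < M - m) \sum_(0 <= j < J) qconj (S j k) * v j (m + k)%N).
    apply: eq_bigr => m _; congr qsqn; apply: eq_bigr => k _.
    transitivity (\sum_(0 <= j < K.+1) (if (j < J)%N then qconj (sol gp j k) * v j (m + k)%N else 0)).
      by apply: eq_bigr => j _; case: ifP => _ //; rewrite mulr0.
    rewrite sum_swap_bound; apply: eq_bigr => j _; rewrite /S; case: ifP => _ //.
    by rewrite qconj0 mul0r.
  move=> /le_trans; apply; apply: ler_sum => m _.
  rewrite (_ : \sum_(0 <= j < K.+1) _ = \sum_(0 <= j < K.+1) (if (j < J)%N then qsqn (v j m) else 0)); last first.
    by apply: eq_bigr => j _; case: ifP => _ //; rewrite qsqn0.
  rewrite sum_swap_bound; apply: ler_sum => j _; case: ifP => _ //; exact: qsqn_ge0.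
pose g j k := if (j < K)%N then gamma *: S j k else 0.
exists K, g; split=> [u Ls J M u0|j k Kj|m mN].
- apply: le_trans (_ : gamma ^+ 2 * \sum_(0 <= j < J) \sum_(0 <= m < M) qsqn (conv (S j) u m) <= _).
    rewrite mulr_sumr; apply: ler_sum => j _; rewrite mulr_sumr; apply: ler_sum => m _.
    rewrite -qsqnZ /conv /g; case: ltnP => _.
      by rewrite scaler_sumr le_eqVlt; apply/orP; left; apply/eqP; congr qsqn; apply: eq_bigr => k _; rewrite scalerAl.
    rewrite big1 ?qsqn0 ?qsqn_ge0 // => k _; by rewrite mul0r.
  by rewrite ler_wpM2l ?(ltW g20) //; have := Scol u Ls J M u0; rewrite mul1r.
- by rewrite /g ltnNge Kj.
have := sol_eq gp mN; rewrite big_nat_recr //= => ->.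
have -> : \sum_(0 <= i < K) \sum_(0 <= k < m.+1) F i (m - k)%N * sol gp i k = \sum_(0 <= j < K) conv (a j) (g j) m.
  apply: eq_big_nat => j /andP[_ jK]; rewrite conv_rev; apply: eq_bigr => k _.
  by rewrite /F /g /S jK ltnS ltnW // -scalerAl scalerAr.
rewrite addrC addrK.
have -> : \sum_(0 <= k < m.+1) F K (m - k)%N * sol gp K k = t *: S K m.
  rewrite /F ltnn big_nat_recr //= subnn big_nat big1 ?add0r => [|k /andP[_ km]].
    by rewrite /delta0 eqxx -scalerAl mul1r /S ltnSn.
  by rewrite /delta0 subn_eq0 leqNgt km /= scaler0 mul0r.
rewrite qsqnZ t2 -[leRHS]mulr1 ler_wpM2l ?(ltW e0) //.
apply: le_trans (col_bound_coefs K.+1 m.+1 Scol).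
rewrite big_nat_recr //= [X in _ + X]big_nat_recr //= addrA lerDr.
by apply: addr_ge0; do ?[apply: sumr_ge0 => ? _]; exact: qsqn_ge0.
Qed.

End LeechLimit.

(** * Removal of the truncation *)

Section Limit.
Context {R : realType}.
Local Notation H := (quat R).

Lemma ultra_bounded_real (U : set_system nat) (x : nat -> R) (B : R) : UltraFilter U ->
  (forall n, `|x n| <= B) -> exists l : R, x @ U --> l.
Proof.
move=> UU xB; have PU : ProperFilter U by exact: ultra_proper.
have : (x @ U) `[- B, B]%classic.
  apply: (@filterS _ U _ setT); last exact: filterT.
  move=> n _ /=.
  by have := xB n; rewrite in_itv /= ler_norml.
move=> /(@segment_compact R (- B) B (x @ U) _)[l [_ cl]]; exists l.
move=> V nV; have [//|UnV] := in_ultra_setVsetC (x @^-1` V) UU.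
have [y [Vy nVy]] : (~` V) `&` V !=set0 by apply: cl.
by [].
Qed.

Lemma ultra_bounded (U : set_system nat) (x : nat -> H) (B : R) : UltraFilter U ->
  (forall n, `|x n| <= B) -> exists l : H, x @ U --> l.
Proof.
move=> UU xB; have PU : ProperFilter U by exact: ultra_proper.
have k (c : H -> R) : (forall q, `|c q| <= `|q|) -> exists l : R, (fun n => c (x n)) @ U --> l.
  by move=> cle; apply: (@ultra_bounded_real _ _ B) => // n; apply: le_trans (cle _) (xB n).
have [l0 h0] := k _ qre_le; have [l1 h1] := k _ qi_le.
have [l2 h2] := k _ qj_le; have [l3 h3] := k _ qk_le.
by exists (Quat l0 l1 l2 l3); apply/qcvgP.
Qed.

Lemma conv_cvg (U : set_system nat) {PU : ProperFilter U} (a : nat -> H) (g : nat -> nat -> H) (b : nat -> H) m :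
  (forall k, (fun n => g n k) @ U --> b k) -> (fun n => conv a (g n) m) @ U --> conv a b m.
Proof.
move=> gb; rewrite conv_nat; under eq_fun do rewrite conv_nat.
by apply: qcvg_sum => k; apply: qcvgMl; exact: gb.
Qed.
Lemma conv_cvg_l (U : set_system nat) {PU : ProperFilter U} (u : nat -> H) (g : nat -> nat -> H) (b : nat -> H) m :
  (forall k, (fun n => g n k) @ U --> b k) -> (fun n => conv (g n) u m) @ U --> conv b u m.
Proof.
move=> gb; rewrite conv_nat; under eq_fun do rewrite conv_nat.
by apply: qcvg_sum => k; apply: qcvgMr; exact: gb.
Qed.

Lemma conv_tail (a g : nat -> nat -> H) m J K (d c : R) : 0 <= d ->
  \sum_(J <= j < K) \sum_(0 <= k < m.+1) qsqn (a j k) <= d ->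
  \sum_(J <= j < K) \sum_(0 <= k < m.+1) qsqn (g j k) <= c ->
  qsqn (\sum_(J <= j < K) conv (a j) (g j) m) <= d * c.
Proof.
move=> d0 ad gc.
have S0 (x : nat -> nat -> H) : 0 <= \sum_(J <= j < K) \sum_(0 <= k < m.+1) qsqn (x j k).
  by apply: sumr_ge0 => j _; apply: sumr_ge0 => k _; exact: qsqn_ge0.
apply: le_trans (_ : (\sum_(J <= j < K) \sum_(0 <= k < m.+1) qsqn (a j k)) *
   (\sum_(J <= j < K) \sum_(0 <= k < m.+1) qsqn (g j k)) <= _); last exact: ler_pM.
(* Euclidean division flattens the pairs (j, k) to a single index, to which the Cauchy-Schwarz
   inequality applies. *)
pose p i := a (J + i %/ m.+1)%N (i %% m.+1)%N.
pose q i := g (J + i %/ m.+1)%N (m - i %% m.+1)%N.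
have flat (V : nmodType) (f : nat -> nat -> V) :
   \sum_(J <= j < K) \sum_(0 <= k < m.+1) f j k = \sum_(0 <= i < (K - J) * m.+1) f (J + i %/ m.+1)%N (i %% m.+1)%N.
  rewrite -{1}[J]add0n big_addn; elim: (K - J)%N => [|n IH]; first by rewrite mul0n !big_geq.
  rewrite big_nat_recr //= IH mulSn (addnC m.+1) (big_cat_nat (leq0n (n * m.+1)%N) (leq_addr _ _)) /=.
  have -> : \sum_(n * m.+1 <= i < n * m.+1 + m.+1) f (J + i %/ m.+1)%N (i %% m.+1)%N =
      \sum_(0 <= k < m.+1) f (J + (k + n * m.+1) %/ m.+1)%N ((k + n * m.+1) %% m.+1)%N.
    by rewrite -{1}[(n * m.+1)%N]add0n big_addn addKn.
  congr (_ + _); apply: eq_big_nat => k /andP[_ km].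
  by rewrite [(k + _)%N]addnC divnMDl // modnMDl divn_small // modn_small // addn0 addnC.
have -> : \sum_(J <= j < K) conv (a j) (g j) m = \sum_(0 <= i < (K - J) * m.+1) p i * q i.
  transitivity (\sum_(J <= j < K) \sum_(0 <= k < m.+1) a j k * g j (m - k)%N).
    by apply: eq_bigr => j _; rewrite conv_nat.
  by rewrite flat.
apply: le_trans (qsqn_CS _ _ _ _) _.
rewrite -(flat _ (fun j k => qsqn (a j k))) -(flat _ (fun j k => qsqn (g j (m - k)%N))).
rewrite le_eqVlt; apply/orP; left; apply/eqP; congr (_ * _); apply: eq_bigr => j _.
by rewrite [RHS]big_nat_rev /=; apply: eq_big_nat => k _; rewrite ?add0n subSS.
Qed.

Lemma leq_sum_tail (s : nat -> R) J K : (forall j, 0 <= s j) ->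
  \sum_(J <= j < K) s j <= \sum_(0 <= j < K) s j.
Proof.
move=> s0; case: (leqP J K) => [JK|/ltnW KJ]; last by rewrite big_geq // sumr_ge0.
by rewrite [leRHS](big_cat_nat (leq0n _) JK) /= lerDr sumr_ge0.
Qed.

(** An ultrafilter finer than the tails gives limits to all bounded sequences [g n j k] at once,
    without diagonal extraction. The column bound involves finitely many coefficients and passes to
    the limit; the equation passes because [conv_tail] bounds the terms j >= J uniformly in n. *)
Lemma factorization_of_poly_ineq (a : nat -> nat -> H) (h : nat -> H) (gamma : R) :
  0 < gamma -> row_coefs a -> poly_ineq (gamma ^+ 2) a h ->
  exists b, col_bound (gamma ^+ 2) b /\ series_conv a b h.
Proof.
move=> g0 ra hp; have g20 : 0 < gamma ^+ 2 by rewrite exprn_gt0.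
have ap n := leech_approx g0 ra hp n (e := (n.+1%:R)^-1) ltac:(by rewrite invr_gt0).
pose KK n := sval (cid (ap n)).
pose g n := sval (cid (svalP (cid (ap n)))).
have [gcol g00 gapx] : [/\ forall n, col_bound (gamma ^+ 2) (g n),
   forall n j k, (KK n <= j)%N -> g n j k = 0 &
   forall n m, (m < n)%N -> qsqn (h m - \sum_(0 <= j < KK n) conv (a j) (g n j) m) <= n.+1%:R^-1].
  by split=> n; have [] := svalP (cid (svalP (cid (ap n)))).
have gle n j k : `|g n j k| <= gamma.
  rewrite -(@ler_pXn2r _ 2) ?nnegrE ?(ltW g0) // normq2.
  apply: le_trans (col_bound_coefs j.+1 k.+1 (gcol n)).
  rewrite big_nat_recr //= [X in _ + X]big_nat_recr //= addrA lerDr.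
  by apply: addr_ge0; do ?[apply: sumr_ge0 => ? _]; exact: qsqn_ge0.
have [U [UU sU]] := @ultraFilterLemma nat \oo _.
have PU : ProperFilter U by exact: ultra_proper.
have lim j k : exists l : H, (fun n => g n j k) @ U --> l.
  by apply: (@ultra_bounded U _ gamma) => // n; exact: gle.
pose b j k := sval (cid (lim j k)).
have bl j k : (fun n => g n j k) @ U --> b j k by exact: svalP (cid (lim j k)).
exists b; split=> [u Ls J M u0|m].
  have cv : (fun n => \sum_(0 <= j < J) \sum_(0 <= m < M) qsqn (conv (g n j) u m)) @ U -->
     \sum_(0 <= j < J) \sum_(0 <= m < M) qsqn (conv (b j) u m).
    by apply: rcvg_sum => j; apply: rcvg_sum => m; apply: qcvg_qsqn; apply: conv_cvg_l => k; exact: bl.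
  by apply: (cvg_le_near cv); apply: nearW => n; exact: gcol.
pose s j := \sum_(0 <= k < m.+1) qsqn (a j k).
have s0 j : 0 <= s j by apply: sumr_ge0 => k _; exact: qsqn_ge0.
have key d : 0 < d -> exists J0, forall J, (J0 <= J)%N ->
    qsqn (h m - \sum_(0 <= j < J) conv (a j) (b j) m) <= 4 * d.
  move=> d0; have [J0 hJ0] := tail_small s0 (fun K => ra K m.+1) (divr_gt0 d0 g20).
  exists J0 => J J0J.
  have cv : (fun n => qsqn (h m - \sum_(0 <= j < J) conv (a j) (g n j) m)) @ U -->
     qsqn (h m - \sum_(0 <= j < J) conv (a j) (b j) m).
    apply: qcvg_qsqn; apply: cvgB; first exact: cvg_cst.
    by apply: qcvg_sum => j; apply: conv_cvg => k; exact: bl.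
  apply: (cvg_le_near cv); apply: sU.
  near=> n.
  have mn : (m < n)%N by near: n; exact: nbhs_infty_gt.
  have nd : n.+1%:R^-1 <= d.
    near: n; have /cvgrPdist_le /(_ _ d0) := @cvg_harmonic R; apply: filterS => n.
    by rewrite sub0r normrN ger0_norm //= invr_ge0.
  (* X is the error of the n-th approximate solution and Y its part beyond J. The [maxn] covers KK n
     < J, since [g n j] vanishes from KK n on. *)
  pose X := h m - \sum_(0 <= j < KK n) conv (a j) (g n j) m.
  pose Y := \sum_(J <= j < maxn J (KK n)) conv (a j) (g n j) m.
  have -> : h m - \sum_(0 <= j < J) conv (a j) (g n j) m = X + Y.
    have e : \sum_(0 <= j < maxn J (KK n)) conv (a j) (g n j) m = \sum_(0 <= j < KK n) conv (a j) (g n j) m.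
      rewrite (big_cat_nat (leq0n _) (leq_maxr J (KK n))) /=.
      have -> : \sum_(KK n <= j < maxn J (KK n)) conv (a j) (g n j) m = 0; last by rewrite addr0.
      rewrite big_nat big1 // => j /andP[Kj _].
      by rewrite conv_nat big1 // => k _; rewrite g00 // mulr0.
    rewrite /X -e (big_cat_nat (leq0n J) (leq_maxl J (KK n))) /= opprD addrA subrK.
    by [].
  have hX : qsqn X <= d by apply: le_trans (gapx n m mn) nd.
  have hY : qsqn Y <= d.
    have -> : d = (d / gamma ^+ 2) * gamma ^+ 2 by rewrite divfK // gt_eqF.
    apply: conv_tail; [by rewrite divr_ge0 // ltW|exact: hJ0|].
    apply: le_trans (leq_sum_tail _ _ _) (col_bound_coefs _ _ (gcol n)) => j.
    by apply: sumr_ge0 => k _; exact: qsqn_ge0.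
  by apply: le_trans (qsqnD_le _ _) _; lra.
apply/cvgrPdist_le => e e0; have d0 : 0 < (e / 2) ^+ 2 by rewrite exprn_gt0 // divr_gt0.
have [J0 hJ0] := key _ d0; exists J0 => // J /= J0J.
rewrite -(@ler_pXn2r _ 2) ?nnegrE ?(ltW e0) // normq2; apply: le_trans (hJ0 J J0J) _.
by rewrite le_eqVlt; apply/orP; left; apply/eqP; field.
Unshelve. all: by end_near. Qed.

End Limit.

(** * Bounds for row multipliers *)

Section RowBound.
Context {R : realType}.
Local Notation H := (quat R).
Implicit Types (q z : H) (u y : nat -> H).

Lemma qpseriesS (a : nat -> H) q n : qpseries a q n.+1 = qpseries a q n + q ^+ n * a n.
Proof. by rewrite /qpseries /series /= big_nat_recr. Qed.

Lemma has_ps_mono (f : H -> H) (a : nat -> H) l (c : H) : has_ps f a ->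
  has_ps (fun q => q ^+ l * f q * c) (fun m => if (l <= m)%N then a (m - l)%N * c else 0).
Proof.
move=> hf q qb; rewrite -(cvg_shiftn l).
have -> : (fun n => qpseries (fun m => if (l <= m)%N then a (m - l)%N * c else 0) q (n + l)%N) =
    fun n => q ^+ l * qpseries a q n * c.
  apply/funext => n; elim: n => [|n IH].
    rewrite add0n /qpseries /series /= big_nil mulr0 mul0r big_nat big1 // => i /andP[_ il].
    by rewrite leqNgt il mulr0.
  rewrite addSn !qpseriesS IH leq_addl addnK mulrDr mulrDl; congr (_ + _).
  by rewrite addnC exprD !mulrA.
by apply: qcvgMr; apply: qcvgMl; exact: hf.
Qed.

(** When the second factor is a polynomial the star product has a pointwise form: the powers of q
    move to the left of f q. *)
Lemma has_ps_conv_fin (f : H -> H) (a u : nat -> H) Ls : has_ps f a ->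
  (forall l, (Ls <= l)%N -> u l = 0) ->
  has_ps (fun q => \sum_(0 <= l < Ls) q ^+ l * f q * u l) (conv a u).
Proof.
move=> hf u0.
have -> : conv a u = fun m => \sum_(0 <= l < Ls) (if (l <= m)%N then a (m - l)%N * u l else 0).
  apply/funext => m; rewrite conv_nat big_nat_rev /=.
  transitivity (\sum_(0 <= k < m.+1) (if (k < Ls)%N then a (m - k)%N * u k else 0)).
    apply: eq_big_nat => k /andP[_ km]; rewrite ?add0n subSS subKn -1?ltnS //.
    by case: ltnP => // kL; rewrite u0 // mulr0.
  by rewrite sum_swap_bound.
elim: Ls {u0} => [|Ls IH] q qb.
  rewrite (_ : (fun m => _) = fun=> 0); last by apply/funext => m; rewrite big_nil.
  by rewrite big_nil; exact: has_ps0.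
rewrite (_ : (fun m => _) = fun m => \sum_(0 <= l < Ls) (if (l <= m)%N then a (m - l)%N * u l else 0) +
   (if (Ls <= m)%N then a (m - Ls)%N * u Ls else 0)); last by apply/funext => m; rewrite big_nat_recr.
rewrite big_nat_recr //=.
have h2 := has_ps_mono (l := Ls) (c := u Ls) hf.
have h1 : has_ps (fun q => \sum_(0 <= l < Ls) q ^+ l * f q * u l) _ := IH.
exact: (has_psD h1 h2) qb.
Qed.

Section Split.
Variable I : H.
Hypothesis hI : imag_unit I.

(** The component of q commuting with I, that is its projection to C_I; [npart] is the complementary
    component, anticommuting with I. *)
Definition ppart q : H := 2^-1 *: (q - I * q * I).
Definition npart q : H := 2^-1 *: (q + I * q * I).

Lemma pn_split q : q = ppart q + npart q.
Proof.
by rewrite /ppart /npart; apply: quatP => /=; field.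
Qed.

Lemma II q : I * (I * q) = - q.
Proof. by rewrite mulrA hI mulN1r. Qed.
Lemma qII q : q * I * I = - q.
Proof. by rewrite -mulrA hI mulrN1. Qed.

Lemma ppart_comm q : I * ppart q = ppart q * I.
Proof.
rewrite /ppart -scalerAr -scalerAl mulrBr mulrBl; congr (_ *: _).
by rewrite -[I * q * I]mulrA II mulrA qII !opprK addrC.
Qed.
Lemma npart_acomm q : I * npart q = - (npart q * I).
Proof.
rewrite /npart -scalerAr -scalerAl mulrDr mulrDl -scalerN; congr (_ *: _).
by rewrite -[I * q * I]mulrA II mulrA qII opprD opprK addrC.
Qed.

Lemma cI_ppart z q : cI I z -> z * ppart q = ppart q * z.
Proof. by move=> cz; apply: (cI_comm hI) => //; exact: ppart_comm. Qed.

Lemma cI_npart z q : cI I z -> z * npart q = npart q * qconj z.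
Proof.
move=> cz; have := npart_acomm q; move: (npart q) => n nE.
rewrite (ciE hI cz) ci_conj // /slice_point mulrDl mulrDr -!scalerAl -!scalerAr mul1r mulr1.
by rewrite nE scalerN scaleNr.
Qed.

Lemma qsqn_split q : qsqn (ppart q) + qsqn (npart q) = qsqn q.
Proof.
rewrite /ppart /npart !qsqnZ qsqnB qsqnD !qsqnM (qsqnI hI) mul1r mulr1.
by field.
Qed.

(** Powers of z pass the commuting part of f unchanged and the anticommuting part conjugated, so the
    polynomial is evaluated at z and at its conjugate. *)
Lemma slice_poly_split (f q : H) z u Ls : cI I z ->
  \sum_(0 <= l < Ls) z ^+ l * f * u l =
  ppart f * (\sum_(0 <= l < Ls) z ^+ l * u l) + npart f * (\sum_(0 <= l < Ls) qconj z ^+ l * u l).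
Proof.
move=> cz; rewrite !mulr_sumr -big_split /=; apply: eq_bigr => l _.
rewrite {1}(pn_split f) mulrDr mulrDl !mulrA (cI_ppart _ (cI_X l cz)).
by rewrite (cI_npart _ (cI_X l cz)) qconjX.
Qed.

End Split.

Lemma sum_double J (V : nmodType) (s t : nat -> V) : \sum_(0 <= j < J) (s j + t j) =
    \sum_(0 <= j < J + J) (if (j < J)%N then s j else t (j - J)%N).
Proof.
rewrite (big_cat_nat (leq0n J) (leq_addr J J)) /= big_split /=; congr (_ + _).
  by apply: eq_big_nat => j /andP[_ ->].
rewrite -[X in index_iota X (J + J)]add0n big_addn addnK; apply: eq_bigr => j _.
by rewrite ltnNge leq_addl /= addnK.
Qed.

Lemma qsqn_CS2 (p q p' q' : nat -> H) J :
  qsqn (\sum_(0 <= j < J) (p j * q j + p' j * q' j)) <=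
  (\sum_(0 <= j < J) (qsqn (p j) + qsqn (p' j))) * (\sum_(0 <= j < J) (qsqn (q j) + qsqn (q' j))).
Proof.
pose P j := if (j < J)%N then p j else p' (j - J)%N.
pose Q j := if (j < J)%N then q j else q' (j - J)%N.
have := qsqn_CS P Q 0 (J + J).
rewrite !(sum_double J); congr (qsqn _ <= _ * _); apply: eq_bigr => j _; rewrite /P /Q; by case: ifP.
Qed.

Lemma circle_conj (I : H) r t : imag_unit I -> qconj (r *: slice_cis I t) = r *: slice_cis (- I) t.
Proof.
by move=> hI; rewrite qconjZ /slice_cis ci_conj // /slice_point scaleNr scalerN.
Qed.

Definition regular_rows (L : nat) (f : nat -> H -> H) (B : R) (I : H) :=
  (forall j, (j < L)%N -> slice_regular (f j)) /\
  forall q, qball q -> cI I q -> \sum_(0 <= j < L) qsqn (f j q) <= B.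

Lemma cis_in_ball (I : H) r t : imag_unit I -> 0 < r < 1 -> qball (r *: slice_cis I t) /\ cI I (r *: slice_cis I t).
Proof.
move=> hI /andP[r0 r1]; split; last exact/cI_Z/cI_cis.
by apply: cis_ball => //; rewrite (ltW r0).
Qed.

Lemma row_coefs_le (I : H) J f (B : R) M : imag_unit I -> 0 <= B -> regular_rows J f B I ->
  \sum_(0 <= j < J) \sum_(0 <= m < M) qsqn (coefs (f j) m) <= B.
Proof.
move=> hI B0 [hf hB].
have := @comparison R I J 1 1 M f (fun=> I) (fun _ _ => (Num.sqrt B)%:A) hI hf (fun=> hI).
rewrite !big_nat1 qsqnZ qsqn1 mulr1 sqr_sqrtr //; apply => r t r01.
rewrite !big_nat1 expr0 mul1r qsqnZ qsqn1 mulr1 sqr_sqrtr //.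
by have [b c] := cis_in_ball t hI r01; exact: hB.
Qed.

(** After the splitting, Cauchy-Schwarz uses the weights [ppart] and [npart] of f_j, whose squares
    add up to |f_j|^2 and hence to at most B. The values of the polynomials at z and at conj z have
    the same mean square, which explains the 2. *)
Lemma row_bound (I : H) J f (B : R) M (u : nat -> nat -> H) : imag_unit I -> 0 <= B ->
  regular_rows J f B I -> (forall j, (j < J)%N -> bseq (coefs (f j))) ->
  \sum_(0 <= m < M) qsqn (\sum_(0 <= j < J) conv (coefs (f j)) (u j) m) <=
  2 * B * \sum_(0 <= j < J) \sum_(0 <= l < M) qsqn (u j l).
Proof.
move=> hI B0 [hf hB] bf.
(* The first M coefficients of the products only see these, and polynomials are needed for pointwise
   evaluation. *)
pose v j l := if (l < M)%N then u j l else 0.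
have v0 j l : (M <= l)%N -> v j l = 0 by rewrite /v ltnNge => ->.
pose c m := \sum_(0 <= j < J) conv (coefs (f j)) (v j) m.
have -> : \sum_(0 <= m < M) qsqn (\sum_(0 <= j < J) conv (coefs (f j)) (u j) m) = \sum_(0 <= m < M) qsqn (c m).
  apply: eq_big_nat => m /andP[_ mM]; congr qsqn; apply: eq_bigr => j _.
  by rewrite !conv_nat; apply: eq_bigr => k _; rewrite /v (leq_ltn_trans (leq_subr _ _) mM).
have bc : bseq c.
  have [D hD] : exists D : R, forall j m, (j < J)%N -> `|coefs (f j) m| <= D.
    elim: J {hf hB c} bf => [|J IH] bf; first by exists 0.
    have [|D hD] := IH; first by move=> j jJ; apply: bf; rewrite ltnS ltnW.
    have [D' hD'] := bf J (ltnSn J); exists (Num.max D D') => j m.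
    rewrite ltnS leq_eqVlt le_max => /predU1P[->|jJ]; apply/orP; [right; exact: hD'|left; exact: hD].
  exists (\sum_(0 <= j < J) \sum_(0 <= l < M) D * `|v j l|) => m.
  apply: le_trans (ler_norm_sum _ _ _) _; rewrite big_nat [leRHS]big_nat; apply: ler_sum => j /andP[_ jJ].
  rewrite conv_rev; apply: le_trans (ler_norm_sum _ _ _) _.
  apply: le_trans (_ : \sum_(0 <= k < m.+1) (if (k < M)%N then D * `|v j k| else 0) <= _).
    apply: ler_sum => k _; rewrite normqM; case: ltnP => kM; last by rewrite v0 // normr0 mulr0.
    by rewrite ler_wpM2r // hD.
  rewrite sum_swap_bound; apply: ler_sum => k _; case: ifP => // _.
  by rewrite mulr_ge0 // (le_trans _ (hD j 0%N jJ)).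
have hFE q : qball q -> psum_fun c q = \sum_(0 <= j < J) \sum_(0 <= l < M) q ^+ l * f j q * v j l.
  move=> qb; apply: qcvg_unique (qpseries_cvg bc qb) _.
  have E : qpseries c q = fun n => \sum_(0 <= j < J) qpseries (conv (coefs (f j)) (v j)) q n.
    apply/funext => n; rewrite /qpseries /series /= exchange_big /=; apply: eq_bigr => m _.
    by rewrite /c mulr_sumr.
  rewrite E; pose g j n := if (j < J)%N then qpseries (conv (coefs (f j)) (v j)) q n else 0.
  rewrite (_ : (fun n => _) = fun n => \sum_(0 <= j < J) g j n); last first.
    by apply/funext => n; apply: eq_big_nat => j /andP[_ jJ]; rewrite /g jJ.
  rewrite (_ : \sum_(0 <= j < J) _ = \sum_(0 <= j < J) (if (j < J)%N then \sum_(0 <= l < M) q ^+ l * f j q * v j l else 0)); last first.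
    by apply: eq_big_nat => j /andP[_ ->].
  apply: qcvg_sum => j; rewrite /g; case: ifP => jJ; last exact: cvg_cst.
  exact: (has_ps_conv_fin (has_ps_coefs (hf j jJ)) (v0 j) qb).
have sB : Num.sqrt B ^+ 2 = B by rewrite sqr_sqrtr.
have qB (x : H) : B * qsqn x = qsqn (Num.sqrt B *: x) by rewrite qsqnZ sB.
(* At the same angle the slice of - I gives the conjugate point; this is how both evaluations enter
   [comparison]. *)
pose I' i := if (i < J)%N then I else - I.
pose w i l := Num.sqrt B *: v (if (i < J)%N then i else (i - J)%N) l.
have cmp : forall r t : R, 0 < r < 1 -> \sum_(0 <= j < 1) qsqn (psum_fun c (r *: slice_cis I t)) <=
     \sum_(0 <= i < J + J) qsqn (\sum_(0 <= l < M) (r *: slice_cis (I' i) t) ^+ l * w i l).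
  move=> r t r01; have [zb cz] := cis_in_ball t hI r01.
  set z := r *: slice_cis I t in zb cz *; rewrite big_nat1 hFE //.
  pose X j := \sum_(0 <= l < M) z ^+ l * v j l; pose Y j := \sum_(0 <= l < M) qconj z ^+ l * v j l.
  have -> : \sum_(0 <= j < J) \sum_(0 <= l < M) z ^+ l * f j z * v j l =
     \sum_(0 <= j < J) (ppart I (f j z) * X j + npart I (f j z) * Y j).
    by apply: eq_bigr => j _; rewrite (slice_poly_split hI).
  apply: le_trans (qsqn_CS2 _ _ _ _ _) _.
  have -> : \sum_(0 <= i < J + J) qsqn (\sum_(0 <= l < M) (r *: slice_cis (I' i) t) ^+ l * w i l) =
     B * \sum_(0 <= j < J) (qsqn (X j) + qsqn (Y j)).
    rewrite mulr_sumr; under [RHS]eq_bigr do rewrite mulrDr.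
    rewrite (sum_double J); apply: eq_bigr => i _; rewrite /I' /w /X /Y; case: ifP => _.
      rewrite qB scaler_sumr; congr qsqn; apply: eq_bigr => l _; by rewrite -scalerAr.
    rewrite qB scaler_sumr /z circle_conj //; congr qsqn; apply: eq_bigr => l _; by rewrite -scalerAr.
  rewrite ler_wpM2r //; first by apply: sumr_ge0 => j _; rewrite addr_ge0 ?qsqn_ge0.
  under eq_bigr do rewrite qsqn_split //.
  exact: hB.
have hI' i : imag_unit (I' i) by rewrite /I'; case: ifP => // _; exact: imag_unitN.
have := @comparison R I 1 (J + J) M M (fun=> psum_fun c) I' w hI (fun _ _ => psum_fun_regular bc) hI' cmp.
rewrite big_nat1 coefs_psum // => /le_trans; apply.
have wE i : \sum_(0 <= l < M) qsqn (w i l) = B * \sum_(0 <= l < M) qsqn (v (if (i < J)%N then i else (i - J)%N) l).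
  by rewrite mulr_sumr; apply: eq_bigr => l _; rewrite /w qsqnZ sB.
under eq_bigr do rewrite wE.
rewrite -mulr_sumr [2 * B]mulrC -mulrA ler_wpM2l //.
pose V j := \sum_(0 <= l < M) qsqn (v j l).
rewrite (_ : \sum_(0 <= i < J + J) _ = \sum_(0 <= j < J) (V j + V j)); last first.
  by rewrite (sum_double J); apply: eq_bigr => i _; rewrite /V; case: ifP.
rewrite mulr_sumr; apply: ler_sum => j _; have -> : V j + V j = 2 * V j by rewrite mulr_natl mulr2n.
  apply: ler_wpM2l => //.
rewrite le_eqVlt; apply/orP; left; apply/eqP; apply: eq_big_nat => l /andP[_ lM].
by rewrite /v lM.
Qed.

End RowBound.

(** * Adjoints and the operator inequality *)

Section Ell2.
Context {R : realType}.
Local Notation H := (quat R).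
Implicit Types (a u v w x y : nat -> H) (C K d : R).

Lemma qcvg_sqP (u : nat -> H) (l : H) : u @ \oo --> l <->
  forall d, 0 < d -> exists N, forall n, (N <= n)%N -> qsqn (l - u n) <= d.
Proof.
split=> [/cvgrPdist_le h d d0|h].
  have s0 : 0 < Num.sqrt d by rewrite sqrtr_gt0.
  have [N _ hN] := h _ s0; exists N => n Nn; have := hN n Nn; rewrite /= -normq2 => k.
  by rewrite -[d]sqr_sqrtr ?(ltW d0) // ler_pXn2r ?nnegrE.
apply/cvgrPdist_le => e e0; have [N hN] := h _ (exprn_gt0 2 e0); exists N => // n /= Nn.
by rewrite -(@ler_pXn2r _ 2) ?nnegrE ?(ltW e0) // normq2 hN.
Qed.

(* The squared norm of [a] in l^2 is at most [C]. *)
Definition nle a C := forall N, \sum_(0 <= m < N) qsqn (a m) <= C.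
Definition ell2 a := exists C, nle a C.
Definition nrm2 a := limn (fun N => \sum_(0 <= m < N) qsqn (a m)).
Definition dot a u := limn (series (fun m => qconj (a m) * u m)).

Lemma nle_ge0 a C : nle a C -> 0 <= C.
Proof. by move=> /(_ 0%N); rewrite big_nil. Qed.

Lemma sum_qsqn_ge0 (I : Type) (s : seq I) (P : pred I) (F : I -> H) :
  0 <= \sum_(i <- s | P i) qsqn (F i).
Proof. by apply: sumr_ge0 => i _; exact: qsqn_ge0. Qed.

Lemma nrm2_cvg a : ell2 a -> (fun N => \sum_(0 <= m < N) qsqn (a m)) @ \oo --> nrm2 a.
Proof.
move=> [C aC]; have : cvgn (series (fun m => qsqn (a m))).
  apply: nondecreasing_is_cvgn; first by apply: nondecreasing_series => n _ _; exact: qsqn_ge0.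
  by exists C => _ [n _ <-]; exact: aC.
by [].
Qed.

Lemma nle_nrm2 a : ell2 a -> nle a (nrm2 a).
Proof.
move=> ea N; have h := nrm2_cvg ea.
have nd : nondecreasing_seq (series (fun m => qsqn (a m))).
  by apply: nondecreasing_series => n _ _; exact: qsqn_ge0.
have c : cvgn (series (fun m => qsqn (a m))) by apply/cvg_ex; exists (nrm2 a).
exact: (nondecreasing_cvgn_le nd c N).
Qed.

Lemma nrm2_le a C : nle a C -> nrm2 a <= C.
Proof.
move=> aC; apply: cvg_le_near (nrm2_cvg (ex_intro _ C aC)) _.
by apply: nearW => n; exact: aC.
Qed.

Lemma nle_lim (v : nat -> nat -> H) w C : (forall M, nle (v M) C) ->
  (forall l, (fun M => v M l) @ \oo --> w l) -> nle w C.
Proof.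
move=> vC vw N; apply: (@cvg_le_near R nat \oo _ (fun M => \sum_(0 <= l < N) qsqn (v M l))).
  by apply: rcvg_sum => l; exact: qcvg_qsqn.
by apply: nearW => M; exact: vC.
Qed.

Lemma nle_tail a C J : nle a C -> nle (fun m => a (J + m)%N) C.
Proof.
move=> aC N; have := aC (J + N)%N; apply: le_trans.
rewrite (big_cat_nat (leq0n J) (leq_addr N J)) /=.
apply: le_trans (_ : \sum_(J <= m < J + N) qsqn (a m) <= _); last by rewrite lerDr sum_qsqn_ge0.
rewrite -[X in index_iota X (J + N)]add0n big_addn addKn.
by apply: ler_sum => m _; rewrite addnC.
Qed.

Lemma nleB a u C D : nle a C -> nle u D -> nle (fun m => a m - u m) (2 * (C + D)).
Proof.
move=> aC uD N; apply: le_trans (_ : \sum_(0 <= m < N) 2 * (qsqn (a m) + qsqn (u m)) <= _).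
  by apply: ler_sum => m _; rewrite -[qsqn (u m)]qsqnN; exact: qsqnD_le.
by rewrite -mulr_sumr ler_wpM2l // big_split lerD.
Qed.

Lemma nle_coef a C m : nle a C -> qsqn (a m) <= C.
Proof.
by move=> /(_ m.+1); apply: le_trans; rewrite big_nat_recr //= lerDr sum_qsqn_ge0.
Qed.

Lemma ell2_bseq a : ell2 a -> bseq a.
Proof.
move=> [C aC]; exists (Num.sqrt C) => m; rewrite -(@ler_pXn2r _ 2) ?nnegrE ?sqrtr_ge0 //.
by rewrite normq2 sqr_sqrtr ?(nle_ge0 aC) // nle_coef.
Qed.

Lemma dot_cvg a u : ell2 a -> ell2 u -> series (fun m => qconj (a m) * u m) @ \oo --> dot a u.
Proof.
move=> [C aC] [D uD].
have [] // := @series_abs_cvg R (fun m => qconj (a m) * u m) (C + D).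
move=> n; apply: le_trans (_ : \sum_(0 <= m < n) (qsqn (a m) + qsqn (u m)) <= _); last first.
  by rewrite big_split lerD.
apply: ler_sum => m _; rewrite normqM normq_conj -!normq2.
have := sqr_ge0 (`|a m| - `|u m|); have := normr_ge0 (a m); have := normr_ge0 (u m).
by move: `|a m| `|u m| => s t; nra.
Qed.

Lemma dotE a u (l : H) : series (fun m => qconj (a m) * u m) @ \oo --> l -> dot a u = l.
Proof. by move=> h; exact: cvg_lim h. Qed.

Lemma dot_CS a u C D : nle a C -> nle u D -> qsqn (dot a u) <= C * D.
Proof.
move=> aC uD.
have h := dot_cvg (ex_intro _ C aC) (ex_intro _ D uD).
apply: (cvg_le_near (qcvg_qsqn h)); apply: nearW => n.
apply: le_trans (qsqn_CS (fun m => qconj (a m)) u 0 n) _.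
by apply: ler_pM; rewrite ?sum_qsqn_ge0 ?uD //; under eq_bigr do rewrite qsqn_conj; exact: aC.
Qed.

Lemma dotBl a u y : ell2 a -> ell2 u -> ell2 y ->
  dot (fun m => a m - u m) y = dot a y - dot u y.
Proof.
move=> ea eu ey; apply: dotE.
rewrite (_ : series _ = fun n => series (fun m => qconj (a m) * y m) n - series (fun m => qconj (u m) * y m) n).
  by apply: cvgB; exact: dot_cvg.
by apply/funext => n; rewrite /series /= -sumrB; apply: eq_bigr => m _; rewrite qconjB mulrBl.
Qed.

Lemma dot_self a : ell2 a -> qre (dot a a) = nrm2 a.
Proof.
move=> ea; have [h _ _ _] := qcvgP _ _ (F := \oo) .1 (dot_cvg ea ea).
rewrite -(cvg_lim _ h) //; congr (limn _); apply/funext => n.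
by rewrite /series /= qre_sum; apply: eq_bigr => m _; rewrite qconj_mul qreA.
Qed.

Definition dirac l : nat -> H := fun m => if m == l then 1 else 0.

Lemma sum_dirac (V : nmodType) (F : nat -> V) l N :
  \sum_(0 <= m < N) (if m == l then F m else 0) = if (l < N)%N then F l else 0.
Proof.
elim: N => [|N IH]; first by rewrite big_nil.
rewrite big_nat_recr //= IH [(l < N.+1)%N]ltnS [(l <= N)%N]leq_eqVlt [l == N]eq_sym; case: eqP => [->|_] /=.
  by rewrite ltnn add0r.
by rewrite addr0.
Qed.

Lemma nle_dirac l : nle (dirac l) 1.
Proof.
move=> N; rewrite (eq_bigr (fun m => if m == l then 1 else 0)) ?sum_dirac; last first.
  by move=> m _; rewrite /dirac; case: ifP; rewrite ?qsqn1 ?qsqn0.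
by case: ifP.
Qed.

Lemma dot_dirac l u : dot (dirac l) u = u l.
Proof.
apply: dotE; rewrite -(cvg_shiftn l.+1) (_ : (fun n => _) = fun=> u l); first exact: cvg_cst.
apply/funext => n; rewrite /series /= (eq_bigr (fun m => if m == l then u m else 0)) ?sum_dirac.
  by rewrite addnS ltnS leq_addl.
by move=> m _; rewrite /dirac; case: ifP; rewrite ?qconj1 ?mul1r // qconj0 mul0r.
Qed.

(** Bounded coordinatewise convergence in l^2 is weak convergence: the tail of x controls the high
    coordinates uniformly in M. The pairing is also truncated at M, as finite sections of adjoints
    are. *)
Lemma weak_dot x (v : nat -> nat -> H) w C : ell2 x -> (forall M, nle (v M) C) ->
  (forall l, (fun M => v M l) @ \oo --> w l) ->
  (fun M => \sum_(0 <= l < M) qconj (x l) * v M l) @ \oo --> dot x w.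
Proof.
move=> ex vC vw; have wC := nle_lim vC vw.
have C0 := nle_ge0 wC; have [X xX] := ex.
have D := dot_cvg ex (ex_intro _ C wC).
suff h : (fun M => \sum_(0 <= l < M) qconj (x l) * (v M l - w l)) @ \oo --> 0.
  rewrite (_ : (fun M => _) = fun M => \sum_(0 <= l < M) qconj (x l) * (v M l - w l) +
      series (fun l => qconj (x l) * w l) M); last first.
    apply/funext => M; rewrite /series /= -big_split /=; apply: eq_bigr => l _.
    by rewrite mulrBr subrK.
  by rewrite -[dot x w]add0r; exact: cvgD.
apply/qcvg_sqP => d d0.
(* By [nleB] the squared norm of v M - w is at most 4 C; the 1 keeps the divisor positive. *)
have D0 : 0 < 4 * C + 1 by lra.
have d1 : 0 < d / (4 * (4 * C + 1)) by rewrite divr_gt0 // mulr_gt0.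
have [K0 hK] := tail_small (fun l => qsqn_ge0 (x l)) xX d1.
have z0 : \sum_(0 <= l < K0) qconj (x l) * 0 = (0 : H) by rewrite big1 // => l _; rewrite mulr0.
have h0 : (fun M => \sum_(0 <= l < K0) qconj (x l) * (v M l - w l)) @ \oo --> (0 : H).
  rewrite -[X in _ --> X]z0.
  apply: (@qcvg_sum R nat \oo _ K0 (fun l M => qconj (x l) * (v M l - w l)) (fun l => qconj (x l) * 0)) => l.
  apply: qcvgMl; rewrite -[X in _ --> X](subrr (w l)).
  by apply: cvgB => //; exact: cvg_cst.
have [N hN] := (qcvg_sqP _ _).1 h0 (d / 4) ltac:(lra).
exists (maxn N K0) => M; rewrite geq_max => /andP[NM KM].
have {hN} := hN M NM; rewrite !sub0r !qsqnN (big_cat_nat (leq0n _) KM) /= => hA.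
set A := \sum_(0 <= l < K0) _ in hA *; set B := \sum_(K0 <= l < M) _.
have hB : qsqn B <= d / 4.
  apply: le_trans (qsqn_CS (fun l => qconj (x l)) (fun l => v M l - w l) K0 M) _.
  have -> : d / 4 = d / (4 * (4 * C + 1)) * (4 * C + 1) by field; lra.
  apply: ler_pM; rewrite ?sum_qsqn_ge0 //; first by under eq_bigr do rewrite qsqn_conj; exact: hK.
  apply: le_trans (leq_sum_tail _ _ (fun l => qsqn_ge0 _)) _.
  by apply: le_trans (nleB (vC M) wC M) _; lra.
by apply: le_trans (qsqnD_le _ _) _; lra.
Qed.

End Ell2.

(** * Adjoints of multipliers on coefficient sequences *)

Section Adjoint.
Context {R : realType}.
Local Notation H := (quat R).
Implicit Types (u v w x y b : nat -> H) (a : nat -> nat -> H) (C K d Y : R).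

(** Initial segments suffice because convolution is causal: the first M coefficients of [conv b u]
    depend only on the first M of u. *)
Definition mulb b K := forall u M,
  \sum_(0 <= m < M) qsqn (conv b u m) <= K * \sum_(0 <= l < M) qsqn (u l).
Definition rowb a K := forall J (u : nat -> nat -> H) M,
  \sum_(0 <= m < M) qsqn (\sum_(0 <= j < J) conv (a j) (u j) m) <=
  K * \sum_(0 <= j < J) \sum_(0 <= l < M) qsqn (u j l).
(* The coefficients of the adjoint of the left multiplier by [b] at [y]. *)
Definition adjs b y l := limn (fun N => bs N b y l).

Lemma conv0r b m : conv b (fun=> 0) m = 0.
Proof. by rewrite conv_nat big1 // => k _; rewrite mulr0. Qed.

Lemma mulb_nle b K u C : 0 <= K -> mulb b K -> nle u C -> nle (conv b u) (K * C).
Proof. by move=> K0 bK uC M; apply: le_trans (bK u M) _; rewrite ler_wpM2l. Qed.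

Lemma mulb_coefs b K : mulb b K -> nle b K.
Proof.
move=> bK M; have := bK (delta0 (R := R)) M.
under eq_bigr do rewrite conv_delta0.
move/le_trans; apply.
have K0 : 0 <= K by have := bK (delta0 (R := R)) 1%N; rewrite !big_nat1 conv_delta0 qsqn1 mulr1; apply: le_trans; exact: qsqn_ge0.
rewrite -[leRHS]mulr1 ler_wpM2l //.
rewrite (eq_bigr (fun m => if m == 0%N then 1 else 0)) ?sum_dirac; last first.
  by move=> m _; rewrite /delta0; case: ifP; rewrite ?qsqn1 ?qsqn0.
by case: ifP.
Qed.

Lemma rowb_mulb a K j : rowb a K -> mulb (a j) K.
Proof.
move=> aK u M; pose v i := if i == j then u else fun=> 0.
have e1 : \sum_(0 <= i < j.+1) \sum_(0 <= l < M) qsqn (v i l) = \sum_(0 <= l < M) qsqn (u l).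
  rewrite (eq_bigr (fun i => if i == j then \sum_(0 <= l < M) qsqn (u l) else 0)) ?sum_dirac ?ltnSn //.
  move=> i _; rewrite /v; case: ifP => // _; by rewrite big1 // => l _; rewrite qsqn0.
have e2 m : \sum_(0 <= i < j.+1) conv (a i) (v i) m = conv (a j) u m.
  rewrite (eq_bigr (fun i => if i == j then conv (a i) u m else 0)) ?sum_dirac ?ltnSn // => i _.
  by rewrite /v; case: ifP => // _; exact: conv0r.
by have := aK j.+1 v M; rewrite e1; under eq_bigr do rewrite e2.
Qed.

Lemma rowb_single b K : 0 <= K -> mulb b K -> rowb (fun j => if j == 0%N then b else fun=> 0) K.
Proof.
move=> K0 bK [|J] u M.
  rewrite big1 ?big_geq ?mulr0 // => m _; by rewrite big_geq // qsqn0.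
have c0 v m : conv (fun=> 0) v m = 0 by rewrite conv_nat big1 // => k _; rewrite mul0r.
rewrite (eq_bigr (fun m => qsqn (conv b (u 0%N) m))).
  apply: le_trans (bK _ _) _; rewrite ler_wpM2l // big_nat_recl //= lerDl.
  by apply: sumr_ge0 => j _; exact: sum_qsqn_ge0.
move=> m _; rewrite big_nat_recl //= big1 ?addr0 // => j _; exact: c0.
Qed.

(** The sum S is the pairing of y with the row applied to its own adjoint at y. Young's inequality
    with weight 1 / K and the row bound give 2 S <= S + K |y|^2. *)
Lemma adj_bound a K : 0 < K -> rowb a K -> forall J N y,
  \sum_(0 <= j < J) \sum_(0 <= l < N) qsqn (bs N (a j) y l) <= K * \sum_(0 <= m < N) qsqn (y m).
Proof.
move=> K0 aK J N y; set S := \sum_(0 <= j < J) _; set T := \sum_(0 <= m < N) _.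
have e : S = \sum_(0 <= m < N) qdot (\sum_(0 <= j < J) conv (a j) (bs N (a j) y) m) (y m).
  under eq_bigr do rewrite qdot_suml.
  rewrite exchange_big /=; apply: eq_bigr => j _; rewrite conv_adj.
  by apply: eq_bigr => l _; rewrite qdotqq.
have t0 : 0 < K^-1 by rewrite invr_gt0.
have : 2 * S <= K^-1 * (K * S) + K * T.
  rewrite {1}e mulr_sumr.
  apply: le_trans (_ : \sum_(0 <= m < N) (K^-1 * qsqn (\sum_(0 <= j < J) conv (a j) (bs N (a j) y) m) +
    K * qsqn (y m)) <= _).
    by apply: ler_sum => m _; have := qdot_le (\sum_(0 <= j < J) conv (a j) (bs N (a j) y) m) (y m) t0; rewrite invrK.
  rewrite big_split /=; apply: lerD; last by rewrite -mulr_sumr.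
  rewrite -mulr_sumr; apply: ler_wpM2l; first exact: ltW.
  exact: (aK J (fun j => bs N (a j) y) N).
by rewrite mulrA mulVf ?gt_eqF // mul1r; lra.
Qed.

Lemma bs_ge N b y l : (N <= l)%N -> bs N b y l = 0.
Proof. by rewrite /bs -subn_eq0 => /eqP ->; rewrite big_geq. Qed.

Lemma sum_cut (F : nat -> R) N M : (forall l, 0 <= F l) -> (forall l, (N <= l)%N -> F l = 0) ->
  \sum_(0 <= l < M) F l <= \sum_(0 <= l < N) F l.
Proof.
move=> F0 F1; case: (leqP M N) => [MN|/ltnW NM].
  by rewrite [leRHS](big_cat_nat (leq0n _) MN) /= lerDl; apply: sumr_ge0.
rewrite (big_cat_nat (leq0n _) NM) /= gerDl big_nat big1 // => l /andP[h _].
exact: F1.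
Qed.

Lemma adj_bound_cut a K : 0 < K -> rowb a K -> forall J M N y,
  \sum_(0 <= j < J) \sum_(0 <= l < M) qsqn (bs N (a j) y l) <= K * \sum_(0 <= m < N) qsqn (y m).
Proof.
move=> K0 aK J M N y; apply: le_trans (adj_bound K0 aK J N y); apply: ler_sum => j _.
apply: sum_cut => [l|l Nl]; first exact: qsqn_ge0.
by rewrite bs_ge // qsqn0.
Qed.

Lemma bs_cvg b y l : ell2 b -> ell2 y -> (fun N => bs N b y l) @ \oo --> adjs b y l.
Proof.
move=> eb [C yC].
have h := dot_cvg eb (ex_intro _ C (nle_tail l yC)).
suff h' : (fun N => bs N b y l) @ \oo --> dot b (fun k => y (l + k)%N).
  by rewrite /adjs; have -> : limn (fun N => bs N b y l) = dot b (fun k => y (l + k)%N) by exact: cvg_lim h'.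
rewrite -(cvg_shiftn l) (_ : (fun n => _) = series (fun m => qconj (b m) * y (l + m)%N)) //.
by apply/funext => n; rewrite /bs addnK.
Qed.

Lemma adjs_bound a K y Y : 0 < K -> rowb a K -> nle y Y -> forall J N,
  \sum_(0 <= j < J) \sum_(0 <= l < N) qsqn (adjs (a j) y l) <= K * Y.
Proof.
move=> K0 aK yY J N.
apply: (@cvg_le_near R nat \oo _ (fun n => \sum_(0 <= j < J) \sum_(0 <= l < N) qsqn (bs n (a j) y l))).
  apply: rcvg_sum => j; apply: rcvg_sum => l; apply: qcvg_qsqn.
  have ea : ell2 (a j) by exists K; exact: (mulb_coefs (rowb_mulb j aK)).
  have ey : ell2 y by exists Y.
  exact: bs_cvg ea ey.
apply: nearW => n; apply: le_trans (adj_bound_cut K0 aK _ _ _ _) _.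
by rewrite ler_wpM2l ?(ltW K0).
Qed.

Lemma adjs_nle b K y Y : 0 < K -> mulb b K -> nle y Y -> nle (adjs b y) (K * Y).
Proof.
move=> K0 bK yY N; have := adjs_bound K0 (rowb_single (ltW K0) bK) yY 1 N.
by rewrite big_nat1.
Qed.

Lemma adjs_nle_row a K y Y j : 0 < K -> rowb a K -> nle y Y -> nle (adjs (a j) y) (K * Y).
Proof. by move=> K0 aK; apply: adjs_nle => //; exact: rowb_mulb. Qed.

Lemma conv_adj_conj M b u w :
  \sum_(0 <= m < M) qconj (conv b u m) * w m = \sum_(0 <= l < M) qconj (u l) * bs M b w l.
Proof.
transitivity (\sum_(0 <= m < M) \sum_(0 <= k < m.+1) qconj (u (m - k)%N) * (qconj (b k) * w ((m - k) + k)%N)).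
  apply: eq_bigr => m _; rewrite conv_nat qconj_sum mulr_suml; apply: eq_big_nat => k /andP[_ km].
  by rewrite qconjM mulrA subnK // -ltnS.
rewrite (sum_triangle (fun k l => qconj (u l) * (qconj (b k) * w (l + k)%N))).
by apply: eq_bigr => l _; rewrite /bs mulr_sumr.
Qed.

(** On sections of length M this is the exchange of sums in [conv_adj_conj]. The sections [bs M b y]
    are bounded uniformly in M and converge coordinatewise, so [weak_dot] passes to the limit. *)
Lemma dot_conv b K x y : 0 < K -> mulb b K -> ell2 x -> ell2 y ->
  dot (conv b x) y = dot x (adjs b y).
Proof.
move=> K0 bK ex [Y yY]; apply: dotE.
have eb : ell2 b by exists K; exact: mulb_coefs.
have := @weak_dot R x (fun M => bs M b y) (adjs b y) (K * Y) ex _ _.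
rewrite (_ : (fun M => _) = series (fun m => qconj (conv b x m) * y m)); last first.
  by apply/funext => M; rewrite /series /= conv_adj_conj.
apply=> [M N|l]; last by apply: bs_cvg => //; exists Y.
have := adj_bound_cut K0 (rowb_single (ltW K0) bK) 1 N M y; rewrite big_nat1 => /le_trans; apply.
by rewrite ler_wpM2l ?(ltW K0).
Qed.

Lemma bs_adjs N b y l : (forall m, (N <= m)%N -> y m = 0) -> bs N b y l = adjs b y l.
Proof.
move=> y0; apply/esym.
have h : (fun M => bs M b y l) @ \oo --> bs N b y l.
  rewrite -(cvg_shiftn N) (_ : (fun n => _) = fun=> bs N b y l); first exact: cvg_cst.
  apply/funext => n; rewrite /bs.
  have le : (N - l <= n + N - l)%N by rewrite leq_sub2r // leq_addl.
  rewrite (big_cat_nat (leq0n _) le) /= [X in _ + X]big_nat.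
  have -> : \sum_(N - l <= i < n + N - l | (N - l <= i < n + N - l)%N) qconj (b i) * y (l + i)%N = 0.
    by apply: big1 => k /andP[h _]; rewrite y0 ?mulr0 // -leq_subLR.
  by rewrite addr0.
exact: cvg_lim h.
Qed.

Lemma bs_trunc N b y l : bs N b (fun m => if (m < N)%N then y m else 0) l = bs N b y l.
Proof.
by rewrite /bs; apply: eq_big_nat => k /andP[_ kN]; rewrite -ltn_subRL kN.
Qed.

Lemma adjsB b y w l : ell2 b -> ell2 y -> ell2 w ->
  adjs b (fun m => y m - w m) l = adjs b y l - adjs b w l.
Proof.
move=> eb ey ew; apply: (@cvg_lim H) => //.
rewrite (_ : (fun N => _) = fun N => bs N b y l - bs N b w l).
  by apply: cvgB; exact: bs_cvg.
by apply/funext => N; rewrite /bs -sumrB; apply: eq_bigr => k _; rewrite mulrBr.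
Qed.

Lemma qsqnD_eps (p q : H) d : 0 < d -> qsqn (p + q) <= (1 + d) * qsqn p + (1 + d^-1) * qsqn q.
Proof. by move=> d0; rewrite qsqnD; have := qdot_le p q d0; lra. Qed.

(* [rho] bounds the sum of the squared norms of the adjoints of the [a j] at [y]. *)
Lemma poly_ineq_ell2 g2 a K b Kb : 0 < g2 -> 0 < K -> rowb a K -> 0 < Kb -> mulb b Kb ->
  poly_ineq g2 a b <-> forall y (rho : R), ell2 y ->
    (forall J N, \sum_(0 <= j < J) \sum_(0 <= l < N) qsqn (adjs (a j) y l) <= rho) ->
    nrm2 (adjs b y) <= g2 * rho.
Proof.
move=> g0 K0 aK Kb0 bK.
have eb : ell2 b by exists Kb; exact: mulb_coefs.
have ea j : ell2 (a j) by exists K; exact: (mulb_coefs (rowb_mulb j aK)).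
split=> [hP y rho ey hr|hE N y C hC]; last first.
  pose z m := if (m < N)%N then y m else 0.
  have z0 m : (N <= m)%N -> z m = 0 by rewrite /z ltnNge => ->.
  have ez : ell2 z by exists (\sum_(0 <= m < N) qsqn (z m)) => M; apply: sum_supp.
  have := hE z C ez _.
  have -> : \sum_(0 <= l < N) qsqn (bs N b y l) = \sum_(0 <= l < N) qsqn (adjs b z l).
    by apply: eq_bigr => l _; rewrite -(bs_adjs _ _ z0) bs_trunc.
  move=> h; apply: le_trans (h _); first by apply: nle_nrm2; exists (Kb * nrm2 z); apply: adjs_nle => //; exact: nle_nrm2.
  move=> J M; apply: le_trans (hC J); apply: ler_sum => j _.
  apply: (@le_trans _ _ (\sum_(0 <= l < M) qsqn (bs N (a j) y l))).
    by apply: ler_sum => l _; rewrite -(bs_adjs _ _ z0) bs_trunc.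
  by apply: sum_cut => [l|l Nl]; rewrite ?qsqn_ge0 // bs_ge // qsqn0.
(* The polynomial inequality applies to truncations of y. The cross terms with the tail of y are
   absorbed by a factor 1 + d, which tends to 1 after the truncation has been removed. *)
have key d M : 0 < d -> \sum_(0 <= l < M) qsqn (adjs b y l) <= g2 * ((1 + d) * rho).
  move=> d0.
  pose T N : R := nrm2 y - \sum_(0 <= m < N) qsqn (y m).
  have hT : T @ \oo --> 0.
    by rewrite -(subrr (nrm2 y)); apply: cvgB; [exact: cvg_cst|exact: nrm2_cvg].
  have hN N : \sum_(0 <= l < N) qsqn (bs N b y l) <= g2 * ((1 + d) * rho + (1 + d^-1) * (K * T N)).
    pose w m : H := if (m < N)%N then 0 else y m.
    have wT : nle w (T N).
      move=> J; rewrite /T lerBrDr.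
      have h := nle_nrm2 ey (maxn N J); apply: le_trans h.
      rewrite (big_cat_nat (leq0n N) (leq_maxl N J)) /= [leLHS]addrC; apply: lerD => //.
      apply: le_trans (_ : \sum_(0 <= m < maxn N J) qsqn (w m) <= _).
        by rewrite [leRHS](big_cat_nat (leq0n J) (leq_maxr N J)) /= lerDl sum_qsqn_ge0.
      rewrite (big_cat_nat (leq0n N) (leq_maxl N J)) /= big_nat.
      have -> : \sum_(0 <= m < N | (0 <= m < N)%N) qsqn (w m) = 0.
        by apply: big1 => m /andP[_ mN]; rewrite /w mN qsqn0.
      by rewrite add0r big_nat [leRHS]big_nat; apply: ler_sum => m /andP[Nm _]; rewrite /w ltnNge Nm.
    apply: hP => J.
    have e j l : bs N (a j) y l = adjs (a j) y l - adjs (a j) w l.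
      rewrite -bs_trunc (@bs_adjs N); last by move=> m; rewrite ltnNge => ->.
      rewrite -adjsB //; last by exists (T N).
      by congr (adjs _ _ _); apply/funext => m; rewrite /w; case: ifP; rewrite ?subr0 ?subrr.
    apply: le_trans (_ : \sum_(0 <= j < J) \sum_(0 <= l < N) ((1 + d) * qsqn (adjs (a j) y l) + (1 + d^-1) * qsqn (adjs (a j) w l)) <= _).
      by do 2!(apply: ler_sum => ? _); rewrite e -[qsqn (adjs _ w _)]qsqnN; exact: qsqnD_eps.
    under eq_bigr do rewrite big_split /= -!mulr_sumr.
    rewrite big_split /= -!mulr_sumr; have d1 : 0 < d^-1 by rewrite invr_gt0.
    apply: lerD; apply: ler_wpM2l; rewrite ?addr_ge0 ?(ltW d0) ?(ltW d1) //.
    exact: adjs_bound.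
  have lim1 : (fun N => \sum_(0 <= l < M) qsqn (bs N b y l)) @ \oo --> \sum_(0 <= l < M) qsqn (adjs b y l).
    by apply: rcvg_sum => l; apply: qcvg_qsqn; exact: bs_cvg.
  have lim2 : (fun N => g2 * ((1 + d) * rho + (1 + d^-1) * (K * T N))) @ \oo --> g2 * ((1 + d) * rho).
    rewrite -[X in _ --> g2 * X]addr0 -(mulr0 (1 + d^-1)) -(mulr0 K).
    apply: cvgMl_tmp; apply: cvgD; first exact: cvg_cst.
    by apply: cvgMl_tmp; apply: cvgMl_tmp.
  rewrite -subr_le0; apply: cvg_le_near (cvgB lim1 lim2) _.
  exists M => // N /= MN; rewrite subr_le0; apply: le_trans (hN N).
  by rewrite [leRHS](big_cat_nat (leq0n _) MN) /= lerDl sum_qsqn_ge0.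
have [Y yY] := ey.
apply: nrm2_le => M; apply/ler_addgt0Pl => e e0.
have rho0 : 0 <= rho by have := hr 0%N 0%N; rewrite big_geq.
have D0 : 0 < g2 * (rho + 1) by rewrite mulr_gt0 // ltr_wpDl.
have d0 : 0 < e / (g2 * (rho + 1)) by rewrite divr_gt0.
apply: le_trans (key _ M d0) _.
have k : e / (g2 * (rho + 1)) * (g2 * rho) <= e.
  rewrite mulrAC ler_pdivrMr // ler_wpM2l ?(ltW e0) // ler_wpM2l ?(ltW g0) //; lra.
by rewrite mulrCA mulrDl mul1r addrC lerD2r.
Qed.

End Adjoint.

(** * Extended-real norms as bounds on partial sums *)

Section Bridge.
Context {R : realType}.
Local Notation H := (quat R).

Lemma nneseries_leP (x : nat -> R) (C : R) : (forall n, 0 <= x n) ->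
  (\sum_(0 <= m <oo) (x m)%:E <= C%:E)%E <-> forall N, \sum_(0 <= m < N) x m <= C.
Proof.
move=> x0; have x0' m : (0%N <= m)%N -> true -> (0 <= (x m)%:E)%E by rewrite lee_fin.
split=> [h N|h].
  by rewrite -lee_fin -sumEFin; apply: le_trans (nneseries_lim_ge N x0') h.
apply: lime_le; first exact: is_cvg_nneseries.
by apply: nearW => n; rewrite sumEFin lee_fin.
Qed.

Lemma nneseries_fin (x : nat -> R) : (forall n, 0 <= x n) ->
  (\sum_(0 <= m <oo) (x m)%:E < +oo)%E <-> exists C, forall N, \sum_(0 <= m < N) x m <= C.
Proof.
move=> x0; split=> [h|[C h]]; last by apply: le_lt_trans (ltry C); apply/nneseries_leP.
have h0 : (0 <= \sum_(0 <= m <oo) (x m)%:E)%E by apply: nneseries_ge0 => m _ _; rewrite lee_fin.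
exists (fine (\sum_(0 <= m <oo) (x m)%:E)%E); apply/nneseries_leP => //.
by rewrite fineK // ge0_fin_numE.
Qed.

Lemma esum_nneseries (L : set nat) (x : nat -> R) : (forall n, L n -> 0 <= x n) ->
  (\esum_(j in L) (x j)%:E = \sum_(0 <= j <oo) (if j \in L then x j else 0)%:E)%E.
Proof.
move=> x0; have := @nneseries_esum R (fun j => (x j)%:E) (fun j => j \in L).
rewrite (_ : [set j | j \in L] = L); last by apply/seteqP; split => j /=; rewrite inE.
move=> <-; last by move=> n; rewrite inE lee_fin; exact: x0.
by rewrite eseries_mkcond; apply: eq_eseriesr => j _; case: ifP.
Qed.

Lemma esum_leP (L : set nat) (x : nat -> R) (C : R) : (forall n, L n -> 0 <= x n) ->
  (\esum_(j in L) (x j)%:E <= C%:E)%E <-> forall J, \sum_(0 <= j < J) (if j \in L then x j else 0) <= C.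
Proof.
move=> x0; rewrite esum_nneseries //; apply: nneseries_leP => n.
by case: ifP => //; rewrite inE; exact: x0.
Qed.

Lemma esum_fin (L : set nat) (x : nat -> R) : (forall n, L n -> 0 <= x n) ->
  (\esum_(j in L) (x j)%:E < +oo)%E <-> exists C, forall J, \sum_(0 <= j < J) (if j \in L then x j else 0) <= C.
Proof.
move=> x0; rewrite esum_nneseries //; apply: nneseries_fin => n.
by case: ifP => //; rewrite inE; exact: x0.
Qed.

Lemma H2normsqE (u : H -> H) : H2normsq u = (\sum_(0 <= m <oo) (qsqn (coefs u m))%:E)%E.
Proof. by rewrite /H2normsq; under eq_eseriesr do rewrite normq2. Qed.

Lemma H2normsq_ell2 (u : H -> H) : (H2normsq u < +oo)%E <-> ell2 (coefs u).
Proof. by rewrite H2normsqE nneseries_fin // => n; exact: qsqn_ge0. Qed.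

Lemma H2normsq_nrm2 (u : H -> H) : ell2 (coefs u) -> H2normsq u = (nrm2 (coefs u))%:E.
Proof.
move=> eu; rewrite H2normsqE; apply: cvg_lim => //.
rewrite (_ : (fun n => _) = EFin \o (fun N => \sum_(0 <= m < N) qsqn (coefs u m))); last first.
  by apply/funext => n /=; rewrite sumEFin.
by apply: cvg_EFin; [exact: nearW|exact: nrm2_cvg].
Qed.

Lemma H2P (u : H -> H) : H2 u <-> slice_regular u /\ ell2 (coefs u).
Proof. by rewrite /H2 /= H2normsq_ell2. Qed.

Lemma H2_psum (a : nat -> H) : ell2 a -> H2 (psum_fun a).
Proof.
move=> ea; have ba := ell2_bseq ea; apply/H2P; split; first exact: psum_fun_regular.
by rewrite coefs_psum.
Qed.

(** Extension by zero outside L, so that finite and infinite index sets are both summed over j <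
    J. *)
Definition fam (L : set nat) (f : nat -> H -> H) j : nat -> H :=
  if j \in L then coefs (f j) else fun=> 0.

Lemma H2l2P L (x : nat -> H -> H) : H2l2 L x <-> (forall j, L j -> H2 (x j)) /\
  exists C, forall J N, \sum_(0 <= j < J) \sum_(0 <= l < N) qsqn (fam L x j l) <= C.
Proof.
have E : (forall j, L j -> H2 (x j)) -> (\esum_(j in L) H2normsq (x j) = \esum_(j in L) (nrm2 (coefs (x j)))%:E)%E.
  by move=> hx; apply: eq_esum => j /hx/H2P[_ ej]; exact: H2normsq_nrm2.
have N0 j : (forall j, L j -> H2 (x j)) -> L j -> 0 <= nrm2 (coefs (x j)).
  by move=> hx /hx/H2P[_ ej]; exact: nle_ge0 (nle_nrm2 ej).
split=> [[hx hs]|[hx [C hC]]]; split=> //.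
  move: hs; rewrite E // => /(esum_fin (N0^~ hx))[C hC]; exists C => J N.
  apply: le_trans (hC J); apply: ler_sum => j _; rewrite /fam; case: ifPn => [|_].
    by rewrite inE => /hx/H2P[_ ej]; exact: nle_nrm2.
  by rewrite big1 // => l _; rewrite qsqn0.
rewrite E //; apply/(esum_fin (N0^~ hx)); exists C => J.
have h j : (fun N => \sum_(0 <= l < N) qsqn (fam L x j l)) @ \oo --> (if j \in L then nrm2 (coefs (x j)) else 0).
  rewrite /fam; case: ifPn => [|_]; first by rewrite inE => /hx/H2P[_ ej]; exact: nrm2_cvg.
  rewrite (_ : (fun N => _) = fun=> 0); first exact: cvg_cst.
  by apply/funext => N; rewrite big1 // => l _; rewrite qsqn0.
by apply: (cvg_le_near (rcvg_sum (n := J) h)); apply: nearW => N; exact: hC.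
Qed.

Lemma star_psum (f g : H -> H) : star f g = psum_fun (conv (coefs f) (coefs g)).
Proof. by []. Qed.

End Bridge.

(** * The row multiplier and its adjoint *)

Section Operators.
Context {R : realType}.
Local Notation H := (quat R).
Implicit Types (L : set nat) (f x : nat -> H -> H) (h u : H -> H).

Lemma conv_abs (a u : nat -> H) m :
  `|conv a u m| <= \sum_(0 <= k < m.+1) qsqn (a k) + \sum_(0 <= k < m.+1) qsqn (u k).
Proof.
have -> : \sum_(0 <= k < m.+1) qsqn (u k) = \sum_(0 <= k < m.+1) qsqn (u (m - k)%N).
  by rewrite big_nat_rev /=; apply: eq_big_nat => k _; rewrite add0n subSS.
rewrite conv_nat -big_split /=; apply: le_trans (ler_norm_sum _ _ _) _; apply: ler_sum => k _.
rewrite normqM -!normq2; set s := `|a k|; set t := `|u _|.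
by have := sqr_ge0 (s - t); have := normr_ge0 (a k); have := normr_ge0 (u (m - k)%N); nra.
Qed.

(** Each coefficient of the series converges absolutely, which defines c. The row bound applied to
    the terms from n to n' estimates the norm of the difference uniformly in n', and letting n' tend
    to infinity gives convergence in norm. *)
Lemma row_sum_exists (a X : nat -> nat -> H) (K C : R) : 0 < K -> rowb a K -> row_coefs a ->
  (forall J N, \sum_(0 <= j < J) \sum_(0 <= l < N) qsqn (X j l) <= C) ->
  exists c : nat -> H, ell2 c /\ forall d, 0 < d -> exists N, forall n, (N <= n)%N ->
    nle (fun m => \sum_(0 <= j < n) conv (a j) (X j) m - c m) d.
Proof.
move=> K0 aK a1 XC; pose p n m := \sum_(0 <= j < n) conv (a j) (X j) m.
have pc m : cvgn (p^~ m).
  have [] // := @series_abs_cvg R (fun j => conv (a j) (X j) m) (1 + C) => n.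
  apply: le_trans (_ : \sum_(0 <= j < n) (\sum_(0 <= k < m.+1) qsqn (a j k) + \sum_(0 <= k < m.+1) qsqn (X j k)) <= _).
    by apply: ler_sum => j _; exact: conv_abs.
  by rewrite big_split /=; apply: lerD; [exact: a1|exact: XC].
pose c m : H := limn (p^~ m).
have pcl m : p^~ m @ \oo --> c m by exact: pc.
have pK n : nle (p n) (K * C).
  by move=> M; apply: le_trans (aK n X M) _; rewrite ler_wpM2l ?(ltW K0).
exists c; split; first by exists (K * C); exact: nle_lim pcl.
move=> d d0.
have eX j : ell2 (X j).
  exists C => N; have := XC j.+1 N; apply: le_trans; rewrite big_nat_recr //= lerDr.
  by apply: sumr_ge0 => i _; exact: sum_qsqn_ge0.
have sC J : \sum_(0 <= j < J) nrm2 (X j) <= C.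
  apply: (cvg_le_near (rcvg_sum (n := J) (fun j => nrm2_cvg (eX j)))).
  by apply: nearW => N; exact: XC.
have dK : 0 < d / K by rewrite divr_gt0.
have [N hN] := tail_small (fun j => nle_ge0 (nle_nrm2 (eX j))) sC dK.
exists N => n Nn.
suff tail n' : (n <= n')%N -> nle (fun m => p n m - p n' m) d.
  apply: (@nle_lim R (fun k m => p n m - p (n + k)%N m)) => [k|m]; first by apply: tail; rewrite leq_addr.
  apply: cvgB; first exact: cvg_cst.
  by have := pcl m; rewrite -(cvg_shiftn n); under eq_fun do rewrite addnC.
move=> nn' M.
pose v j := if (n <= j)%N then X j else fun=> 0.
have e m : qsqn (p n m - p n' m) = qsqn (\sum_(0 <= j < n') conv (a j) (v j) m).
  rewrite -qsqnN opprB /p !(big_cat_nat (leq0n n) nn') /= addrAC subrr add0r.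
  rewrite [X in _ = qsqn (X + _)]big_nat.
  have -> : \sum_(0 <= j < n | (0 <= j < n)%N) conv (a j) (v j) m = 0.
    by apply: big1 => j /andP[_ jn]; rewrite /v leqNgt jn conv0r.
  by rewrite add0r; congr qsqn; apply: eq_big_nat => j /andP[nj _]; rewrite /v nj.
under eq_bigr do rewrite e.
apply: le_trans (aK n' v M) _; rewrite -ler_pdivlMl // [K^-1 * d]mulrC.
rewrite (big_cat_nat (leq0n n) nn') /= big_nat.
have -> : \sum_(0 <= j < n | (0 <= j < n)%N) \sum_(0 <= l < M) qsqn (v j l) = 0.
  by apply: big1 => j /andP[_ jn]; apply: big1 => l _; rewrite /v leqNgt jn qsqn0.
rewrite add0r; apply: le_trans (hN n n' Nn); rewrite big_nat [leRHS]big_nat.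
by apply: ler_sum => j /andP[nj _]; rewrite /v nj; exact: nle_nrm2.
Qed.

Lemma H2_has_ps u : H2 u -> has_ps u (coefs u).
Proof. by move=> /H2P[su _]; exact: has_ps_coefs. Qed.

Section Row.
Variables (L : set nat) (f : nat -> H -> H) (K : R).
Hypotheses (K0 : 0 < K) (fK : rowb (fam L f) K) (f1 : row_coefs (fam L f)).

Let p (x : nat -> H -> H) n m := \sum_(0 <= j < n) conv (fam L f j) (fam L x j) m.

Lemma fam_in (g : nat -> H -> H) j : L j -> fam L g j = coefs (g j).
Proof. by move=> Lj; rewrite /fam mem_set. Qed.

Lemma fam_nle x C : (forall J N, \sum_(0 <= j < J) \sum_(0 <= l < N) qsqn (fam L x j l) <= C) ->
  forall j, nle (fam L x j) C.
Proof.
move=> hC j N; have := hC j.+1 N; apply: le_trans; rewrite big_nat_recr //= lerDr.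
by apply: sumr_ge0 => i _; exact: sum_qsqn_ge0.
Qed.

Lemma row_partial x n : H2l2 L x ->
  has_ps (fun q => psum L (fun j => star (f j) (x j) q) n) (p x n).
Proof.
move=> /H2l2P[hx [C /fam_nle hC]].
rewrite (_ : p x n = fun m => psum L (fun j => conv (fam L f j) (fam L x j) m) n); last first.
  apply/funext => m; rewrite /p /psum [RHS]big_mkcond; apply: eq_bigr => j _.
  by rewrite /fam; case: ifP => // _; exact: conv0r.
apply: (@has_ps_psum R L (fun j => star (f j) (x j))) => j Lj; rewrite star_psum -!fam_in //.
apply: has_psum; apply: ell2_bseq; exists (K * C).
exact: mulb_nle (ltW K0) (rowb_mulb j fK) (hC j).
Qed.

Lemma coefs_row_diff x n u : H2l2 L x -> H2 u ->
  coefs (fun q => psum L (fun j => star (f j) (x j) q) n - u q) = fun m => p x n m - coefs u m.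
Proof.
by move=> hx hu; apply: coefsE; apply: has_psD; [exact: row_partial|apply: has_psN; exact: H2_has_ps].
Qed.

(** [row_mult] is a choice among the norm limits, so nothing but its defining convergence is known;
    [row_sum_exists] shows that there is something to choose. *)
Lemma row_mult_spec x : H2l2 L x -> H2 (row_mult L f x) /\
  forall d, 0 < d -> exists N, forall n, (N <= n)%N ->
    nle (fun m => p x n m - coefs (row_mult L f x) m) d.
Proof.
move=> hx; have /H2l2P[hx1 [C hC]] := hx.
have pe n : ell2 (p x n).
  by exists (K * C) => M; apply: le_trans (fK n (fam L x) M) _; rewrite ler_wpM2l ?(ltW K0).
have ed n u : H2 u -> ell2 (fun m => p x n m - coefs u m).
  by move=> /H2P[_ [D uD]]; have [E pE] := pe n; exists (2 * (E + D)); exact: nleB.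
have nE n u : H2 u -> H2normsq (fun q => psum L (fun j => star (f j) (x j) q) n - u q) =
    (nrm2 (fun m => p x n m - coefs u m))%:E.
  move=> hu; have e := coefs_row_diff n hx hu.
  by rewrite H2normsq_nrm2 e //; exact: ed.
have ex : exists u, H2 u /\ H2normsq (fun q => psum L (fun j => star (f j) (x j) q) n - u q)
      @[n --> \oo] --> 0%E.
  have [c [ec hc]] := row_sum_exists K0 fK f1 hC.
  exists (psum_fun c); split; first exact: H2_psum.
  have hc2 : H2 (psum_fun c) by exact: H2_psum.
  rewrite (_ : (fun n => _) = fun n => (nrm2 (fun m => p x n m - c m))%:E); last first.
    by apply/funext => n; rewrite nE // coefs_psum //; exact: ell2_bseq.
  apply: cvg_EFin; first exact: nearW.
  apply/cvgrPdist_le => e /hc[N hN]; exists N => // n /= Nn.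
  have h := hN n Nn; rewrite sub0r normrN ger0_norm; last by apply: nle_ge0 (nle_nrm2 _); exists e.
  exact: nrm2_le.
have [hU hlim] := xgetPex (fun=> 0) ex; rewrite -/(row_mult L f x) in hU hlim.
split=> // d d0.
have e : (fun n => H2normsq (fun q => psum L (fun j => star (f j) (x j) q) n - row_mult L f x q)) =
    fun n => (nrm2 (fun m => p x n m - coefs (row_mult L f x) m))%:E.
  by apply/funext => n; rewrite nE.
have : (fun n => nrm2 (fun m => p x n m - coefs (row_mult L f x) m)) @ \oo --> (0 : R).
  by rewrite e in hlim; exact: fine_cvg hlim.
move/cvgrPdist_le => /(_ d d0)[N _ hN]; exists N => n Nn M.
have := hN n Nn; rewrite /= sub0r normrN; apply: le_trans.
by apply: le_trans (ler_norm _); apply: nle_nrm2; exact: ed.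
Qed.

Lemma dot_suml (F : nat -> nat -> H) (y : nat -> H) n : (forall j, ell2 (F j)) -> ell2 y ->
  dot (fun m => \sum_(0 <= j < n) F j m) y = \sum_(0 <= j < n) dot (F j) y.
Proof.
move=> eF ey; apply: dotE.
rewrite (_ : series _ = fun M => \sum_(0 <= j < n) series (fun m => qconj (F j m) * y m) M).
  by apply: qcvg_sum => j; exact: dot_cvg.
apply/funext => M; rewrite /series /= exchange_big /=; apply: eq_bigr => m _.
by rewrite qconj_sum mulr_suml.
Qed.

Definition row_adjoint (u : H -> H) j : H -> H := psum_fun (adjs (fam L f j) (coefs u)).

Lemma fam_row_adjoint u j : H2 u -> fam L (row_adjoint u) j = if j \in L then adjs (fam L f j) (coefs u) else fun=> 0.
Proof.
move=> /H2P[_ [Y uY]]; rewrite {1}/fam; case: ifP => // _; rewrite coefs_psum //.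
by apply: ell2_bseq; exists (K * Y); exact: adjs_nle_row.
Qed.

Lemma fam_row_adjoint_le u Y : H2 u -> nle (coefs u) Y ->
  forall J N, \sum_(0 <= j < J) \sum_(0 <= l < N) qsqn (fam L (row_adjoint u) j l) <= K * Y.
Proof.
move=> hu uY J N; apply: le_trans (adjs_bound K0 fK uY J N).
apply: ler_sum => j _; rewrite fam_row_adjoint //; case: ifP => // _.
by rewrite big1 ?sum_qsqn_ge0 // => l _; rewrite qsqn0.
Qed.

Lemma row_adjoint_in u : H2 u -> H2l2 L (row_adjoint u).
Proof.
move=> hu; have /H2P[_ [Y uY]] := hu; apply/H2l2P; split; last first.
  by exists (K * Y); exact: fam_row_adjoint_le.
by move=> j _; apply: H2_psum; exists (K * Y); exact: adjs_nle_row.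
Qed.

Lemma H2l2dotE x y (l : H) :
  (fun n => \sum_(0 <= j < n) dot (fam L x j) (fam L y j)) @ \oo --> l -> H2l2dot L x y = l.
Proof.
move=> h; apply: cvg_lim => //.
rewrite (_ : psum _ _ = fun n => \sum_(0 <= j < n) dot (fam L x j) (fam L y j)) //.
apply/funext => n; rewrite /psum big_mkcond; apply: eq_bigr => j _.
rewrite /fam; case: ifP => // _; apply/esym/dotE.
rewrite (_ : series _ = fun=> 0); first exact: cvg_cst.
by apply/funext => M; rewrite /series /= big1 // => m _; rewrite mulr0.
Qed.

Lemma row_is_adjoint : is_adjoint (H2l2 L) (H2l2dot L) H2 (@H2dot R) (row_mult L f) row_adjoint.
Proof.
move=> u hu; split; first exact: row_adjoint_in.
move=> x hx; have [hU hlim] := row_mult_spec hx.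
have /H2P[_ eU] := hU; have /H2P[_ ey] := hu; have [Y uY] := ey.
have /H2l2P[hx1 [C /fam_nle hC]] := hx.
apply/esym/H2l2dotE; rewrite /H2dot -/(dot _ _).
have ec j : ell2 (conv (fam L f j) (fam L x j)).
  by exists (K * C); exact: mulb_nle (ltW K0) (rowb_mulb j fK) (hC j).
have pe n : ell2 (p x n).
  have [_ [C' hC']] := (H2l2P L x).1 hx.
  by exists (K * C') => M; apply: le_trans (fK n (fam L x) M) _; rewrite ler_wpM2l ?(ltW K0).
rewrite (_ : (fun n => _) = fun n => dot (p x n) (coefs u)); last first.
  apply/funext => n; rewrite /p dot_suml //; apply: eq_bigr => j _.
  rewrite (dot_conv K0 (rowb_mulb j fK)) //; last by exists C.
  rewrite fam_row_adjoint //; case: ifP => // jL.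
  rewrite /fam jL; apply/eqP; rewrite eq_sym; apply/eqP.
  have z v : dot (fun=> 0) v = 0 :> H.
    apply: dotE; rewrite (_ : series _ = fun=> 0); first exact: cvg_cst.
    by apply/funext => M; rewrite /series /= big1 // => m _; rewrite qconj0 mul0r.
  by rewrite !z.
apply/qcvg_sqP => d d0.
have Y0 := nle_ge0 uY.
have d1 : 0 < d / (Y + 1) by rewrite divr_gt0 // ltr_wpDl.
have [N hN] := hlim _ d1; exists N => n Nn.
rewrite -qsqnN opprB -dotBl //.
apply: le_trans (dot_CS (hN n Nn) uY) _.
rewrite mulrAC ler_pdivrMr ?ltr_wpDl // ler_wpM2l ?(ltW d0) //; lra.
Qed.

(** [row_mult_adj] is a chosen adjoint, known only through the adjoint identity. Testing that
    identity on the family with q^l at place j and zero elsewhere identifies its coefficients with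
    those of the explicit adjoint. *)
Lemma row_mult_adj_coefs u : H2 u -> H2l2 L (row_mult_adj L f u) /\
  forall j, fam L (row_mult_adj L f u) j = fam L (row_adjoint u) j.
Proof.
move=> hu.
have ad : is_adjoint (H2l2 L) (H2l2dot L) H2 (@H2dot R) (row_mult L f) (row_mult_adj L f).
  by apply: (xgetPex _ (P := [set S | is_adjoint (H2l2 L) (H2l2dot L) H2 (@H2dot R) (row_mult L f) S]));
     exists row_adjoint; exact: row_is_adjoint.
have [h1 h2] := ad u hu; have [g1 g2] := row_is_adjoint hu.
split=> // j; case: (boolP (j \in L)) => jL; last by rewrite /fam (negbTE jL).
apply/funext => l.
pose x i : H -> H := if i == j then psum_fun (dirac (R := R) l) else psum_fun (fun=> 0).
have bd : bseq (dirac (R := R) l) by apply: ell2_bseq; exists 1; exact: nle_dirac.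
have b0 : bseq (fun=> 0 : H) by exists 0 => m; rewrite normr0.
have fx i : fam L x i = if i == j then dirac (R := R) l else fun=> 0.
  rewrite /fam /x; case: eqP => [->|_]; first by rewrite jL coefs_psum.
  by case: ifP => // _; rewrite coefs_psum.
have hx : H2l2 L x.
  apply/H2l2P; split.
    move=> i _; rewrite /x; case: ifP => _; apply: H2_psum; first by exists 1; exact: nle_dirac.
    by exists 0 => N; rewrite big1 // => m _; rewrite qsqn0.
  exists 1 => J N; rewrite (eq_bigr (fun i => if i == j then \sum_(0 <= m < N) qsqn (dirac (R := R) l m) else 0)).
    by rewrite sum_dirac; case: ifP => // _; exact: nle_dirac.
  by move=> i _; rewrite fx; case: ifP => // _; rewrite big1 // => m _; rewrite qsqn0.
have dE y : H2l2dot L x y = fam L y j l.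
  apply: H2l2dotE; rewrite -(cvg_shiftn j.+1) (_ : (fun n => _) = fun=> fam L y j l); first exact: cvg_cst.
  apply/funext => n.
  rewrite (eq_bigr (fun i => if i == j then fam L y i l else 0)).
    by rewrite sum_dirac addnS ltnS leq_addl.
  move=> i _; rewrite fx; case: ifP => _; first exact: dot_dirac.
  apply: dotE; rewrite (_ : series _ = fun=> 0); first exact: cvg_cst.
  by apply/funext => M; rewrite /series /= big1 // => m _; rewrite qconj0 mul0r.
by rewrite -!dE -h2 // g2.
Qed.

Lemma row_form (g2 : R) u : H2 u ->
  (fun n => \sum_(0 <= j < n) nrm2 (fam L (row_adjoint u) j)) @ \oo -->
    qre (H2dot (row_mult L f (row_mult_adj L f u)) u) /\
  H2dot (fun q => g2 *: row_mult L f (row_mult_adj L f u) q) u =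
    g2 *: H2dot (row_mult L f (row_mult_adj L f u)) u.
Proof.
move=> hu; have [h1 h2] := row_mult_adj_coefs hu.
have ad : is_adjoint (H2l2 L) (H2l2dot L) H2 (@H2dot R) (row_mult L f) (row_mult_adj L f).
  by apply: (xgetPex _ (P := [set S | is_adjoint (H2l2 L) (H2l2dot L) H2 (@H2dot R) (row_mult L f) S]));
     exists row_adjoint; exact: row_is_adjoint.
have [hU _] := row_mult_spec h1; have /H2P[_ eU] := hU; have /H2P[_ ey] := hu.
split; last first.
  rewrite /H2dot -!/(dot _ _) (coefsE (has_psZ (t := g2) (H2_has_ps hU))); apply: dotE.
  rewrite (_ : series _ = fun N => g2 *: series (fun m => qconj (coefs (row_mult L f (row_mult_adj L f u)) m) * coefs u m) N).
    by apply: cvgZl_tmp; exact: dot_cvg.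
  by apply/funext => N; rewrite /series /= scaler_sumr; apply: eq_bigr => m _; rewrite qconjZ scalerAl.
have [g1 g2'] := row_is_adjoint hu.
have e : H2dot (row_mult L f (row_mult_adj L f u)) u = H2l2dot L (row_mult_adj L f u) (row_mult_adj L f u).
  by have [_ ->] := ad u hu.
have [Y uY] := ey.
have er j : ell2 (fam L (row_adjoint u) j).
  by exists (K * Y); apply: fam_nle; exact: fam_row_adjoint_le.
pose s j := nrm2 (fam L (row_adjoint u) j).
have sC n : \sum_(0 <= j < n) s j <= K * Y.
  apply: (cvg_le_near (rcvg_sum (n := n) (fun j => nrm2_cvg (er j)))).
  by apply: nearW => N; exact: fam_row_adjoint_le.
have sc : cvgn (series s).
  apply: nondecreasing_is_cvgn.
    by apply: nondecreasing_series => n _ _; exact: nle_ge0 (nle_nrm2 (er n)).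
  by exists (K * Y) => _ [n _ <-]; exact: sC.
have self (j : nat) : dot (fam L (row_mult_adj L f u) j) (fam L (row_mult_adj L f u) j) = (s j)%:A.
  rewrite h2; apply: dotE.
  rewrite (_ : series _ = fun N => (\sum_(0 <= m < N) qsqn (fam L (row_adjoint u) j m))%:A).
    by apply: cvgZr_tmp; exact: nrm2_cvg.
  by apply/funext => N; rewrite /series /= scaler_suml; apply: eq_bigr => m _; rewrite qconj_mul.
rewrite e (@H2l2dotE _ _ ((limn (series s))%:A)); first by rewrite qreA.
rewrite (_ : (fun n => _) = fun n => (series s n)%:A); first by apply: cvgZr_tmp.
by apply/funext => n; rewrite /series /= scaler_suml; apply: eq_bigr => j _.
Qed.

End Row.
End Operators.

(** * The operator inequality read on coefficients *)

Section Inequality.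
Context {R : realType}.
Local Notation H := (quat R).
Implicit Types (L : set nat) (f : nat -> H -> H) (h u : H -> H).

Lemma row_bseq (I : H) J (f : nat -> H -> H) (B : R) : imag_unit I -> 0 <= B -> regular_rows J f B I ->
  forall j, (j < J)%N -> bseq (coefs (f j)).
Proof.
move=> hI B0 hf j jJ; apply: ell2_bseq; exists B => M.
apply: le_trans (row_coefs_le M hI B0 hf).
rewrite (big_cat_nat (leq0n j) (ltnW jJ)) /= [X in _ + X]big_ltn //= addrCA lerDl addr_ge0 //.
  by apply: sumr_ge0 => i _; exact: sum_qsqn_ge0.
by apply: sumr_ge0 => i _; exact: sum_qsqn_ge0.
Qed.

Lemma Hinf_bound h : Hinf h -> exists2 B : R, 0 <= B & forall q, qball q -> qsqn (h q) <= B.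
Proof.
move=> [_ [M hM]]; exists (M ^+ 2); first exact: sqr_ge0.
move=> q /hM qM; rewrite -normq2 ler_pXn2r ?nnegrE //.
exact: le_trans (normr_ge0 _) qM.
Qed.

Lemma Hinf_mulb (I : H) h : imag_unit I -> Hinf h -> exists2 K : R, 0 < K & mulb (coefs h) K.
Proof.
move=> hI hh; have [sh _] := hh; have [B B0 hB] := Hinf_bound hh.
have rr : regular_rows 1 (fun=> h) B I by split=> // q qb _; rewrite big_nat1; exact: hB.
exists (2 * B + 1) => [|u M]; first by rewrite ltr_wpDl // mulr_ge0.
have := row_bound M (fun=> u) hI B0 rr (row_bseq hI B0 rr).
rewrite big_nat1; under eq_bigr do rewrite big_nat1.
move=> /le_trans; apply; rewrite ler_wpM2r ?sum_qsqn_ge0 //; lra.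
Qed.

Lemma hypothesis_rows (I : H) L f J : imag_unit I -> (forall j, L j -> Hinf (f j)) ->
  (forall q, qball q -> (\esum_(j in L) (`|f j q| ^+ 2)%:E <= 1%:E)%E) ->
  regular_rows J (fun j => if j \in L then f j else psum_fun (fun=> 0)) 1 I.
Proof.
move=> hI hf hf1; have b0 : bseq (fun=> 0 : H) by exists 0 => m; rewrite normr0.
split=> [j _|q qb _].
  case: ifPn => [|_]; last exact: psum_fun_regular.
  by rewrite inE => /hf[].
have /(esum_leP (x := fun j => `|f j q| ^+ 2)) := hf1 q qb.
move=> /(_ (fun n _ => sqr_ge0 _) J); apply: le_trans; apply: ler_sum => j _.
case: ifP => _; first by rewrite normq2.
rewrite (qcvg_unique (has_psum b0 qb) (has_ps0 qb)) qsqn0 //.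
Qed.

Lemma fam_hyp L f j : fam L f j = coefs (if j \in L then f j else psum_fun (fun=> 0)).
Proof.
rewrite /fam; case: ifP => // _; rewrite coefs_psum //; by exists 0 => m; rewrite normr0.
Qed.

(** The 2 is the constant of [row_bound] for B = 1; it serves boundedness and does not enter the
    constant gamma. *)
Lemma hypothesis_rowb (I : H) L f : imag_unit I -> (forall j, L j -> Hinf (f j)) ->
  (forall q, qball q -> (\esum_(j in L) (`|f j q| ^+ 2)%:E <= 1%:E)%E) ->
  rowb (fam L f) 2 /\ row_coefs (fam L f).
Proof.
move=> hI hf hf1; have rr J := hypothesis_rows J hI hf hf1; split=> [J u M|J M].
  under eq_bigr do under eq_bigr do rewrite fam_hyp.
  have := row_bound M u hI ler01 (rr J) (row_bseq hI ler01 (rr J)).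
  by rewrite mulr1.
under eq_bigr do rewrite fam_hyp.
exact: (row_coefs_le M hI ler01 (rr J)).
Qed.

Section Single.
Variables (h : H -> H) (K : R).
Hypotheses (K0 : 0 < K) (hK : mulb (coefs h) K).

Lemma star_H2 x : H2 x -> H2 (star h x) /\ coefs (star h x) = conv (coefs h) (coefs x).
Proof.
move=> /H2P[_ [C xC]]; have ec : ell2 (conv (coefs h) (coefs x)).
  by exists (K * C); exact: mulb_nle (ltW K0) hK xC.
rewrite star_psum; split; first exact: H2_psum.
by rewrite coefs_psum //; exact: ell2_bseq.
Qed.

Lemma mult_is_adjoint : is_adjoint (@H2 R) (@H2dot R) (@H2 R) (@H2dot R) (star h)
  (fun u => psum_fun (adjs (coefs h) (coefs u))).
Proof.
move=> u /H2P[su eu]; have [Y uY] := eu.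
have ea : ell2 (adjs (coefs h) (coefs u)) by exists (K * Y); exact: adjs_nle.
split; first exact: H2_psum.
move=> x hx; have [_ xE] := star_H2 hx; have /H2P[_ ex] := hx.
by rewrite /H2dot -!/(dot _ _) xE (dot_conv K0 hK) // coefs_psum //; exact: ell2_bseq.
Qed.

Lemma mult_form u : H2 u ->
  qre (H2dot (star h (mult_adj h u)) u) = nrm2 (adjs (coefs h) (coefs u)).
Proof.
move=> hu; have /H2P[_ [Y uY]] := hu.
have ea : ell2 (adjs (coefs h) (coefs u)) by exists (K * Y); exact: adjs_nle.
have ad : is_adjoint (@H2 R) (@H2dot R) (@H2 R) (@H2dot R) (star h) (mult_adj h).
  apply: (xgetPex _ (P := [set S | is_adjoint (@H2 R) (@H2dot R) (@H2 R) (@H2dot R) (star h) S])).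
  by eexists; exact: mult_is_adjoint.
have [h1 h2] := ad u hu; have [g1 g2] := mult_is_adjoint hu.
have e : coefs (mult_adj h u) = adjs (coefs h) (coefs u).
  apply/funext => l.
  have bd : ell2 (dirac (R := R) l) by exists 1; exact: nle_dirac.
  have hx := H2_psum bd; have := h2 _ hx; rewrite g2 //.
  rewrite /H2dot -!/(dot _ _) !coefs_psum ?dot_dirac //; exact: ell2_bseq.
rewrite h2 // /H2dot -/(dot _ _) e dot_self //.
Qed.
End Single.

(** Both quadratic forms are squared norms of adjoints. In [poly_ineq_ell2], the bound [rho]
    dominates the form of the row multiplier in one direction and is taken equal to it in the
    other. *)
Lemma ineq_poly L f (K : R) h Kh (gamma : R) : 0 < gamma -> 0 < K -> rowb (fam L f) K ->
  row_coefs (fam L f) -> 0 < Kh -> mulb (coefs h) Kh ->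
  op_le (fun u => star h (mult_adj h u))
        (fun u q => gamma ^+ 2 *: row_mult L f (row_mult_adj L f u) q) <->
  poly_ineq (gamma ^+ 2) (fam L f) (coefs h).
Proof.
move=> g0 K0 fK f1 Kh0 hK; rewrite (poly_ineq_ell2 _ K0 fK Kh0 hK) ?exprn_gt0 //.
have er j u : H2 u -> nle (fam L (row_adjoint L f u) j) (K * nrm2 (coefs u)).
  move=> hu; have /H2P[_ ey] := hu.
  by apply: fam_nle; apply: (fam_row_adjoint_le K0 fK hu); exact: nle_nrm2.
have fa u j : H2 u -> fam L (row_adjoint L f u) j = adjs (fam L f j) (coefs u).
  move=> hu; rewrite (fam_row_adjoint K0 fK) //; case: ifPn => // jL.
  apply/funext => l; apply/esym/(@cvg_lim H) => //.
  rewrite (_ : (fun N => _) = fun=> 0); first exact: cvg_cst.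
  by apply/funext => N; rewrite /bs big1 // => k _; rewrite /fam (negbTE jL) qconj0 mul0r.
split=> [hle y rho ey hr|hP u hu].
  have hu := H2_psum ey; have cu : coefs (psum_fun y) = y by rewrite coefs_psum //; exact: ell2_bseq.
  have := hle _ hu; rewrite (mult_form Kh0 hK) // cu => /le_trans; apply.
  have [lim ->] := row_form K0 fK f1 (gamma ^+ 2) hu.
  rewrite qreZ ler_wpM2l ?sqr_ge0 //; apply: (cvg_le_near lim); apply: nearW => n.
  apply: (cvg_le_near (rcvg_sum (n := n) (fun j => nrm2_cvg (ex_intro _ _ (er j _ hu))))).
  by apply: nearW => N; under eq_bigr do under eq_bigr do rewrite fa // cu; exact: hr.
rewrite (mult_form Kh0 hK) //; have [lim ->] := row_form K0 fK f1 (gamma ^+ 2) hu.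
rewrite qreZ; apply: hP => [|J N]; first by have /H2P[] := hu.
have nd : nondecreasing_seq (series (fun j => nrm2 (fam L (row_adjoint L f u) j))).
  by apply: nondecreasing_series => n _ _; apply: nle_ge0; apply: nle_nrm2; exists (K * nrm2 (coefs u)); exact: er.
have c : cvgn (series (fun j => nrm2 (fam L (row_adjoint L f u) j))) by apply/cvg_ex; eexists; exact: lim.
have := nondecreasing_cvgn_le nd c J; rewrite (cvg_lim _ lim) //; apply: le_trans.
apply: ler_sum => j _; rewrite -fa //; apply: nle_nrm2; exists (K * nrm2 (coefs u)); exact: er.
Qed.

End Inequality.

(** * The matrix realization *)

Section Realization.
Context {R : realType}.
Local Notation H := (quat R).
Variables I J : H.
Hypotheses (hI : imag_unit I) (hJ : imag_unit J) (hIJ : I * J = - (J * I)).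
Implicit Types (p q u z c : H) (v w : 'cV[H]_2).

Lemma sliceP q : slice I q <-> cI I q.
Proof.
split=> [[x [y ->]]|/(ciE hI) ->]; first exact: (cI_ci I x y).
by exists (qre q), (yI I q).
Qed.

Lemma cI_J z : cI I z -> J * z = qconj z * J.
Proof.
move=> cz; rewrite (ciE hI cz) ci_conj // /slice_point mulrDl mulrDr -!scalerAl -!scalerAr mul1r mulr1.
by rewrite hIJ scalerN scaleNr opprK.
Qed.

Lemma half_double (q : H) : 2^-1 *: (q + q) = q.
Proof. by apply: quatP => /=; field. Qed.

(** The component G of the splitting: the anticommuting part of q is G J, and the inverse of J is -
    J. *)
Definition spl2 q : H := - (npart I q * J).

Lemma spl2_cI q : cI I (spl2 q).
Proof.
apply: cI_N; rewrite /cI mulrA (npart_acomm hI) mulNr -[RHS]mulrA.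
have -> : J * I = - (I * J) by rewrite hIJ opprK.
by rewrite mulrN mulrA.
Qed.

Lemma ppart_cI q : cI I (ppart I q).
Proof. exact: ppart_comm. Qed.

Lemma spl_eq q : q = ppart I q + spl2 q * J.
Proof. by rewrite /spl2 mulNr -mulrA hJ mulrN1 opprK -pn_split. Qed.

Lemma slice_splitE q : slice_split I J q = (ppart I q, spl2 q).
Proof.
have ex : exists p : H * H, [set p : H * H | [/\ slice I p.1, slice I p.2 & q = p.1 + p.2 * J]] p.
  exists (ppart I q, spl2 q); split=> /=; first exact/sliceP/ppart_cI.
    exact/sliceP/spl2_cI.
  exact: spl_eq.
have := xgetPex (0, 0) ex; rewrite -/(slice_split I J q).
case: (slice_split I J q) => p1 p2 [/= /sliceP c1 /sliceP c2 e].
  have E : ppart I q - p1 = (p2 - spl2 q) * J.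
  by apply/eqP; rewrite mulrBl subr_eq addrAC [p2 * J + p1]addrC -e {2}(spl_eq q) addrK.
have ca := cI_D (ppart_cI q) (cI_N c1); have cb := cI_D c2 (cI_N (spl2_cI q)).
move: E ca cb; set a := ppart I q - p1; set b := p2 - spl2 q => E ca cb.
(* As an element of the slice [a] commutes with I; as an element of C_I J it anticommutes with I. *)
have a0 : a = 0.
  have h : a * I = - (a * I).
    by rewrite -{1}ca {1}E mulrA cb -mulrA hIJ mulrN mulrA -E.
  have : 2 *: (a * I) = 0 by rewrite scaler_nat mulr2n {1}h addNr.
  move/eqP; rewrite scaler_eq0 pnatr_eq0 /= => /eqP/(congr1 (fun x => x * I)).
  by rewrite -mulrA hI mulrN1 mul0r => /eqP; rewrite oppr_eq0 => /eqP.
have b0 : b = 0.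
  have : b * J * J = 0 by rewrite -E a0 mul0r.
  by rewrite -mulrA hJ mulrN1 => /eqP; rewrite oppr_eq0 => /eqP.
by congr (_, _); apply/eqP; [rewrite eq_sym -subr_eq0 -/a a0|rewrite -subr_eq0 -/b b0].
Qed.

(* The quaternion of a vector of C_I^2 for which the realization becomes right
   evaluation, see [realiz_lim]. *)
Definition dvec v : H := v 0 0 - qconj (v 1 0) * J.

Lemma C2P v : C2 I v <-> cI I (v 0 0) /\ cI I (v 1 0).
Proof.
split=> [h|[h0 h1] i]; first by split; apply/sliceP; exact: h.
apply/sliceP; case: i => [[|[|//]] Hi].
  by rewrite (_ : Ordinal Hi = 0) //; exact: val_inj.
by rewrite (_ : Ordinal Hi = 1) //; exact: val_inj.
Qed.

Lemma dvecE v : C2 I v -> ppart I (dvec v) = v 0 0 /\ spl2 (dvec v) = - qconj (v 1 0).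
Proof.
move=> /C2P[c0 c1]; have := slice_splitE (dvec v).
set d := dvec v; suff -> : slice_split I J d = (v 0 0, - qconj (v 1 0)) by move=> h; split; [have := congr1 fst h|have := congr1 snd h] => /= ->.
have e : d = v 0 0 + (- qconj (v 1 0)) * J by rewrite mulNr.
rewrite slice_splitE; congr (_, _).
  rewrite e /ppart mulrDr mulrDl c0 (qII hI) mulrA.
  have ck : I * (- qconj (v 1 0)) = - qconj (v 1 0) * I by apply: cI_N; apply: cI_conj.
  move: (- qconj (v 1 0)) ck => k ck.
  rewrite ck -[k * I * J]mulrA hIJ mulrN mulrA mulNr (qII hI) opprK opprD opprK.
  by rewrite addrACA subrr addr0 half_double.
rewrite e /spl2 /npart mulrDr mulrDl c0 (qII hI) mulrA.
have ck : I * (- qconj (v 1 0)) = - qconj (v 1 0) * I by apply: cI_N; apply: cI_conj.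
move: (- qconj (v 1 0)) ck => k ck.
rewrite ck -[k * I * J]mulrA hIJ mulrN mulrA mulNr (qII hI) opprK.
rewrite addrACA subrr add0r half_double.
by rewrite -mulrA hJ mulrN1 opprK.
Qed.

(** The two summands of [dvec v] are its commuting and anticommuting parts, hence orthogonal. With
    [dvec_onto] this identifies C_I^2 isometrically with H, so operator norms are computed on
    quaternions. *)
Lemma qsqn_dvec v : C2 I v -> C2normsq v = qsqn (dvec v).
Proof.
move=> hv; have [e1 e2] := dvecE hv.
have := qsqn_split hI (dvec v); rewrite e1.
have -> : qsqn (npart I (dvec v)) = qsqn (spl2 (dvec v)).
  by rewrite /spl2 qsqnN qsqnM (qsqnI hJ) mulr1.
rewrite e2 qsqnN qsqn_conj => <-.
by rewrite /C2normsq big_ord_recl big_ord1 !normq2; congr (_ + qsqn (v _ _)); exact: val_inj.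
Qed.

Lemma dvecD v w : dvec (v + w) = dvec v + dvec w.
Proof. by rewrite /dvec !mxE qconjD mulrDl opprD addrACA. Qed.
(** Scalars of C_I become right factors; the conjugate in [dvec] compensates the passage of c across
    J. *)
Lemma dvecZ c v : cI I c -> C2 I v -> dvec (c *: v) = dvec v * c.
Proof.
move=> cc /C2P[c0 c1]; rewrite /dvec !mxE qconjM mulrBl (cI_comm hI cc c0); congr (_ - _).
by rewrite -!mulrA (cI_J cc).
Qed.
Lemma dvecN v : dvec (- v) = - dvec v.
Proof. by rewrite /dvec !mxE qconjN mulNr opprB opprK addrC. Qed.

Lemma dvec_onto u : exists2 v, C2 I v & dvec v = u.
Proof.
exists (\col_i (if i == 0 then ppart I u else - qconj (spl2 u))).
  apply/C2P; rewrite !mxE /=; split; first exact: ppart_cI.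
  by apply: cI_N; apply: cI_conj => //; exact: spl2_cI.
by rewrite /dvec !mxE /= qconjN qconjK mulNr opprK -spl_eq.
Qed.

Lemma C2D v w : C2 I v -> C2 I w -> C2 I (v + w).
Proof. by move=> /C2P[a b] /C2P[c d]; apply/C2P; rewrite !mxE; split; exact: cI_D. Qed.
Lemma C2Z c v : cI I c -> C2 I v -> C2 I (c *: v).
Proof. by move=> cc /C2P[a b]; apply/C2P; rewrite !mxE; split; exact: cI_M. Qed.
Lemma C2N v : C2 I v -> C2 I (- v).
Proof. by move=> /C2P[a b]; apply/C2P; rewrite !mxE; split; exact: cI_N. Qed.

Lemma realiz_row (f : H -> H) z v :
  (realiz I J f z *m v) 0 0 = ppart I (f z) * v 0 0 + spl2 (f z) * v 1 0 /\
  (realiz I J f z *m v) 1 0 = - qconj (spl2 (f (qconj z))) * v 0 0 + qconj (ppart I (f (qconj z))) * v 1 0.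
Proof.
have e1 : lift ord0 ord0 = 1 :> 'I_2 by exact: val_inj.
have e0 : ord0 = 0 :> 'I_2 by exact: val_inj.
by split; rewrite !mxE big_ord_recl big_ord1 !mxE ?slice_splitE /= ?e1 ?e0 // /sharp !slice_splitE.
Qed.

Lemma realiz_C2 (f : H -> H) z v : C2 I v -> C2 I (realiz I J f z *m v).
Proof.
move=> /C2P[c0 c1]; apply/C2P; have [-> ->] := realiz_row f z v.
have a q := ppart_cI q; have b q := spl2_cI q.
by split; apply: cI_D; apply: cI_M => //; first apply: cI_N; exact: cI_conj.
Qed.

(** The quaternion of the realization applied to v, as a function of the only data of f that enter,
    p = f z and p' = f (qconj z). It is additive in the pair (p, p'), so the terms of a series can
    be inserted one at a time. *)
Definition theta v p p' : H := ppart I p * v 0 0 + spl2 p * v 1 0 +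
  qconj (v 0 0) * (spl2 p' * J) - qconj (v 1 0) * (ppart I p' * J).

Lemma theta_realiz (f : H -> H) z v : dvec (realiz I J f z *m v) = theta v (f z) (f (qconj z)).
Proof.
rewrite /dvec; have [-> ->] := realiz_row f z v.
rewrite /theta; move: (ppart _ _) (spl2 (f z)) (ppart _ _) (spl2 _) => A B A' B'.
by rewrite qconjD !qconjM qconjN !qconjK mulrN mulrDl mulNr opprD opprK !mulrA addrA.
Qed.

Lemma ppart_Ml c q : cI I c -> ppart I (c * q) = c * ppart I q.
Proof. by move=> cc; rewrite /ppart -scalerAr mulrBr !mulrA cc. Qed.
Lemma npart_Ml c q : cI I c -> npart I (c * q) = c * npart I q.
Proof. by move=> cc; rewrite /npart -scalerAr mulrDr !mulrA cc. Qed.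
Lemma spl2_Ml c q : cI I c -> spl2 (c * q) = c * spl2 q.
Proof. by move=> cc; rewrite /spl2 npart_Ml // -mulrA mulrN. Qed.
Lemma ppartD p q : ppart I (p + q) = ppart I p + ppart I q.
Proof. by rewrite /ppart -scalerDr mulrDr mulrDl opprD addrACA. Qed.
Lemma npartD p q : npart I (p + q) = npart I p + npart I q.
Proof. by rewrite /npart -scalerDr mulrDr mulrDl addrACA. Qed.
Lemma spl2D p q : spl2 (p + q) = spl2 p + spl2 q.
Proof. by rewrite /spl2 npartD mulrDl opprD. Qed.

(** One term of the series, with c = z^m in mind: the four products recombine because elements of
    C_I commute with each other and are conjugated when they pass J. The conjugate argument in the
    second row of the realization is what brings all occurrences of c to the right. *)
Lemma theta_term v c q : C2 I v -> cI I c -> theta v (c * q) (qconj c * q) = q * dvec v * c.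
Proof.
move=> /C2P[c0 c1] cc; have cc' := cI_conj hI cc.
rewrite /theta !ppart_Ml // !spl2_Ml // {5}(spl_eq q) /dvec.
have ca := ppart_cI q; have cb := spl2_cI q.
move: (ppart I q) (spl2 q) ca cb => A B ca cb.
move: (v 0 0) (v 1 0) c0 c1 => v0 v1 c0 c1.
have c0' := cI_conj hI c0; have c1' := cI_conj hI c1.
rewrite !mulrDl !mulrDr !mulrDl !mulrN !mulNr.
have e1 : A * v0 * c = c * A * v0 by rewrite (cI_comm hI (cI_M ca c0) cc) mulrA.
have e2 : A * (qconj v1 * J) * c = qconj v1 * (qconj c * A * J).
  rewrite -!mulrA (cI_J cc) !mulrA; congr (_ * J).
  by rewrite (cI_comm hI ca c1') -!mulrA (cI_comm hI ca cc').
have e3 : B * J * v0 * c = qconj v0 * (qconj c * B * J).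
  rewrite -[B * J * v0]mulrA (cI_J c0) -!mulrA (cI_J cc) !mulrA; congr (_ * J).
  by rewrite (cI_comm hI cb c0') -!mulrA (cI_comm hI cb cc').
have e4 : B * J * (qconj v1 * J) * c = - (c * B * v1).
  rewrite mulrA -[B * J * qconj v1]mulrA (cI_J c1') qconjK -!mulrA (cI_J cc).
  rewrite [J * (_ * J)]mulrA (cI_J cc') qconjK -!mulrA hJ !mulrN mulr1 mulrA; congr (- _).
  by rewrite (cI_comm hI (cI_M cb c1) cc).
rewrite e1 e2 e3 e4 opprK -!mulrA; apply: quatP => /=; ring.
Qed.

Lemma ppart_cvg (u : nat -> H) q : u @ \oo --> q -> (fun n => ppart I (u n)) @ \oo --> ppart I q.
Proof.
move=> h; rewrite /ppart; apply: cvgZl_tmp; apply: cvgB => //.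
by apply: qcvgMr; apply: qcvgMl.
Qed.
Lemma spl2_cvg (u : nat -> H) q : u @ \oo --> q -> (fun n => spl2 (u n)) @ \oo --> spl2 q.
Proof.
move=> h; rewrite /spl2; apply: cvgN; apply: qcvgMr; apply: cvgZl_tmp; apply: cvgD => //.
by apply: qcvgMr; apply: qcvgMl.
Qed.

Lemma theta_cvg v (u u' : nat -> H) p p' : u @ \oo --> p -> u' @ \oo --> p' ->
  (fun n => theta v (u n) (u' n)) @ \oo --> theta v p p'.
Proof.
move=> h h'; rewrite /theta; apply: cvgB; first apply: cvgD; first apply: cvgD.
- by apply: qcvgMr; exact: ppart_cvg.
- by apply: qcvgMr; exact: spl2_cvg.
- by apply: qcvgMl; apply: qcvgMr; exact: spl2_cvg.
- by apply: qcvgMl; apply: qcvgMr; exact: ppart_cvg.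
Qed.

(* Left multiplication by the realization is right evaluation: for f(q) = sum_m q^m b_m
   it sends the vector of u to the vector of sum_m b_m u z^m. *)
Lemma realiz_lim (f : H -> H) (b c : nat -> H) z v : C2 I v -> (forall m, cI I (c m)) ->
  series (fun m => c m * b m) @ \oo --> f z ->
  series (fun m => qconj (c m) * b m) @ \oo --> f (qconj z) ->
  series (fun m => b m * dvec v * c m) @ \oo --> dvec (realiz I J f z *m v).
Proof.
move=> hv cc h h'; rewrite theta_realiz.
have h5 := theta_cvg (v := v) h h'.
rewrite (_ : series (fun m => b m * dvec v * c m) =
  fun n => theta v (series (fun m => c m * b m) n) (series (fun m => qconj (c m) * b m) n)) //.
apply/funext => n; rewrite /series /=; elim: n => [|n IH].
  rewrite !big_nil /theta; have p0 : ppart I 0 = 0 by rewrite /ppart mulr0 mul0r subrr scaler0.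
  have s0 : spl2 0 = 0 by rewrite /spl2 /npart mulr0 mul0r addr0 scaler0 mul0r oppr0.
  by rewrite p0 s0 !mul0r !mulr0 !addr0 subrr.
rewrite !big_nat_recr //= IH -theta_term // /theta !ppartD !spl2D !mulrDl !mulrDr.
by apply: quatP => /=; ring.
Qed.

End Realization.

(** * Right evaluation and the column bound *)

Section RightEvaluation.
Context {R : realType}.
Local Notation H := (quat R).
Implicit Types (b c u : nat -> H) (q p z w v : H) (s B C D : R).

(** The weights are general: powers of z give the value, [powL] gives the derivative and [powR] the
    remainder. *)
Definition rlim b v c : H := limn (series (fun m => b m * v * c m)).
(* Right evaluation: the sum of the b_m v z^m. *)
Definition rev b v z : H := rlim b v (fun m => z ^+ m).

Lemma rlim_cvg b v c B : bseq b -> (forall n, \sum_(0 <= m < n) `|c m| <= B) ->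
  series (fun m => b m * v * c m) @ \oo --> rlim b v c.
Proof.
move=> [C bC] cB; have [] // := @series_abs_cvg R (fun m => b m * v * c m) (C * `|v| * B).
move=> n; apply: le_trans (_ : \sum_(0 <= m < n) C * `|v| * `|c m| <= _).
  by apply: ler_sum => m _; rewrite !normqM ler_wpM2r // ler_wpM2r.
by rewrite -mulr_sumr ler_wpM2l // mulr_ge0 // (bseq_ge0 bC).
Qed.

Lemma rlimE b v c (l : H) : series (fun m => b m * v * c m) @ \oo --> l -> rlim b v c = l.
Proof. by move=> h; exact: cvg_lim h. Qed.

Lemma rev_cvg b v z : bseq b -> qball z -> series (fun m => b m * v * z ^+ m) @ \oo --> rev b v z.
Proof.
move=> bb zb; apply: (@rlim_cvg _ _ _ (1 - `|z|)^-1 bb) => n.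
by under eq_bigr do rewrite normqX; apply: geo_sum; rewrite normr_ge0.
Qed.

Lemma revD b v v' z : bseq b -> qball z -> rev b (v + v') z = rev b v z + rev b v' z.
Proof.
move=> bb zb; apply: rlimE.
rewrite (_ : series _ = fun n => series (fun m => b m * v * z ^+ m) n + series (fun m => b m * v' * z ^+ m) n).
  by apply: cvgD; exact: rev_cvg.
by apply/funext => n; rewrite /series /= -big_split /=; apply: eq_bigr => m _; rewrite mulrDr mulrDl.
Qed.

Lemma revZ (t : R) b v z : bseq b -> qball z -> rev b (t *: v) z = t *: rev b v z.
Proof.
move=> bb zb; apply: rlimE.
rewrite (_ : series _ = fun n => t *: series (fun m => b m * v * z ^+ m) n).
  by apply: cvgZl_tmp; exact: rev_cvg.
by apply/funext => n; rewrite /series /= scaler_sumr; apply: eq_bigr => m _; rewrite -scalerAr -scalerAl.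
Qed.

Lemma rev0 b z : rev b 0 z = 0.
Proof.
apply: rlimE; rewrite (_ : series _ = fun=> 0); first exact: cvg_cst.
by apply/funext => n; rewrite /series /= big1 // => m _; rewrite mulr0 mul0r.
Qed.

Lemma bseq_conv b u Ls : bseq b -> (forall l, (Ls <= l)%N -> u l = 0) -> bseq (conv b u).
Proof.
move=> [D hD] u0; have D0 := bseq_ge0 hD.
exists (\sum_(0 <= l < Ls) D * `|u l|) => m.
rewrite conv_rev; apply: le_trans (ler_norm_sum _ _ _) _.
apply: le_trans (_ : \sum_(0 <= k < m.+1) (if (k < Ls)%N then D * `|u k| else 0) <= _).
  apply: ler_sum => k _; rewrite normqM; case: ltnP => kM; last by rewrite u0 // normr0 mulr0.
  by rewrite ler_wpM2r.
rewrite sum_swap_bound; apply: ler_sum => k _; case: ifP => // _.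
by rewrite mulr_ge0.
Qed.

(** In the terms b_k u_l z^(l+k) the factor z^l can be attached to u_l. Right evaluation thus turns
    the star product with a polynomial u into the evaluation of b at the value of u, for any z in
    the ball. *)
Lemma rev_conv b u Ls z : bseq b -> qball z -> (forall l, (Ls <= l)%N -> u l = 0) ->
  series (fun m => conv b u m * z ^+ m) @ \oo --> rev b (\sum_(0 <= l < Ls) u l * z ^+ l) z.
Proof.
move=> bb zb u0.
have -> : conv b u = fun m => \sum_(0 <= l < Ls) (if (l <= m)%N then b (m - l)%N * u l else 0).
  apply/funext => m; rewrite conv_rev.
  transitivity (\sum_(0 <= k < m.+1) (if (k < Ls)%N then b (m - k)%N * u k else 0)).
    by apply: eq_bigr => k _; case: ltnP => // kL; rewrite u0 // mulr0.
  by rewrite sum_swap_bound.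
elim: Ls {u0} => [|Ls IH].
  rewrite big_nil rev0 (_ : series _ = fun=> 0); first exact: cvg_cst.
  by apply/funext => n; rewrite /series /= big1 // => m _; rewrite big_nil mul0r.
rewrite big_nat_recr //= revD //.
rewrite (_ : series _ = fun n => series (fun m => (\sum_(0 <= l < Ls) (if (l <= m)%N then b (m - l)%N * u l else 0)) * z ^+ m) n +
   series (fun m => (if (Ls <= m)%N then b (m - Ls)%N * u Ls else 0) * z ^+ m) n); last first.
  apply/funext => n; rewrite /series /= -big_split /=; apply: eq_bigr => m _.
  by rewrite big_nat_recr //= mulrDl.
apply: cvgD => //; rewrite -(cvg_shiftn Ls).
rewrite (_ : (fun n => _) = series (fun m => b m * (u Ls * z ^+ Ls) * z ^+ m)); first exact: rev_cvg.
apply/funext => n; rewrite /series /=; elim: n => [|n IHn].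
  rewrite add0n big_nil big_nat big1 // => m /andP[_ mL].
  by rewrite leqNgt mL mul0r.
by rewrite addSn !big_nat_recr //= IHn leq_addl addnK addnC exprD !mulrA.
Qed.

(** Conjugation turns right evaluation at conj z into a power series at z with powers on the left,
    to which [comparison] applies. *)
Lemma col_bound_of_rev (I : H) (gamma : R) (b : nat -> nat -> H) : imag_unit I ->
  (forall j, bseq (b j)) ->
  (forall z v n, qball z -> cI I z -> \sum_(0 <= j < n) qsqn (rev (b j) v z) <= gamma ^+ 2 * qsqn v) ->
  col_bound (gamma ^+ 2) b.
Proof.
move=> hI bb hb u Ls n M u0.
have bc j : bseq (fun m => qconj (conv (b j) u m)).
  by have [D hD] := bseq_conv (bb j) u0; exists D => m; rewrite normq_conj.
suff main : \sum_(0 <= j < n) \sum_(0 <= m < M) qsqn (coefs (psum_fun (fun m => qconj (conv (b j) u m))) m) <=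
    \sum_(0 <= i < 1) \sum_(0 <= l < Ls) qsqn (gamma *: qconj (u l)).
  have -> : gamma ^+ 2 * \sum_(0 <= l < Ls) qsqn (u l) = \sum_(0 <= i < 1) \sum_(0 <= l < Ls) qsqn (gamma *: qconj (u l)).
    by rewrite big_nat1 mulr_sumr; apply: eq_bigr => l _; rewrite qsqnZ qsqn_conj.
  apply: le_trans main; apply: ler_sum => j _; apply: ler_sum => m _.
  by rewrite coefs_psum // qsqn_conj.
apply: (@comparison R I n 1 Ls M (fun j => psum_fun (fun m => qconj (conv (b j) u m))) (fun=> I)
  (fun _ l => gamma *: qconj (u l)) hI (fun j _ => psum_fun_regular (bc j)) (fun=> hI)).
move=> r t r01; have [zb cz] := cis_in_ball t hI r01.
set z := r *: slice_cis I t in zb cz *; rewrite big_nat1.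
have wb : qball (qconj z) by rewrite /qball /= normq_conj.
have cw : cI I (qconj z) by exact: cI_conj.
pose U := \sum_(0 <= l < Ls) u l * qconj z ^+ l.
have FE j : psum_fun (fun m => qconj (conv (b j) u m)) z = qconj (rev (b j) U (qconj z)).
  apply: qcvg_unique (qpseries_cvg (bc j) zb) _.
  rewrite (_ : qpseries _ z = fun N => qconj (series (fun m => conv (b j) u m * qconj z ^+ m) N)).
    by apply: qcvg_conj; exact: (rev_conv (bb j) wb u0).
  apply/funext => N; rewrite /qpseries /series /= qconj_sum; apply: eq_bigr => m _.
  by rewrite qconjM qconjX qconjK.
under eq_bigr do rewrite FE qsqn_conj.
apply: le_trans (hb _ U n wb cw) _.
rewrite le_eqVlt; apply/orP; left; apply/eqP; rewrite -qsqnZ -qsqn_conj; congr qsqn.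
rewrite qconjZ /U qconj_sum scaler_sumr; apply: eq_bigr => l _; rewrite qconjM qconjX qconjK.
by rewrite scalerAr.
Qed.

(** The test sequences below are truncated geometric sequences; this lets their length tend to
    infinity. *)
Lemma geo_final (s X D : R) : 0 <= s < 1 ->
  (forall L, X * (\sum_(0 <= l < L) s ^+ l) <= D / (1 - s)) -> X <= D.
Proof.
move=> /andP[s0 s1] h; have s1' : 0 < 1 - s by rewrite subr_gt0.
have k L : X * (1 - s ^+ L) <= D.
  have := h L; rewrite ler_pdivlMr // -mulrA; congr (_ * _ <= _).
  by have := subrX1 s L; rewrite big_mkord; lra.
have lim : (fun L => X * (1 - s ^+ L)) @ \oo --> X * (1 - 0).
  apply: cvgMl_tmp; apply: cvgB; first exact: cvg_cst.
  by apply: cvg_expr; rewrite ger0_norm.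
by rewrite -[X]mulr1 -[1]subr0; apply: (cvg_le_near lim); exact: nearW.
Qed.

Lemma qsqnX q m : qsqn (q ^+ m) = qsqn q ^+ m.
Proof. by elim: m => [|m IH]; rewrite ?expr0 ?qsqn1 // !exprS qsqnM IH. Qed.

Lemma qsqn_lt1 q : qball q -> 0 <= qsqn q < 1.
Proof. by move=> qb; rewrite qsqn_ge0 -normq2 expr_lt1. Qed.

Lemma qsqnX_sum q M : qball q -> \sum_(0 <= m < M) qsqn (q ^+ m) <= (1 - qsqn q)^-1.
Proof. by move=> qb; under eq_bigr do rewrite qsqnX; apply: geo_sum; exact: qsqn_lt1. Qed.

Lemma col_bound_bseq (g2 : R) (b : nat -> nat -> H) j : col_bound g2 b -> bseq (b j).
Proof.
move=> hb; apply: ell2_bseq; exists g2 => M; apply: le_trans (col_bound_coefs j.+1 M hb).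
by rewrite big_nat_recr //= lerDr; apply: sumr_ge0 => i _; exact: sum_qsqn_ge0.
Qed.

Lemma geo_cancel (S X D e : R) : 0 <= S -> 0 <= D -> 0 < e -> S ^+ 2 * X <= D * S / e -> X * S <= D / e.
Proof.
rewrite le_eqVlt => /predU1P[<- D0 e0 _|S0 D0 e0 h]; first by rewrite mulr0 divr_ge0 // ltW.
by rewrite -(ler_pM2l S0); move: h; congr (_ <= _); ring.
Qed.

(** Multipliers are bounded at a point by testing them on the reproducing kernel of that point:
    Cauchy-Schwarz against the powers of z loses exactly the factor 1 / (1 - |z|^2) that the kernel
    gains. *)
Lemma col_bound_rev (g2 : R) (b : nat -> nat -> H) z v n : 0 <= g2 -> col_bound g2 b -> qball z ->
  \sum_(0 <= j < n) qsqn (rev (b j) v z) <= g2 * qsqn v.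
Proof.
move=> g0 hb zb; have bb j := col_bound_bseq j hb; have s01 := qsqn_lt1 zb.
apply: (geo_final s01) => Ls; set S := \sum_(0 <= l < Ls) _.
have S0 : 0 <= S by apply: sumr_ge0 => l _; rewrite exprn_ge0 ?qsqn_ge0.
have e0 : 0 < 1 - qsqn z by move: s01 => /andP[_]; rewrite subr_gt0.
apply: geo_cancel => //; first by rewrite mulr_ge0 ?qsqn_ge0.
(* Truncated kernel at z in the direction v: its right evaluation at z is [S *: v], and its squared
   norm is S |v|^2. *)
pose u l := if (l < Ls)%N then v * qconj z ^+ l else 0.
have u0 l : (Ls <= l)%N -> u l = 0 by rewrite /u ltnNge => ->.
have U : \sum_(0 <= l < Ls) u l * z ^+ l = S *: v.
  rewrite /S scaler_suml; apply: eq_big_nat => l /andP[_ lL]; rewrite /u lL -mulrA -qconjX qconj_mul qsqnX.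
  by rewrite -scalerAr mulr1.
have uS : \sum_(0 <= l < Ls) qsqn (u l) = qsqn v * S.
  rewrite /S mulr_sumr; apply: eq_big_nat => l /andP[_ lL].
  by rewrite /u lL qsqnM qsqnX qsqn_conj.
have lim j := rev_conv (bb j) zb u0.
rewrite mulr_sumr.
have -> : \sum_(0 <= j < n) S ^+ 2 * qsqn (rev (b j) v z) = \sum_(0 <= j < n) qsqn (rev (b j) (\sum_(0 <= l < Ls) u l * z ^+ l) z).
  by apply: eq_bigr => j _; rewrite U revZ // qsqnZ.
apply: (cvg_le_near (rcvg_sum (n := n) (fun j => qcvg_qsqn (lim j)))); apply: nearW => N.
apply: le_trans (_ : \sum_(0 <= j < n) (\sum_(0 <= m < N) qsqn (conv (b j) u m)) * (1 - qsqn z)^-1 <= _).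
  apply: ler_sum => j _; apply: le_trans (qsqn_CS (conv (b j) u) (fun m => z ^+ m) 0 N) _.
  by rewrite ler_wpM2l ?sum_qsqn_ge0 //; exact: qsqnX_sum.
rewrite -mulr_suml ler_wpM2r ?invr_ge0 ?(ltW e0) //.
by apply: le_trans (hb u Ls n N u0) _; rewrite uS mulrA.
Qed.

(** Here the evaluation is the usual one, with powers on the left. Where G = g(q) is not zero, q^l G
    = G p^l with p = G^-1 q G, so (g * u)(q) is G times the value of u at p, and the kernel at p is
    the test sequence. This shows that the solutions are bounded on the ball. *)
Lemma col_bound_psum (g2 : R) (b : nat -> nat -> H) j q : 0 <= g2 -> col_bound g2 b -> qball q ->
  qsqn (psum_fun (b j) q) <= g2.
Proof.
move=> g0 hb qb; have bb := col_bound_bseq j hb; have s01 := qsqn_lt1 qb.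
set G := psum_fun (b j) q; case: (eqVneq G 0) => [->|G0]; first by rewrite qsqn0.
apply: (geo_final s01) => Ls; set S := \sum_(0 <= l < Ls) _.
have S0 : 0 <= S by apply: sumr_ge0 => l _; rewrite exprn_ge0 ?qsqn_ge0.
have e0 : 0 < 1 - qsqn q by move: s01 => /andP[_]; rewrite subr_gt0.
apply: geo_cancel => //.
pose p := qinv G * q * G.
have pG l : q ^+ l * G = G * p ^+ l.
  elim: l => [|l IH]; first by rewrite !expr0 mul1r mulr1.
  by rewrite exprS -mulrA IH exprS !mulrA qmulV // mul1r.
have ps : qsqn p = qsqn q.
  have := congr1 (@qsqn R) (qmulVl G0); rewrite qsqnM qsqn1 => h.
  by rewrite /p !qsqnM mulrAC h mul1r.
pose u l := if (l < Ls)%N then qconj p ^+ l else 0.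
have u0 l : (Ls <= l)%N -> u l = 0 by rewrite /u ltnNge => ->.
have uS : \sum_(0 <= l < Ls) qsqn (u l) = S.
  by apply: eq_big_nat => l /andP[_ lL]; rewrite /u lL qsqnX qsqn_conj ps.
have lim := has_ps_conv_fin (has_psum bb) u0 qb.
have E : \sum_(0 <= l < Ls) q ^+ l * psum_fun (b j) q * u l = S *: G.
  rewrite /S scaler_suml; apply: eq_big_nat => l /andP[_ lL].
  by rewrite -/G pG /u lL -mulrA -qconjX qmul_conj qsqnX ps -scalerAr mulr1.
rewrite -qsqnZ -E; apply: (cvg_le_near (qcvg_qsqn lim)); apply: nearW => N.
apply: le_trans (qsqn_CS (fun m => q ^+ m) (conv (b j) u) 0 N) _.
rewrite mulrC; apply: ler_pM; rewrite ?sum_qsqn_ge0 //; last exact: qsqnX_sum.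
rewrite -uS; apply: le_trans (hb u Ls j.+1 N u0).
by rewrite big_nat_recr //= lerDr; apply: sumr_ge0 => i _; exact: sum_qsqn_ge0.
Qed.

(** The sum of the |c m|^2 is at most the square of the sum of the |c m|, the quantity controlled
    for [powL] and [powR]; the bound is uniform in the number of components. *)
Lemma rlim_bound (g2 : R) (b : nat -> nat -> H) v c B n : 0 <= g2 -> col_bound g2 b ->
  (forall N, \sum_(0 <= m < N) `|c m| <= B) ->
  \sum_(0 <= j < n) qsqn (rlim (b j) v c) <= g2 * qsqn v * B ^+ 2.
Proof.
move=> g0 hb cB; have bb j := col_bound_bseq j hb.
have B0 : 0 <= B by have := cB 0%N; rewrite big_nil.
have c2 N : \sum_(0 <= m < N) qsqn (v * c m) <= qsqn v * B ^+ 2.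
  under eq_bigr do rewrite qsqnM; rewrite -mulr_sumr ler_wpM2l ?qsqn_ge0 //.
  apply: le_trans (_ : (\sum_(0 <= m < N) `|c m|) ^+ 2 <= _); last first.
    by rewrite ler_pXn2r ?nnegrE ?sumr_ge0.
  elim: N => [|N IH]; first by rewrite !big_nil expr0n.
  rewrite !big_nat_recr //= -normq2; move: IH.
  have : 0 <= \sum_(0 <= m < N) `|c m| by apply: sumr_ge0.
  have := normr_ge0 (c N); move: `|c N| (\sum_(0 <= m < N) `|c m|) (\sum_(0 <= m < N) qsqn (c m)) => x y t.
  by rewrite expr2 sqrrD; nra.
have lim j : series (fun m => b j m * v * c m) @ \oo --> rlim (b j) v c by exact: rlim_cvg (bb j) cB.
apply: (cvg_le_near (rcvg_sum (n := n) (fun j => qcvg_qsqn (lim j)))); apply: nearW => N.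
apply: le_trans (_ : \sum_(0 <= j < n) (\sum_(0 <= m < N) qsqn (b j m)) * (qsqn v * B ^+ 2) <= _).
  apply: ler_sum => j _; rewrite /series /=; under eq_bigr do rewrite -mulrA.
  apply: le_trans (qsqn_CS (b j) (fun m => v * c m) 0 N) _.
  by rewrite ler_wpM2l ?sum_qsqn_ge0.
rewrite -mulr_suml -mulrA ler_wpM2r ?mulr_ge0 ?qsqn_ge0 ?sqr_ge0 //.
exact: col_bound_coefs.
Qed.

End RightEvaluation.

(** * Operator norm and holomorphy of the realization *)

Section OperatorNorm.
Context {R : realType}.
Local Notation H := (quat R).
Variables I J : H.
Hypotheses (hI : imag_unit I) (hJ : imag_unit J) (hIJ : I * J = - (J * I)).
Implicit Types (L : set nat) (T : @colop R) (v w : 'cV[H]_2).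

Lemma sqrte_le (x : \bar R) (g : R) : (0 <= x)%E -> 0 <= g ->
  (x `^ 2^-1 <= g%:E)%E = (x <= (g ^+ 2)%:E)%E.
Proof.
case: x => [r|_ g0|//]; last by rewrite poweRyr // !leye_eq.
rewrite lee_fin => r0 g0; rewrite poweR_EFin powR12_sqrt // !lee_fin.
by rewrite -(@ler_pXn2r _ 2) ?nnegrE ?sqrtr_ge0 // sqr_sqrtr.
Qed.

Lemma C2normsq_ge0 v : 0 <= C2normsq v.
Proof. by apply: sumr_ge0 => i _; exact: sqr_ge0. Qed.

Definition partial L (y : nat -> 'cV[H]_2) n : R :=
  \sum_(0 <= j < n) (if j \in L then C2normsq (y j) else 0).

Lemma opnorm_leP L T (g : R) : 0 <= g -> (opnorm I L T <= g%:E)%E <->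
  forall v, C2 I v -> C2normsq v <= 1 -> forall n, partial L (T v) n <= g ^+ 2.
Proof.
move=> g0; have P v : (ell2normsq L (T v) `^ 2^-1 <= g%:E)%E <-> forall n, partial L (T v) n <= g ^+ 2.
  rewrite sqrte_le //; last by apply: esum_ge0 => j _; rewrite lee_fin C2normsq_ge0.
  by apply: esum_leP => j _; exact: C2normsq_ge0.
split=> [h v hv v1|h].
  by apply/P; apply: le_trans h; apply: ereal_sup_ubound; exists v.
by apply: ge_ereal_sup => _ [v [hv v1] <-]; apply/P; exact: h.
Qed.

Lemma ell2normsq_fin L (y : nat -> 'cV[H]_2) : (ell2normsq L y < +oo)%E <-> exists C, forall n, partial L y n <= C.
Proof. by apply: esum_fin => j _; exact: C2normsq_ge0. Qed.

Lemma cV2P v w : v 0 0 = w 0 0 -> v 1 0 = w 1 0 -> v = w.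
Proof.
move=> h0 h1; apply/colP => -[[|[|//]] Hi].
  by rewrite (_ : Ordinal Hi = 0) //; exact: val_inj.
by rewrite (_ : Ordinal Hi = 1) //; exact: val_inj.
Qed.

Lemma realiz_lin (f : H -> H) z c v w : slice I c ->
  realiz I J f z *m (c *: v + w) = c *: (realiz I J f z *m v) + realiz I J f z *m w.
Proof.
move=> /(sliceP hI) cc; rewrite mulmxDr; congr (_ + _).
have a q := ppart_cI hI q; have b q := spl2_cI hI hIJ q.
have [e0 e1] := realiz_row hI hJ hIJ f z v.
have [e0' e1'] := realiz_row hI hJ hIJ f z (c *: v).
apply: cV2P; rewrite [in RHS]mxE ?e0 ?e1 ?e0' ?e1' !mxE mulrDr !mulrA; congr (_ * _ + _ * _).
- exact: (cI_comm hI).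
- exact: (cI_comm hI).
- by apply: (cI_comm hI) => //; apply: cI_N; exact: cI_conj.
- by apply: (cI_comm hI) => //; exact: cI_conj.
Qed.

Lemma bounded_realiz L (f : nat -> H -> H) z (G : R) : 0 <= G ->
  (forall v, C2 I v -> forall n, partial L (fun j => realiz I J (f j) z *m v) n <= G * C2normsq v) ->
  bounded_op I L (fun v j => realiz I J (f j) z *m v).
Proof.
move=> G0 hG; split=> [v hv|c v w hc hv hw j _|].
- split=> [j _|]; first exact: (realiz_C2 hI hJ hIJ).
  by apply/ell2normsq_fin; exists (G * C2normsq v); exact: hG.
- exact: realiz_lin.
apply: le_lt_trans (ltry (Num.sqrt G)); apply/opnorm_leP; first exact: sqrtr_ge0.
move=> v hv v1 n; rewrite sqr_sqrtr //; apply: le_trans (hG v hv n) _.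
by rewrite -[leRHS]mulr1 ler_wpM2l.
Qed.

Lemma discP z : disc I z <-> qball z /\ cI I z.
Proof. by split=> -[zb /(sliceP hI) cz]. Qed.

Lemma realiz_rev (f : H -> H) (b : nat -> H) z v : has_ps f b -> disc I z -> C2 I v -> bseq b ->
  dvec J (realiz I J f z *m v) = rev b (dvec J v) z.
Proof.
move=> hf /discP[zb cz] hv bb.
have zb' : qball (qconj z) by rewrite /qball /= normq_conj.
apply: qcvg_unique (rev_cvg (v := dvec J v) bb zb).
apply: (realiz_lim hI hJ hIJ (c := fun m => z ^+ m)) => //; first by move=> m; exact: cI_X.
  exact: hf.
rewrite (_ : (fun m => _) = fun m => qconj z ^+ m * b m); first exact: hf.
by apply/funext => m; rewrite qconjX.
Qed.

Lemma partial_rlim L (y : nat -> 'cV[H]_2) (x : nat -> H) n :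
  (forall j, L j -> C2 I (y j) /\ dvec J (y j) = x j) ->
  partial L y n <= \sum_(0 <= j < n) qsqn (x j).
Proof.
move=> h; apply: ler_sum => j _; case: ifP; last by rewrite qsqn_ge0.
by rewrite inE => /h[c e]; rewrite (qsqn_dvec hI hJ hIJ c) e.
Qed.

(** The operator norm tests the unit ball of C_I^2; surjectivity of [dvec] and homogeneity carry the
    bound to every quaternion, as [col_bound_of_rev] requires. *)
Lemma col_bound_of_Psi L (g : nat -> H -> H) (gamma : R) : 0 < gamma ->
  (forall j, L j -> Hinf (g j)) -> (Hinf_op_norm I L (Psi I J g) <= gamma%:E)%E ->
  (forall j, bseq (fam L g j)) ->
  col_bound (gamma ^+ 2) (fam L g).
Proof.
move=> g0 hg hn bb; apply: (col_bound_of_rev hI bb) => z u n zb cz.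
have dz : disc I z by apply/discP.
have hz : (opnorm I L (Psi I J g z) <= gamma%:E)%E.
  by apply: le_trans hn; apply: ereal_sup_ubound; exists z.
have key u' : qsqn u' <= 1 -> \sum_(0 <= j < n) qsqn (rev (fam L g j) u' z) <= gamma ^+ 2.
  have [v hv <-] := dvec_onto hI hJ hIJ u'; rewrite -(qsqn_dvec hI hJ hIJ hv) => v1.
  have := (opnorm_leP L (Psi I J g z) (ltW g0)).1 hz v hv v1 n; apply: le_trans.
  apply: ler_sum => j _; case: ifPn => jL.
    have Lj : L j by rewrite inE in jL.
    have hps : has_ps (g j) (fam L g j) by rewrite /fam jL; apply: has_ps_coefs; have [] := hg j Lj.
    by rewrite (qsqn_dvec hI hJ hIJ (realiz_C2 hI hJ hIJ _ _ hv)) (realiz_rev hps dz hv (bb j)).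
  rewrite (_ : rev _ _ _ = 0) ?qsqn0 //; apply: rlimE.
  rewrite (_ : series _ = fun=> 0); first exact: cvg_cst.
  by apply/funext => N; rewrite /series /= big1 // => m _; rewrite /fam (negbTE jL) !mul0r.
case: (eqVneq u 0) => [->|u0].
  by rewrite qsqn0 mulr0 big1 // => j _; rewrite rev0 qsqn0.
have nu : `|u| != 0 by rewrite normr_eq0.
have := key (`|u|^-1 *: u); rewrite qsqnZ -normq2 -exprMn mulVf // expr1n => /(_ (lexx _)).
under eq_bigr do rewrite revZ // qsqnZ.
rewrite -mulr_sumr exprVn ler_pdivrMl ?exprn_gt0 ?normr_gt0 // normq2.
by rewrite [X in _ <= X]mulrC.
Qed.

Section Derivative.
Variables (z : H) (rho : R).
Hypotheses (cz : cI I z) (rho01 : 0 <= rho < 1) (zr : `|z| <= rho).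

Lemma powL_cI m : cI I (powL z 1 m).
Proof.
elim: m => [|m IH] /=; first exact: cI_0.
by rewrite mul1r; apply: cI_D; [exact: cI_M|exact: cI_X].
Qed.

Lemma powL_conj m : qconj (powL z 1 m) = powL (qconj z) 1 m.
Proof.
elim: m => [|m IH] /=; first exact: qconj0.
rewrite !mul1r qconjD qconjX qconjM IH; congr (_ + _); rewrite -IH.
by apply: (cI_comm hI); apply: cI_conj => //; exact: powL_cI.
Qed.

Lemma powR_eq e m : cI I e -> powR z e m = (z + e) ^+ m - z ^+ m - powL z 1 m * e.
Proof.
move=> ce; rewrite /powR /powD; congr (_ - _).
rewrite -{1}[e]mulr1 powL_comm; last exact: (cI_comm hI).
by apply: (cI_comm hI) => //; exact: powL_cI.
Qed.
End Derivative.

(* The slice derivative of the sum of the q^m b_m. *)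
Definition dpsum (b : nat -> H) q : H := limn (series (fun m => powL q 1 m * b m)).

Lemma dpsum_cvg (b : nat -> H) q : bseq b -> qball q ->
  series (fun m => powL q 1 m * b m) @ \oo --> dpsum b q.
Proof.
move=> [C bC] qb; have r01 : 0 <= `|q| < 1 by rewrite normr_ge0.
by have [] := weighted_cvg bC (fun n => powL_sum 1 r01 (lexx _) n).
Qed.

Lemma realiz_dpsum (b : nat -> H) z v : disc I z -> C2 I v -> bseq b ->
  dvec J (realiz I J (dpsum b) z *m v) = rlim b (dvec J v) (powL z 1).
Proof.
move=> /discP[zb cz] hv bb.
have zb' : qball (qconj z) by rewrite /qball /= normq_conj.
have r01 : 0 <= `|z| < 1 by rewrite normr_ge0.
apply: qcvg_unique (rlim_cvg bb (fun n => powL_sum 1 r01 (lexx _) n)).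
apply: (realiz_lim hI hJ hIJ) => //; first by move=> m; exact: powL_cI.
  exact: dpsum_cvg.
rewrite (_ : (fun m => _) = fun m => powL (qconj z) 1 m * b m); first exact: dpsum_cvg.
by apply/funext => m; rewrite powL_conj.
Qed.

Lemma dvec_combo (Y1 Y2 Y3 : 'cV[H]_2) (s x1 x2 x3 : H) : cI I s ->
  C2 I Y1 -> C2 I Y2 -> C2 I Y3 -> dvec J Y1 = x1 -> dvec J Y2 = x2 -> dvec J Y3 = x3 ->
  C2 I (Y1 - Y2 - s *: Y3) /\ dvec J (Y1 - Y2 - s *: Y3) = x1 - x2 - x3 * s.
Proof.
move=> cs c1 c2 c3 <- <- <-; have c4 := C2Z hI cs c3; split.
  exact: (C2D hI (C2D hI c1 (C2N hI c2)) (C2N hI c4)).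
by rewrite !dvecD !dvecN (dvecZ hI hIJ cs c3).
Qed.

(** The derivative in operator norm is the realization of the termwise derivatives. [dvec] turns the
    remainder into right series with weights [powR], whose bound from [rlim_bound] is quadratic in w
    - z and uniform in the number of rows. *)
Lemma Psi_of_col_bound L (gamma : R) (b : nat -> nat -> H) : 0 < gamma -> col_bound (gamma ^+ 2) b ->
  Hinf_op I L (Psi I J (fun j => psum_fun (b j))) /\
  (Hinf_op_norm I L (Psi I J (fun j => psum_fun (b j))) <= gamma%:E)%E.
Proof.
move=> g0 hb; have gg : 0 <= gamma ^+ 2 by exact: sqr_ge0.
have bb j := col_bound_bseq j hb.
have evz z v n : disc I z -> C2 I v -> partial L (fun j => realiz I J (psum_fun (b j)) z *m v) n <= gamma ^+ 2 * C2normsq v.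
  move=> dz hv; have /discP[zb cz] := dz.
  apply: le_trans (_ : \sum_(0 <= j < n) qsqn (rev (b j) (dvec J v) z) <= _).
    apply: partial_rlim => j _; split; first exact: (realiz_C2 hI hJ hIJ).
    exact: (realiz_rev (has_psum (bb j)) dz hv (bb j)).
  by rewrite (qsqn_dvec hI hJ hIJ hv); exact: col_bound_rev.
have nz z : disc I z -> (opnorm I L (Psi I J (fun j => psum_fun (b j)) z) <= gamma%:E)%E.
  move=> dz; apply/opnorm_leP; first exact: ltW.
  move=> v hv v1 n; apply: le_trans (evz z v n dz hv) _.
  by rewrite -[leRHS]mulr1 ler_wpM2l.
have nn : (Hinf_op_norm I L (Psi I J (fun j => psum_fun (b j))) <= gamma%:E)%E.
  by apply: ge_ereal_sup => _ [z dz <-]; exact: nz.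
split=> //; split; last exact: le_lt_trans nn (ltry _).
  by move=> z dz; apply: (bounded_realiz gg) => v hv n; exact: evz.
move=> z dz; have /discP[zb cz] := dz; rewrite /qball /= in zb.
have z1 : 0 < 1 - `|z| by rewrite subr_gt0.
exists (fun v j => realiz I J (dpsum (b j)) z *m v).
  have r01 : 0 <= `|z| < 1 by rewrite normr_ge0.
  pose B : R := `|1 : H| / (1 - `|z|) ^+ 2.
  apply: (@bounded_realiz _ (fun j => dpsum (b j)) z (gamma ^+ 2 * B ^+ 2)).
    by rewrite mulr_ge0 ?sqr_ge0.
  move=> v hv n; apply: le_trans (_ : \sum_(0 <= j < n) qsqn (rlim (b j) (dvec J v) (powL z 1)) <= _).
    apply: partial_rlim => j _; split; first exact: (realiz_C2 hI hJ hIJ).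
    exact: realiz_dpsum.
  rewrite (qsqn_dvec hI hJ hIJ hv) mulrAC; apply: rlim_bound => // N.
  exact: powL_sum.
move=> e e0.
pose rho := (1 + `|z|) / 2.
have zr : `|z| <= rho by rewrite /rho; lra.
have rho01 : 0 <= rho < 1 by have := normr_ge0 z; rewrite /rho; move: z1 {zr}; move: `|z| => t h1 h2; lra.
have q0 : 0 < (1 - rho) ^+ 3 by rewrite exprn_gt0 // subr_gt0; case/andP: rho01.
(* The first bound keeps w within radius rho; the second makes gamma |s|^2 / (1 - rho)^3 at most e
   |s|. *)
pose d := Num.min ((1 - `|z|) / 2) (e * (1 - rho) ^+ 3 / gamma).
have d0 : 0 < d by rewrite lt_min !divr_gt0 // mulr_gt0.
apply/nbhs_ballP; exists d => //= w; rewrite -ball_normE /= distrC => wd dw.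
have /discP[wb cw] := dw.
pose s := w - z; have cs : cI I s by apply: cI_D => //; exact: cI_N.
have sd : `|s| < d by [].
have [sd1 sd2] : `|s| <= (1 - `|z|) / 2 /\ `|s| <= e * (1 - rho) ^+ 3 / gamma.
  by move: (ltW sd); rewrite le_min => /andP[].
have wr : `|z + s| <= rho by apply: le_trans (ler_normD _ _) _; rewrite /rho; move: sd1; move: `|z| `|s| => t1 t2; lra.
pose B := `|s| ^+ 2 / (1 - rho) ^+ 3.
have Bs : gamma * B <= e * `|s|.
  rewrite /B mulrA ler_pdivrMr //; move: sd2; rewrite ler_pdivlMr // -subr_ge0 => sd2.
  rewrite -subr_ge0; have := mulr_ge0 (normr_ge0 s) sd2.
  by congr (0 <= _); ring.
apply/opnorm_leP; first by rewrite mulr_ge0 // ltW.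
move=> v hv v1 n; rewrite -/s.
apply: le_trans (_ : \sum_(0 <= j < n) qsqn (rlim (b j) (dvec J v) (powR z s)) <= _).
  apply: partial_rlim => j _.
  have c1 := realiz_C2 hI hJ hIJ (psum_fun (b j)) w hv.
  have c2 := realiz_C2 hI hJ hIJ (psum_fun (b j)) z hv.
  have c3 := realiz_C2 hI hJ hIJ (dpsum (b j)) z hv.
  have e1 := realiz_rev (has_psum (bb j)) dw hv (bb j).
  have e2 := realiz_rev (has_psum (bb j)) dz hv (bb j).
  have e3 := realiz_dpsum dz hv (bb j).
  have [k1 k2] := dvec_combo cs c1 c2 c3 e1 e2 e3.
  split; first exact: k1.
  apply: (etrans k2).
  apply/esym/rlimE.
  have r01 : 0 <= `|z| < 1 by rewrite normr_ge0.
  rewrite (_ : series _ = fun N => series (fun m => b j m * dvec J v * w ^+ m) N -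
     series (fun m => b j m * dvec J v * z ^+ m) N - series (fun m => b j m * dvec J v * powL z 1 m) N * s).
    apply: cvgB; first by apply: cvgB; exact: rev_cvg.
    by apply: qcvgMr; exact: (rlim_cvg (bb j) (fun n => powL_sum 1 r01 (lexx _) n)).
  apply/funext => N; rewrite /series /= mulr_suml -!sumrB; apply: eq_bigr => m _.
  have zw : z + s = w by rewrite /s addrC subrK.
  by rewrite powR_eq // zw !mulrBr !mulrA.
apply: le_trans (rlim_bound _ _ gg hb (fun N => powR_sum rho01 zr wr N)) _.
rewrite -/B -(qsqn_dvec hI hJ hIJ hv).
apply: le_trans (_ : gamma ^+ 2 * B ^+ 2 <= _).
  by rewrite ler_wpM2r ?sqr_ge0 // -[leRHS]mulr1 ler_wpM2l.
have B0 : 0 <= B by rewrite divr_ge0 ?sqr_ge0 // ltW.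
rewrite -exprMn ler_pXn2r ?nnegrE //; first exact: mulr_ge0 (ltW g0) B0.
exact: mulr_ge0 (ltW e0) (normr_ge0 s).
Qed.

End OperatorNorm.

(** * Convergence of the series of products *)

Section UniformSeries.
Context {R : realType}.
Local Notation H := (quat R).
Implicit Types (L : set nat).

Lemma uniform_cvgI (V : pseudoMetricNormedZmodType R) (K : set H) (F : nat -> H -> V) (s : H -> V) :
  (forall e : R, 0 < e -> exists N, forall n, (N <= n)%N -> forall q, K q -> `|s q - F n q| <= e) ->
  {uniform K, F @ \oo --> s}.
Proof.
move=> h P /uniform_nbhs [E [entE sub]].
move: entE; rewrite -entourage_ballE => -[e e0 hE].
have e2 : 0 < e / 2 by rewrite divr_gt0.
have [N hN] := h (e / 2) e2; exists N => // n /= Nn.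
apply: sub => q Kq; apply: hE => /=; rewrite -ball_normE /=.
by apply: le_lt_trans (hN n Nn q Kq) _; rewrite ltr_pdivrMr // ltr_pMr // ltr1n.
Qed.

Lemma compact_in_ball (K : set H) : compactly_in qball K ->
  exists2 r : R, 0 <= r < 1 & forall q, K q -> `|q| <= r.
Proof.
move=> [Kb Kc]; have [/eqP K0|/set0P K0] := boolP (K == set0).
  by exists 0 => [|q]; rewrite ?lexx ?ltr01 // K0.
have [|c cK hc] := @compact_EVT_max H R (fun q => `|q|) K K0 Kc.
  by apply: continuous_subspaceT => q; exact: norm_continuous.
exists `|c|; first by rewrite normr_ge0; apply: Kb; rewrite inE in cK.
by move=> q Kq; apply: hc; rewrite inE.
Qed.

(** Weierstrass' test with one majorant per radius; a compact subset of the ball lies in a smaller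
    closed ball. *)
Lemma abs_unif_cvgI (u : nat -> H -> H) (M : R -> nat -> R) (C : R -> R) :
  (forall r, 0 <= r < 1 -> (forall n, \sum_(0 <= j < n) M r j <= C r) /\
     forall j q, `|q| <= r -> `|u j q| <= M r j) ->
  abs_unif_cvg_on_compacts u.
Proof.
move=> h.
have ptw q : qball q -> cvgn (series (fun j => u j q)) /\ cvgn (series (fun j => `|u j q|)).
  move=> qb; have r01 : 0 <= `|q| < 1 by rewrite normr_ge0.
  have [hC hM] := h _ r01.
  have uC n : \sum_(0 <= j < n) `|u j q| <= C `|q|.
    by apply: le_trans (hC n); apply: ler_sum => j _; exact: hM.
  split; first by have [] := @series_abs_cvg R (fun j => u j q) _ uC.
  apply: nondecreasing_is_cvgn; first by apply: nondecreasing_series => n _ _; exact: normr_ge0.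
  by exists (C `|q|) => _ [n _ <-]; exact: uC.
have tail r e : 0 <= r < 1 -> 0 < e -> exists N, forall n q, (N <= n)%N -> `|q| <= r ->
    forall k, \sum_(n <= j < k) `|u j q| <= e.
  move=> r01 e0; have [hC hM] := h r r01.
  have M0 j : 0 <= M r j.
    by apply: le_trans (normr_ge0 (u j 0)) _; apply: hM; rewrite normr0; case/andP: r01.
  have [N hN] := tail_small M0 hC e0; exists N => n q Nn qr k.
  by apply: le_trans (hN n k Nn); apply: ler_sum => j _; exact: hM.
have split_sum (V : zmodType) (F : nat -> V) n k :
    \sum_(0 <= j < n + k) F j - \sum_(0 <= j < n) F j = \sum_(n <= j < n + k) F j.
  by rewrite (big_cat_nat (leq0n n) (leq_addr k n)) /= addrAC subrr add0r.
split.
  exists (fun q => limn (series (fun j => `|u j q|))); apply/fam_cvgP => K /compact_in_ball[r r01 Kr].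
  apply: uniform_cvgI => e e0; have [N hN] := tail r e r01 e0; exists N => n Nn q Kq.
  have qb : qball q by apply: le_lt_trans (Kr q Kq) _; case/andP: r01.
  have [_ cq] := ptw q qb.
  have lim : (fun k => `|series (fun j => `|u j q|) (n + k)%N - \sum_(0 <= j < n) `|u j q| |) @ \oo -->
      `|limn (series (fun j => `|u j q|)) - \sum_(0 <= j < n) `|u j q| |.
    apply: cvg_norm; apply: cvgB; last exact: cvg_cst.
    by have := cq; rewrite /= -(cvg_shiftn n); under eq_fun do rewrite addnC.
  apply: (cvg_le_near lim); apply: nearW => k; rewrite split_sum ger0_norm; first exact: hN n q Nn (Kr q Kq) (n + k)%N.
  by apply: sumr_ge0.
exists (fun q => limn (series (fun j => u j q))); apply/fam_cvgP => K /compact_in_ball[r r01 Kr].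
apply: uniform_cvgI => e e0; have [N hN] := tail r e r01 e0; exists N => n Nn q Kq.
have qb : qball q by apply: le_lt_trans (Kr q Kq) _; case/andP: r01.
have [cq _] := ptw q qb.
have lim : (fun k => `|series (fun j => u j q) (n + k)%N - \sum_(0 <= j < n) u j q|) @ \oo -->
    `|limn (series (fun j => u j q)) - \sum_(0 <= j < n) u j q|.
  apply: cvg_norm; apply: cvgB; last exact: cvg_cst.
  by have := cq; rewrite /= -(cvg_shiftn n); under eq_fun do rewrite addnC.
apply: (cvg_le_near lim); apply: nearW => k; rewrite split_sum.
exact: le_trans (ler_norm_sum _ _ _) (hN n q Nn (Kr q Kq) _).
Qed.

Lemma conv_abs_sum (a b : nat -> nat -> H) (C : R) m n : row_coefs a ->
  (forall J N, \sum_(0 <= j < J) \sum_(0 <= l < N) qsqn (b j l) <= C) ->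
  \sum_(0 <= j < n) `|conv (a j) (b j) m| <= 1 + C.
Proof.
move=> a1 bC.
apply: le_trans (_ : \sum_(0 <= j < n) (\sum_(0 <= k < m.+1) qsqn (a j k) + \sum_(0 <= k < m.+1) qsqn (b j k)) <= _).
  by apply: ler_sum => j _; exact: conv_abs.
by rewrite big_split /=; apply: lerD; [exact: a1|exact: bC].
Qed.

(** The majorant at radius r is the sum over m of r^m times the modulus of the m-th coefficient. For
    each m these moduli sum over j to at most 1 + C, so the majorants sum to at most (1 + C) / (1 -
    r). *)
Lemma abs_unif_psum (a b : nat -> nat -> H) (C : R) : row_coefs a ->
  (forall J N, \sum_(0 <= j < J) \sum_(0 <= l < N) qsqn (b j l) <= C) ->
  abs_unif_cvg_on_compacts (fun j => psum_fun (conv (a j) (b j))).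
Proof.
move=> a1 bC; have C0 : 0 <= 1 + C by have := conv_abs_sum 0 0 a1 bC; rewrite big_geq.
pose s r j n := \sum_(0 <= m < n) r ^+ m * `|conv (a j) (b j) m|.
have s1 r n k : 0 <= r < 1 -> \sum_(0 <= j < n) s r j k <= (1 - r)^-1 * (1 + C).
  move=> r01; have [r0 _] := andP r01; rewrite /s exchange_big /=.
  apply: le_trans (_ : \sum_(0 <= m < k) r ^+ m * (1 + C) <= _).
    by apply: ler_sum => m _; rewrite -mulr_sumr ler_wpM2l ?exprn_ge0 //; exact: conv_abs_sum.
  by rewrite -mulr_suml ler_wpM2r //; exact: geo_sum.
have t0 r j m : 0 <= r < 1 -> 0 <= r ^+ m * `|conv (a j) (b j) m|.
  by move=> /andP[r0 _]; rewrite mulr_ge0 // exprn_ge0.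
have s2 r j k : 0 <= r < 1 -> s r j k <= (1 - r)^-1 * (1 + C).
  move=> r01; apply: le_trans (s1 r j.+1 k r01); rewrite big_nat_recr //= lerDr.
  by apply: sumr_ge0 => i _; apply: sumr_ge0 => m _; exact: t0.
have nd r j : 0 <= r < 1 -> nondecreasing_seq (s r j).
  by move=> r01; apply: (@nondecreasing_series R _ xpredT 0) => m _ _; exact: t0.
have sc r j : 0 <= r < 1 -> s r j @ \oo --> limn (s r j).
  move=> r01; apply: nondecreasing_is_cvgn; first exact: nd.
  by exists ((1 - r)^-1 * (1 + C)) => _ [k _ <-]; exact: s2.
apply: (@abs_unif_cvgI _ (fun r j => limn (s r j)) (fun r => (1 - r)^-1 * (1 + C))) => r r01; split=> [n|j q qr].
  apply: (cvg_le_near (rcvg_sum (n := n) (fun j => sc r j r01))); apply: nearW => k; exact: s1.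
have [] // := @series_abs_cvg R (fun m => q ^+ m * conv (a j) (b j) m) (limn (s r j)) => n.
have cs : cvgn (s r j) by apply/cvg_ex; exists (limn (s r j)); exact: sc.
apply: le_trans (_ : s r j n <= _); last exact: nondecreasing_cvgn_le (nd r j r01) cs n.
apply: ler_sum => m _; rewrite normqM normqX ler_wpM2r // lerXn2r // nnegrE //.
by case/andP: r01.
Qed.

(** Norm convergence of the partial sums implies pointwise convergence, by Cauchy-Schwarz against
    the powers of q, whose squares sum to at most 1 / (1 - |q|^2). *)
Lemma psum_series (a b : nat -> nat -> H) (K C : R) : 0 < K -> rowb a K -> row_coefs a ->
  (forall J N, \sum_(0 <= j < J) \sum_(0 <= l < N) qsqn (b j l) <= C) ->
  exists2 c : nat -> H, ell2 c /\ series_conv a b c &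
    forall q, qball q -> (fun n => \sum_(0 <= j < n) psum_fun (conv (a j) (b j)) q) @ \oo --> psum_fun c q.
Proof.
move=> K0 aK a1 bC; have [c [ec hc]] := row_sum_exists K0 aK a1 bC.
exists c.
  split=> // m; apply/qcvg_sqP => d d0; have [N hN] := hc d d0; exists N => n Nn.
  by rewrite -qsqnN opprB; exact: (nle_coef m (hN n Nn)).
move=> q qb; apply/qcvg_sqP => d d0.
have eb j : ell2 (conv (a j) (b j)).
  exists (K * C); apply: (mulb_nle (ltW K0) (rowb_mulb j aK)) => N.
  apply: le_trans (bC j.+1 N); rewrite big_nat_recr //= lerDr.
  by apply: sumr_ge0 => i _; exact: sum_qsqn_ge0.
have q1 : 0 < 1 - qsqn q by rewrite subr_gt0 -normq2 expr_lt1.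
have [N hN] := hc (d * (1 - qsqn q)) (mulr_gt0 d0 q1); exists N => n Nn.
have hb j := ell2_bseq (eb j).
have lim : (fun M => qpseries c q M - \sum_(0 <= j < n) qpseries (conv (a j) (b j)) q M) @ \oo -->
    psum_fun c q - \sum_(0 <= j < n) psum_fun (conv (a j) (b j)) q.
  apply: cvgB; first exact: (qpseries_cvg (ell2_bseq ec) qb).
  by apply: qcvg_sum => j; exact: qpseries_cvg.
apply: (cvg_le_near (qcvg_qsqn lim)); apply: nearW => M.
have -> : qpseries c q M - \sum_(0 <= j < n) qpseries (conv (a j) (b j)) q M =
   - \sum_(0 <= m < M) q ^+ m * (\sum_(0 <= j < n) conv (a j) (b j) m - c m).
  rewrite /qpseries /series /= exchange_big /= -sumrB -sumrN; apply: eq_bigr => m _.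
  by rewrite -mulr_sumr -mulrBr -mulrN opprB.
rewrite qsqnN; apply: le_trans (qsqn_CS _ _ _ _) _.
have -> : d = (1 - qsqn q)^-1 * (d * (1 - qsqn q)) by rewrite mulrCA mulVf ?mulr1 // gt_eqF.
apply: ler_pM; rewrite ?sum_qsqn_ge0 //; last exact: hN.
have qX m : qsqn (q ^+ m) = qsqn q ^+ m by rewrite -!normq2 normqX exprAC.
by under eq_bigr do rewrite qX; apply: geo_sum; rewrite qsqn_ge0 -subr_gt0.
Qed.

End UniformSeries.

(** * Assembly of the equivalence *)

Section Final.
Context {R : realType}.
Local Notation H := (quat R).
Implicit Types (L : set nat) (f g : nat -> H -> H) (h : H -> H).

Lemma psum_star L f g n q : qball q -> 
  psum L (fun j => star (f j) (g j) q) n = \sum_(0 <= j < n) psum_fun (conv (fam L f j) (fam L g j)) q.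
Proof.
move=> qb; rewrite /psum big_mkcond; apply: eq_bigr => j _; rewrite /fam; case: ifP => // _.
have c0 : conv (fun=> 0) (fun=> 0) = fun=> 0 :> H by apply/funext => m; rewrite conv0r.
have b0 : bseq (fun=> 0 : H) by exists 0 => m; rewrite normr0.
by rewrite c0; apply/esym; exact: qcvg_unique (has_psum b0 qb) (has_ps0 qb).
Qed.

Lemma fam_Hinf_mulb (I : H) L g : imag_unit I -> (forall j, L j -> Hinf (g j)) ->
  forall j, exists2 K : R, 0 < K & mulb (fam L g j) K.
Proof.
move=> hI hg j; rewrite /fam; case: ifPn => [|_]; first by rewrite inE => /hg hgj; exact: (Hinf_mulb hI hgj).
exists 1 => // u M; have -> : \sum_(0 <= m < M) qsqn (conv (fun=> 0) u m) = 0.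
  by apply: big1 => m _; rewrite conv_nat big1 ?qsqn0 // => k _; rewrite mul0r.
by rewrite mul1r sum_qsqn_ge0.
Qed.

Lemma fam_bseq (I : H) L g : imag_unit I -> (forall j, L j -> Hinf (g j)) ->
  forall j, bseq (fam L g j).
Proof.
move=> hI hg j; have [K _ hK] := fam_Hinf_mulb hI hg j.
by apply: ell2_bseq; exists K; exact: mulb_coefs.
Qed.

(** The partial sums converge to the same [c] in coefficients and at points, so either form of
    convergence says that h has the coefficients c. *)
Lemma series_convP L f g h (K C : R) : 0 < K -> rowb (fam L f) K -> row_coefs (fam L f) ->
  (forall J N, \sum_(0 <= j < J) \sum_(0 <= l < N) qsqn (fam L g j l) <= C) ->
  slice_regular h ->
  (series_conv (fam L f) (fam L g) (coefs h) <->
   forall q, qball q -> psum L (fun j => star (f j) (g j) q) @ \oo --> h q).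
Proof.
move=> K0 fK f1 gC sh; have [c [ec cS] cq] := psum_series K0 fK f1 gC.
have P q : qball q -> psum L (fun j => star (f j) (g j) q) @ \oo --> psum_fun c q.
  move=> qb; rewrite (_ : psum _ _ = fun n => \sum_(0 <= j < n) psum_fun (conv (fam L f j) (fam L g j)) q); first exact: cq.
  by apply/funext => n; exact: psum_star.
have hs := has_ps_coefs sh.
split=> [hS q qb|hq].
  have -> : h q = psum_fun c q; last exact: P.
  apply: qcvg_unique (hs q qb) _.
  have -> : coefs h = c by apply/funext => m; exact: qcvg_unique (hS m) (cS m).
  exact: qpseries_cvg (ell2_bseq ec) qb.
suff -> : coefs h = c by [].
apply: coefsE => q qb; rewrite (qcvg_unique (hq q qb) (P q qb)).
exact: qpseries_cvg (ell2_bseq ec) qb.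
Qed.

Lemma fam_psum L (b : nat -> nat -> H) j : (forall j, bseq (b j)) ->
  fam L (fun j => psum_fun (b j)) j = if j \in L then b j else fun=> 0.
Proof. by move=> bb; rewrite /fam; case: ifP => // _; rewrite coefs_psum. Qed.

Lemma finite_mulb (b : nat -> nat -> H) n : (forall j, exists2 K : R, 0 < K & mulb (b j) K) ->
  exists2 C : R, 0 < C & forall u M, \sum_(0 <= j < n) \sum_(0 <= m < M) qsqn (conv (b j) u m) <=
    C * \sum_(0 <= l < M) qsqn (u l).
Proof.
move=> hK; elim: n => [|n [C C0 IH]]; first by exists 1 => // u M; rewrite big_geq // mul1r sum_qsqn_ge0.
have [K K0 nK] := hK n; exists (C + K) => [|u M]; first exact: addr_gt0.
by rewrite big_nat_recr //= mulrDl; apply: lerD.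
Qed.

Lemma finite_col_bound (I : H) n g : imag_unit I -> (forall j, (j < n)%N -> Hinf (g j)) ->
  exists2 gamma : R, 0 < gamma & col_bound (gamma ^+ 2) (fam `I_n g).
Proof.
move=> hI hg; have [C C0 hC] := finite_mulb n (@fam_Hinf_mulb I `I_n g hI hg).
exists (Num.sqrt C); first by rewrite sqrtr_gt0.
move=> u Ls J M u0; rewrite sqr_sqrtr ?(ltW C0) //.
apply: le_trans (_ : \sum_(0 <= j < n) \sum_(0 <= m < M) qsqn (conv (fam `I_n g j) u m) <= _).
  apply: sum_cut => [j|j nj]; first exact: sum_qsqn_ge0.
  apply: big1 => m _; rewrite /fam; case: ifPn => [|_]; first by rewrite inE /= ltnNge nj.
  by rewrite conv_nat big1 ?qsqn0 // => k _; rewrite mul0r.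
apply: le_trans (hC u M) _; rewrite ler_wpM2l ?(ltW C0) //; exact: sum_supp.
Qed.

End Final.

Theorem theorem6p3 (R : realType) (L : set nat)
    (hL : (exists n : nat, (0 < n)%N /\ L = `I_n) \/ L = setT)
    (I J : quat R) (hI : imag_unit I) (hJ : imag_unit J)
    (hIJ : I * J = - (J * I))
    (f : nat -> quat R -> quat R) (hf : forall j, L j -> Hinf (f j))
    (hf1 : forall q, qball q ->
       (\esum_(j in L) (`|f j q| ^+ 2)%:E <= 1%:E)%E)
    (h : quat R -> quat R) (hh : Hinf h) :
  let ineq (gamma : R) :=
    op_le (fun u => star h (mult_adj h u))
          (fun u q => gamma ^+ 2 *: row_mult L f (row_mult_adj L f u) q) in
  let admissible (gamma : R) (g : nat -> quat R -> quat R) :=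
    [/\ forall j, L j -> Hinf (g j),
        Hinf_op I L (Psi I J g)
      & (Hinf_op_norm I L (Psi I J g) <= gamma%:E)%E] in
  (forall gamma : R, 0 < gamma ->
     (ineq gamma <->
      exists g : nat -> quat R -> quat R, admissible gamma g /\
        forall q, qball q ->
          psum L (fun j => star (f j) (g j) q) @ \oo --> h q) /\
     (L = setT -> forall g : nat -> quat R -> quat R, admissible gamma g ->
        abs_unif_cvg_on_compacts (fun j => star (f j) (g j)))) /\
  (forall n : nat, L = `I_n ->
     (right_ideal n f h <-> exists2 gamma : R, 0 < gamma & ineq gamma)).
Proof.
move=> ineq admissible.
have [fK f1] := hypothesis_rowb hI hf hf1.
have [Kh Kh0 hK] := Hinf_mulb hI hh.
have sh : slice_regular h by case: hh.
have two0 : 0 < 2 :> R by [].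
have ineqP gamma : 0 < gamma -> ineq gamma <-> poly_ineq (gamma ^+ 2) (fam L f) (coefs h).
  by move=> g0; exact: ineq_poly g0 two0 fK f1 Kh0 hK.
have adm_bound gamma g : 0 < gamma -> admissible gamma g -> col_bound (gamma ^+ 2) (fam L g).
  move=> g0 [hg _ hn]; apply: (col_bound_of_Psi hI hJ hIJ g0 hg hn).
  exact: fam_bseq hI hg.
have equiv gamma : 0 < gamma -> ineq gamma <-> exists g, admissible gamma g /\
    forall q, qball q -> psum L (fun j => star (f j) (g j) q) @ \oo --> h q.
  move=> g0; have g20 : 0 < gamma ^+ 2 by rewrite exprn_gt0.
  rewrite ineqP //; split=> [hP|[g [ag hq]]]; last first.
    have cb := adm_bound gamma g g0 ag.
    apply: (poly_ineq_of_factorization g20 cb).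
    apply/(@series_convP R L f g h 2 (gamma ^+ 2) two0 fK f1 _ sh); last exact: hq.
    by move=> n N; exact: (col_bound_coefs n N cb).
  have [b [cb hS]] := factorization_of_poly_ineq g0 f1 hP.
  have bb j := col_bound_bseq j cb.
  pose g j := psum_fun (b j); exists g.
  have [P1 P2] := Psi_of_col_bound hI hJ hIJ L g0 cb.
  split.
    split=> // j _; split; first exact: psum_fun_regular.
    exists gamma => q qb; rewrite -(@ler_pXn2r _ 2) ?nnegrE ?(ltW g0) // normq2.
    exact: col_bound_psum (ltW g20) cb qb.
  apply/(@series_convP R L f g h 2 (gamma ^+ 2) two0 fK f1 _ sh).
    move=> n N; apply: le_trans (col_bound_coefs n N cb).
    apply: ler_sum => j _; rewrite fam_psum //; case: ifP => // _.
    by rewrite big1 ?sum_qsqn_ge0 // => l _; rewrite qsqn0.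
  (* For j outside L the coefficients of [fam L f] vanish, so replacing b j by zero there changes no
     product. *)
  move=> m; have := hS m.
  rewrite (_ : (fun n => _) = fun n => \sum_(0 <= j < n) conv (fam L f j) (fam L g j) m) //.
  apply/funext => n; apply: eq_bigr => j _; rewrite fam_psum //; case: ifPn => // jL.
  by rewrite conv0r conv_nat big1 // => k _; rewrite /fam (negbTE jL) mul0r.
split.
  move=> gamma g0; split; first exact: equiv.
  move=> LT g ag; have cb := adm_bound gamma g g0 ag.
  rewrite (_ : (fun j => star (f j) (g j)) = fun j => psum_fun (conv (fam L f j) (fam L g j))).
    apply: (abs_unif_psum f1 (C := gamma ^+ 2)) => n N; exact: (col_bound_coefs n N cb).
  by apply/funext => j; rewrite !fam_in // LT.
move=> n Ln.
have psumE (g : nat -> quat R -> quat R) q k : psum L (fun j => star (f j) (g j) q) (k + n)%N =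
    \sum_(0 <= j < n) star (f j) (g j) q.
  rewrite /psum Ln big_mkcond (big_cat_nat (leq0n n) (leq_addl k n)) /=.
  rewrite [X in _ + X]big_nat.
  have -> : \sum_(n <= j < k + n | (n <= j < k + n)%N) (if j \in `I_n then star (f j) (g j) q else 0) = 0.
    by apply: big1 => j /andP[nj _]; case: ifPn => //; rewrite inE /= ltnNge nj.
  rewrite addr0; apply: eq_big_nat => j /andP[_ jn].
  by rewrite mem_set.
split=> [[g [hg hq]]|[gamma g0 /(equiv _ g0) [g [[hg _ _] hq]]]]; last first.
  exists g; split=> [j jn|q qb]; first by apply: hg; rewrite Ln.
  apply: qcvg_unique (hq q qb) _.
  rewrite -(cvg_shiftn n) (_ : (fun k => _) = fun=> \sum_(0 <= j < n) star (f j) (g j) q); first exact: cvg_cst.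
  by apply/funext => k; exact: psumE.
(* The ideal prescribes no bound; finitely many bounded multipliers form a bounded column, and its
   bound provides gamma. *)
have [gamma g0 cb] := finite_col_bound hI hg.
exists gamma => //; apply/ineqP => //; rewrite -Ln in cb.
apply: (poly_ineq_of_factorization (exprn_gt0 2 g0) cb).
apply/(@series_convP R L f g h 2 (gamma ^+ 2) two0 fK f1 _ sh); first by move=> k N; exact: (col_bound_coefs k N cb).
move=> q qb; rewrite hq // -(cvg_shiftn n).
rewrite (_ : (fun k => _) = fun=> \sum_(0 <= j < n) star (f j) (g j) q); first exact: cvg_cst.
by apply/funext => k; exact: psumE.
Qed.
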